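(* Let $\mathcal{M}$ be a $d$-dimensional compact rank one symmetric space (CROSS), let $m\in\mathbb{N}$, and let $r^0<\ldots<r^m$ and $k$ be real numbers (superscripts are indices) and $\lambda_0,\ldots,\lambda_m>0$ be such that $\lambda_0+\ldots+\lambda_m=1$ and $k+\frac d4\leqslant\lambda_0r^0+\ldots+\lambda_mr^m$. Then for every $x\in H_0^{2r^m}(\mathcal{M})$ there holds the sharp inequality $$\|\Delta^kx\|_{C(\mathcal{M})}\leqslant\sqrt{\mathcal{C}\cdot\prod_{j=0}^m\lambda_j^{-\lambda_j}}\cdot\prod_{j=0}^m\|\Delta^{r^j}x\|_{L_2(\mathcal{M})}^{\lambda_j},$$ where $$\mathcal{C}=\sup_{\mathbf{h}\in\mathbb{R}_+^{m+1}}\ \prod_{j=0}^mh_j^{\lambda_j}\sum_{j=1}^\infty\frac{(2j+\alpha+\beta+1)\,\Gamma(\beta+1)\,\Gamma(j+\alpha+1)\,\Gamma(j+\alpha+\beta+1)\,\gamma_j^{4k}}{\Gamma(\alpha+\beta+2)\,\Gamma(\alpha+1)\,\Gamma(j+1)\,\Gamma(j+\beta+1)\left(\sum_{l=0}^mh_l\gamma_j^{4r^l}\right)}.$$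
   Context: $\mathbb{R}_+=(0,+\infty)$, $\mathbf{h}=(h_0,\ldots,h_m)$; $\Gamma$ is the Euler gamma function. A CROSS is one of the spaces below with its standard metric; the parameters are ($b\in\mathbb{N}$, $j=0,1,2,\ldots$, $\gamma_j\geqslant0$): - $\mathbb{S}^b$ (Euclidean sphere): $d=b$, $\gamma_j^2=j(j+b-1)$, $\alpha=\beta=\frac{d-2}{2}$; - $\mathbb{R}P^b$: $d=b$, $\gamma_j^2=2j(2j+b-1)$, $\alpha=\frac{d-2}{2}$, $\beta=-\frac12$; - $\mathbb{C}P^b$: $d=2b$, $\gamma_j^2=4j(j+b)$, $\alpha=\frac{d-2}{2}$, $\beta=0$; - $\mathbb{H}P^b$: $d=4b$, $\gamma_j^2=4j(j+2b+1)$, $\alpha=\frac{d-2}{2}$, $\beta=1$; - Cayley plane $\mathbb{C}\mathrm{a}P^2$: $d=16$, $\gamma_j^2=4j(j+11)$, $\alpha=\frac{d-2}{2}$, $\beta=3$. The metric is normalized so that the distinct eigenvalues of the positive Laplace–Beltrami operator $\Delta$ are the $\gamma_j^2$. The space $L_2(\mathcal{M})$ is taken with respect to the invariant volume measure normalized to total mass $1$; $\|\cdot\|_{C(\mathcal{M})}$ is the maximum norm. Let $0=\mu_0^2<\mu_1^2\leqslant\mu_2^2\leqslant\ldots$ be the eigenvalues of $\Delta$ counted with multiplicity and $\{\varphi_j\}_{j=0}^\infty$ an $L_2$-orthonormal basis of real eigenfunctions, $\Delta\varphi_j=\mu_j^2\varphi_j$. For $x\in L_2(\mathcal{M})$ put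 $a_j=(x,\varphi_j)_{L_2(\mathcal{M})}$. For $s\in\mathbb{R}$, $H_0^s(\mathcal{M})$ is the set of functions $x$ with $a_0=0$ and $\sum_{j=1}^\infty|a_j|^2\mu_j^{2s}<\infty$. For $x\in H_0^{2s}(\mathcal{M})$, $\Delta^sx:=\sum_{j=1}^\infty a_j\mu_j^{2s}\varphi_j$. Sharp means that the constant in front of the product of norms cannot be reduced. *)

(* Defs.v *)
From HB Require Import structures.
From mathcomp Require Import all_boot all_order all_algebra.
From mathcomp Require Import all_classical all_reals all_analysis.

Set Implicit Arguments.
Unset Strict Implicit.
Unset Printing Implicit Defensive.
Import Order.TTheory GRing.Theory Num.Theory.
Import numFieldNormedType.Exports.
Local Open Scope classical_set_scope.
Local Open Scope ring_scope.

(** Compact rank one symmetric spaces are modelled as submanifolds [carrier]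
    of real matrix spaces: the sphere is the unit sphere, and the projective
    spaces over the reals, complexes, quaternions and octonions are the sets of
    Hermitian idempotent matrices of trace 1 over the corresponding
    Cayley-Dickson algebra (the orthogonal projections onto lines).  The
    Riemannian metric is the restriction of a multiple of the Euclidean inner
    product, and all the geometry (gradient, divergence, Laplacian,
    isometries) is expressed through smooth curves in the submanifold.
    Functions on the space are functions on the ambient matrix space, whose
    values off [carrier] are irrelevant. *)

Inductive cross : Type :=
| Sphere (b : nat) of (0 < b)%N
| RealProj (b : nat) of (0 < b)%N
| ComplexProj (b : nat) of (0 < b)%N
| QuatProj (b : nat) of (0 < b)%N
| CayleyPlane.

Definition cross_dim (M : cross) : nat :=
  match M with
  | Sphere b _ => b
  | RealProj b _ => b
  | ComplexProj b _ => 2 * b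
  | QuatProj b _ => 4 * b
  | CayleyPlane => 16
  end.

Section SpectralData.
Variable R : realType.

Definition cross_gamma2 (M : cross) (j : nat) : R :=
  match M with
  | Sphere b _ => j%:R * (j%:R + b%:R - 1)
  | RealProj b _ => 2 * j%:R * (2 * j%:R + b%:R - 1)
  | ComplexProj b _ => 4 * j%:R * (j%:R + b%:R)
  | QuatProj b _ => 4 * j%:R * (j%:R + 2 * b%:R + 1)
  | CayleyPlane => 4 * j%:R * (j%:R + 11)
  end.

Definition cross_gamma (M : cross) (j : nat) : R :=
  Num.sqrt (cross_gamma2 M j).

Definition cross_alpha (M : cross) : R := ((cross_dim M)%:R - 2) / 2.

Definition cross_beta (M : cross) : R :=
  match M with
  | Sphere _ _ => ((cross_dim M)%:R - 2) / 2
  | RealProj _ _ => - (1 / 2)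
  | ComplexProj _ _ => 0
  | QuatProj _ _ => 1
  | CayleyPlane => 3
  end.

Definition Euler_Gamma (x : R) : R :=
  \int[@lebesgue_measure R]_(t in `]0, +oo[) (t `^ (x - 1) * expR (- t)).

End SpectralData.

Section CayleyDickson.
Variable R : realType.

(* [cdim k] is 2 ^ k; the algebra of level 0, 1, 2, 3 is that of the
   reals, complexes, quaternions, octonions. *)
Fixpoint cdim (k : nat) : nat :=
  if k is k'.+1 then (cdim k' + cdim k')%N else 1%N.

Fixpoint cdone (k : nat) : 'rV[R]_(cdim k) :=
  match k with
  | 0 => const_mx 1
  | k'.+1 => row_mx (cdone k') 0
  end.

Fixpoint cdconj (k : nat) : 'rV[R]_(cdim k) -> 'rV[R]_(cdim k) :=
  match k with
  | 0 => id
  | k'.+1 => fun x => row_mx (cdconj (lsubmx x)) (- rsubmx x)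
  end.

(* (a, b) (c, d) = (a c - d^* b, d a + b c^* ) *)
Fixpoint cdmul (k : nat) :
    'rV[R]_(cdim k) -> 'rV[R]_(cdim k) -> 'rV[R]_(cdim k) :=
  match k with
  | 0 => fun x y => \row_i (x 0 i * y 0 i)
  | k'.+1 => fun x y =>
      let a := lsubmx x in let b := rsubmx x in
      let c := lsubmx y in let d := rsubmx y in
      row_mx (cdmul a c - cdmul (cdconj d) b) (cdmul d a + cdmul b (cdconj c))
  end.

(* An n x n matrix over the algebra of level k is stored as a real matrix
   whose rows, indexed by pairs (i, j), are its entries. *)
Definition cdentry (n k : nat) (X : 'M[R]_(n * n, cdim k)) (i j : 'I_n) :
  'rV[R]_(cdim k) := row (mxvec_index i j) X.

Definition proj_space (n k : nat) : set 'M[R]_(n * n, cdim k) :=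
  [set X | [/\ forall i j : 'I_n, cdentry X j i = cdconj (cdentry X i j),
               forall i j : 'I_n,
                 \sum_(l < n) cdmul (cdentry X i l) (cdentry X l j)
                   = cdentry X i j
             & \sum_(i < n) cdentry X i i = cdone k]].

Definition unit_sphere (n : nat) : set 'M[R]_(1, n) :=
  [set x | \sum_(i < n) x ord0 i ^+ 2 = 1].

End CayleyDickson.

Definition nrow (M : cross) : nat :=
  match M with
  | Sphere _ _ => 1
  | RealProj b _ => b.+1 * b.+1
  | ComplexProj b _ => b.+1 * b.+1
  | QuatProj b _ => b.+1 * b.+1
  | CayleyPlane => 3 * 3
  end.

Definition ncol (M : cross) : nat :=
  match M with
  | Sphere b _ => b.+1
  | RealProj _ _ => cdim 0
  | ComplexProj _ _ => cdim 1
  | QuatProj _ _ => cdim 2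
  | CayleyPlane => cdim 3
  end.

Notation ambient R M := 'M[R]_(nrow M, ncol M).

Definition carrier (R : realType) (M : cross) : set (ambient R M) :=
  match M return set (ambient R M) with
  | Sphere b _ => @unit_sphere R b.+1
  | RealProj b _ => @proj_space R b.+1 0
  | ComplexProj b _ => @proj_space R b.+1 1
  | QuatProj b _ => @proj_space R b.+1 2
  | CayleyPlane => @proj_space R 3 3
  end.
Arguments carrier : clear implicits.

(* In the projective spaces t |-> the projection onto the line spanned by
   cos t e + sin t f has Euclidean speed sqrt 2; the factor 1/2 makes it a unit
   speed geodesic, as for the Riemannian submersion from the unit sphere. *)
Definition cross_scale (R : realType) (M : cross) : R :=
  if M is Sphere _ _ then 1 else 1 / 2.

Definition metric (R : realType) (M : cross) (u v : ambient R M) : R :=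
  cross_scale R M * \sum_(i < nrow M) \sum_(j < ncol M) u i j * v i j.

Section Geometry.
Variable R : realType.

Fixpoint Ck (V W : normedModType R) (n : nat) (f : V -> W) : Prop :=
  continuous f /\
  (if n is n'.+1 then
     forall v : V, (forall a : V, derivable f a v) /\ Ck n' (fun a => 'D_v f a)
   else True).

Definition smooth (V W : normedModType R) (f : V -> W) : Prop :=
  forall n : nat, Ck n f.

Variable M : cross.
Local Notation E := (ambient R M).
Implicit Types (p : E) (f : E -> R) (X : E -> E).

Definition smooth_curve (c : R -> E) : Prop :=
  smooth (c : R^o -> E) /\ (forall t : R, carrier R M (c t)).

Definition tangent p (v : E) : Prop :=
  exists c : R -> E, [/\ smooth_curve c, c 0 = p & derive1 c 0 = v].

Definition smooth_on_cross f : Prop :=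
  exists F : E -> R,
    smooth (F : E -> R^o) /\ (forall p, carrier R M p -> f p = F p).

Definition is_gradient f X : Prop :=
  forall p, carrier R M p ->
    tangent p (X p) /\
    forall c : R -> E, smooth_curve c -> c 0 = p ->
      is_derive (0 : R) 1 (fun t => f (c t) : R^o) (metric (X p) (derive1 c 0)).

(* The trace over an orthonormal frame of the tangent space of the ambient
   derivative of X; the tangential projection implied by the inner product
   turns the ambient derivative into the Levi-Civita one. *)
Definition is_divergence_at X p (delta : R) : Prop :=
  forall c : 'I_(cross_dim M) -> R -> E,
    (forall i, smooth_curve (c i) /\ c i 0 = p) ->
    (forall i j, metric (derive1 (c i) 0) (derive1 (c j) 0) = (i == j)%:R) ->
    \sum_(i < cross_dim M)
      metric (derive1 (fun t => X (c i t)) 0) (derive1 (c i) 0) = delta.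

(* [g] is the positive Laplace-Beltrami operator - div grad applied to [f]. *)
Definition is_laplacian f (g : E -> R) : Prop :=
  exists X, is_gradient f X /\
    forall p, carrier R M p -> is_divergence_at X p (- g p).

Definition is_isometry (Phi : E -> E) : Prop :=
  set_bij (carrier R M) (carrier R M) Phi /\
  forall c : R -> E, smooth_curve c ->
    smooth_curve (fun t => Phi (c t)) /\
    forall t : R,
      metric (derive1 (fun t => Phi (c t)) t) (derive1 (fun t => Phi (c t)) t)
      = metric (derive1 c t) (derive1 c t).

End Geometry.

(* The ambient matrix space with its Borel sigma-algebra. *)
Notation borel_ambient R M := (g_sigma_algebraType (@open (ambient R M))).

Definition is_invariant_volume (R : realType) (M : cross)
    (vol : probability (borel_ambient R M) R) : Prop :=
  vol (carrier R M) = 1%E /\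
  forall Phi : ambient R M -> ambient R M, is_isometry Phi ->
    forall A : set (borel_ambient R M), measurable A ->
      vol (carrier R M `&` Phi @^-1` A) = vol (carrier R M `&` A).

Section Analysis.
Variables (R : realType) (M : cross).
Variable vol : probability (borel_ambient R M) R.
Local Notation E := (borel_ambient R M).
Implicit Types x y : E -> R.

Definition L2 : set (E -> R) := [set x | x \in Lfun vol 2%:E].

Definition L2_norm x : R := fine ('N[vol]_2%:E[EFin \o x])%E.

Definition L2_inner x y : R := \int[vol]_p (x p * y p).

Definition is_L2_sum (u : nat -> E -> R) x : Prop :=
  L2 x /\
  L2_norm (fun p => x p - \sum_(0 <= j < n) u j p) @[n --> \oo] --> (0 : R).

(* nu 0 ^ 2, nu 1 ^ 2, ... are the eigenvalues of the Laplacian, counted with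
   multiplicity since phi is an orthonormal basis of L_2. *)
Definition is_eigenbasis (nu : nat -> R) (phi : nat -> E -> R) : Prop :=
  [/\ nu 0%N = 0,
      0 < nu 1%N,
      forall i j : nat, (i <= j)%N -> nu i <= nu j,
      forall j, [/\ L2 (phi j), smooth_on_cross (phi j)
                  & is_laplacian (phi j) (fun p => nu j ^+ 2 * phi j p)]
    & (forall i j, L2_inner (phi i) (phi j) = (i == j)%:R) /\
      (forall x, L2 x ->
         is_L2_sum (fun j p => L2_inner x (phi j) * phi j p) x)].

Variables (nu : nat -> R) (phi : nat -> E -> R).

Definition H0 (s : R) : set (E -> R) :=
  [set x | [/\ L2 x, L2_inner x (phi 0%N) = 0
    & (\sum_(1 <= j <oo)
         (`|L2_inner x (phi j)| ^+ 2 * nu j `^ (2 * s))%:E < +oo)%E]].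

Definition laplace_power (s : R) x : E -> R :=
  xget (fun=> 0) [set y | is_L2_sum
    (fun j p => if j is 0%N then 0
                else L2_inner x (phi j) * nu j `^ (2 * s) * phi j p) y].

Definition C_norm y : R := sup [set `|y p| | p in carrier R M].

(* As an element of L_2, Delta^k x is a class of functions; its maximum norm
   is that of its continuous representative y. *)
Definition kolmogorov_inequality (m : nat) (k : R) (r lambda : 'I_m.+1 -> R)
    (K : R) : Prop :=
  forall x, H0 (2 * r ord_max) x ->
    exists y : E -> R,
      [/\ {within carrier R M, continuous (y : ambient R M -> R)},
          {ae vol, forall p, y p = laplace_power k x p}
        & C_norm y <=
          K * \prod_(j < m.+1)
                L2_norm (laplace_power (r j) x) `^ lambda j].

End Analysis.

Section Constant.
Variables (R : realType) (M : cross).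
Local Notation alpha := (cross_alpha R M).
Local Notation beta := (cross_beta R M).
Local Notation gamma := (cross_gamma R M).
Local Notation Gamma := (@Euler_Gamma R).

Definition cross_series (m : nat) (k : R) (r h : 'I_m.+1 -> R) : \bar R :=
  (\sum_(1 <= j <oo)
    (((2 * j%:R + alpha + beta + 1) * Gamma (beta + 1)
        * Gamma (j%:R + alpha + 1) * Gamma (j%:R + alpha + beta + 1)
        * gamma j `^ (4 * k))
     / (Gamma (alpha + beta + 2) * Gamma (alpha + 1)
        * Gamma (j%:R + 1) * Gamma (j%:R + beta + 1)
        * \sum_(l < m.+1) h l * gamma j `^ (4 * r l)))%:E)%E.

Definition cross_constant (m : nat) (k : R) (r lambda : 'I_m.+1 -> R) :
    \bar R :=
  ereal_sup
    [set ((\prod_(j < m.+1) h j `^ lambda j)%:E * cross_series k r h)%E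
      | h in [set h : 'I_m.+1 -> R | forall j, 0 < h j]].

End Constant.

(* Main.v *)
(** Each space carries enough linear symmetries to swap any two of its points,
    and geodesics of the form A + cos (w t) B + sin (w t) C.  With s(p, q) =
    (1 - <p, q>) / kappa, the Laplacian acts on zonal functions f(s(p, .)) as the
    Jacobi operator of parameters (alpha, beta), so that the zonal kernels J_j(s(p, q))
    built from the Jacobi polynomials are eigenfunctions for gamma_j^2.  Averaging
    an eigenfunction against the kernels (1 - s)^n and applying the maximum
    principle shows that the eigenvalues are exactly the gamma_j^2 and that the
    convolution with J_j projects onto the j-th eigenspace.  Parseval then yields
    the addition theorem: at every point the sum of phi_i^2 over the j-th
    eigenspace is the Gamma quotient in the constant.

    The inequality is Cauchy-Schwarz for the Fourier coefficients of x with
    weights nu^(4 k) / sum_l h_l nu^(4 r_l), followed by the choice of h that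
    makes the products h_l |Delta^(r_l) x|^2 proportional to lambda_l.  Equality
    in Cauchy-Schwarz at a base point gives extremal functions, hence sharpness. *)

Require Import Defs.
From mathcomp Require Import all_boot all_order all_algebra.
From mathcomp Require Import all_classical all_reals all_analysis.
From mathcomp Require Import measurable_realfun ring lra.
Import Order.TTheory GRing.Theory Num.Theory.
Import numFieldNormedType.Exports.
Local Open Scope classical_set_scope.
Local Open Scope ring_scope.
Set Implicit Arguments.
Unset Strict Implicit.
Unset Printing Implicit Defensive.

(** The obstacle is that the eigenbasis is arbitrary and known only through derivatives along
    curves, so that no Green formula links an eigenfunction to the zonal kernels; the maximum
    principle for 1 + Delta takes its place. The five families enter through one record,
    [cross_model]: a transitive stock of linear symmetries, geodesics at one base point, and two
    trace identities. The octonionic plane, where matrix products do not associate, dictates that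
    these symmetries be block reflections checked with Moufang-type identities. All kernels are
    polynomials in the inner product, hence of finite rank, so that differentiation under the
    integral and Fubini become finite algebra. The law of s(p, .) is recognized as a beta law
    because it is annihilated by the Jacobi operator, without polar coordinates; the same
    annihilation shows that the kernels (1 - s)^n concentrate at p and yields the norms of the J_j.
    The delicate point of finiteness is the borderline case of the condition on k, where the terms
    are of size 1/j times a factor depending on h and the bound must be uniform in h. *)

Section Dot.
Context {R : realType} {m n : nat}.
Implicit Types (p q u v : 'M[R]_(m, n)) (a : R).

Definition dot p q : R := \sum_(i < m) \sum_(j < n) p i j * q i j.

Lemma dotC p q : dot p q = dot q p.
Proof. by apply: eq_bigr => i _; apply: eq_bigr => j _; rewrite mulrC. Qed.

Lemma dotDl p q v : dot (p + q) v = dot p v + dot q v.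
Proof.
rewrite /dot -big_split; apply: eq_bigr => i _; rewrite -big_split.
by apply: eq_bigr => j _; rewrite mxE mulrDl.
Qed.

Lemma dotZl a p q : dot (a *: p) q = a * dot p q.
Proof.
rewrite /dot mulr_sumr; apply: eq_bigr => i _; rewrite mulr_sumr.
by apply: eq_bigr => j _; rewrite mxE mulrA.
Qed.

Lemma dotDr p q v : dot v (p + q) = dot v p + dot v q.
Proof. by rewrite dotC dotDl !(dotC v). Qed.

Lemma dotZr a p q : dot q (a *: p) = a * dot q p.
Proof. by rewrite dotC dotZl (dotC q). Qed.

Lemma dotNl p q : dot (- p) q = - dot p q.
Proof. by rewrite -scaleN1r dotZl mulN1r. Qed.

Lemma dotNr p q : dot q (- p) = - dot q p.
Proof. by rewrite dotC dotNl dotC. Qed.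

Lemma dot0l p : dot 0 p = 0.
Proof. by rewrite -(scale0r p) dotZl mul0r. Qed.

Lemma dot0r p : dot p 0 = 0.
Proof. by rewrite dotC dot0l. Qed.

Lemma dot_suml (I : finType) (F : I -> 'M[R]_(m, n)) q :
  dot (\sum_i F i) q = \sum_i dot (F i) q.
Proof.
by elim/big_rec2: _ => [|i x y _ <-]; rewrite ?dot0l // dotDl.
Qed.

Lemma dot_ge0 p : 0 <= dot p p.
Proof.
by apply: sumr_ge0 => i _; apply: sumr_ge0 => j _; rewrite -expr2 sqr_ge0.
Qed.

Lemma sqr_coord_le_dot p i j : p i j ^+ 2 <= dot p p.
Proof.
rewrite /dot (bigD1 i) //= (bigD1 j) //= -expr2 -addrA lerDl addr_ge0 //.
  by apply: sumr_ge0 => k _; rewrite -expr2 sqr_ge0.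
by apply: sumr_ge0 => k _; apply: sumr_ge0 => l _; rewrite -expr2 sqr_ge0.
Qed.

Lemma dot_eq0 p : dot p p = 0 -> p = 0.
Proof.
move=> p0; apply/matrixP => i j; rewrite mxE; apply/eqP.
by rewrite -sqrf_eq0 eq_le sqr_ge0 -p0 sqr_coord_le_dot.
Qed.

Lemma dot_delta p i j : dot p (delta_mx i j) = p i j.
Proof.
rewrite /dot (bigD1 i) //= (bigD1 j) //= mxE !eqxx mulr1 !big1 ?addr0 //.
  move=> k ki; rewrite big1 // => l _.
  by rewrite mxE (negbTE ki) mulr0.
by move=> l lj; rewrite mxE (negbTE lj) andbF mulr0.
Qed.

End Dot.

(** * Linear maps of matrix spaces and calculus for matrix-valued functions *)

Definition lin_map {R : realType} {m n : nat}
    (g : 'M[R]_(m, n) -> 'M[R]_(m, n)) : Prop :=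
  forall (a : R) u v, g (a *: u + v) = a *: g u + g v.

Section LinMap.
Context {R : realType} {m n : nat}.
Variable g : 'M[R]_(m, n) -> 'M[R]_(m, n).
Hypothesis lg : lin_map g.

Lemma lin_mapD u v : g (u + v) = g u + g v.
Proof. by rewrite -[u]scale1r lg !scale1r. Qed.

Lemma lin_map0 : g 0 = 0.
Proof. by apply: (addrI (g 0)); rewrite -lin_mapD !addr0. Qed.

Lemma lin_mapZ a u : g (a *: u) = a *: g u.
Proof. by rewrite -[a *: u]addr0 lg lin_map0 addr0. Qed.

Lemma lin_map_sum (I : finType) (F : I -> 'M[R]_(m, n)) :
  g (\sum_i F i) = \sum_i g (F i).
Proof. by elim/big_rec2: _ => [|i x y _ <-]; rewrite ?lin_map0 ?lin_mapD. Qed.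

Lemma lin_map_delta u : g u = \sum_i \sum_j u i j *: g (delta_mx i j).
Proof.
rewrite {1}[u]matrix_sum_delta lin_map_sum; apply: eq_bigr => i _.
by rewrite lin_map_sum; apply: eq_bigr => j _; rewrite lin_mapZ.
Qed.

End LinMap.

Section Continuity.
Context {R : realType}.

Lemma cvg_sumf (W : normedModType R) (T : Type) (F : set_system T)
    {FF : Filter F} (I : finType) (f : I -> T -> W) (l : I -> W) :
  (forall i, f i x @[x --> F] --> l i) -> \sum_i f i x @[x --> F] --> \sum_i l i.
Proof.
move=> h; elim: (index_enum I) => [|i s IH].
  by rewrite big_nil; under eq_fun do rewrite big_nil; exact: cvg_cst.
by rewrite big_cons; under eq_fun do rewrite big_cons; exact: cvgD.
Qed.

Lemma continuous_sumf (U : topologicalType) (W : normedModType R) (I : finType)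
    (f : I -> U -> W) :
  (forall i, continuous (f i)) -> continuous (fun x => \sum_i f i x).
Proof. by move=> h x; apply: (cvg_sumf (F := nbhs x)) => i; exact: h. Qed.

Lemma lin_map_continuous m n (g : 'M[R]_(m, n) -> 'M[R]_(m, n)) :
  lin_map g -> continuous g.
Proof.
move=> lg.
rewrite (_ : g = fun x => \sum_i \sum_j x i j *: g (delta_mx i j)); last first.
  by apply/funext => x; exact: lin_map_delta.
apply: continuous_sumf => i; apply: continuous_sumf => j x.
have c : (x0 i j : R) @[x0 --> x] --> (x i j : R) by exact: coord_continuous.
exact: cvgZr_tmp c.
Qed.

Lemma dot_continuousr m n (p : 'M[R]_(m, n)) : continuous (dot p).
Proof.
apply: continuous_sumf => i; apply: continuous_sumf => j x.
have c : (x0 i j : R) @[x0 --> x] --> (x i j : R) by exact: coord_continuous.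
exact: cvgMl_tmp c.
Qed.

End Continuity.

Section Derivatives.
Context {R : realType}.

Lemma is_derive_derivable (V W : normedModType R) (f : V -> W) x v d :
  is_derive x v f d -> derivable f x v.
Proof. by case. Qed.

Lemma is_derive_val (V W : normedModType R) (f : V -> W) x v d :
  is_derive x v f d -> 'D_v f x = d.
Proof. by case. Qed.

Lemma is_derive_mx (V : normedModType R) m n (F : V -> 'M[R]_(m, n)) t v (D : 'M[R]_(m, n)) :
  (forall i j, is_derive t v (fun x => F x i j) (D i j)) -> is_derive t v F D.
Proof.
move=> h; have dF : derivable F t v by apply/derivable_mxP.
apply: DeriveDef => //; rewrite derive_mx //; apply/matrixP => i j.
by rewrite mxE derive_val.
Qed.

Lemma is_derive_coord (V : normedModType R) m n (F : V -> 'M[R]_(m, n)) t v (D : 'M[R]_(m, n)) i j :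
  is_derive t v F D -> is_derive t v (fun x => F x i j) (D i j).
Proof.
move=> [dF <-]; apply: DeriveDef; first exact: (derivable_mxP _ _ _).1.
by rewrite derive_mx // mxE.
Qed.

Lemma is_derive_sumf (V W : normedModType R) (I : finType) (h : I -> V -> W)
    (x v : V) (dh : I -> W) :
  (forall i, is_derive x v (h i) (dh i)) ->
  is_derive x v (fun y => \sum_i h i y) (\sum_i dh i).
Proof.
move=> H; elim: (index_enum I) => [|i s IH].
  rewrite big_nil; under eq_fun do rewrite big_nil; exact: is_derive_cst.
rewrite big_cons; under eq_fun do rewrite big_cons.
exact: is_deriveD.
Qed.

Lemma is_deriveZl (V W : normedModType R) (h : V -> R) (w : W) (x v : V) dh :
  is_derive x v h dh -> is_derive x v (fun y => h y *: w) (dh *: w).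
Proof.
move=> [dh1 <-].
have cv : (fun k : R => k^-1 *: (h (k *: v + x) - h x)) @ 0^' --> 'D_v h x.
  exact: dh1.
have cw : (fun k : R => k^-1 *: (h (k *: v + x) *: w - h x *: w)) @ 0^'
    --> 'D_v h x *: w.
  have -> : (fun k : R => k^-1 *: (h (k *: v + x) *: w - h x *: w)) =
            (fun k : R => (k^-1 *: (h (k *: v + x) - h x)) *: w).
    by apply/funext => k; rewrite -scalerBl scalerA.
  exact: cvgZr_tmp cv.
apply: DeriveDef; first by apply/cvg_ex; exists ('D_v h x *: w).
exact: cvg_lim cw.
Qed.

Lemma is_derive_lin_map (V : normedModType R) m n g (F : V -> 'M[R]_(m, n)) t v (D : 'M[R]_(m, n)) :
  lin_map g -> is_derive t v F D -> is_derive t v (g \o F) (g D).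
Proof.
move=> lg dF; rewrite (lin_map_delta lg D).
rewrite (_ : g \o F = fun x => \sum_i \sum_j F x i j *: g (delta_mx i j)).
  apply: is_derive_sumf => i; apply: is_derive_sumf => j.
  exact/is_deriveZl/is_derive_coord.
by apply/funext => x /=; exact: lin_map_delta.
Qed.

Lemma is_derive_mulf (V : normedModType R) (f g : V -> R) t v (df dg : R) :
  is_derive t v f df -> is_derive t v g dg ->
  is_derive t v (fun x => f x * g x) (df * g t + f t * dg).
Proof.
move=> hf hg; apply: (is_derive_eq (is_deriveM hf hg)).
by rewrite /GRing.scale /= addrC mulrC.
Qed.

Lemma derivable_sumf (V W : normedModType R) (I : finType) (h : I -> V -> W) (x v : V) :
  (forall i, derivable (h i) x v) -> derivable (fun y => \sum_i h i y) x v.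
Proof.
move=> H; apply: is_derive_derivable.
by apply: is_derive_sumf => i; apply: derivableP.
Qed.

Lemma derivable_mulf (V : normedModType R) (f g : V -> R) x v :
  derivable f x v -> derivable g x v -> derivable (fun y => f y * g y) x v.
Proof. exact: derivableM. Qed.

Lemma is_derive_dot (V : normedModType R) m n (F G : V -> 'M[R]_(m, n)) t v
    (dF dG : 'M[R]_(m, n)) :
  is_derive t v F dF -> is_derive t v G dG ->
  is_derive t v (fun x => dot (F x) (G x)) (dot dF (G t) + dot (F t) dG).
Proof.
move=> hF hG; rewrite /dot -big_split /=; apply: is_derive_sumf => i.
rewrite -big_split /=; apply: is_derive_sumf => j.
exact: is_derive_mulf (is_derive_coord i j hF) (is_derive_coord i j hG).
Qed.

Lemma is_derive_addf (V W : normedModType R) (f g : V -> W) t v (df dg : W) :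
  is_derive t v f df -> is_derive t v g dg ->
  is_derive t v (fun x => f x + g x) (df + dg).
Proof. exact: is_deriveD. Qed.

Lemma is_derive_scalef (V W : normedModType R) (f : V -> W) a t v (df : W) :
  is_derive t v f df -> is_derive t v (fun x => a *: f x) (a *: df).
Proof. exact: is_deriveZ. Qed.

Lemma is_derive1_comp (W : normedModType R) (f : R -> W) (g : R -> R) (t dg : R) (df : W) :
  is_derive t 1 g dg -> is_derive (g t) 1 f df ->
  is_derive t 1 (f \o g) (dg *: df).
Proof.
move=> [g1 gE] [f1 fE].
have dg1 : differentiable g t by apply/derivable1_diffP.
have df1 : differentiable f (g t) by apply/derivable1_diffP.
have dfg : differentiable (f \o g) t by apply: differentiable_comp.
apply: DeriveDef; first exact: diff_derivable.
rewrite deriveE // diff_comp //= -fE -gE !deriveE //.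
by rewrite -{1}['d g t 1](mulr1) -[LHS]/('d f (g t) (('d g t 1) *: (1 : R))) linearZ.
Qed.

(* Covers both the unit speed geodesics t |-> cos t A + sin t B of the sphere
   and t |-> cos^2 t A + sin t cos t B + sin^2 t C of the projective spaces. *)
Definition trig_curve (W : lmodType R) (w : R) (A B C : W) (t : R) : W :=
  A + cos (w * t) *: B + sin (w * t) *: C.

Lemma is_derive_mulcst (w t : R) : is_derive t 1 (fun s => w * s) w.
Proof.
by apply: (is_derive_eq (is_deriveZ (f := id) w _)); rewrite /GRing.scale /= mulr1.
Qed.

Lemma is_derive_trig_curve (W : normedModType R) (w : R) (A B C : W) (t : R) :
  is_derive t 1 (trig_curve w A B C) (trig_curve w 0 (w *: C) (- w *: B) t).
Proof.
have dc := is_derive1_comp (is_derive_mulcst w t) (is_derive_cos (w * t)).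
have ds := is_derive1_comp (is_derive_mulcst w t) (is_derive_sin (w * t)).
have := is_derive_addf (is_derive_addf (is_derive_cst A t 1) (is_deriveZl B dc))
  (is_deriveZl C ds).
move/is_derive_eq; apply; rewrite /trig_curve.
have E (x : R) : w *: x = w * x by [].
rewrite !E !add0r addrC !scalerA; congr (_ + _).
  by rewrite mulrC.
by congr (_ *: _); rewrite !mulrN mulrC.
Qed.

End Derivatives.

Section Smooth.
Context {R : realType}.

Lemma smooth_derivable (W : normedModType R) (c : R -> W) (t : R) :
  smooth (c : R^o -> W) -> derivable c t 1.
Proof. by move=> /(_ 1%N) [_ /(_ 1)[h _]]; exact: h. Qed.

Lemma smooth_derive1 (W : normedModType R) (c : R -> W) (t : R) :
  smooth (c : R^o -> W) -> is_derive t 1 c (derive1 c t).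
Proof. by move=> /(@smooth_derivable _ _ t) dc; rewrite derive1E; exact: derivableP. Qed.

Lemma derive_dir (W : normedModType R) (c : R -> W) (t v : R) (d : W) :
  is_derive t 1 c d -> is_derive t v c (v *: d).
Proof.
move=> [h E]; have dc : differentiable c t by apply/derivable1_diffP.
apply: DeriveDef; first exact: diff_derivable.
by rewrite -E !deriveE // -linearZ /= [v *: 1]mulr1.
Qed.

Lemma smooth_trig_curve (W : normedModType R) (w : R) (A B C : W) :
  smooth (trig_curve w A B C : R^o -> W).
Proof.
have cT A' B' C' : continuous (trig_curve w A' B' C' : R^o -> W).
  move=> t; apply: differentiable_continuous; apply/derivable1_diffP.
  exact: is_derive_derivable (is_derive_trig_curve w A' B' C' t).
move=> n; elim: n A B C => [|n IH] A B C; first by split.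
split=> // v; have D t := derive_dir v (is_derive_trig_curve w A B C t).
split=> [t|]; first exact: is_derive_derivable (D t).
rewrite (_ : (fun a => _) = trig_curve w 0 (v *: (w *: C)) (v *: (- w *: B))).
  exact: IH.
apply/funext => t; rewrite (is_derive_val (D t)).
by rewrite /trig_curve !add0r scalerDr !scalerA; congr (_ *: _ + _ *: _); ring.
Qed.

Lemma smooth_lin_map m n (g : 'M[R]_(m, n) -> 'M[R]_(m, n)) (c : R -> 'M[R]_(m, n)) :
  lin_map g -> smooth (c : R^o -> _) -> smooth (g \o c : R^o -> _).
Proof.
move=> lg sc k; move: (sc k) => {sc}.
have cT c' : continuous (c' : R^o -> 'M[R]_(m, n)) -> continuous (g \o c' : R^o -> _).
  by move=> cc t; apply: continuous_comp (cc t) _; exact: lin_map_continuous.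
elim: k c => [|k IH] c [cc H]; first by split => //; exact: cT.
split=> [|v]; first exact: cT.
have [h1 h2] := H v.
have D a : is_derive a v (g \o c) (g ('D_v c a)).
  exact: (is_derive_lin_map lg (derivableP (h1 a))).
split=> [a|]; first exact: is_derive_derivable (D a).
rewrite (_ : (fun a => _) = g \o (fun a => 'D_v c a)); first exact: IH.
by apply/funext => a; rewrite (is_derive_val (D a)).
Qed.

End Smooth.

(** * Chain rule along curves for functions of class C^1 *)

Section ChainRule.
Context {R : realType}.

Lemma is_derive_shift0 (W : normedModType R) (f : R -> W) (t : R) (d : W) :
  is_derive t 1 f d <-> is_derive (0 : R) 1 (fun h => f (h + t)) d.
Proof.
have E : (fun h : R => h^-1 *: ((f \o shift t) (h *: 1) - f t)) =
   (fun h : R => h^-1 *: (((fun h => f (h + t)) \o shift 0) (h *: 1) - f (0 + t))).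
  by apply/funext => h /=; rewrite addr0 add0r.
by split=> -[h1 h2]; apply: DeriveDef;
  rewrite /derivable /derive; [rewrite -E|rewrite -E|rewrite E|rewrite E].
Qed.

(** Since d vanishes at 0, only the limit of w there matters. In the application w is evaluated at
    mean value points, which come from a choice and need not depend continuously on h. *)
Lemma is_derive_mul_cvg (d w : R -> R) (d' w0 : R) :
  is_derive (0 : R) 1 d d' -> d 0 = 0 -> w h @[h --> 0^'] --> w0 ->
  is_derive (0 : R) 1 (fun h => d h * w h) (d' * w0).
Proof.
move=> [d1 dE] d0 cw.
have cd : (fun h : R => h^-1 *: (d (h *: 1 + 0) - d 0)) @ 0^' --> d'.
  by rewrite -dE; exact: d1.
have E : (fun h : R => h^-1 *: (d (h *: 1 + 0) * w (h *: 1 + 0) - d 0 * w 0)) =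
    (fun h : R => (h^-1 *: (d (h *: 1 + 0) - d 0)) * w h).
  apply/funext => h; rewrite d0 mul0r !subr0 addr0 /GRing.scale /= mulr1.
  by rewrite mulrA.
have c : (fun h : R => h^-1 *: (d (h *: 1 + 0) * w (h *: 1 + 0) - d 0 * w 0)) @ 0^'
    --> d' * w0 by rewrite E; exact: cvgM.
apply: DeriveDef; first by apply/cvg_ex; exists (d' * w0).
exact: cvg_lim c.
Qed.

Variables (m n : nat).
Local Notation E := 'M[R]_(m, n).
Variable F : E -> R.
Hypothesis C1F : Ck 1 (F : E -> R^o).

Lemma Ck1_is_derive x v : is_derive x v F ('D_v F x).
Proof. by apply: derivableP; case: C1F => _ /(_ v) [h _]; exact: h. Qed.

Lemma is_derive_line x v (t : R) :
  is_derive t 1 (fun s => F (x + s *: v)) ('D_v F (x + t *: v)).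
Proof.
have [h1 h2] := Ck1_is_derive (x + t *: v) v.
have E1 : (fun h : R => h^-1 *: ((F \o shift (x + t *: v)) (h *: v) - F (x + t *: v))) =
  (fun h : R => h^-1 *: (((fun s => F (x + s *: v)) \o shift t) (h *: 1) - F (x + t *: v))).
  apply/funext => h /=; congr (_ *: (F _ - _)).
  by rewrite scalerDl [_ *: 1]mulr1 addrCA.
by apply: DeriveDef; rewrite /derivable /derive -E1.
Qed.

Lemma line_mvt x v (t : R) :
  exists2 th : R, `|th| <= `|t| & F (x + t *: v) - F x = t * 'D_v F (x + th *: v).
Proof.
have D := is_derive_line x v.
have cD (a b : R) : {within `[a, b], continuous (fun s => F (x + s *: v))}.
  apply: derivable_within_continuous => s _.
  exact: is_derive_derivable (D s).
have [t0|t0] := leP 0 t.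
  have [c cI e] := MVT_segment t0 (fun s _ => D s) (cD 0 t).
  move: cI; rewrite in_itv /= => /andP[c0 ct]; exists c.
    by rewrite !ger0_norm.
  by move: e; rewrite scale0r addr0 subr0 mulrC => ->.
have [c cI e] := MVT_segment (ltW t0) (fun s _ => D s) (cD t 0).
move: cI; rewrite in_itv /= => /andP[c0 ct]; exists c.
  by rewrite !ler0_norm ?lerN2 // ltW.
move: e; rewrite scale0r addr0 sub0r => e.
by rewrite -opprB e mulrN opprK mulrC.
Qed.

(** [Ck] speaks of directional derivatives only, so the increment is split into one step per
    direction e k. Each step is d k h times a derivative at an intermediate point, by [line_mvt],
    and continuity of the derivatives gives the limit. *)
Lemma is_derive_curve_seq (I : Type) (s : seq I) (e : I -> E) (d : I -> R -> R)
    (d' : I -> R) x :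
  (forall k, is_derive (0 : R) 1 (d k) (d' k)) -> (forall k, d k 0 = 0) ->
  is_derive (0 : R) 1 (fun h => F (x + \sum_(k <- s) d k h *: e k))
    (\sum_(k <- s) d' k * 'D_(e k) F x).
Proof.
move=> Hd d0; elim: s => [|k s IH].
  rewrite big_nil; under eq_fun do rewrite big_nil.
  exact: is_derive_cst.
have dc j : d j h @[h --> 0^'] --> (0 : R).
  have cj : d j h @[h --> (0 : R)] --> d j 0.
    apply: (@differentiable_continuous _ _ _ 0 (d j)).
    by apply/derivable1_diffP; exact: is_derive_derivable (Hd j).
  by rewrite d0 in cj; apply: cvg_trans cj; apply: cvg_app; exact: cvg_within.
pose P h := x + \sum_(k <- s) d k h *: e k.
have cP : P h @[h --> 0^'] --> x.
  have c0 : \sum_(k <- s) d k h *: e k @[h --> 0^'] --> (0 : E).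
    elim: (s) => [|j s' IHs].
      by under eq_fun do rewrite big_nil; exact: cvg_cst.
    have -> : (fun h => \sum_(k <- j :: s') d k h *: e k) =
        (fun h => d j h *: e j + \sum_(k <- s') d k h *: e k).
      by apply/funext => h; rewrite big_cons.
    have := cvgD (cvgZr_tmp (a := e j) (dc j)) IHs.
    by rewrite scale0r addr0; apply.
  by have := cvgD (cvg_cst x) c0; rewrite addr0; apply.
have /choice[th thP] : forall h, exists th : R, `|th| <= `|d k h| /\
    F (P h + d k h *: e k) - F (P h) = d k h * 'D_(e k) F (P h + th *: e k).
  by move=> h; have [th th1 th2] := line_mvt (P h) (e k) (d k h); exists th.
have cth : th h @[h --> 0^'] --> (0 : R).
  apply/cvgr0Pnorm_lt => eps eps0; near=> h.
  apply: le_lt_trans (thP h).1 _.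
  by near: h; move/cvgr0Pnorm_lt : (dc k) => /(_ _ eps0).
have cw : 'D_(e k) F (P h + th h *: e k) @[h --> 0^'] --> 'D_(e k) F x.
  have cD : {for x, continuous ('D_(e k) F)}.
    by case: C1F => _ /(_ (e k)) [_ [cD _]]; exact: cD.
  apply: (continuous_cvg _ cD).
  by have := cvgD cP (cvgZr_tmp (a := e k) cth); rewrite scale0r addr0; apply.
have D1 := is_derive_mul_cvg (Hd k) (d0 k) cw.
rewrite big_cons.
rewrite (_ : (fun h => _) = (fun h => d k h * 'D_(e k) F (P h + th h *: e k) + F (P h))).
  exact: is_derive_addf D1 IH.
apply/funext => h; rewrite -(thP h).2 subrK big_cons /P.
by rewrite (addrC (d k h *: _)) addrA.
Unshelve. all: by end_near. Qed.

Lemma is_derive_along_curve (c : R -> E) (t : R) (c' : E) :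
  is_derive t 1 c c' ->
  is_derive t 1 (F \o c) (\sum_i \sum_j c' i j * 'D_(delta_mx i j) F (c t)).
Proof.
move=> /is_derive_shift0 dc; apply/is_derive_shift0.
pose d (k : 'I_m * 'I_n) h := c (h + t) k.1 k.2 - c t k.1 k.2.
have dd k : is_derive (0 : R) 1 (d k) (c' k.1 k.2).
  rewrite -[X in is_derive _ _ _ X]subr0.
  exact: (is_deriveB (is_derive_coord k.1 k.2 dc) (is_derive_cst _ _ _)).
have := is_derive_curve_seq (index_enum _) (fun k => delta_mx k.1 k.2) (c t) dd.
rewrite (pair_bigA _ (fun i j => c' i j * 'D_(delta_mx i j) F (c t))) /=.
rewrite (_ : (fun h => F _) = (fun h => (F \o c) (h + t))).
  by apply => k; rewrite /d add0r subrr.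
apply/funext => h /=; congr F; rewrite /d.
rewrite -[RHS](subrK (c t)) addrC; congr (_ + _).
rewrite [RHS]matrix_sum_delta pair_big /=.
by apply: eq_bigr => k _; rewrite !mxE.
Qed.

End ChainRule.

(** * The abstract model of a space and the Laplacian along its geodesics *)

Section Model.
Context {R : realType}.
Variable M : cross.
Local Notation E := (ambient R M).
Local Notation S := (carrier R M).
Local Notation d := (cross_dim M).
Local Notation alpha := (cross_alpha R M).
Local Notation beta := (cross_beta R M).

Definition ortho_map (g : E -> E) : Prop :=
  [/\ lin_map g, forall u v, dot (g u) (g v) = dot u v
    & forall p, S p -> S (g p)].

Definition symm (g : E -> E) : Prop :=
  exists h, [/\ ortho_map g, ortho_map h, cancel g h & cancel h g].

(* What the proof uses of the space: [mvel] and [macc] are the velocity and the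
   acceleration at [mbase] of the geodesics [t |-> mflow i t mbase], which form
   an orthonormal frame; [msd] is the zonal variable (1 - cos) / 2, running
   over [0, 1], in which the radial part of the Laplacian is [mrho] times the
   Jacobi operator. *)
Record cross_model : Type := CrossModel {
  mbase : E;
  mkap : R;
  mrho : R;
  momega : R;
  mcurveA : 'I_d -> E;
  mcurveB : 'I_d -> E;
  mcurveC : 'I_d -> E;
  mflow : 'I_d -> R -> E -> E;
  mvel := fun i => momega *: mcurveC i;
  macc := fun i => momega *: (- momega *: mcurveB i);
  msd := fun p q : E => (1 - dot p q) / mkap;
  mbaseS : S mbase;
  mclosed : closed S;
  mdot1 : forall p, S p -> dot p p = 1;
  mkap_gt0 : 0 < mkap;
  mrho_gt0 : 0 < mrho;
  msd_ge0 : forall p q, S p -> S q -> 0 <= msd p q;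
  msd_le1 : forall p q, S p -> S q -> msd p q <= 1;
  mswap : forall p q, S p -> S q -> exists g, [/\ symm g, g p = q & g q = p];
  mflow_symm : forall i t, symm (mflow i t);
  mflow_base : forall i t, mflow i t mbase =
    trig_curve momega (mcurveA i) (mcurveB i) (mcurveC i) t;
  mflow_derivable : forall i x, derivable (fun t => mflow i t x) (0 : R) 1;
  mcurve0 : forall i, mcurveA i + mcurveB i = mbase;
  mvel_ortho : forall i j, metric (mvel i) (mvel j) = (i == j)%:R;
  mtangent : forall c, smooth_curve c -> c 0 = mbase ->
    derive1 c 0 = \sum_i metric (derive1 c 0) (mvel i) *: mvel i;
  mtangent_acc : forall c, smooth_curve c -> c 0 = mbase ->
    forall i, dot (derive1 c 0) (macc i) = 0;
  msum_vel : forall q, S q -> \sum_i dot (mvel i) q ^+ 2 =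
    mrho * mkap ^+ 2 * (msd mbase q * (1 - msd mbase q));
  msum_acc : forall q, S q -> \sum_i dot (macc i) q =
    - (mrho * mkap * ((alpha + 1) - (alpha + beta + 2) * msd mbase q));
  mgamma2 : forall j : nat, cross_gamma2 R M j =
    mrho * (j%:R * (j%:R + alpha + beta + 1))
}.

Lemma symm_comp g h : symm g -> symm h -> symm (g \o h).
Proof.
move=> [g' [[lg dg Sg] [lg' dg' Sg'] c1 c2]] [h' [[lh dh Sh] [lh' dh' Sh'] c3 c4]].
exists (h' \o g'); split.
- split=> [a u v /=|u v /=|p /Sh /Sg //]; first by rewrite lh lg.
  by rewrite dg dh.
- split=> [a u v /=|u v /=|p /Sg' /Sh' //]; first by rewrite lg' lh'.
  by rewrite dh' dg'.
- exact: (can_comp c1 c3).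
- exact: (can_comp c4 c2).
Qed.

Lemma symm_inv g : symm g -> exists h, [/\ symm h, cancel g h & cancel h g].
Proof. by move=> [h [a b c e]]; exists h; split=> //; exists g; split. Qed.

Lemma symmS g p : symm g -> S p -> S (g p).
Proof. by move=> [h [[_ _ H] _ _ _]]; exact: H. Qed.

Lemma symm_dot g u v : symm g -> dot (g u) (g v) = dot u v.
Proof. by move=> [h [[_ H _] _ _ _]]; exact: H. Qed.

Lemma symm_lin g : symm g -> lin_map g.
Proof. by move=> [h [[H _ _] _ _ _]]; exact: H. Qed.

Lemma symm_metric g u v : symm g -> metric (g u) (g v) = metric u v.
Proof. by move=> sg; rewrite /metric -!/(dot _ _) symm_dot. Qed.

Lemma symm_curve g c : symm g -> smooth_curve c -> @smooth_curve R M (g \o c).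
Proof.
move=> sg [c1 c2]; split; first exact: (smooth_lin_map (symm_lin sg) c1).
by move=> t; exact: symmS.
Qed.

Lemma derive1_lin_map g (c : R -> E) t :
  lin_map g -> smooth (c : R^o -> E) -> derive1 (g \o c) t = g (derive1 c t).
Proof.
move=> lg sc; rewrite derive1E.
exact: (is_derive_val (is_derive_lin_map lg (smooth_derive1 t sc))).
Qed.

Lemma symm_isometry g : symm g -> is_isometry g.
Proof.
move=> sg; have [h [sh c1 c2]] := symm_inv sg; split.
  split=> [p Sp|p q _ _|p Sp] /=; first exact: symmS.
  - exact: (can_inj c1).
  - by exists (h p); [exact: symmS|exact: c2].
move=> c sc; split; first exact: symm_curve.
move=> t; rewrite [X in metric X X](derive1_lin_map t (symm_lin sg) sc.1).
exact: symm_metric.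
Qed.

Variable X : cross_model.
Local Notation base := (mbase X).

Lemma flowS i t : S (mflow X i t base).
Proof. exact: symmS (mflow_symm X i t) (mbaseS X). Qed.

Lemma flow0 i : mflow X i 0 base = base.
Proof.
by rewrite mflow_base /trig_curve mulr0 cos0 sin0 scale1r scale0r addr0 mcurve0.
Qed.

Lemma flow_is_derive i (t : R) : is_derive t 1 (fun s => mflow X i s base)
  (trig_curve (momega X) 0 (momega X *: mcurveC X i) (- momega X *: mcurveB X i) t).
Proof.
rewrite (_ : (fun _ => _) = trig_curve (momega X) (mcurveA X i) (mcurveB X i) (mcurveC X i)).
  exact: is_derive_trig_curve.
by apply/funext => s; rewrite mflow_base.
Qed.

Lemma flow_curve i : smooth_curve (fun s => mflow X i s base).
Proof.
split; last by move=> t; exact: flowS.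
rewrite (_ : (fun _ => _) = trig_curve (momega X) (mcurveA X i) (mcurveB X i) (mcurveC X i)).
  exact: smooth_trig_curve.
by apply/funext => s; rewrite mflow_base.
Qed.

(* Second derivatives are taken along the geodesics of the frames [g o mvel]
   at [g base]; [laplacian_on w w'] says that w' is minus their sum. *)
Definition laplacian_on (w w' : E -> R) : Prop :=
  forall g, symm g -> exists (h1 : 'I_d -> R -> R) (s : 'I_d -> R),
    [/\ forall i (t : R), is_derive t 1 (fun t => w (g (mflow X i t base))) (h1 i t),
        forall i, is_derive (0 : R) 1 (h1 i) (s i)
      & \sum_i s i = - w' (g base)].

Lemma smooth_shift (W : normedModType R) (c : R -> W) (t : R) :
  smooth (c : R^o -> W) -> smooth ((fun s => c (s + t)) : R^o -> W).
Proof.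
move=> sc n; move: (sc n) => {sc}; elim: n c => [|n IH] c [cc H].
all: have cs : continuous ((fun s => c (s + t)) : R^o -> W) by
  move=> s; apply: (@continuous_comp _ _ _ (fun s : R => s + t) c);
  [apply: cvgD; [exact: cvg_id|exact: cvg_cst]|exact: cc].
  by split.
split=> // v; have [h1 h2] := H v.
have E a : (fun h : R => h^-1 *: (((fun s => c (s + t)) \o shift a) (h *: v) - c (a + t)))
    = (fun h : R => h^-1 *: ((c \o shift (a + t)) (h *: v) - c (a + t))).
  by apply/funext => h /=; rewrite addrA.
split=> [a|]; first by rewrite /derivable (E a); exact: h1.
rewrite (_ : (fun a => _) = (fun s => 'D_v (c : R^o -> W) (s + t))).
  exact: (IH ('D_v (c : R^o -> W)) h2).
by apply/funext => a; rewrite /derive (E a).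
Qed.

Lemma curve_shift c (t : R) :
  @smooth_curve R M c -> @smooth_curve R M (fun s => c (s + t)).
Proof. by move=> [c1 c2]; split=> //; exact: smooth_shift. Qed.

(** The inverse symmetry pulls the curve back to the base point, where [mtangent] and [mtangent_acc]
    apply. The second part says that the geodesics have normal acceleration. *)
Lemma tangent_frame g v : symm g -> tangent (g base) v ->
  v = \sum_i metric v (g (mvel X i)) *: g (mvel X i) /\
  forall i, metric v (g (macc X i)) = 0.
Proof.
move=> sg [c [sc c0 cv]]; have [h [sh c1 c2]] := symm_inv sg.
have shc := symm_curve sh sc.
have hc0 : (h \o c) 0 = base by rewrite /= c0 c1.
have dhc : derive1 (h \o c) 0 = h v.
  by rewrite (derive1_lin_map _ (symm_lin sh) sc.1) cv.
have hm w : metric (h v) w = metric v (g w).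
  by rewrite -(symm_metric _ _ sg) c2.
split.
  rewrite -[LHS]c2 -dhc (mtangent shc hc0) dhc (lin_map_sum (symm_lin sg)).
  by apply: eq_bigr => i _; rewrite (lin_mapZ (symm_lin sg)) hm.
move=> i; rewrite -hm -dhc /metric -!/(dot _ _).
by rewrite (mtangent_acc shc hc0) mulr0.
Qed.

(** Along a geodesic c, (f o c)' = <V, c'> for the gradient V, hence (f o c)'' = <(V o c)', c'> +
    <V, c''>. The last term vanishes because c'' is normal, and the first ones add up to the
    divergence. What needs an argument is that V o c is differentiable. *)
Lemma laplacian_laplacian_on f f' :
  smooth_on_cross f -> is_laplacian f f' -> laplacian_on f f'.
Proof.
move=> [F [sF fF]] [V [gV dV]] g sg.
pose G i t := g \o mflow X i t.
have sG i t : symm (G i t) by apply: symm_comp => //; exact: mflow_symm.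
have SG i t : S (G i t base) by apply: symmS => //; exact: mbaseS.
pose c i t := G i t base.
have sc i : smooth_curve (c i) by exact: (symm_curve sg (flow_curve i)).
have Dc i (t : R) : is_derive t 1 (c i) (g (trig_curve (momega X) 0
    (momega X *: mcurveC X i) (- momega X *: mcurveB X i) t)).
  exact: (is_derive_lin_map (symm_lin sg) (flow_is_derive i t)).
have Dc2 i : is_derive (0 : R) 1 (fun t => g (trig_curve (momega X) 0
    (momega X *: mcurveC X i) (- momega X *: mcurveB X i) t)) (g (macc X i)).
  apply: (is_derive_lin_map (symm_lin sg)).
  apply: (is_derive_eq (is_derive_trig_curve _ _ _ _ _)).
  by rewrite /trig_curve mulr0 cos0 sin0 scale1r scale0r addr0 add0r.
have c0 i : c i 0 = g base by rewrite /c /G /= flow0.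
have cv i : g (trig_curve (momega X) 0 (momega X *: mcurveC X i)
    (- momega X *: mcurveB X i) 0) = g (mvel X i).
  by rewrite /trig_curve mulr0 cos0 sin0 scale1r scale0r addr0 add0r.
have dc i t : derive1 (c i) t = g (trig_curve (momega X) 0
    (momega X *: mcurveC X i) (- momega X *: mcurveB X i) t).
  by rewrite derive1E; exact: is_derive_val (Dc i t).
have dc0 i : derive1 (c i) 0 = g (mvel X i) := etrans (dc i 0) (cv i).
(* V is prescribed only pointwise on the carrier. In the transported frame its coefficients are
   derivatives of the smooth extension F, which will make V o c i differentiable. *)
have Vc i (t : R) : V (c i t) = \sum_l
    (\sum_a \sum_b G i t (mvel X l) a b * 'D_(delta_mx a b) F (c i t))
      *: G i t (mvel X l).
  have tV : tangent (G i t base) (V (c i t)) by have [] := gV (c i t) (SG i t).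
  rewrite [LHS](tangent_frame (sG i t) tV).1; apply: eq_bigr => l _; congr (_ *: _).
  have sGl := symm_curve (sG i t) (flow_curve l).
  have G0 : (G i t \o (fun s => mflow X l s base)) 0 = c i t by rewrite /= flow0.
  have [_ /(_ _ sGl G0) H] := gV (c i t) (SG i t).
  have dG := is_derive_lin_map (symm_lin (sG i t)) (flow_is_derive l 0).
  have e0 : G i t (trig_curve (momega X) 0 (momega X *: mcurveC X l)
    (- momega X *: mcurveB X l) 0) = G i t (mvel X l).
    by rewrite /trig_curve mulr0 cos0 sin0 scale1r scale0r addr0 add0r.
  rewrite e0 in dG.
  have := is_derive_along_curve (sF 1%N) dG; rewrite G0 => H2.
  have dGE : derive1 (G i t \o (fun s => mflow X l s base)) 0 = G i t (mvel X l).
    by rewrite derive1E; exact: is_derive_val dG.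
  rewrite dGE in H; rewrite -(is_derive_val H2) -(is_derive_val H).
  by congr (derive _ _ _); apply/funext => s; apply: fF; exact: sGl.2.
have DV i : derivable (V \o c i) (0 : R) 1.
  have DG l a b : derivable (fun t => G i t (mvel X l) a b) (0 : R) 1.
    move: a b; apply/derivable_mxP.
    apply: (@is_derive_derivable _ _ _ _ _ _ (g ('D_1 (fun t => mflow X i t (mvel X l)) (0 : R)))).
    apply: (is_derive_lin_map (symm_lin sg)).
    by apply: derivableP; exact: mflow_derivable.
  have DF a b : derivable (fun t => 'D_(delta_mx a b) F (c i t)) (0 : R) 1.
    apply: is_derive_derivable.
    exact: (is_derive_along_curve (proj2 ((sF 2%N).2 (delta_mx a b))) (Dc i 0)).
  rewrite (_ : V \o c i = fun t => \sum_l
    (\sum_a \sum_b G i t (mvel X l) a b * 'D_(delta_mx a b) F (c i t))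
      *: G i t (mvel X l)); last by apply/funext => t; exact: Vc.
  apply: derivable_sumf => l; apply/derivable_mxP => a0 b0.
  rewrite (_ : (fun t => _) = (fun t => (\sum_a \sum_b G i t (mvel X l) a b *
     'D_(delta_mx a b) F (c i t)) * G i t (mvel X l) a0 b0)); last first.
    by apply/funext => t; rewrite mxE.
  apply: derivable_mulf; last exact: DG.
  apply: derivable_sumf => a; apply: derivable_sumf => b.
  by apply: derivable_mulf; [exact: DG|exact: DF].
have DVP i := derivableP (DV i).
have tp : tangent (g base) (V (g base)) by have [] := gV _ (symmS sg (mbaseS X)).
exists (fun i t => metric (V (c i t)) (derive1 (c i) t)),
  (fun i => metric ('D_1 (V \o c i) (0 : R)) (g (mvel X i))); split.
- move=> i t; apply/is_derive_shift0.
  have [_ H] := gV (c i t) (SG i t).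
  have sct := curve_shift t (sc i).
  have := H _ sct; rewrite add0r => /(_ erefl).
  have -> : derive1 (fun s => c i (s + t)) 0 = derive1 (c i) t by
    rewrite dc derive1E; apply: is_derive_val;
    exact: (is_derive_shift0 _ _ _).1 (Dc i t).
  exact.
- move=> i; rewrite /metric.
  rewrite (_ : (fun t => _) = fun t => cross_scale R M * dot (V (c i t)) (g (trig_curve (momega X) 0
    (momega X *: mcurveC X i) (- momega X *: mcurveB X i) t))); last first.
    by apply/funext => t; rewrite dc.
  apply: is_derive_eq.
    exact: is_derive_scalef (is_derive_dot (DVP i) (Dc2 i)).
  have := (tangent_frame sg tp).2 i; rewrite /metric -!/(dot _ _) => e.
  rewrite /GRing.scale /= cv mulrDr c0 e addr0 //.
- have /= := dV _ (symmS sg (mbaseS X)) c (fun i => conj (sc i) (c0 i)).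
  move=> H; rewrite -H.
    by apply: eq_bigr => i _; rewrite dc0 derive1E.
  by move=> i j; rewrite !dc0 symm_metric // mvel_ortho.
Qed.

End Model.

(** * Second derivative test, compactness and separable kernels *)

Section RealAnalysis.
Context {R : realType}.

(** h1 is differentiable at 0 only, so the mean value theorem replaces a Taylor formula: if s > 0,
    then h1 > 0 just to the right of 0 and h exceeds h 0 there. *)
Lemma second_derivative_at_max (h h1 : R -> R) (s : R) :
  (forall t : R, is_derive t 1 h (h1 t)) -> is_derive (0 : R) 1 h1 s ->
  (forall t, h t <= h 0) -> s <= 0.
Proof.
move=> Dh [c1 sE] hmax; rewrite leNgt; apply/negP => s0.
have I0 : (0 : R) \in `](- 1), 1[%R by rewrite in_itv /= ltrN10 ltr01.
have D0 : is_derive (0 : R) 1 h 0.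
  apply: (derive1_at_max _ _ I0 (fun t _ => hmax t)); first by lra.
  by move=> t _; exact: is_derive_derivable (Dh t).
have h10 : h1 0 = 0 by rewrite -(is_derive_val (Dh 0)) (is_derive_val D0).
have cv : (fun k : R => k^-1 *: (h1 (k *: 1 + 0) - h1 0)) @ 0^' --> s.
  by rewrite -sE; exact: c1.
have : \forall k \near 0^', 0 < k^-1 *: (h1 (k *: 1 + 0) - h1 0).
  exact: (cvgr_gt s).
rewrite near_withinE => /nbhs_ballP[e /= e0 He].
have e20 : 0 < e / 2 by rewrite divr_gt0.
have ch : {within `[0, e / 2], continuous h}.
  by apply: derivable_within_continuous => t _; exact: is_derive_derivable (Dh t).
have [c] := MVT e20 (fun t _ => Dh t) ch.
rewrite in_itv /= subr0 => /andP[c0 ce] E.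
have := He c; rewrite /ball /= sub0r normrN gtr0_norm // => /(_ _ _).
have -> : c *: 1 + 0 = c by rewrite addr0 [_ *: 1]mulr1.
rewrite h10 subr0 [_ *: _]/(_ * _) pmulr_rgt0 ?invr_gt0 // => H.
have h1c : 0 < h1 c.
  by apply: H; [apply: lt_trans ce _; rewrite ltr_pdivrMr // mulr2n; lra|rewrite gt_eqF].
have := hmax (e / 2); rewrite leNgt => /negP; apply.
by rewrite -subr_gt0 E mulr_gt0.
Qed.

Lemma vec_mx_continuous m n :
  continuous (vec_mx : 'rV[R]_(m * n) -> 'M[R]_(m, n)).
Proof.
rewrite (_ : vec_mx = fun v : 'rV[R]_(m * n) =>
    \sum_k v 0 k *: (vec_mx (delta_mx 0 k) : 'M[R]_(m, n))); last first.
  apply/funext => v; rewrite {1}[v]row_sum_delta linear_sum.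
  by apply: eq_bigr => k _; rewrite linearZ.
apply: continuous_sumf => k x.
have c : (v 0 k : R) @[v --> x] --> (x 0 k : R) by exact: coord_continuous.
exact: cvgZr_tmp c.
Qed.

Lemma mx_compact m n (A : set 'M[R]_(m, n)) (B : R) :
  closed A -> (forall x, A x -> forall i j, `|x i j| <= B) -> compact A.
Proof.
move=> cA bA.
have K : compact [set v : 'rV[R]_(m * n) | forall i, v ord0 i \in `[(- B), B]].
  apply: (@rV_compact _ _ (fun=> `[(- B), B]%classic)).
  by move=> _; exact: segment_compact.
have K2 : compact (vec_mx @` [set v : 'rV[R]_(m * n) | forall i, v ord0 i \in `[(- B), B]]).
  apply: continuous_compact K; apply: continuous_subspaceT.
  exact: vec_mx_continuous.
apply: subclosed_compact cA K2 _ => x Ax; exists (mxvec x); last exact: mxvecK.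
move=> k; case/mxvec_indexP: k => i j; rewrite mxvecE in_itv /=.
by rewrite -ler_norml bA.
Qed.

End RealAnalysis.

Section Separable.
Context {R : realType} {E : topologicalType}.

(* Finite rank kernels h(t, q), whose t-derivatives commute with integration in
   q by linearity. *)
Definition separable (h : R -> E -> R) : Prop :=
  exists (K : finType) (a : K -> E -> R) (e e1 : K -> R -> R) (e2 : K -> R),
    [/\ forall k, continuous (a k),
        forall k (t : R), is_derive t 1 (e k) (e1 k t),
        forall k, is_derive (0 : R) 1 (e1 k) (e2 k)
      & forall t q, h t q = \sum_k a k q * e k t].

Lemma separable_q (a : E -> R) : continuous a -> separable (fun _ q => a q).
Proof.
move=> ca; exists unit, (fun _ => a), (fun _ _ => 1), (fun _ _ => 0), (fun=> 0).
split=> [//|_ t|_|t q]; try exact: is_derive_cst.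
by rewrite (big_pred1 tt) ?mulr1 //; case.
Qed.

Lemma separable_t (e e1 : R -> R) (e2 : R) :
  (forall t : R, is_derive t 1 e (e1 t)) -> is_derive (0 : R) 1 e1 e2 ->
  separable (fun t _ => e t).
Proof.
move=> de de1; exists unit, (fun _ _ => 1), (fun=> e), (fun=> e1), (fun=> e2).
split=> // [_ q|t q]; first exact: cvg_cst.
by rewrite (big_pred1 tt) ?mul1r //; case.
Qed.

Lemma separableD h g : separable h -> separable g ->
  separable (fun t q => h t q + g t q).
Proof.
move=> [K [a [e [e1 [e2 [ca de de1 hE]]]]]] [L [b [f [f1 [f2 [cb df df1 gE]]]]]].
pose S (T : Type) (x : K -> T) (y : L -> T) s :=
  match s with inl k => x k | inr l => y l end.
exists (K + L)%type, (S _ a b), (S _ e f), (S _ e1 f1), (S _ e2 f2).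
split=> [[k|k]|[k|k] t|[k|k]|t q].
- exact: ca.
- exact: cb.
- exact: de.
- exact: df.
- exact: de1.
- exact: df1.
by rewrite hE gE big_sumType.
Qed.

Lemma separableM h g : separable h -> separable g ->
  separable (fun t q => h t q * g t q).
Proof.
move=> [K [a [e [e1 [e2 [ca de de1 hE]]]]]] [L [b [f [f1 [f2 [cb df df1 gE]]]]]].
exists (K * L)%type, (fun k q => a k.1 q * b k.2 q), (fun k t => e k.1 t * f k.2 t),
  (fun k t => e1 k.1 t * f k.2 t + e k.1 t * f1 k.2 t),
  (fun k => e2 k.1 * f k.2 0 + e1 k.1 0 * f1 k.2 0 +
            (e1 k.1 0 * f1 k.2 0 + e k.1 0 * f2 k.2)).
split=> [k q|k t|k|t q].
- by apply: cvgM; [exact: ca|exact: cb].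
- exact: is_derive_mulf.
- apply: is_derive_addf; exact: is_derive_mulf.
rewrite hE gE big_distrl /= (eq_bigr (fun k => \sum_l (a k q * b l q) * (e k t * f l t))).
  by rewrite (pair_bigA _ (fun k l => (a k q * b l q) * (e k t * f l t))).
by move=> k _; rewrite big_distrr; apply: eq_bigr => l _; rewrite /= mulrACA.
Qed.

Lemma separable_horner (p : {poly R}) h : separable h ->
  separable (fun t q => p.[h t q]).
Proof.
move=> sh; elim/poly_ind: p => [|p c IH].
  rewrite (_ : (fun _ => _) = fun _ _ => 0); first exact: separable_q (@cst_continuous _ _ _).
  by apply/funext => t; apply/funext => q; rewrite horner0.
rewrite (_ : (fun _ => _) = fun t q => p.[h t q] * h t q + c).
  by apply: separableD; [exact: separableM|exact: separable_q (@cst_continuous _ _ _)].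
by apply/funext => t; apply/funext => q; rewrite hornerD hornerMX hornerC.
Qed.

End Separable.

(** * Jacobi polynomials and their norms for the beta distribution *)

Section Jacobi.
Context {R : realType}.
Implicit Types (a b : R) (f g u : {poly R}).

(** The Jacobi operator moved from [-1, 1] to [0, 1]; it is w^-1 d/ds (s (1 - s) w f') for the
    weight w = s^a (1 - s)^b. *)
Definition jacobi_op a b f : {poly R} :=
  'X * (1 - 'X) * f^`()^`() + ((a + 1)%:P - (a + b + 2) *: 'X) * f^`().

Lemma jacobi_op_horner a b f s : (jacobi_op a b f).[s] =
  s * (1 - s) * f^`()^`().[s] + ((a + 1) - (a + b + 2) * s) * f^`().[s].
Proof. by rewrite /jacobi_op !hornerE. Qed.

(** Coefficients of the hypergeometric polynomial 2F1(-j, j + a + b + 1; a + 1; s), given by the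
    two-term recurrence that [coef_jacobi_op] exhibits. The factor i' - j ends the series at degree
    j. *)
Fixpoint jacobi_coef a b (j i : nat) : R :=
  if i is i'.+1 then jacobi_coef a b j i' *
    ((i'%:R - j%:R) * (i'%:R + j%:R + a + b + 1)) / (i'.+1%:R * (i'%:R + a + 1))
  else 1.

(* The Jacobi polynomials on [0, 1], normalized to take the value 1 at 0. *)
Definition jacobi a b j : {poly R} := \poly_(i < j.+1) jacobi_coef a b j i.

Definition jacobi_eig a b (j : nat) : R := j%:R * (j%:R + a + b + 1).

Lemma jacobi_coef_gt a b j i : (j < i)%N -> jacobi_coef a b j i = 0.
Proof.
elim: i => // i IH; rewrite ltnS leq_eqVlt => /orP[/eqP <-|/IH /= ->].
  by rewrite /= subrr mul0r mulr0 mul0r.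
by rewrite !mul0r.
Qed.

Lemma coef_jacobi a b j i : (jacobi a b j)`_i = jacobi_coef a b j i.
Proof.
by rewrite coef_poly ltnS; case: leqP => // /(jacobi_coef_gt a b) ->.
Qed.

Lemma coef_jacobi_op a b f i : (jacobi_op a b f)`_i =
  i.+1%:R * (i%:R + a + 1) * f`_i.+1 - i%:R * (i%:R + a + b + 1) * f`_i.
Proof.
have -> : jacobi_op a b f = 'X * f^`()^`() - 'X * ('X * f^`()^`())
   + ((a + 1) *: f^`() - (a + b + 2) *: ('X * f^`())).
  rewrite /jacobi_op mulrBl scalerAl mul_polyC -mulrA mulrBl mul1r mulrBr; ring.
rewrite !coefD !coefN !coefZ !coefXM !coef_deriv.
have E (k l : nat) : f`_k *+ l = l%:R * f`_k by rewrite mulr_natl.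
have E2 (k l l' : nat) : f`_k *+ l *+ l' = l'%:R * (l%:R * f`_k) by rewrite !mulr_natl.
have S (k : nat) : k.+1%:R = k%:R + 1 :> R by rewrite natr1.
by case: i => [|[|i]] /=; rewrite ?E2 ?E ?S; ring.
Qed.

Section Eigen.
Variables a b : R.
Hypotheses (a1 : 0 < a + 1) (b1 : 0 < b + 1).

Let an (i : nat) : i%:R + a + 1 != 0.
Proof. by rewrite gt_eqF // -addrA ltr_wpDl. Qed.

Lemma jacobi_eigen j :
  jacobi_op a b (jacobi a b j) = - jacobi_eig a b j *: jacobi a b j.
Proof.
apply/polyP => i; rewrite coef_jacobi_op coefZ !coef_jacobi /= /jacobi_eig.
rewrite -!natr1; field; rewrite an /= natr1 pnatr_eq0 //.
Qed.

Lemma jacobi_horner0 j : (jacobi a b j).[0] = 1.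
Proof. by rewrite horner_coef0 coef_jacobi. Qed.

Lemma jacobi_coef_neq0 j i : (i <= j)%N -> jacobi_coef a b j i != 0.
Proof.
elim: i => [|i IH] ij /=; first exact: oner_neq0.
rewrite mulf_neq0 ?invr_eq0 ?mulf_neq0 ?pnatr_eq0 ?an // ?IH 1?ltnW //.
  by rewrite subr_eq0 eqr_nat ltn_eqF.
(* a + b + 1 is only known to exceed -1; j >= 1, which follows from i < j, compensates for it. *)
have j1 : 1 <= j%:R :> R by rewrite ler1n (leq_ltn_trans _ ij).
have i0 : 0 <= i%:R :> R by rewrite ler0n.
have p0 : 0 < i%:R + j%:R + a + b + 1 by move: (i%:R) (j%:R) j1 i0 a1 b1 => x y; lra.
by rewrite gt_eqF.
Qed.

Lemma jacobi_basis f n : (size f <= n)%N ->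
  exists c : nat -> R, f = \sum_(j < n) c j *: jacobi a b j.
Proof.
elim: n f => [|n IH] f.
  by rewrite leqn0 size_poly_eq0 => /eqP ->; exists (fun=> 0); rewrite big_ord0.
move=> sf; pose k := f`_n / jacobi_coef a b n n.
have [|c fE] := IH (f - k *: jacobi a b n).
  apply/leq_sizeP => i; rewrite leq_eqVlt => /orP[/eqP <-|ni].
    by rewrite coefB coefZ coef_jacobi /k divfK ?subrr // jacobi_coef_neq0.
  rewrite coefB coefZ coef_jacobi jacobi_coef_gt // mulr0 subr0.
  by move/leq_sizeP : sf; apply.
exists (fun j => if (j == n)%N then k else c j).
rewrite big_ord_recr /= eqxx -[LHS](subrK (k *: jacobi a b n)) fE; congr (_ + _).
by apply: eq_bigr => i _; rewrite ltn_eqF.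
Qed.

(** Differentiation lowers the degree and raises both parameters by one: the step along which
    [bfun_jacobi_norm] recurses. *)
Lemma jacobi_deriv j :
  (jacobi a b j.+1)^`() =
  - (jacobi_eig a b j.+1 / (a + 1)) *: jacobi (a + 1) (b + 1) j.
Proof.
apply/polyP => i; rewrite coef_deriv coefZ !coef_jacobi -mulr_natl.
elim: i => [|i IH].
  by rewrite /= /jacobi_eig mulr0n !mul1r !mulr1 -!natr1; field; rewrite gt_eqF.
have H0 : i.+1%:R != 0 :> R by rewrite pnatr_eq0.
have -> : jacobi_coef a b j.+1 i.+2 = jacobi_coef a b j.+1 i.+1 *
  ((i.+1%:R - j.+1%:R) * (i.+1%:R + j.+1%:R + a + b + 1)) / (i.+2%:R * (i.+1%:R + a + 1)) by [].
have -> : i.+2%:R * (jacobi_coef a b j.+1 i.+1 * ((i.+1%:R - j.+1%:R) *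
   (i.+1%:R + j.+1%:R + a + b + 1)) / (i.+2%:R * (i.+1%:R + a + 1))) =
   (i.+1%:R * jacobi_coef a b j.+1 i.+1) * (((i.+1%:R - j.+1%:R) *
   (i.+1%:R + j.+1%:R + a + b + 1)) / (i.+1%:R * (i.+1%:R + a + 1))).
  have gen (x y z w J : R) : y != 0 -> z != 0 -> w != 0 ->
    z * (x * J / (z * w)) = y * x * (J / (y * w)).
    by move=> y0 z0 w0; field; rewrite y0 z0 w0.
  by apply: gen; rewrite ?pnatr_eq0 // an.
have S (k : nat) : k.+1%:R = k%:R + 1 :> R by rewrite natr1.
rewrite IH /= -!mulrA; congr (_ * (_ * (_ * _))); first by rewrite !S; ring.
by congr (_ / (_ * _)); rewrite ?S; ring.
Qed.

Lemma jacobi_eig_inj i j : 0 <= a + b + 1 ->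
  jacobi_eig a b i = jacobi_eig a b j -> i = j.
Proof.
rewrite /jacobi_eig => c0 e.
have : (i%:R - j%:R) * (i%:R + j%:R + a + b + 1) = 0 :> R.
  rewrite (_ : _ * _ = i%:R * (i%:R + a + b + 1) - j%:R * (j%:R + a + b + 1)).
    by rewrite e subrr.
  by ring.
move/eqP; rewrite mulf_eq0 subr_eq0 eqr_nat => /orP[/eqP //|/eqP h].
have i0 : 0 <= i%:R :> R by rewrite ler0n.
have j0 : 0 <= j%:R :> R by rewrite ler0n.
have : i%:R + j%:R = 0 :> R.
  by move: (i%:R) (j%:R) i0 j0 h c0 {e} => x y *; apply/eqP; rewrite eq_le; apply/andP; split; lra.
move/eqP; rewrite -natrD pnatr_eq0 addn_eq0.
by case/andP=> /eqP -> /eqP ->.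
Qed.

End Eigen.

(* A linear functional annihilating the image of the Jacobi operator is
   integration against the normalized beta distribution. *)
Definition beta_functional a b (l : {poly R} -> R) : Prop :=
  [/\ forall k f g, l (k *: f + g) = k * l f + l g, l 1 = 1
    & forall f, l (jacobi_op a b f) = 0].

(** What the norm computation consumes of Euler's Gamma function: the norms are reached by recursion
    on j, which involves only shifts of the arguments by one. *)
Definition gamma_like (G : R -> R) : Prop :=
  [/\ G 1 = 1, forall x, 0 < x -> 0 < G x & forall x, 0 < x -> G (x + 1) = x * G x].

(** For the parameters of a space this is the dimension of the j-th eigenspace, j > 0. When a + b +
    1 = 0, as on the circle, the formula degenerates at j = 0: a zero factor multiplies G at 0. *)
Definition cross_mult (G : R -> R) a b (j : nat) : R :=
  ((2 * j%:R + a + b + 1) * G (b + 1) * G (j%:R + a + 1) * G (j%:R + a + b + 1))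
  / (G (a + b + 2) * G (a + 1) * G (j%:R + 1) * G (j%:R + b + 1)).

Section Functional.
Variables (a b : R) (l : {poly R} -> R).
Hypotheses (a1 : 0 < a + 1) (b1 : 0 < b + 1).
Hypothesis bl : beta_functional a b l.

Lemma bfunD f g : l (f + g) = l f + l g.
Proof. by case: bl => h _ _; have := h 1 f g; rewrite scale1r mul1r. Qed.

Lemma bfun0 : l 0 = 0.
Proof. by apply: (addrI (l 0)); rewrite -bfunD !addr0. Qed.

Lemma bfunZ k f : l (k *: f) = k * l f.
Proof. by case: bl => h _ _; have := h k f 0; rewrite addr0 bfun0 addr0. Qed.

Lemma bfunN f : l (- f) = - l f.
Proof. by rewrite -scaleN1r bfunZ mulN1r. Qed.

Lemma antideriv u : exists f, f^`() = u.
Proof.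
exists (\poly_(i < (size u).+1) (u`_i.-1 / i%:R)).
apply/polyP => i; rewrite coef_deriv coef_poly ltnS /=.
case: ltnP => h; last by rewrite mul0rn nth_default.
by rewrite -[LHS]mulr_natr divfK // pnatr_eq0.
Qed.

(** Every polynomial is a derivative, so l kills w^-1 d/ds (s (1 - s) w u) for every polynomial u,
    where w = s^a (1 - s)^b: integration by parts without boundary terms. *)
Lemma bfun_deriv u :
  l ('X * (1 - 'X) * u^`() + ((a + 1)%:P - (a + b + 2) *: 'X) * u) = 0.
Proof. by have [f <-] := antideriv u; case: bl => _ _; apply. Qed.

(** Green's formula for l: [bfun_deriv] at u = f g'. *)
Lemma bfun_jacobi_op f g :
  l (f * jacobi_op a b g) = - l ('X * (1 - 'X) * (f^`() * g^`())).
Proof.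
apply/eqP; rewrite -subr_eq0 opprK -bfunD; apply/eqP.
rewrite -(bfun_deriv (f * g^`())) derivM /jacobi_op; congr (l _); ring.
Qed.

(** [bfun_deriv] at u = (1 - s)^n. Under the weight (1 - s)^n the mean of s is therefore (a + 1) /
    (n + a + b + 2), which tends to 0: the kernels (1 - s)^n concentrate at s = 0. *)
Lemma bfun_concentrate n :
  (n%:R + a + b + 2) * l ('X * (1 - 'X) ^+ n) = (a + 1) * l ((1 - 'X) ^+ n).
Proof.
have := bfun_deriv ((1 - 'X) ^+ n).
have -> : ((1 - 'X) ^+ n)^`() = - (n%:R *: (1 - 'X) ^+ n.-1) :> {poly R}.
  rewrite deriv_exp derivB derivX derivC sub0r mulN1r mulNrn.
  by rewrite -scaler_nat.
have -> : 'X * (1 - 'X) * (- (n%:R *: (1 - 'X) ^+ n.-1)) =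
   - (n%:R *: ('X * (1 - 'X) ^+ n)) :> {poly R}.
  case: n => [|n] /=; first by rewrite !scale0r !oppr0 mulr0.
  by rewrite exprS mulrN -scalerAr mulrA.
have -> : ((a + 1)%:P - (a + b + 2) *: 'X) * (1 - 'X) ^+ n =
  (a + 1) *: (1 - 'X) ^+ n - (a + b + 2) *: ('X * (1 - 'X) ^+ n).
  by rewrite mulrBl mul_polyC scalerAl.
rewrite !bfunD !bfunN !bfunZ; lra.
Qed.

(** By [bfun_concentrate] consecutive values have the ratio (n + b + 1) / (n + a + b + 2), so
    positivity comes from l 1 = 1 without any integral. *)
Lemma bfun_pow_gt0 n : 0 < l ((1 - 'X) ^+ n).
Proof.
elim: n => [|n IH]; first by rewrite expr0; case: bl => _ -> _.
have -> : (1 - 'X) ^+ n.+1 = (1 - 'X) ^+ n - 'X * (1 - 'X) ^+ n :> {poly R}.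
  by rewrite exprS mulrBl mul1r.
rewrite bfunD bfunN; have e := bfun_concentrate n.
have n0 : 0 <= n%:R :> R by rewrite ler0n.
have p0 : 0 < n%:R + a + b + 2 by move: (n%:R) n0 a1 b1 => x *; lra.
rewrite -(pmulr_rgt0 _ p0) mulrBr e -mulrBl; apply: mulr_gt0 => //.
by move: (n%:R) n0 a1 b1 => x *; lra.
Qed.

End Functional.

(** Multiplying the weight by s (1 - s) raises both parameters. The normalizing value solves the two
    linear equations that [bfun_concentrate] gives for n = 0 and n = 1; the annihilation is
    [bfun_deriv] at u = s (1 - s) f'. *)
Lemma beta_functional_shift a b l : 0 < a + 1 -> 0 < b + 1 ->
  beta_functional a b l ->
  l ('X * (1 - 'X)) = (a + 1) * (b + 1) / ((a + b + 2) * (a + b + 3)) /\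
  beta_functional (a + 1) (b + 1) (fun f => l ('X * (1 - 'X) * f) / l ('X * (1 - 'X))).
Proof.
move=> a1 b1 bl; have p2 : 0 < a + b + 2 by lra.
have p3 : 0 < a + b + 3 by lra.
have kE : l ('X * (1 - 'X)) = (a + 1) * (b + 1) / ((a + b + 2) * (a + b + 3)).
  have e0 := bfun_concentrate bl 0; have e1 := bfun_concentrate bl 1.
  rewrite !expr1 expr0 mulr1 in e0 e1.
  have l1 : l 1 = 1 by case: bl.
  rewrite (bfunD bl) (bfunN bl) l1 in e1; rewrite l1 add0r in e0.
  have -> : l ('X * (1 - 'X)) = (a + 1) * (1 - l 'X) / (a + b + 3).
    apply: (canRL (mulfK (lt0r_neq0 p3))).
    by rewrite -e1 mulrC; congr (_ * _); lra.
  have -> : l 'X = (a + 1) / (a + b + 2).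
    by apply: (canRL (mulfK (lt0r_neq0 p2))); rewrite mulrC e0 mulr1.
  by field; rewrite !gt_eqF.
have k0 : l ('X * (1 - 'X)) != 0.
  by rewrite kE !mulf_neq0 ?invr_eq0 ?mulf_neq0 ?gt_eqF.
split=> //; split=> [k f g||f].
- by rewrite mulrDr -scalerAr (bfunD bl) (bfunZ bl) mulrDl mulrA.
- by rewrite mulr1 divff.
apply/eqP; rewrite mulf_eq0; apply/orP; left; apply/eqP.
rewrite -(bfun_deriv bl ('X * (1 - 'X) * f^`())); congr (l _).
rewrite /jacobi_op !derivM derivB derivX derivC sub0r !polyCD.
rewrite -!mul_polyC !polyCD; ring.
Qed.

(** Induction on j for all parameters at once: Green's formula turns the eigenvalue times l (J^2)
    into l (s (1 - s) J'^2), and J' is a Jacobi polynomial of lower degree for the shifted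
    functional. The last positivity condition admits a + b + 1 = 0 as soon as j > 0. *)
Lemma bfun_jacobi_norm G a b l j : gamma_like G -> 0 < a + 1 -> 0 < b + 1 ->
  0 < a + b + 1 + j%:R ->
  beta_functional a b l -> l (jacobi a b j ^+ 2) * cross_mult G a b j = 1.
Proof.
move=> [G1 G0 GS]; have Gn x : 0 < x -> G x != 0 by move=> x0; rewrite gt_eqF // G0.
elim: j a b l => [|j IH] a b l a1 b1 ab bl.
  rewrite addr0 in ab; case: bl => _ l1 _.
  have -> : jacobi a b 0 = 1.
    apply/polyP => i; rewrite coef_jacobi coef1; case: i => [//|i].
    exact: (@jacobi_coef_gt _ _ 0 i.+1).
  rewrite expr1n l1 mul1r /cross_mult mulr0 !add0r.
  have -> : a + b + 2 = (a + b + 1) + 1 by ring.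
  by rewrite (GS (a + b + 1)) // G1; field; rewrite !Gn //= gt_eqF.
have [kE bl'] := beta_functional_shift a1 b1 bl.
set l' := (fun f => _) in bl'.
have p2 : 0 < a + b + 2 by lra.
have p3 : 0 < a + b + 3 by lra.
have j0 : 0 <= j%:R :> R by rewrite ler0n.
have jS : j.+1%:R = j%:R + 1 :> R by rewrite natr1.
have c0 : 0 < j%:R + 1 + a + b + 1.
  by move: ab; rewrite jS; move: (j%:R) => x *; lra.
have IHj : l' (jacobi (a + 1) (b + 1) j ^+ 2) * cross_mult G (a + 1) (b + 1) j = 1.
  by apply: IH => //; [lra|lra|move: (j%:R) c0 j0 => x *; lra].
have E : jacobi_eig a b j.+1 * l (jacobi a b j.+1 ^+ 2) =
   l ('X * (1 - 'X)) * (jacobi_eig a b j.+1 / (a + 1)) ^+ 2 *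
   l' (jacobi (a + 1) (b + 1) j ^+ 2).
  have := bfun_jacobi_op bl (jacobi a b j.+1) (jacobi a b j.+1).
  rewrite jacobi_eigen // -scalerAr (bfunZ bl) -expr2 mulNr => /oppr_inj ->.
  rewrite jacobi_deriv // -expr2 exprZn sqrrN -scalerAr (bfunZ bl) /l'.
  by rewrite -mulrA [RHS]mulrC mulrA divfK // kE !mulf_neq0 ?invr_eq0 ?mulf_neq0 ?gt_eqF.
have eig0 : jacobi_eig a b j.+1 != 0.
  by rewrite /jacobi_eig jS mulf_neq0 // gt_eqF // ltr_wpDl.
have -> : l (jacobi a b j.+1 ^+ 2) = l ('X * (1 - 'X)) * jacobi_eig a b j.+1
    / (a + 1) ^+ 2 * l' (jacobi (a + 1) (b + 1) j ^+ 2).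
  by apply: (mulfI eig0); rewrite E; field; rewrite gt_eqF.
rewrite -[RHS]IHj mulrAC [RHS]mulrC; congr (_ * _).
rewrite kE /jacobi_eig /cross_mult jS.
have x1 : 0 < j%:R + 1 :> R by rewrite ltr_wpDl.
have x2 : 0 < j%:R + 1 + a + 1 by rewrite -addrA ltr_wpDl // ltW.
have x3 : 0 < j%:R + 1 + b + 1 by rewrite -addrA ltr_wpDl // ltW.
have -> : j%:R + (a + 1) + 1 = j%:R + 1 + a + 1 by ring.
have -> : j%:R + (a + 1) + (b + 1) + 1 = (j%:R + 1 + a + b + 1) + 1 by ring.
have -> : a + 1 + (b + 1) + 2 = ((a + b + 2) + 1) + 1 by ring.
have -> : a + b + 3 = a + b + 2 + 1 by ring.
have -> : j%:R + (b + 1) + 1 = j%:R + 1 + b + 1 by ring.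
have p3' : 0 < a + b + 2 + 1 by lra.
rewrite !(GS (b + 1)) // (GS (j%:R + 1 + a + b + 1)) // (GS (a + b + 2 + 1)) //.
rewrite (GS (a + b + 2)) // (GS (a + 1)) // (GS (j%:R + 1)) //.
have g1 := Gn _ b1; have g2 := Gn _ a1; have g3 := Gn _ c0; have g4 := Gn _ p2.
have g5 := Gn _ x1; have g6 := Gn _ x2; have g7 := Gn _ x3.
have h1 := lt0r_neq0 p2; have h2 := lt0r_neq0 p3'; have h3 := lt0r_neq0 a1.
have h4 := lt0r_neq0 b1; have h5 := lt0r_neq0 c0; have h6 := lt0r_neq0 x1.
move: (G (b + 1)) (G (a + 1)) (G (j%:R + 1 + a + b + 1)) (G (a + b + 2)) (G (j%:R + 1))
  (G (j%:R + 1 + a + 1)) (G (j%:R + 1 + b + 1)) g1 g2 g3 g4 g5 g6 g7.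
move=> y1 y2 y3 y4 y5 y6 y7 g1 g2 g3 g4 g5 g6 g7.
move: (j%:R) h1 h2 h3 h4 h5 h6 => x h1 h2 h3 h4 h5 h6.
field.
by rewrite ?g1 ?g2 ?g3 ?g4 ?g5 ?g6 ?g7 ?h1 ?h2 ?h3 ?h4 ?h5 ?h6.
Qed.
End Jacobi.

(** * Functional equation, finiteness and positivity of the Gamma integral *)

Section EulerGamma.
Context {R : realType}.
Local Notation leb := (@lebesgue_measure R).
Implicit Types (x t : R).

Lemma cvg_EFin_seq (u : nat -> R) l : u n @[n --> \oo] --> l ->
  (u n)%:E @[n --> \oo] --> l%:E.
Proof. by move=> c; apply: cvg_EFin => //; exact: nearW. Qed.

Definition gamma_integrand (x t : R) : R := t `^ (x - 1) * expR (- t).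
(** Compact intervals increasing to the open half-line, on which parts can be taken also when the
    integrand is singular at 0. The end n + 2 keeps the first interval from being a point. *)
Definition gamma_range (n : nat) : set R := `[(n.+1%:R : R)^-1, n.+2%:R]%classic.
Local Notation gi := gamma_integrand.
Local Notation F := gamma_range.
Let EG x : \bar R := (\int[leb]_(t in `]0%R, +oo[) (gi x t)%:E)%E.

Let gi_ge0 x t : 0 <= gi x t.
Proof. by rewrite mulr_ge0 ?powR_ge0 ?expR_ge0. Qed.

Let gi_meas x (A : set R) : measurable_fun A (EFin \o gi x).
Proof.
apply/measurable_EFinP; apply: measurable_funM.
  by apply: measurable_funTS; exact: measurable_powR.
by apply: measurable_funTS; apply: (measurableT_comp (@measurable_expR R)).
Qed.

Let a_lt_b n : (n.+1%:R : R)^-1 < n.+2%:R.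
Proof.
apply: (@le_lt_trans _ _ 1); last by rewrite ltr1n.
by rewrite invf_le1 ?ltr0n // ler1n.
Qed.

Let a_gt0 n : 0 < (n.+1%:R : R)^-1.
Proof. by rewrite invr_gt0. Qed.

Let FU : \bigcup_n F n = `]0, +oo[%classic.
Proof.
apply/seteqP; split=> [t [n _] /=|t /=]; rewrite !in_itv /= andbT.
  by move=> /andP[h _]; exact: lt_le_trans (a_gt0 n) h.
move=> t0; have s0 : 0 <= t + t^-1 by rewrite addr_ge0 ?invr_ge0 // ltW.
have := archi_boundP s0; set n := Num.bound _ => hn.
exists n => //; rewrite /F /= in_itv /=; apply/andP; split.
  rewrite -(invrK t) lef_pV2 ?posrE ?invr_gt0 ?ltr0n //.
  apply: (@le_trans _ _ n%:R); last by rewrite ler_nat.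
  by rewrite (le_trans _ (ltW hn)) // lerDr ltW.
apply: (@le_trans _ _ n%:R); last by rewrite ler_nat -addn2 leq_addr.
by rewrite (le_trans _ (ltW hn)) // lerDl invr_ge0 ltW.
Qed.

Let EG_cvg x : (\int[leb]_(t in F n) (gi x t)%:E)%E @[n --> \oo] --> EG x.
Proof.
rewrite /EG -FU; apply: ge0_nondecreasing_set_cvg_integral => //=.
- move=> n m nm; apply/subsetPset => t; rewrite /F /= !in_itv /= => /andP[h1 h2].
  rewrite (le_trans _ h1) ?(le_trans h2) ?ler_nat ?ltnS //.
  by rewrite lef_pV2 ?posrE // ler_nat.
- by move=> n; exact: measurable_itv.
- by move=> n; exact: gi_meas.
- by move=> n t _; rewrite lee_fin gi_ge0.
Qed.

Let der_expN (t : R) : is_derive t 1 (fun s : R => - expR (- s)) (expR (- t)).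
Proof.
have h1 : is_derive t 1 (fun s : R => - s) (-1) by apply: is_deriveNid.
have h2 : is_derive (- t) 1 (expR : R -> R) (expR (- t)) by exact: is_derive_expR.
have h3 := is_derive1_comp h1 h2.
have := is_deriveN h3; rewrite scaleN1r opprK; apply.
Qed.

Let der_oo (f f' : R -> R) (a b : R) : (forall t : R, 0 < t -> is_derive t 1 f (f' t)) ->
  0 < a -> 0 < b -> derivable_oo_LRcontinuous f a b.
Proof.
move=> H a0 b0; have cf (t : R) : 0 < t -> {for t, continuous f}.
  move=> t0; apply: differentiable_continuous; apply/derivable1_diffP.
  exact: is_derive_derivable (H t t0).
split.
- move=> t; rewrite in_itv /= => /andP[at' _].
  exact: is_derive_derivable (H t (lt_trans a0 at')).
- by apply: cvg_at_right_filter; exact: cf.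
- by apply: cvg_at_left_filter; exact: cf.
Qed.

Let within_cont (f f' : R -> R) (a b : R) : (forall t : R, 0 < t -> is_derive t 1 f (f' t)) ->
  0 < a -> {within `[a, b], continuous f}.
Proof.
move=> H a0; apply: derivable_within_continuous => t; rewrite in_itv /= => /andP[h _].
exact: is_derive_derivable (H t (lt_le_trans a0 h)).
Qed.

Let bd x n : R := (n.+1%:R^-1) `^ x * expR (- n.+1%:R^-1) - n.+2%:R `^ x * expR (- n.+2%:R).

Let parts x n : 0 < x -> (\int[leb]_(t in F n) (gi (x + 1) t)%:E =
  (bd x n)%:E + x%:E * \int[leb]_(t in F n) (gi x t)%:E)%E.
Proof.
move=> x0; have b0 : 0 < n.+2%:R :> R by rewrite ltr0n.
have dP (y t : R) : 0 < t -> is_derive t 1 (fun s : R => s `^ y) (y * t `^ (y - 1)).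
  by move=> t0; exact: is_derive1_powR.
have dXP (t : R) : 0 < t -> is_derive t 1 (fun s : R => x * s `^ (x - 1)) (x * ((x - 1) * t `^ (x - 1 - 1))).
  by move=> t0; exact: (@is_derive_scalef _ R^o R^o (fun s : R => s `^ (x - 1)) x _ _ _ (dP _ _ t0)).
have dE (t : R) : 0 < t -> is_derive t 1 (fun s : R => expR (- s)) (- expR (- t)).
  by move=> t0; have := is_deriveN (der_expN t); rewrite (_ : - _ = fun s => expR (- s)) //;
    apply/funext => s; rewrite /= opprfctE opprK.
have := @integration_by_parts R (fun t => t `^ x) (fun t => - expR (- t))
  (fun t => x * t `^ (x - 1)) (fun t => expR (- t)) _ _ (a_lt_b n)
  (within_cont dXP (a_gt0 n)) (der_oo (dP x) (a_gt0 n) b0) _ (within_cont dE (a_gt0 n))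
  (der_oo (fun t _ => der_expN t) (a_gt0 n) b0) _.
have pos (t : R) : t \in `](n.+1%:R^-1 : R), n.+2%:R[ -> 0 < t.
  by rewrite in_itv /= => /andP[h _]; exact: lt_trans (a_gt0 n) h.
rewrite (_ : (\int[leb]_(t in F n) (gi (x + 1) t)%:E)%E =
  (\int[leb]_(t in F n) (t `^ x * expR (- t))%:E)%E); last first.
  by apply: eq_integral => t _; rewrite /gi addrK.
rewrite /F => -> => [|t /pos t0|t _]; last 2 first.
- by rewrite derive1E (is_derive_val (dP x t t0)).
- by rewrite derive1E (is_derive_val (der_expN t)).
transitivity ((bd x n)%:E - \int[leb]_(t in F n) (- (x * gi x t))%:E)%E.
  congr (_%:E - _)%E; last by apply: eq_integral => t _; rewrite mulrN -mulrA.
  by rewrite /bd; ring.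
transitivity ((bd x n)%:E - - (\int[leb]_(t in F n) (x * gi x t)%:E))%E; last first.
  rewrite oppeK; congr (_ + _)%E; rewrite -ge0_integralZl_EFin //; last exact: ltW.
  - by move=> t _; rewrite lee_fin gi_ge0.
  - exact: gi_meas.
congr (_ - _)%E; rewrite -integral_ge0N //.
by move=> t _; rewrite lee_fin mulr_ge0 ?gi_ge0 // ltW.
Qed.

Let bd_cvg x : 0 < x -> bd x n @[n --> \oo] --> (0 : R).
Proof.
move=> x0.
have cinv : (n.+1%:R : R)^-1 @[n --> \oo] --> (0 : R)^'+.
  move=> A /= [e e0 H]; have [N _ HN] := (cvgr0Pnorm_lt (@harmonic R)).1 cvg_harmonic e e0.
  exists N => // n nN; apply: H => /=; last exact: a_gt0.
  by rewrite sub0r normrN; exact: HN.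
have c1 : (n.+1%:R^-1 : R) `^ x @[n --> \oo] --> (0 : R).
  exact: (cvg_comp _ _ cinv (powR_cvg0 x0)).
(* With x < k, the bound e^t >= t^(k + 1) / (k + 1)! gives t^x e^-t <= (k + 1)! / t for t >= 1; this
   controls the boundary term at n + 2. *)
have := archi_boundP (ltW x0); set k := Num.bound _ => hk.
have c2 : (k.+1`!%:R : R) * (n.+1%:R)^-1 @[n --> \oo] --> (0 : R).
  rewrite -(mulr0 (k.+1`!%:R : R)); apply: cvgMl_tmp; exact: cvg_harmonic.
have c3 : (n.+1%:R^-1 : R) `^ x + (k.+1`!%:R : R) * (n.+1%:R)^-1 @[n --> \oo] --> (0 : R).
  by rewrite -(addr0 (0 : R)); exact: (cvgD c1 c2).
apply/cvgr0Pnorm_le => e e0; have [N _ HN] := (cvgr0Pnorm_le _).1 c3 e e0.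
exists N => // n nN; apply: le_trans (HN n nN).
have t0 : 0 < n.+2%:R :> R by rewrite ltr0n.
rewrite [leRHS]ger0_norm ?addr_ge0 ?powR_ge0 ?mulr_ge0 ?invr_ge0 // /bd.
rewrite (le_trans (ler_normB _ _)) // lerD // ger0_norm ?mulr_ge0 ?powR_ge0 ?expR_ge0 //.
  rewrite ler_piMr ?powR_ge0 // -expR0 ler_expR oppr_le0 ltW //; exact: a_gt0.
apply: (@le_trans _ _ (k.+1`!%:R * (n.+2%:R : R)^-1)); last first.
  by rewrite ler_pM2l ?ltr0n ?fact_gt0 // lef_pV2 ?posrE ?ltr0n // ler_nat.
have h : n.+2%:R `^ x <= n.+2%:R ^+ k :> R.
  by rewrite -powR_mulrn ?ler0n // ler_powR ?ler1n // ltW.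
have h2 := expR_ge1Dxn k (ltW t0).
rewrite expRN -ler_pdivlMr ?invr_gt0 ?expR_gt0 // invrK.
apply: (le_trans h); rewrite -mulrA mulrCA ler_pdivlMl // -exprS mulrC -ler_pdivrMr ?ltr0n ?fact_gt0 //.
by apply: le_trans h2; rewrite lerDr.
Qed.

Let EG_ge0 x : (0 <= EG x)%E.
Proof. by apply: integral_ge0 => t _; rewrite lee_fin gi_ge0. Qed.

Let EG_S x : 0 < x -> EG (x + 1) = (x%:E * EG x)%E.
Proof.
move=> x0; have c1 := @EG_cvg (x + 1).
have c2 : ((bd x n)%:E + x%:E * \int[leb]_(t in F n) (gi x t)%:E)%E @[n --> \oo] --> (0%:E + x%:E * EG x)%E.
  apply: cvgeD; first exact: fin_num_adde_defr.
    by apply: cvg_EFin_seq; exact: bd_cvg.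
  apply: cvgeZl => //; exact: EG_cvg.
rewrite add0e in c2; move: c1.
rewrite (_ : (fun n => _) = fun n => ((bd x n)%:E + x%:E * \int[leb]_(t in F n) (gi x t)%:E)%E).
  by move=> c1; exact: (cvg_unique (@ereal_hausdorff R) c1 c2).
by apply/funext => n; exact: parts.
Qed.

Let EG_1 : EG 1 = 1%E.
Proof.
have c1 := @EG_cvg 1.
have I n : (\int[leb]_(t in F n) (gi 1 t)%:E = (- expR (- n.+2%:R) - - expR (- n.+1%:R^-1))%:E)%E.
  have dE (t : R) : 0 < t -> is_derive t 1 (fun s : R => expR (- s)) (- expR (- t)).
    by move=> t0; have := is_deriveN (der_expN t); rewrite (_ : - _ = fun s => expR (- s)) //;
      apply/funext => s; rewrite /= opprfctE opprK.
  have b0 : 0 < n.+2%:R :> R by rewrite ltr0n.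
  have dF : {in `](n.+1%:R^-1 : R), n.+2%:R[, (fun t : R => - expR (- t))^`()%classic =1 (fun t => expR (- t))}.
    by move=> t _; rewrite derive1E (is_derive_val (der_expN t)).
  rewrite EFinB -(continuous_FTC2 (a_lt_b n) (within_cont dE (a_gt0 n))
    (der_oo (fun t _ => der_expN t) (a_gt0 n) b0) dF).
  by apply: eq_integral => t _; rewrite /gi subrr powRr0 mul1r.
suff c2 : - expR (- n.+2%:R) - - expR (- (n.+1%:R : R)^-1) @[n --> \oo] --> (1 : R).
  move: c1; rewrite (_ : (fun n => _) = fun n => (- expR (- n.+2%:R) - - expR (- (n.+1%:R : R)^-1))%:E).
    by move=> c1; exact: (cvg_unique (@ereal_hausdorff R) c1 (cvg_EFin_seq c2)).
  by apply/funext => n; exact: I.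
have c3 : expR (- (n.+1%:R : R)^-1) @[n --> \oo] --> (1 : R).
  have ch : - (n.+1%:R : R)^-1 @[n --> \oo] --> - (0 : R) by exact: (cvgN cvg_harmonic).
  have := cvg_comp _ _ ch (@continuous_expR R (- 0)).
  by rewrite /= oppr0 expR0; apply.
have c4 : expR (- (n.+2%:R : R)) @[n --> \oo] --> (0 : R).
  have c2 : (n.+2%:R : R) @[n --> \oo] --> +oo.
    apply/cvgryPge => A; have [N _ H] := (cvgryPge _).1 (@cvgr_idn R) A.
    by exists N => // n nN; apply: (le_trans (H n nN)); rewrite ler_nat -addn2 leq_addr.
  exact: (cvg_comp _ _ c2 (@cvgr_expR R)).
have c5 : expR (- (n.+1%:R : R)^-1) - expR (- (n.+2%:R : R)) @[n --> \oo] --> 1 - (0 : R) by exact: cvgB c3 c4.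
rewrite subr0 in c5; rewrite (_ : (fun n => _) = fun n => expR (- (n.+1%:R : R)^-1) - expR (- (n.+2%:R : R))) //.
by apply/funext => n; rewrite opprK addrC.
Qed.

Let EG_nat n : (EG n.+1%:R < +oo)%E.
Proof.
elim: n => [|n IH]; first by rewrite EG_1 ltry.
by rewrite -natr1 EG_S ?ltr0n // lte_mul_pinfty // lee_fin.
Qed.

Let EG_fin x : 0 < x -> (EG x < +oo)%E.
Proof.
(* At x + 1 the integrand is bounded near 0, so that it can be compared with integer arguments; the
   functional equation brings finiteness back to x, since x > 0. *)
move=> x0; suff h : (EG (x + 1) < +oo)%E.
  rewrite ltey; apply/negP => /eqP e; move: h; rewrite EG_S // e.
  by rewrite gt0_muley ?lte_fin // ltxx.
have := archi_boundP (ltW x0); set k := Num.bound _ => hk.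
(* Pointwise t^x <= 1 + t^k, according to whether t <= 1 or t > 1. *)
apply: (@le_lt_trans _ _ (EG 1 + EG k.+1%:R)%E); last first.
  by rewrite lte_add_pinfty // EG_1 ltry.
have m0 : measurable (`]0%R, +oo[%classic : set R) by exact: measurable_itv.
rewrite /EG -ge0_integralD //; last 4 first.
- by move=> t _; rewrite lee_fin gi_ge0.
- exact: gi_meas.
- by move=> t _; rewrite lee_fin gi_ge0.
- exact: gi_meas.
apply: ge0_le_integral => //.
- by move=> t _; rewrite lee_fin gi_ge0.
- exact: gi_meas.
- by apply: emeasurable_funD; exact: gi_meas.
move=> t; rewrite /= in_itv /= andbT => t0; rewrite -EFinD lee_fin /gi -mulrDl.
rewrite ler_pM2r ?expR_gt0 // subrr powRr0 addrK -natr1 addrK.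
have [t1|t1] := leP t 1.
  have h : t `^ x <= 1 `^ x by apply: ge0_ler_powR => //; rewrite ?nnegrE // ltW.
  by rewrite (le_trans h) // powR1 ler_wpDr ?powR_ge0.
by rewrite ler_wpDl // ler_powR // ltW.
Qed.

Let EG_gt0 x : (0 < EG x)%E.
Proof.
have m0 : measurable (`]0%R, +oo[%classic : set R) by exact: measurable_itv.
have m1 : measurable (`[1%R, 2%R]%classic : set R) by exact: measurable_itv.
(* On [1, 2] the logarithm lies in [0, 1], so t^(x - 1) >= e^(- |x - 1|), while e^-t >= e^-2. *)
apply: (@lt_le_trans _ _ (\int[leb]_(t in `[1%R, 2%R]) (expR (- `|x - 1| - 2))%:E)%E).
  rewrite integral_cst // [X in (_ * X)%E]lebesgue_measure_itv /= lte_fin ltr1n /=.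
  by rewrite -EFinB mule_gt0 ?lte_fin ?expR_gt0 // subr_gt0 ltr1n.
apply: (@le_trans _ _ (\int[leb]_(t in `[1%R, 2%R]) (gi x t)%:E)%E); last first.
  apply: ge0_subset_integral => //; first exact: gi_meas.
    by move=> t _; rewrite lee_fin gi_ge0.
  by move=> t; rewrite /= !in_itv /= andbT => /andP[h _]; exact: lt_le_trans h.
apply: ge0_le_integral => //; first exact: gi_meas.
move=> t; rewrite /= in_itv /= => /andP[t1 t2].
have t0 : 0 < t by exact: lt_le_trans t1.
rewrite lee_fin /gi /powR gt_eqF // -expRD ler_expR lerB //.
have l0 : 0 <= ln t by rewrite ln_ge0.
have l1 : ln t <= 1.
  rewrite -ler_expR lnK ?posrE //; apply: le_trans t2 _.
  by have := @expR_ge1Dx R 1; rewrite -(natrD _ 1 1).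
rewrite lerNl -mulNr (le_trans (ler_norm _)) // normrM normrN ler_piMr //.
by rewrite ger0_norm.
Qed.

Lemma Euler_Gamma_like : gamma_like (@Euler_Gamma R).
Proof.
split=> [|x x0|x x0]; rewrite /Euler_Gamma /Rintegral.
- by rewrite -[RHS]/(fine 1%E) -EG_1.
- by apply: fine_gt0; rewrite EG_gt0 EG_fin.
- rewrite -[LHS]/(fine (EG (x + 1))) -[X in _ * X]/(fine (EG x)) EG_S //.
  by rewrite fineM // ge0_fin_numE // EG_fin.
Qed.

End EulerGamma.

(** * Ranges of the Jacobi parameters *)

Section JacobiParameters.
Variables (R : realType) (M : cross).
Local Notation alpha := (cross_alpha R M).
Local Notation beta := (cross_beta R M).

Lemma cross_dim_gt0 : (0 < cross_dim M)%N.
Proof. by case: M => [b|b|b|b|] //= b0; rewrite muln_gt0. Qed.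

Lemma cross_alpha_gt : 0 < alpha + 1.
Proof.
have : 0 < (cross_dim M)%:R :> R by rewrite ltr0n cross_dim_gt0.
by rewrite /cross_alpha; move: ((cross_dim M)%:R) => x; lra.
Qed.

Lemma cross_beta_gt : 0 < beta + 1.
Proof.
have := cross_alpha_gt; rewrite /cross_alpha.
by case: M => [b|b|b|b|] /=; try lra; move=> b0; move: (b%:R) => x; lra.
Qed.

Lemma cross_ab_ge0 : 0 <= alpha + beta + 1.
Proof.
have : 1 <= (cross_dim M)%:R :> R by rewrite ler1n cross_dim_gt0.
rewrite /cross_alpha.
by case: M => [b|b|b|b|] /= => [b0|b0|b0|b0|]; try lra; move: (_%:R : R) => x; lra.
Qed.

(** The one-dimensional spaces are the only ones with alpha < 0. They are set apart because the
    estimate of the growth of the multiplicities multiplies inequalities valid for alpha >= 0. *)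
Lemma cross_alpha_cases : (alpha = - (1 / 2) /\ beta = - (1 / 2)) \/
  0 <= alpha /\ - (1 / 2) <= beta.
Proof.
have h : forall b : nat, (0 < b)%N -> b = 1%N \/ 2 <= b%:R :> R.
  by move=> [//|[|b]] _; [left|right; rewrite ler_nat].
have h1 : forall b : nat, (0 < b)%N -> 1 <= b%:R :> R by move=> b b0; rewrite ler1n.
case: M => [b|b|b|b|]; rewrite /cross_alpha /= ?natrM; last by right; split; lra.
- by move=> /h[->|]; [left; split; lra|move: (b%:R) => x *; right; split; lra].
- by move=> /h[->|]; [left; split; lra|move: (b%:R) => x *; right; split; lra].
- by move=> /h1; move: (b%:R) => x *; right; split; lra.
- by move=> /h1; move: (b%:R) => x *; right; split; lra.
Qed.

End JacobiParameters.

(** * Growth of the multiplicities and finiteness of the constant *)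

Section Finiteness.
Variables (R : realType) (M : cross).
Local Notation alpha := (cross_alpha R M).
Local Notation beta := (cross_beta R M).
Local Notation g2 := (cross_gamma2 R M).
Local Notation gam := (cross_gamma R M).
Local Notation N := (cross_mult (@Euler_Gamma R) alpha beta).

Let a1 := cross_alpha_gt R M.
Let b1 := cross_beta_gt R M.
Let c0 := cross_ab_ge0 R M.

Lemma cross_mult_gt0 j : (0 < j)%N -> 0 < N j.
Proof.
move=> j0; have [_ G0 _] := @Euler_Gamma_like R.
have j1 : 1 <= j%:R :> R by rewrite ler1n.
have a1' := a1; have b1' := b1; have c0' := c0.
rewrite /cross_mult divr_gt0 // !mulr_gt0 ?G0 //;
  move: (j%:R) alpha beta j1 a1' b1' c0' => x y z *; lra.
Qed.

Lemma cross_mult_rec (j : nat) : (0 < j)%N ->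
  N j.+1 * ((2 * j%:R + alpha + beta + 1) * (j%:R + 1) * (j%:R + beta + 1)) =
  N j * ((2 * j%:R + alpha + beta + 1 + 2) * (j%:R + alpha + 1) * (j%:R + alpha + beta + 1)).
Proof.
move=> j0; have [_ G0 GS] := @Euler_Gamma_like R.
have j1 : 1 <= j%:R :> R by rewrite ler1n.
have a1' := a1; have b1' := b1; have c0' := c0.
have jS : j.+1%:R = j%:R + 1 :> R by rewrite natr1.
rewrite /cross_mult jS.
have -> : j%:R + 1 + alpha + 1 = (j%:R + alpha + 1) + 1 by ring.
have -> : j%:R + 1 + alpha + beta + 1 = (j%:R + alpha + beta + 1) + 1 by ring.
have -> : j%:R + 1 + beta + 1 = (j%:R + beta + 1) + 1 by ring.
move: (j%:R) alpha beta j1 a1' b1' c0' => x a b x1 a1' b1' c0'.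
have p1 : 0 < x + a + 1 by lra.
have p2 : 0 < x + a + b + 1 by lra.
have p3 : 0 < x + b + 1 by lra.
have p4 : 0 < x + 1 by lra.
have p5 : 0 < a + b + 2 by lra.
rewrite (GS _ p1) (GS _ p2) (GS _ p3) (GS _ p4).
have := lt0r_neq0 (G0 _ p1); have := lt0r_neq0 (G0 _ p2); have := lt0r_neq0 (G0 _ p3).
have := lt0r_neq0 (G0 _ p4); have := lt0r_neq0 (G0 _ p5).
have := lt0r_neq0 (G0 _ a1'); have := lt0r_neq0 (G0 _ b1').
move: (Euler_Gamma _) (Euler_Gamma _) (Euler_Gamma _) (Euler_Gamma _) (Euler_Gamma _) (Euler_Gamma _) (Euler_Gamma _).
move=> y1 y2 y3 y4 y5 y6 y7 h1 h2 h3 h4 h5 h6 h7.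
have := lt0r_neq0 p1; have := lt0r_neq0 p2; have := lt0r_neq0 p3; have := lt0r_neq0 p4.
move=> q1 q2 q3 q4.
by field; rewrite ?h1 ?h2 ?h3 ?h4 ?h5 ?h6 ?h7 ?q1 ?q2 ?q3 ?q4.
Qed.

Lemma cross_mult_ratio (j : nat) : (0 < j)%N ->
  N j.+1 <= N j * expR ((2 * alpha + 1) / j%:R).
Proof.
move=> j0; have x1 : 1 <= j%:R :> R by rewrite ler1n.
have x0 : 0 < j%:R :> R by lra.
have N0 := cross_mult_gt0 j0; have rec := cross_mult_rec j0.
have c0' := c0.
have [[aE bE]|[a0 b0]] := cross_alpha_cases R M.
  have -> : 2 * alpha + 1 = 0 by rewrite aE; field.
  rewrite mul0r expR0 mulr1; rewrite aE bE in rec N0 *.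
  move: (cross_mult _ _ _ j.+1) (cross_mult _ _ _ j) N0 (j%:R) x0 rec => u v N0 x x0 rec.
  have D0 : 0 < (2 * x + - (1 / 2) + - (1 / 2) + 1) * (x + 1) * (x + - (1 / 2) + 1).
    by rewrite !mulr_gt0 //; lra.
  rewrite -(ler_pM2r D0) rec (ler_pM2l N0).
  by rewrite le_eqVlt; apply/orP; left; apply/eqP; field.
set u := N j.+1 in rec *; set v := N j in N0 rec *.
move: (j%:R) alpha beta x0 x1 a0 b0 c0' rec => x a b x0 x1 a0 b0 c0' rec.
have D0 : 0 < (2 * x + a + b + 1) * (x + 1) * (x + b + 1).
  by rewrite !mulr_gt0 //; lra.
rewrite -(ler_pM2r D0) rec -[leRHS]mulrA (ler_pM2l N0).
(* One exponential for each of the three factors in the ratio of consecutive multiplicities, each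
   estimated by 1 + y <= e^y. *)
have -> : (2 * a + 1) / x = x^-1 + a / x + a / x by field; rewrite gt_eqF.
rewrite !expRD.
have e1 : 1 + x^-1 <= expR x^-1 := expR_ge1Dx _.
have e2 : 1 + a / x <= expR (a / x) := expR_ge1Dx _.
have ax0 : 0 <= a / x by rewrite divr_ge0 // ltW.
have xi0 : 0 <= x^-1 by rewrite invr_ge0 ltW.
have h1 : 2 * x + a + b + 1 + 2 <= expR x^-1 * (2 * x + a + b + 1).
  apply: le_trans (ler_wpM2r _ e1); last by lra.
  have -> : (1 + x^-1) * (2 * x + a + b + 1) = 2 * x + a + b + 1 + 2 + (a + b + 1) / x by field; rewrite gt_eqF.
  by rewrite lerDl mulr_ge0.
have h2 : x + a + 1 <= expR (a / x) * (x + 1).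
  apply: le_trans (ler_wpM2r _ e2); last by lra.
  have -> : (1 + a / x) * (x + 1) = x + a + 1 + a / x by field; rewrite gt_eqF.
  by rewrite lerDl.
have h3 : x + a + b + 1 <= expR (a / x) * (x + b + 1).
  apply: le_trans (ler_wpM2r _ e2); last by lra.
  have -> : (1 + a / x) * (x + b + 1) = x + a + b + 1 + a / x * (b + 1) by field; rewrite gt_eqF.
  by rewrite lerDl mulr_ge0 //; lra.
have -> : expR x^-1 * expR (a / x) * expR (a / x) * ((2 * x + a + b + 1) * (x + 1) * (x + b + 1)) =
  (expR x^-1 * (2 * x + a + b + 1)) * (expR (a / x) * (x + 1)) * (expR (a / x) * (x + b + 1)) by ring.
by apply: ler_pM => //; [rewrite mulr_ge0|lra|apply: ler_pM] => //; lra.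
Qed.

(* The factor exp (- (2 alpha + 1) / j) makes the induction go through. *)
Lemma cross_mult_growth : exists K, 0 < K /\ forall j : nat, (0 < j)%N ->
  N j <= K * j%:R `^ (2 * alpha + 1).
Proof.
set e := 2 * alpha + 1.
have e0 : 0 <= e.
  by rewrite /e; have [[-> _]|[h _]] := cross_alpha_cases R M; [lra|move: alpha h => a h; lra].
have K0 : 0 < N 1%N * expR e.
  by apply: mulr_gt0; [exact: cross_mult_gt0|exact: expR_gt0].
exists (N 1%N * expR e); split=> // j j0.
have powE (i : nat) : (0 < i)%N -> i%:R `^ e = expR (e * ln (i%:R : R)).
  by move=> i0; rewrite /powR pnatr_eq0 gtn_eqF.
suff H : N j <= N 1%N * expR e * (j%:R `^ e * expR (- (e / j%:R))).
  apply: (le_trans H); rewrite (ler_pM2l K0).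
  by rewrite ler_piMr ?powR_ge0 // -expR0 ler_expR oppr_le0 divr_ge0.
case: j j0 => [//|j] _; elim: j => [|j IH].
  by rewrite powR1 mul1r divr1 -mulrA -expRD subrr expR0 mulr1.
apply: le_trans (cross_mult_ratio (ltn0Sn j)) _.
apply: (@le_trans _ _ (N 1%N * expR e * (j.+1%:R `^ e * expR (- (e / j.+1%:R))) * expR (e / j.+1%:R))).
  by rewrite (ler_pM2r (expR_gt0 _)).
rewrite -mulrA (ler_pM2l K0) -mulrA -expRD addNr expR0 mulr1.
rewrite !powE // -expRD ler_expR -mulrN -mulrDr ler_wpM2l //.
have y0 : 0 < j.+1%:R :> R by rewrite ltr0n.
have z0 : 0 < j.+2%:R :> R by rewrite ltr0n.
have := @ln_sublinear R (j.+1%:R / j.+2%:R); rewrite divr_gt0 // => /(_ isT) _.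
have h : ln (j.+1%:R / j.+2%:R : R) <= - (j.+2%:R)^-1.
  have -> : j.+1%:R / j.+2%:R = 1 + - (j.+2%:R : R)^-1.
    have zE : j.+2%:R = j.+1%:R + 1 :> R by rewrite natr1.
    by move: z0; rewrite zE => z0; field; rewrite gt_eqF.
  apply: le_ln1Dx; rewrite ltrN2 invf_lt1 ?ltr1n //.
by move: h; rewrite ln_div ?posrE // lerBlDr addrC.
Qed.

Lemma g2_ge (j : nat) : (0 < j)%N -> j%:R ^+ 2 <= g2 j.
Proof.
move=> j0; have j1 : 1 <= j%:R :> R by rewrite ler1n.
have h1 : forall b : nat, (0 < b)%N -> 1 <= b%:R :> R by move=> b b0; rewrite ler1n.
case: M => [b|b|b|b|] /= => [/h1|/h1|/h1|/h1|]; move: (j%:R) j1 => x x1;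
  try (move: (b%:R) => y y1); nra.
Qed.

(** gamma_j^2 / j is nondecreasing; hence the s-th power of gamma_j^2 grows at least by the factor 1
    + s / (j + 1), the growth that [telescoping_bound] asks for. *)
Lemma g2_step (j : nat) : (0 < j)%N -> g2 j * j.+1%:R <= g2 j.+1 * j%:R.
Proof.
move=> j0; have j1 : 1 <= j%:R :> R by rewrite ler1n.
have h1 : forall b : nat, (0 < b)%N -> 1 <= b%:R :> R by move=> b b0; rewrite ler1n.
rewrite -natr1.
case: M => [b|b|b|b|] /= => [/h1|/h1|/h1|/h1|]; rewrite -?natr1; move: (j%:R) j1 => x x1;
  try (move: (b%:R) => y y1); nra.
Qed.

(** Comparison with the increments of z / (1 + z), whose derivative is 1 / (1 + z)^2. The bound
    depends on s alone and not on the scale of y; this is what makes the supremum over h finite. *)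
Lemma telescoping_bound (y : nat -> R) (s : R) : 0 < s -> (forall j, (0 < j)%N -> 0 < y j) ->
  (forall j, (0 < j)%N -> y j * (1 + s / j.+1%:R) <= y j.+1) ->
  forall n, \sum_(1 <= j < n) y j / (1 + y j) ^+ 2 / j%:R <= (1 + s) / s.
Proof.
move=> s0 y0 ys; suff H n : \sum_(1 <= j < n.+2) y j / (1 + y j) ^+ 2 / j%:R <=
    (1 + s) / s * (y n.+1 / (1 + y n.+1)).
  have p n : 0 <= \sum_(1 <= j < n) y j / (1 + y j) ^+ 2 / j%:R.
    rewrite big_nat_cond sumr_ge0 // => j /andP[/andP[/y0 yj _] _].
    by rewrite !divr_ge0 ?sqr_ge0 // ltW.
  have q : 0 <= (1 + s) / s by rewrite divr_ge0 ?addr_ge0 // ltW.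
  move=> [|[|n]]; [by rewrite big_geq|by rewrite big_geq|].
  apply: (le_trans (H n)); rewrite ler_piMr //.
  by have := y0 n.+1 isT => h; rewrite ler_pdivrMr ?mul1r ?lerDr // addr_gt0.
elim: n => [|n IH].
  rewrite big_nat1; have := y0 1%N isT; move: (y 1%N) => z z0; rewrite divr1.
  have -> : z / (1 + z) ^+ 2 = (1 + z)^-1 * (z / (1 + z)) by field; rewrite gt_eqF // addr_gt0.
  rewrite ler_wpM2r ?divr_ge0 ?addr_ge0 ?(ltW z0) //.
  apply: (@le_trans _ _ 1); first by rewrite invf_le1 ?addr_gt0 // lerDl ltW.
  by rewrite ler_pdivlMr // mul1r lerDr.
rewrite big_nat_recr //=; apply: (le_trans (lerD IH (lexx _))).
rewrite -lerBrDl -mulrBr; have := ys n.+1 isT; have := y0 n.+1 isT; have := y0 n.+2 isT.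
have x0 : 1 <= n.+2%:R :> R by rewrite ler1n.
move: (y n.+1) (y n.+2) (n.+2%:R) x0 => u v x x1 v0 u0 uv.
have x0 : 0 < x by lra.
have u1 : 0 < 1 + u by lra.
have v1 : 0 < 1 + v by lra.
have -> : v / (1 + v) - u / (1 + u) = (v - u) / ((1 + u) * (1 + v)).
  by field; rewrite !gt_eqF.
have uv' : u * (x + s) <= v * x.
  have := ler_wpM2r (ltW x0) uv; have -> : u * (1 + s / x) * x = u * (x + s) by field; rewrite gt_eqF.
  by [].
have h1 : u * s <= (v - u) * x by lra.
have vu : 0 <= v - u.
  by rewrite -(pmulr_lge0 _ x0) (le_trans _ h1) // mulr_ge0 // ltW.
have h2 : 0 <= (v - u) * s * (x - 1) by rewrite !mulr_ge0 //; lra.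
(* Growth gives v - u >= v s / (x + s), and x + s <= x (1 + s) because x >= 1. *)
have d0 : v * s / (x * (1 + s)) <= v - u.
  by rewrite ler_pdivrMr ?mulr_gt0 //; lra.
have uv2 : u <= v by lra.
apply: (@le_trans _ _ ((1 + s) / s * (v * s / (x * (1 + s)) / ((1 + v) * (1 + v))))).
  rewrite le_eqVlt; apply/orP; left; apply/eqP.
  by field; rewrite !gt_eqF //; lra.
rewrite ler_wpM2l ?divr_ge0 ?(ltW s0) //; first lra.
apply: ler_pM => //.
- by rewrite !divr_ge0 ?mulr_ge0 //; lra.
- by rewrite invr_ge0 mulr_ge0 // ltW.
- by rewrite lef_pV2 ?posrE ?mulr_gt0 // ler_pM2r //; lra.
Qed.

Lemma gam_ge (j : nat) : (0 < j)%N -> j%:R <= gam j.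
Proof.
move=> j0; rewrite -(@ger0_norm _ (j%:R : R)) // -sqrtr_sqr /cross_gamma.
by apply: ler_wsqrtr; exact: g2_ge.
Qed.

Lemma gam_ge1 (j : nat) : (0 < j)%N -> 1 <= gam j.
Proof. by move=> j0; apply: le_trans (gam_ge j0); rewrite ler1n. Qed.

Lemma gam_gt0 (j : nat) : (0 < j)%N -> 0 < gam j.
Proof. by move=> /gam_ge1; exact: lt_le_trans. Qed.

Lemma powRD_gt0 (g x y : R) : 0 < g -> g `^ (x + y) = g `^ x * g `^ y.
Proof. by move=> g0; rewrite powRD // (gt_eqF g0) implybT. Qed.

Lemma prod_powR_sum (I : finType) (g : R) (f : I -> R) : 0 < g ->
  \prod_i g `^ f i = g `^ (\sum_i f i).
Proof.
move=> g0; elim/big_rec2: _ => [|i y x _ ->]; first by rewrite powRr0.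
by rewrite powRD_gt0.
Qed.

Lemma prod_powR_le (I : finType) (w lam : I -> R) i :
  (forall l, 0 <= w l <= 1) -> (forall l, 0 < lam l) ->
  \prod_l w l `^ lam l <= w i `^ lam i.
Proof.
move=> w01 l0; rewrite (bigD1 i) //= ler_piMr ?powR_ge0 //.
elim/big_rec: _ => // l y _ y1; have /andP[w0 w1] := w01 l.
have h : w l `^ lam l <= 1 `^ lam l.
  by apply: ge0_ler_powR => //; rewrite ?nnegrE // ltW.
rewrite powR1 in h; apply: (le_trans (ler_wpM2l (powR_ge0 _ _) y1)).
by rewrite mulr1.
Qed.

Section Weights.
Variables (m : nat) (k : R) (r lam : 'I_m.+1 -> R).
Hypotheses (hm : (0 < m)%N) (hr : forall i j : 'I_m.+1, (i < j)%N -> r i < r j).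
Hypotheses (hlam : forall j, 0 < lam j) (hsum : \sum_j lam j = 1).
Hypothesis hk : k + (cross_dim M)%:R / 4 <= \sum_j lam j * r j.

Definition wden (h : 'I_m.+1 -> R) (g : R) : R := \sum_(l < m.+1) h l * g `^ (4 * r l).
Definition wgt (h : 'I_m.+1 -> R) (g : R) : R := g `^ (4 * k) / wden h g.

Lemma wden_ge0 h g : (forall l, 0 < h l) -> 0 <= wden h g.
Proof. by move=> h0; apply: sumr_ge0 => l _; rewrite mulr_ge0 ?powR_ge0 // ltW. Qed.

Lemma wden_ge h g l : (forall l, 0 < h l) -> h l * g `^ (4 * r l) <= wden h g.
Proof.
move=> h0; rewrite /wden (bigD1 l) //= lerDl; apply: sumr_ge0 => i _.
by rewrite mulr_ge0 ?powR_ge0 // ltW.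
Qed.

Lemma wden_gt0 h g : (forall l, 0 < h l) -> 0 < g -> 0 < wden h g.
Proof.
move=> h0 g0; apply: lt_le_trans (wden_ge _ ord0 h0).
by rewrite mulr_gt0 ?powR_gt0.
Qed.

Lemma wgt_ge0 h g : (forall l, 0 < h l) -> 0 <= wgt h g.
Proof. by move=> h0; rewrite divr_ge0 ?powR_ge0 ?wden_ge0. Qed.

Lemma cross_seriesE h :
  cross_series M k r h = (\sum_(1 <= j <oo) (N j * wgt h (gam j))%:E)%E.
Proof.
congr (limn _); apply/funext => n; apply: eq_bigr => j _; congr EFin.
by rewrite /wgt /wden /cross_mult mulf_div.
Qed.

(** With u_l = h_l gamma_j^(4 r_l) and B = h_m / h_0, [ys B j] is (u_m / u_0)^minl, written as a
    power of gamma_j^2 so that [g2_step] applies; [sexp] is the exponent that results. *)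
Let sexp : R := 2 * (r ord_max - r ord0) * Num.min (lam ord0) (lam ord_max).
Let minl : R := Num.min (lam ord0) (lam ord_max).
Let ys (B : R) (j : nat) : R := B `^ minl * g2 j `^ sexp.

Let minl_gt0 : 0 < minl. Proof. by rewrite /minl lt_min !hlam. Qed.

Let r_lt : r ord0 < r ord_max. Proof. exact: hr. Qed.

Let sexp_gt0 : 0 < sexp.
Proof.
rewrite /sexp -/minl; apply: mulr_gt0 minl_gt0.
by apply: mulr_gt0 => //; rewrite subr_gt0.
Qed.

Let g2_gt0 j : (0 < j)%N -> 0 < g2 j.
Proof. by move=> j0; apply: lt_le_trans (g2_ge j0); rewrite exprn_gt0 // ltr0n. Qed.

Let ys_gt0 B j : 0 < B -> (0 < j)%N -> 0 < ys B j.
Proof. by move=> B0 j0; rewrite mulr_gt0 ?powR_gt0 ?g2_gt0. Qed.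

Let ys_step B j : 0 < B -> (0 < j)%N -> ys B j * (1 + sexp / j.+1%:R) <= ys B j.+1.
Proof.
move=> B0 j0; rewrite /ys -mulrA (ler_pM2l (powR_gt0 _ B0)).
have x0 : 0 < j%:R :> R by rewrite ltr0n.
have x1 : 0 < j.+1%:R :> R by rewrite ltr0n.
have h : g2 j <= g2 j.+1 * (j%:R / j.+1%:R).
  by rewrite mulrA ler_pdivlMr //; exact: g2_step.
have h2 : g2 j `^ sexp <= (g2 j.+1 * (j%:R / j.+1%:R)) `^ sexp.
  apply: ge0_ler_powR => //; rewrite ?nnegrE ?(ltW sexp_gt0) ?(ltW (g2_gt0 _)) //.
  by rewrite mulr_ge0 ?divr_ge0 ?ltW ?g2_gt0.
have q0 : 0 <= 1 + sexp / j.+1%:R by rewrite addr_ge0 // divr_ge0 // (ltW sexp_gt0).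
apply: (le_trans (ler_wpM2r q0 h2)).
rewrite powRM ?divr_ge0 ?(ltW (g2_gt0 _)) // -mulrA ler_piMr ?powR_ge0 //.
have jj : 0 < j%:R / j.+1%:R :> R by rewrite divr_gt0.
have -> : (j%:R / j.+1%:R : R) `^ sexp = expR (sexp * ln (j%:R / j.+1%:R)).
  by rewrite /powR gt_eqF.
have h3 : ln (j%:R / j.+1%:R : R) <= - (j.+1%:R)^-1.
  have -> : j%:R / j.+1%:R = 1 + - (j.+1%:R : R)^-1.
    have zE : j.+1%:R = j%:R + 1 :> R by rewrite natr1.
    by move: x1; rewrite zE => z0; field; rewrite gt_eqF.
  by apply: le_ln1Dx; rewrite ltrN2 invf_lt1 ?ltr1n.
apply: (@le_trans _ _ (expR (- (sexp / j.+1%:R)) * expR (sexp / j.+1%:R))); last first.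
  by rewrite -expRD addNr expR0.
apply: ler_pM; rewrite ?expR_ge0 ?expR_ge1Dx // ler_expR -mulrN.
by apply: ler_wpM2l h3; exact: ltW sexp_gt0.
Qed.

Let ysE B j : 0 < B -> (0 < j)%N ->
  (B * gam j `^ (4 * (r ord_max - r ord0))) `^ minl = ys B j.
Proof.
move=> B0 j0; rewrite powRM ?powR_ge0 ?(ltW B0) // /ys; congr (_ * _).
rewrite /cross_gamma -powR12_sqrt ?(ltW (g2_gt0 _)) // -!powRrM; congr (_ `^ _).
by rewrite /sexp -/minl; field.
Qed.

(** Put u_l = h_l gamma_j^(4 r_l), v = u_m / u_0 and y = v^minl. Each u_l is at most the sum U, so
    all factors of the product but one may be dropped: keeping the index m if v <= 1 and the index 0
    otherwise gives min (y, 1/y), and this is at most 4 y / (1 + y)^2. *)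
Let ratio_bound (h : 'I_m.+1 -> R) j : (forall l, 0 < h l) -> (0 < j)%N ->
  (\prod_l (h l * gam j `^ (4 * r l)) `^ lam l) / wden h (gam j) <=
  4 * (ys (h ord_max / h ord0) j / (1 + ys (h ord_max / h ord0) j) ^+ 2).
Proof.
move=> h0 j0; have g0 := gam_gt0 j0; have U0 := wden_gt0 h0 g0.
set U := wden h (gam j) in U0 *; pose u l := h l * gam j `^ (4 * r l).
have u0 l : 0 < u l by rewrite mulr_gt0 ?powR_gt0.
have uU l : u l <= U by exact: wden_ge.
have uU01 l : 0 <= u l / U <= 1.
  by rewrite divr_ge0 ?(ltW (u0 _)) ?(ltW U0) //= ler_pdivrMr // mul1r.
have -> : (\prod_l u l `^ lam l) / U = \prod_l (u l / U) `^ lam l.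
  rewrite [RHS](eq_bigr (fun l => u l `^ lam l * U `^ (- lam l))) => [|l _].
    by rewrite big_split /= prod_powR_sum // sumrN hsum powR_inv1 // ltW.
  rewrite powRM ?invr_ge0 ?(ltW (u0 _)) ?(ltW U0) //.
  by rewrite -powR_inv1 ?(ltW U0) // -powRrM mulN1r.
have B0 : 0 < h ord_max / h ord0 by rewrite divr_gt0.
have y0 := ys_gt0 B0 j0.
have vE : h ord_max / h ord0 * gam j `^ (4 * (r ord_max - r ord0)) = u ord_max / u ord0.
  rewrite /u mulrBr powRD_gt0 // powRN invfM.
  by field; rewrite !gt_eqF ?powR_gt0.
have e1 : (1 : R) `^ minl = 1 by rewrite powR1.
have := ysE B0 j0; rewrite vE => yE; set y := ys _ j in y0 yE *.
set v := u ord_max / u ord0 in yE.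
have v0 : 0 < v by rewrite divr_gt0.
have [v1|/ltW v1] := leP v 1.
  have y1 : y <= 1.
    rewrite -yE -[leRHS]e1; apply: ge0_ler_powR => //; rewrite ?nnegrE ?(ltW minl_gt0) //.
    exact: ltW.
  apply: (@le_trans _ _ y); last first.
    rewrite mulrCA ler_peMr ?(ltW y0) // ler_pdivlMr ?exprn_gt0 ?addr_gt0 //; nra.
  apply: (le_trans (prod_powR_le ord_max uU01 hlam)); rewrite -yE.
  apply: (@le_trans _ _ (v `^ lam ord_max)).
    apply: ge0_ler_powR => //; rewrite ?nnegrE ?(ltW (hlam _)) ?(ltW v0) //.
      by have /andP[] := uU01 ord_max.
    by rewrite ler_pM2l // lef_pV2 ?posrE.
  by apply: ger_powR; rewrite ?v0 // /minl ge_min lexx orbT.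
have vi1 : v^-1 <= 1 by rewrite invf_le1.
have yiE : v^-1 `^ minl = y^-1.
  by rewrite -yE -powR_inv1 ?(ltW v0) // -powRrM mulN1r powRN.
have y1 : 1 <= y.
  rewrite -yE -[leLHS]e1; apply: ge0_ler_powR => //; rewrite ?nnegrE ?(ltW minl_gt0) //.
  exact: ltW.
apply: (@le_trans _ _ y^-1); last first.
  rewrite mulrA ler_pdivlMr ?exprn_gt0 ?addr_gt0 // ler_pdivrMl //; nra.
apply: (le_trans (prod_powR_le ord0 uU01 hlam)); rewrite -yiE.
apply: (@le_trans _ _ (v^-1 `^ lam ord0)).
  apply: ge0_ler_powR => //; rewrite ?nnegrE ?(ltW (hlam _)) ?invr_ge0 ?(ltW v0) //.
    by have /andP[] := uU01 ord0.
  by rewrite /v invf_div ler_pM2l // lef_pV2 ?posrE.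
by apply: ger_powR; rewrite ?invr_gt0 ?v0 // /minl ge_min lexx.
Qed.

(** Multiplicities grow at most like j^(d - 1) and 4 k - 4 rho <= - d, which leaves a factor 1/j,
    not summable by itself. [ratio_bound] supplies the missing decay and [telescoping_bound] sums
    it, uniformly in h and n. *)
Lemma cross_series_partial : exists K, forall (h : 'I_m.+1 -> R) n,
  (forall l, 0 < h l) ->
  (\prod_l h l `^ lam l) * (\sum_(1 <= j < n) N j * wgt h (gam j)) <= K.
Proof.
have [K [K0 HK]] := cross_mult_growth.
exists (K * 4 * ((1 + sexp) / sexp)) => h n h0.
have B0 : 0 < h ord_max / h ord0 by rewrite divr_gt0.
have T := telescoping_bound sexp_gt0 (fun j => @ys_gt0 _ j B0) (fun j => @ys_step _ j B0) n.
apply: le_trans (ler_wpM2l _ T); last by rewrite mulr_ge0 // ltW.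
rewrite !mulr_sumr [leLHS]big_nat_cond [leRHS]big_nat_cond; apply: ler_sum => j /andP[/andP[j0 _] _].
have g0 := gam_gt0 j0; have U0 := wden_gt0 h0 g0.
pose rho := \sum_l lam l * r l.
(* The powers of h are absorbed into the products h_l gamma_j^(4 r_l), at the price of gamma_j^(- 4
   rho). *)
have -> : (\prod_l h l `^ lam l) * (N j * wgt h (gam j)) =
  N j * gam j `^ (4 * k - 4 * rho) *
   ((\prod_l (h l * gam j `^ (4 * r l)) `^ lam l) / wden h (gam j)).
  have -> : \prod_l (h l * gam j `^ (4 * r l)) `^ lam l =
     (\prod_l h l `^ lam l) * gam j `^ (4 * rho).
    rewrite /rho mulr_sumr -prod_powR_sum // -big_split; apply: eq_bigr => l _ /=.
    by rewrite powRM ?powR_ge0 ?(ltW (h0 l)) // -powRrM; congr (_ * _ `^ _); ring.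
  rewrite powRD_gt0 // powRN /wgt; field.
  by rewrite !gt_eqF ?powR_gt0.
have dN : N j * gam j `^ (4 * k - 4 * rho) <= K / j%:R.
  have x1 : 0 < j%:R :> R by rewrite ltr0n.
  apply: (@le_trans _ _ (K * j%:R `^ (2 * alpha + 1) * (j%:R `^ (- (cross_dim M)%:R)))).
    apply: ler_pM; rewrite ?(ltW (cross_mult_gt0 _)) ?powR_ge0 ?HK //.
    apply: (@le_trans _ _ (gam j `^ (- (cross_dim M)%:R))).
      apply: ler_powR; first exact: gam_ge1.
      have := hk; rewrite -/rho; move: ((cross_dim M)%:R) => x; lra.
    rewrite !powRN lef_pV2 ?posrE ?powR_gt0 //.
    by apply: ge0_ler_powR => //; rewrite ?nnegrE ?ler0n ?(ltW g0) //; exact: gam_ge.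
  rewrite -mulrA -powRD_gt0 //.
  have -> : 2 * alpha + 1 + - (cross_dim M)%:R = -1.
    by rewrite /cross_alpha; field.
  by rewrite powR_inv1 // ltW.
have R0 : 0 <= (\prod_l (h l * gam j `^ (4 * r l)) `^ lam l) / wden h (gam j).
  by rewrite divr_ge0 ?(ltW U0) // prodr_ge0 // => l _; exact: powR_ge0.
apply: (le_trans (ler_wpM2r R0 dN)).
apply: (le_trans (ler_wpM2l _ (ratio_bound h0 j0))); first by rewrite divr_ge0 // ltW.
by rewrite le_eqVlt; apply/orP; left; apply/eqP; ring.
Qed.

Lemma cross_series_ge0 h : (forall l, 0 < h l) -> (0 <= cross_series M k r h)%E.
Proof.
move=> h0; rewrite cross_seriesE; apply: nneseries_ge0 => j j0 _.
by rewrite lee_fin mulr_ge0 ?wgt_ge0 // ltW // cross_mult_gt0.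
Qed.

Let prodh_gt0 (h : 'I_m.+1 -> R) : (forall l, 0 < h l) -> 0 < \prod_l h l `^ lam l.
Proof. by move=> h0; apply: prodr_gt0 => l _; exact: powR_gt0. Qed.

Let series_bound : exists K, forall h, (forall l, 0 < h l) ->
  (cross_series M k r h <= (K / \prod_l h l `^ lam l)%:E)%E.
Proof.
have [K HK] := cross_series_partial; exists K => h h0.
rewrite cross_seriesE; apply: lime_le.
  by apply: is_cvg_nneseries => j j0 _; rewrite lee_fin mulr_ge0 ?wgt_ge0 // ltW // cross_mult_gt0.
apply: nearW => n; rewrite sumEFin lee_fin ler_pdivlMr ?prodh_gt0 // mulrC.
exact: HK.
Qed.

Lemma cross_series_fin h : (forall l, 0 < h l) -> cross_series M k r h \is a fin_num.
Proof.
move=> h0; have [K HK] := series_bound; rewrite ge0_fin_numE ?cross_series_ge0 //.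
exact: le_lt_trans (HK h h0) (ltry _).
Qed.

Lemma cross_constant_ge h : (forall l, 0 < h l) ->
  ((\prod_l h l `^ lam l)%:E * cross_series M k r h <= cross_constant M k r lam)%E.
Proof. by move=> h0; apply: ereal_sup_ubound; exists h. Qed.

Lemma cross_constant_fin : cross_constant M k r lam \is a fin_num.
Proof.
have [K HK] := series_bound; rewrite ge0_fin_numE.
  apply: (@le_lt_trans _ _ K%:E); last exact: ltry.
  apply: ge_ereal_sup => _ [h /= h0 <-].
  apply: (le_trans (lee_wpmul2l _ (HK h h0))); first by rewrite lee_fin ltW ?prodh_gt0.
  by rewrite -EFinM lee_fin mulrC divfK // gt_eqF ?prodh_gt0.
have h1 : forall l : 'I_m.+1, 0 < (1 : R) by [].
apply: le_trans (cross_constant_ge h1); apply: mule_ge0; last exact: cross_series_ge0.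
by rewrite lee_fin ltW ?prodh_gt0.
Qed.

End Weights.
End Finiteness.

(** * Zonal functions, maximum principle and the Jacobi operator *)

Section Zonal.
Context {R : realType} {M : cross}.
Variable X : @cross_model R M.
Local Notation E := (ambient R M).
Local Notation S := (carrier R M).
Local Notation base := (mbase X).
Local Notation alpha := (cross_alpha R M).
Local Notation beta := (cross_beta R M).
Local Notation sd := (msd X).
Local Notation rho := (mrho X).
Implicit Types (p q : E) (f : {poly R}) (w : E -> R).

Lemma symm_trans p : S p -> exists2 g, symm g & g base = p.
Proof. by move=> Sp; have [g [sg e _]] := mswap X (mbaseS X) Sp; exists g. Qed.

Lemma sdC p q : sd p q = sd q p.
Proof. by rewrite /msd dotC. Qed.

Lemma sd_symm g p q : symm g -> sd (g p) (g q) = sd p q.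
Proof. by move=> sg; rewrite /msd (symm_dot _ _ sg). Qed.

Lemma sdpp p : S p -> sd p p = 0.
Proof. by move=> Sp; rewrite /msd (mdot1 X Sp) subrr mul0r. Qed.

Lemma sd_eq0 p q : S p -> S q -> sd p q = 0 -> p = q.
Proof.
move=> Sp Sq /eqP; rewrite /msd mulf_eq0 invr_eq0 (gt_eqF (mkap_gt0 X)) orbF.
rewrite subr_eq0 => /eqP e; apply/eqP; rewrite -subr_eq0; apply/eqP/dot_eq0.
by rewrite dotDl !dotDr !dotNl !dotNr (mdot1 X Sp) (mdot1 X Sq) (dotC q) -e; ring.
Qed.

Lemma sd_continuous p : continuous (sd p).
Proof.
move=> q; rewrite /continuous_at /msd.
have c : 1 - dot p x @[x --> q] --> 1 - dot p q.
  have cd : dot p x @[x --> q] --> dot p q by exact: dot_continuousr.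
  exact: cvgB (cvg_cst _) cd.
exact: cvgMr_tmp c.
Qed.

Lemma carrier_compact : compact S.
Proof.
apply: (mx_compact (B := 1)) => [|p Sp i j]; first exact: mclosed X.
by rewrite -(expr_le1 (n := 2)) // real_normK ?num_real // -(mdot1 X Sp) sqr_coord_le_dot.
Qed.

(** Uniform continuity measured by the zonal variable instead of a distance: on the compact set of
    pairs with |w p - w q| >= e, sd attains a minimum, which is positive because sd p q = 0 only for
    p = q. *)
Lemma carrier_unif_continuous w : continuous w ->
  forall e, 0 < e -> exists2 dl, 0 < dl &
    forall p q, S p -> S q -> sd p q < dl -> `|w p - w q| < e.
Proof.
move=> cw e e0.
pose K := (S `*` S) `&` [set x : E * E | e <= `|w x.1 - w x.2|].
have cK : compact K.
  apply: compact_closedI; first by apply: compact_setX; exact: carrier_compact.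
  rewrite (_ : [set x | _] = (fun x : E * E => `|w x.1 - w x.2|) @^-1` [set y | e <= y]) //.
  apply: preimage_closed; last exact: closed_ge.
  move=> x _; apply: cvg_norm; apply: cvgB.
    by apply: (@continuous_comp _ _ _ fst w); [exact: cvg_fst|exact: cw].
  by apply: (@continuous_comp _ _ _ snd w); [exact: cvg_snd|exact: cw].
have [K0|/set0P/negP/negPn/eqP K0] := pselect (K !=set0); last first.
  exists 1 => // p q Sp Sq _; rewrite ltNge; apply/negP => h.
  have : K (p, q) by [].
  by rewrite K0.
have cs : {within K, continuous (fun x : E * E => sd x.1 x.2)}.
  apply: continuous_subspaceT => x; rewrite /continuous_at /msd.
  suff c : 1 - dot y.1 y.2 @[y --> x] --> 1 - dot x.1 x.2 by exact: cvgMr_tmp c.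
  apply: cvgB; first exact: cvg_cst.
  apply: (cvg_sumf (F := nbhs x)) => i; apply: (cvg_sumf (F := nbhs x)) => j.
  apply: cvgM.
    apply: (@continuous_comp _ _ _ fst (fun p : E => p i j)); first exact: cvg_fst.
    exact: coord_continuous.
  apply: (@continuous_comp _ _ _ snd (fun p : E => p i j)); first exact: cvg_snd.
  exact: coord_continuous.
have [c cK1 cmin] := compact_EVT_min K0 cK cs.
move: cK1; rewrite inE => -[[Sc1 Sc2] ce].
exists (sd c.1 c.2).
  rewrite lt_neqAle (msd_ge0 X Sc1 Sc2) andbT eq_sym; apply/negP => /eqP h.
  by move: ce; rewrite /= (sd_eq0 Sc1 Sc2 h) subrr normr0 leNgt e0.
move=> p q Sp Sq; apply: contraTT; rewrite -!leNgt => h.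
by apply: (cmin (p, q)); rewrite inE.
Qed.

Lemma laplacian_on_ext w w' v v' : (forall p, S p -> w p = v p) ->
  (forall p, S p -> w' p = v' p) -> laplacian_on X w w' -> laplacian_on X v v'.
Proof.
move=> e e' L g sg; have [h1 [s [a b c]]] := L g sg.
exists h1, s; split=> // [i t|]; last by rewrite c e' //; apply: symmS (mbaseS X).
rewrite (_ : (fun _ => _) = (fun t => w (g (mflow X i t base)))) //.
by apply/funext => u; rewrite e //; apply: symmS (flowS X i u).
Qed.

Lemma laplacian_onD w w' v v' : laplacian_on X w w' -> laplacian_on X v v' ->
  laplacian_on X (fun p => w p + v p) (fun p => w' p + v' p).
Proof.
move=> L1 L2 g sg; have [h1 [s [a b c]]] := L1 g sg.
have [k1 [r [a2 b2 c2]]] := L2 g sg.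
exists (fun i t => h1 i t + k1 i t), (fun i => s i + r i); split.
- by move=> i t; apply: is_derive_addf.
- by move=> i; apply: is_derive_addf.
by rewrite big_split /= c c2 opprD.
Qed.

Lemma laplacian_onZ a w w' : laplacian_on X w w' ->
  laplacian_on X (fun p => a * w p) (fun p => a * w' p).
Proof.
move=> L1 g sg; have [h1 [s [h b c]]] := L1 g sg.
exists (fun i t => a * h1 i t), (fun i => a * s i); split.
- by move=> i t; apply: is_derive_scalef (h i t).
- by move=> i; apply: is_derive_scalef (b i).
by rewrite -mulr_sumr c mulrN.
Qed.

Lemma laplacian_on_cst c : laplacian_on X (fun=> c) (fun=> 0).
Proof.
move=> g sg; exists (fun _ _ => 0), (fun=> 0).
split=> [i t|i|]; try exact: is_derive_cst.
by rewrite big1 // oppr0.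
Qed.

Lemma laplacian_on_sum (I : finType) (w w' : I -> E -> R) :
  (forall i, laplacian_on X (w i) (w' i)) ->
  laplacian_on X (fun p => \sum_i w i p) (fun p => \sum_i w' i p).
Proof.
move=> L; elim: (index_enum I) => [|i s IH].
  apply: laplacian_on_ext (laplacian_on_cst 0) => p _; by rewrite big_nil.
by apply: laplacian_on_ext (laplacian_onD (L i) IH) => p _; rewrite big_cons.
Qed.

(** Both values are sums of second derivatives of the same functions along the same geodesics, and
    the symmetries carry the base to every point of the carrier. *)
Lemma laplacian_on_uniq w a b : laplacian_on X w a -> laplacian_on X w b ->
  forall p, S p -> a p = b p.
Proof.
move=> L1 L2 p Sp; have [g sg <-] := symm_trans Sp.
have [h1 [s [h c e]]] := L1 g sg; have [k1 [r [h' c' e']]] := L2 g sg.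
apply: oppr_inj; rewrite -e -e'; apply: eq_bigr => i _.
rewrite -(is_derive_val (c i)) -(is_derive_val (c' i)).
congr (derive _ _ _); apply/funext => t.
by rewrite -(is_derive_val (h i t)) -(is_derive_val (h' i t)).
Qed.

(* At a maximum of w on the compact carrier the Laplacian is nonnegative. *)
Lemma maximum_principle w w' e : laplacian_on X w w' ->
  {within S, continuous w} -> (forall p, S p -> w p + w' p <= e) ->
  forall p, S p -> w p <= e.
Proof.
move=> L cw H p Sp.
have [c] := compact_EVT_max (ex_intro _ p Sp) carrier_compact cw.
rewrite inE => Sc cmax; apply: (le_trans (cmax p _)); first by rewrite inE.
apply: le_trans (H c Sc); rewrite lerDl.
have [g sg gc] := symm_trans Sc.
have [h1 [s [h b e1]]] := L g sg; rewrite -gc -oppr_le0 -e1.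
apply: sumr_le0 => i _; apply: (second_derivative_at_max (h i) (b i)) => t.
by rewrite flow0 gc; apply: cmax; rewrite inE; apply: symmS (flowS X i t).
Qed.

Local Notation Lop := (jacobi_op alpha beta).

Lemma zonal_separable g i : symm g ->
  separable (fun t q => sd (g (mflow X i t base)) q).
Proof.
move=> sg.
have -> : (fun t q => sd (g (mflow X i t base)) q) = (fun t q =>
    (1 / mkap X - dot (g (mcurveA X i)) q / mkap X)
    + cos (momega X * t) * (- (dot (g (mcurveB X i)) q / mkap X))
    + sin (momega X * t) * (- (dot (g (mcurveC X i)) q / mkap X))).
  apply/funext => t; apply/funext => q.
  rewrite mflow_base /trig_curve !(lin_mapD (symm_lin sg)) !(lin_mapZ (symm_lin sg)).
  by rewrite /msd !dotDl !dotZl; field; rewrite gt_eqF // mkap_gt0.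
have cd u : continuous (fun q : E => dot u q / mkap X).
  move=> q; rewrite /continuous_at.
  have c : dot u x @[x --> q] --> dot u q by exact: dot_continuousr.
  exact: cvgMr_tmp c.
have cN u : continuous (fun q : E => - (dot u q / mkap X)).
  by move=> q; exact: cvgN (cd u q).
have om := @is_derive_mulcst R (momega X).
apply: separableD; first apply: separableD.
- apply: separable_q => q; exact: cvgB (cvg_cst _) (cd _ q).
- apply: separableM; last exact: separable_q (cN _).
  apply: (@separable_t _ _ _ (fun t => momega X * - sin (momega X * t))
    (momega X * (- (momega X * cos (momega X * 0))))).
    by move=> t; exact: (is_derive1_comp (om t) (is_derive_cos _)).
  apply: is_derive_scalef; apply: is_deriveN.
  exact: (is_derive1_comp (om 0) (is_derive_sin _)).
- apply: separableM; last exact: separable_q (cN _).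
  apply: (@separable_t _ _ _ (fun t => momega X * cos (momega X * t))
    (momega X * (momega X * - sin (momega X * 0)))).
    by move=> t; exact: (is_derive1_comp (om t) (is_derive_sin _)).
  apply: is_derive_scalef.
  exact: (is_derive1_comp (om 0) (is_derive_cos _)).
Qed.

(** The chain rule gives f'' times the sum of the squared first derivatives of s, plus f' times the
    sum of its second derivatives. Moving q by the inverse of g brings both sums to the base point,
    where [msum_vel] and [msum_acc] evaluate them as the coefficients of the Jacobi operator. *)
Lemma laplacian_on_zonal f q : S q ->
  laplacian_on X (fun p => f.[sd p q]) (fun p => - rho * (Lop f).[sd p q]).
Proof.
move=> Sq g sg; have [h [sh c1 c2]] := symm_inv sg.
have Shq : S (h q) by exact: symmS Sq.
pose s1 i t := - (dot (trig_curve (momega X) 0 (momega X *: mcurveC X i)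
    (- momega X *: mcurveB X i) t) (h q) / mkap X).
have sE i t : sd (g (mflow X i t base)) q = sd (mflow X i t base) (h q).
  by rewrite -[X in sd _ X]c2 sd_symm.
have D1 i (t : R) : is_derive t 1 (fun t => sd (g (mflow X i t base)) q) (s1 i t).
  have dd := is_derive_dot (flow_is_derive X i t) (is_derive_cst (h q) t 1).
  have := is_derive_addf (is_derive_cst (mkap X)^-1 t 1)
    (is_derive_scalef (- (mkap X)^-1) dd).
  rewrite (_ : (fun t => _ + _) = (fun t => sd (g (mflow X i t base)) q)).
    by move/is_derive_eq; apply; rewrite /s1 dot0r addr0 add0r [LHS]mulNr mulrC.
  apply/funext => u; rewrite sE /msd [X in _ + X]mulNr mulrBl mul1r.
  by congr (_ - _); rewrite mulrC.
have D2 i : is_derive (0 : R) 1 (s1 i) (- (dot (macc X i) (h q) / mkap X)).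
  have dd := is_derive_dot (is_derive_trig_curve (momega X) 0
    (momega X *: mcurveC X i) (- momega X *: mcurveB X i) 0) (is_derive_cst (h q) (0 : R) 1).
  have := is_derive_scalef (- (mkap X)^-1) dd.
  rewrite (_ : (fun t => - (mkap X)^-1 *: _) = s1 i).
    move/is_derive_eq; apply; rewrite dot0r addr0 /trig_curve mulr0 cos0 sin0.
    by rewrite scale1r scale0r addr0 add0r [LHS]mulNr mulrC.
  by apply/funext => u; rewrite /s1 [LHS]mulNr mulrC.
exists (fun i t => f^`().[sd (g (mflow X i t base)) q] * s1 i t),
  (fun i => f^`()^`().[sd (g (mflow X i 0 base)) q] * s1 i 0 * s1 i 0 +
     f^`().[sd (g (mflow X i 0 base)) q] * (- (dot (macc X i) (h q) / mkap X))).
split.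
- move=> i t; have := is_derive1_comp (D1 i t) (is_derive_poly f _).
  by move/is_derive_eq; apply; rewrite mulrC.
- move=> i; have D3 := is_derive1_comp (D1 i 0) (is_derive_poly f^`() _).
  by apply: (is_derive_eq (is_derive_mulf D3 (D2 i))); rewrite [_ *: _]mulrC.
have s10 i : s1 i 0 = - (dot (mvel X i) (h q) / mkap X).
  by rewrite /s1 /trig_curve mulr0 cos0 sin0 scale1r scale0r addr0 add0r.
have sb : sd (g base) q = sd base (h q) by rewrite -[X in sd _ X]c2 sd_symm.
rewrite sb big_split /=.
rewrite (eq_bigr (fun i => f^`()^`().[sd base (h q)] / mkap X ^+ 2 * dot (mvel X i) (h q) ^+ 2)).
  rewrite -mulr_sumr (msum_vel X Shq).
  rewrite (eq_bigr (fun i => - f^`().[sd base (h q)] / mkap X * dot (macc X i) (h q))).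
    rewrite -mulr_sumr (msum_acc X Shq) jacobi_op_horner.
    by field; rewrite gt_eqF // mkap_gt0.
  by move=> i _; rewrite flow0 sb; field; rewrite gt_eqF // mkap_gt0.
move=> i _; rewrite flow0 sb s10; field; rewrite gt_eqF // mkap_gt0 //.
Qed.

End Zonal.

(** * Square integrable functions, Parseval and Riesz-Fischer *)

Section SquareIntegrable.
Context {d : measure_display} {T : measurableType d} {R : realType}.
Variable mu : probability T R.
Implicit Types (x y z : T -> R).

Definition sqint x : Prop := x \in Lfun mu 2%:E.
Definition inn x y : R := \int[mu]_p (x p * y p).
Definition nrm x : R := fine ('N[mu]_2%:E[EFin \o x])%E.

Lemma sqint_measurable x : sqint x -> measurable_fun setT x.
Proof. by rewrite /sqint inE => /andP[]; rewrite !inE. Qed.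

Lemma Lnorm_sqr x :
  ((('N[mu]_2%:E[EFin \o x]) `^ 2) = \int[mu]_p (x p ^+ 2)%:E)%E.
Proof.
rewrite powR_Lnorm ?pnatr_eq0 //; apply: eq_integral => p _ /=.
by rewrite powR_mulrn // real_normK // num_real.
Qed.

Lemma nrm_ge0 x : 0 <= nrm x.
Proof. by rewrite fine_ge0 // Lnorm_ge0. Qed.

Lemma nrm_sqr x : nrm x ^+ 2 = inn x x.
Proof.
rewrite -powR_mulrn ?nrm_ge0 // /nrm -fine_poweR Lnorm_sqr /inn /Rintegral.
by congr fine; apply: eq_integral => p _; rewrite expr2.
Qed.

Lemma sqintP x : measurable_fun setT x ->
  (\int[mu]_p (x p ^+ 2)%:E < +oo)%E -> sqint x.
Proof.
move=> mx; rewrite -Lnorm_sqr => h; rewrite /sqint inE; apply/andP; rewrite !inE.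
by split=> //; apply: (lty_poweRy _ h); rewrite pnatr_eq0.
Qed.

Lemma sqint_bounded x K : measurable_fun setT x -> (forall p, `|x p| <= K) -> sqint x.
Proof.
move=> mx bx; apply: sqintP => //.
apply: (@le_lt_trans _ _ (\int[mu]_p (K ^+ 2)%:E)%E).
  apply: ge0_le_integral => //.
  - by move=> p _; rewrite lee_fin sqr_ge0.
  - by apply/measurable_EFinP; apply: measurable_funX.
  - by move=> p _; rewrite lee_fin -real_normK ?num_real // lerXn2r ?nnegrE // (le_trans _ (bx p)).
by rewrite (integral_cst mu measurableT) [X in (_ * X)%E](probability_setT mu) mule1 ltry.
Qed.

Lemma sqintD x y : sqint x -> sqint y -> sqint (fun p => x p + y p).
Proof.
have [|_ h] := @Lfun_submod_closed _ _ _ mu 2%:E; first by rewrite lee_fin ler1n.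
by move=> hx hy; have := h 1 x y hx hy; rewrite scale1r.
Qed.

Lemma sqint0 : sqint (fun=> 0).
Proof. by have [|h _] := @Lfun_submod_closed _ _ _ mu 2%:E; first by rewrite lee_fin ler1n. Qed.

Lemma sqintZ c x : sqint x -> sqint (fun p => c * x p).
Proof.
have [|h0 h] := @Lfun_submod_closed _ _ _ mu 2%:E; first by rewrite lee_fin ler1n.
by move=> hx; have := h c x 0 hx h0; rewrite addr0.
Qed.

Lemma sqintB x y : sqint x -> sqint y -> sqint (fun p => x p - y p).
Proof.
move=> hx hy; rewrite (_ : (fun p => _) = fun p => x p + -1 * y p).
  by apply: sqintD => //; exact: sqintZ.
by apply/funext => p; rewrite mulN1r.
Qed.

Lemma sqint_sum (u : nat -> T -> R) m n : (forall j, sqint (u j)) ->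
  sqint (fun p => \sum_(m <= j < n) u j p).
Proof.
move=> hu; elim: n => [|n IH].
  rewrite (_ : (fun p => _) = fun=> 0); first exact: sqint0.
  by apply/funext => p; rewrite big_geq.
have [mn|nm] := leqP m n.
  rewrite (_ : (fun p => _) = fun p => \sum_(m <= j < n) u j p + u n p).
    exact: sqintD.
  by apply/funext => p; rewrite big_nat_recr.
rewrite (_ : (fun p => _) = fun=> 0); first exact: sqint0.
by apply/funext => p; rewrite big_geq.
Qed.

Lemma inn_integrable x y : sqint x -> sqint y ->
  mu.-integrable setT (EFin \o (fun p => x p * y p)).
Proof. by move=> hx hy; apply/Lfun1_integrable; exact: Lfun2_mul_Lfun1. Qed.

Lemma innC x y : inn x y = inn y x.
Proof. by apply: eq_Rintegral => p _; rewrite mulrC. Qed.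

Lemma innDl x y z : sqint x -> sqint y -> sqint z ->
  inn (fun p => x p + y p) z = inn x z + inn y z.
Proof.
move=> hx hy hz; rewrite /inn -RintegralD //; try exact: inn_integrable.
by apply: eq_Rintegral => p _; rewrite mulrDl.
Qed.

Lemma innZl c x z : sqint x -> sqint z -> inn (fun p => c * x p) z = c * inn x z.
Proof.
move=> hx hz; rewrite /inn -RintegralZl //; try exact: inn_integrable.
by apply: eq_Rintegral => p _; rewrite mulrA.
Qed.

Lemma innBl x y z : sqint x -> sqint y -> sqint z ->
  inn (fun p => x p - y p) z = inn x z - inn y z.
Proof.
move=> hx hy hz; rewrite -mulN1r -innZl // -innDl //; last exact: sqintZ.
by apply: eq_Rintegral => p _; rewrite mulN1r.
Qed.

Lemma innBr x y z : sqint x -> sqint y -> sqint z ->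
  inn z (fun p => x p - y p) = inn z x - inn z y.
Proof. by move=> hx hy hz; rewrite innC innBl // !(innC z). Qed.

Lemma innZr c x z : sqint x -> sqint z -> inn z (fun p => c * x p) = c * inn z x.
Proof. by move=> hx hz; rewrite innC innZl // (innC z). Qed.

Lemma inn_ge0 x : 0 <= inn x x.
Proof. by rewrite -nrm_sqr sqr_ge0. Qed.

Lemma inn_suml (u : nat -> T -> R) m n z : (forall j, sqint (u j)) -> sqint z ->
  inn (fun p => \sum_(m <= j < n) u j p) z = \sum_(m <= j < n) inn (u j) z.
Proof.
move=> hu hz; have h0 : inn (fun=> 0) z = 0.
  transitivity (\int[mu]_(p in setT) (0 : R)); last by rewrite Rintegral_cst ?mul0r.
  by apply: eq_Rintegral => p _; rewrite mul0r.
elim: n => [|n IH].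
  by rewrite big_geq // -[RHS]h0; apply: eq_Rintegral => p _; rewrite big_geq.
have [mn|nm] := leqP m n; last first.
  by rewrite big_geq // -[RHS]h0; apply: eq_Rintegral => p _; rewrite big_geq.
rewrite big_nat_recr //= -IH -innDl //; last exact: sqint_sum.
by apply: eq_Rintegral => p _; rewrite big_nat_recr.
Qed.

Lemma EFin_inn x : sqint x -> (\int[mu]_p (x p ^+ 2)%:E)%E = (inn x x)%:E.
Proof.
move=> hx; rewrite /inn /Rintegral fineK; first by apply: eq_integral => p _; rewrite expr2.
apply: integrable_fin_num => //; exact: inn_integrable.
Qed.

(* Fatou applied to (z - u n)^2. *)
Lemma L2_lim_ae (u : nat -> T -> R) z (y : T -> R) :
  (forall n, sqint (u n)) -> sqint z ->
  inn (fun p => z p - u n p) (fun p => z p - u n p) @[n --> \oo] --> (0 : R) ->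
  {ae mu, forall p, u n p @[n --> \oo] --> y p -> y p = z p}.
Proof.
move=> hu hz c0; pose f n p := ((z p - u n p) ^+ 2)%:E.
have mf n : measurable_fun setT (f n).
  apply/measurable_EFinP; apply: measurable_funX; apply: measurable_funB.
    exact: sqint_measurable.
  exact: sqint_measurable.
have f0 n p : setT p -> (0 <= f n p)%E by rewrite lee_fin sqr_ge0.
have := fatou mu measurableT mf f0.
have -> : (fun n => \int[mu]_(x in setT) f n x)%E =
   (fun n => (inn (fun p => z p - u n p) (fun p => z p - u n p))%:E).
  by apply/funext => n; rewrite -EFin_inn //; exact: sqintB.
have cE : (inn (fun p => z p - u n p) (fun p => z p - u n p))%:E @[n --> \oo] --> 0%:E.
  by apply: cvg_EFin => //; near=> n.
rewrite (cvg_limn_einf_sup cE).1 => I0.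
have g0 p : (0 <= limn_einf (f ^~ p))%E.
  by rewrite limn_einf_lim; apply: lime_ge; [exact: is_cvg_einfs|near=> n; apply: le_ereal_inf_tmp => _ [k _ <-]; exact: f0].
have Ie : (\int[mu]_p `|limn_einf (f ^~ p)|)%E = 0%E.
  apply/eqP; rewrite eq_le; apply/andP; split; last exact: integral_ge0.
  apply: le_trans I0; rewrite le_eqVlt; apply/orP; left; apply/eqP.
  by apply: eq_integral => p _; rewrite gee0_abs.
have me : measurable_fun setT (fun p => limn_einf (f ^~ p)).
  apply: (measurableT_comp (@oppe_measurable _ _)).
  by apply: measurable_fun_limn_esup => n; exact: (measurableT_comp (@oppe_measurable _ _)).
move: Ie => /(ae_eq_integral_abs mu measurableT me).
apply: filterS => p /(_ I) /= e cy.
have : f n p @[n --> \oo] --> ((z p - y p) ^+ 2)%:E.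
  apply: cvg_EFin; first by near=> n.
  have c1 : z p - u n p @[n --> \oo] --> z p - y p by exact: cvgB (cvg_cst _) cy.
  rewrite expr2 (_ : fine \o _ = fun n => (z p - u n p) * (z p - u n p)).
    by have c2 := c1; exact: (cvgM c1 c2).
  by apply/funext => n; rewrite /= expr2.
move=> /cvg_limn_einf_sup [h _]; rewrite h in e.
by case: e => /eqP; rewrite sqrf_eq0 subr_eq0 => /eqP.
Unshelve. all: by end_near. Qed.

Section Orthonormal.
Variable phi : nat -> T -> R.
Hypothesis hphi : forall j, sqint (phi j).
Hypothesis ortho : forall i j, inn (phi i) (phi j) = (i == j)%:R.

Definition psum (a : nat -> R) m n p := \sum_(m <= j < n) a j * phi j p.

Lemma psum_sqint a m n : sqint (psum a m n).
Proof. by apply: sqint_sum => j; exact: sqintZ. Qed.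

Lemma inn_psum_phi a m n i : (m <= i < n)%N -> inn (psum a m n) (phi i) = a i.
Proof.
move=> mi; rewrite /psum inn_suml // => [|j]; last exact: sqintZ.
rewrite (eq_bigr (fun j => a j * (j == i)%:R)) => [|j _]; last by rewrite innZl // ortho.
rewrite (big_rem i) /=; last by rewrite mem_index_iota.
rewrite eqxx mulr1 big1_seq ?addr0 // => j /andP[_]; rewrite mem_rem_uniq ?iota_uniq //.
by rewrite inE => /andP[/negbTE -> _]; rewrite mulr0.
Qed.

Lemma inn_psum a m n x : sqint x ->
  inn (psum a m n) x = \sum_(m <= j < n) a j * inn (phi j) x.
Proof.
move=> hx; rewrite inn_suml // => [|j]; last exact: sqintZ.
by apply: eq_bigr => j _; rewrite innZl.
Qed.

Lemma inn_psum_sqr a m n : inn (psum a m n) (psum a m n) = \sum_(m <= j < n) a j ^+ 2.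
Proof.
rewrite inn_psum; last exact: psum_sqint.
rewrite big_nat_cond [RHS]big_nat_cond; apply: eq_bigr => j /andP[mj _].
by rewrite innC inn_psum_phi // expr2.
Qed.

Lemma bessel1 x i : sqint x -> inn x (phi i) ^+ 2 <= inn x x.
Proof.
move=> hx; have hc : sqint (fun p => inn x (phi i) * phi i p) by exact: sqintZ.
have := inn_ge0 (fun p => x p - inn x (phi i) * phi i p).
rewrite innBl ?innBr ?innZl ?innZr //; last exact: sqintB.
by rewrite ortho eqxx (innC (phi i) x) mulr1 subrr subr0 -expr2 subr_ge0.
Qed.

Definition L2sum a z := sqint z /\
  nrm (fun p => z p - psum a 0 n p) @[n --> \oo] --> (0 : R).

Lemma L2sum_inn0 a z : L2sum a z ->
  inn (fun p => z p - psum a 0 n p) (fun p => z p - psum a 0 n p) @[n --> \oo] --> (0 : R).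
Proof.
move=> [hz c]; under eq_fun do rewrite -nrm_sqr expr2.
rewrite -(mul0r 0); have c2 := c; exact: (cvgM c c2).
Qed.

Lemma L2sum_coef a z i : L2sum a z -> inn z (phi i) = a i.
Proof.
move=> [hz c]; apply/eqP; rewrite -subr_eq0; apply/eqP/normr0_eq0/eqP.
rewrite eq_le normr_ge0 andbT; apply/ler_addgt0Pr => e e0; rewrite add0r.
move/cvgr0Pnorm_le : c => /(_ _ e0) [N _ HN].
have hp := psum_sqint a 0 (maxn N i.+1).
have -> : inn z (phi i) - a i = inn (fun p => z p - psum a 0 (maxn N i.+1) p) (phi i).
  by rewrite innBl // inn_psum_phi //= leq_max ltnSn orbT.
apply: le_trans (HN (maxn N i.+1) (leq_maxl _ _)).
rewrite (ger0_norm (nrm_ge0 _)) -(@ler_sqr R) ?nnegrE ?nrm_ge0 //.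
by rewrite real_normK ?num_real // nrm_sqr bessel1 //; exact: sqintB.
Qed.

Lemma L2sum_parseval a z : L2sum a z ->
  \sum_(0 <= j < n) a j ^+ 2 @[n --> \oo] --> inn z z.
Proof.
move=> hL; have c := L2sum_inn0 hL; have [hz _] := hL.
have -> : (fun n => \sum_(0 <= j < n) a j ^+ 2) = (fun n => inn z z -
   inn (fun p => z p - psum a 0 n p) (fun p => z p - psum a 0 n p)).
  apply/funext => n; have hp := psum_sqint a 0 n.
  rewrite innBl //; last exact: sqintB.
  rewrite !innBr // inn_psum_sqr (innC z (psum a 0 n)) inn_psum //.
  rewrite [X in _ - (_ - X - (X - _))](_ : _ = \sum_(0 <= j < n) a j ^+ 2); first by ring.
  by apply: eq_bigr => j _; rewrite innC (L2sum_coef j hL) expr2.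
rewrite -[X in _ --> X]subr0; exact: cvgB (cvg_cst _) c.
Qed.

Lemma psumB a m n p : (m <= n)%N -> psum a 0 n p - psum a 0 m p = psum a m n p.
Proof. by move=> mn; rewrite /psum (@big_cat_nat _ _ _ m 0 n) //= (addrC (\sum_(0 <= j < m) _)) addrK. Qed.

Lemma psum_dist a m n :
  inn (fun p => psum a 0 n p - psum a 0 m p) (fun p => psum a 0 n p - psum a 0 m p) =
  `|\sum_(0 <= j < n) a j ^+ 2 - \sum_(0 <= j < m) a j ^+ 2|.
Proof.
have key i l : (i <= l)%N -> inn (fun p => psum a 0 l p - psum a 0 i p) (fun p => psum a 0 l p - psum a 0 i p) =
  `|\sum_(0 <= j < l) a j ^+ 2 - \sum_(0 <= j < i) a j ^+ 2|.
  move=> il; rewrite (_ : (fun p => _) = psum a i l); last by apply/funext => p; rewrite psumB.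
  rewrite inn_psum_sqr (@big_cat_nat _ _ _ i 0 l) //= (addrC (\sum_(0 <= j < i) _)) addrK ger0_norm //.
  by apply: sumr_ge0 => j _; rewrite sqr_ge0.
have [mn|/ltnW nm] := leqP m n; first exact: key.
rewrite distrC -key //; apply: eq_Rintegral => p _; rewrite -(opprB (psum a 0 n p)).
by rewrite mulrNN.
Qed.

(* A subsequence of the partial sums whose consecutive L_2 distances are at
   most 2^-k converges almost everywhere; its limit is the L_2 sum. *)
Theorem riesz_fischer (a : nat -> R) (K : R) : (forall n, \sum_(0 <= j < n) a j ^+ 2 <= K) ->
  exists z, L2sum a z.
Proof.
move=> hK; pose s n : R := \sum_(0 <= j < n) a j ^+ 2.
have snd : nondecreasing_seq s.
  move=> i l il; rewrite /s (@big_cat_nat _ _ _ i 0 l) //= lerDl.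
  by apply: sumr_ge0 => j _; rewrite sqr_ge0.
have sc : cvgn s by apply: nondecreasing_is_cvgn => //; exists K => _ [n _ <-]; exact: hK.
pose L : R := limn s.
have sL n : s n <= L by exact: nondecreasing_cvgn_le.
have exN k : exists N : nat, L - s N <= (2 ^+ k)^-1 ^+ 2.
  have e0 : 0 < (2 ^+ k : R)^-1 ^+ 2 by rewrite exprn_gt0 // invr_gt0 exprn_gt0.
  move/cvgrPdist_le : sc => /(_ _ e0) [N _ HN]; exists N.
  by rewrite (le_trans (ler_norm _)) // HN /=.
pose N k := projT1 (cid (exN k)).
have HN k : L - s (N k) <= (2 ^+ k)^-1 ^+ 2 by exact: (projT2 (cid (exN k))).
have c_gt0 k : 0 < (2 ^+ k : R) by rewrite exprn_gt0.
pose D k p := psum a 0 (N k.+1) p - psum a 0 (N k) p.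
have hS n := psum_sqint a 0 n.
have mS n : measurable_fun setT (psum a 0 n) := sqint_measurable (hS n).
have hD k : sqint (D k) by exact: sqintB.
have ID k : inn (D k) (D k) <= (2 ^+ k)^-1 ^+ 2.
  have h : (2 ^+ k.+1 : R)^-1 ^+ 2 <= (2 ^+ k)^-1 ^+ 2.
    rewrite lerXn2r ?nnegrE ?invr_ge0 ?(ltW (c_gt0 _)) // lef_pV2 ?posrE //.
    by rewrite exprS ler_peMl ?(ltW (c_gt0 _)) // ler1n.
  rewrite psum_dist -/(s (N k.+1)) -/(s (N k)).
  have h1 := HN k.+1; have h2 := HN k; have h3 := sL (N k); have h4 := sL (N k.+1).
  move: (s (N k.+1)) (s (N k)) ((2 ^+ k.+1)^-1 ^+ 2) ((2 ^+ k)^-1 ^+ 2) h h1 h2 h3 h4 => *.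
  by rewrite ler_norml; apply/andP; split; lra.
(* From t <= c t^2 + 1/c with c = 2^k: since D k has L_2 norm at most 2^-k, the integral of g k is
   at most twice 2^-k, so the sum of the g k is integrable. *)
pose g k p := 2 ^+ k * D k p ^+ 2 + (2 ^+ k)^-1.
have g0 k p : 0 <= g k p.
  have h := ltW (c_gt0 k); apply: addr_ge0; last by rewrite invr_ge0.
  by apply: mulr_ge0 => //; exact: sqr_ge0.
have Dg k p : `|D k p| <= g k p.
  rewrite /g -(real_normK (num_real (D k p))) -subr_ge0.
  have := c_gt0 k; move: (2 ^+ k) (Num.norm (D k p)) => c t c0.
  have -> : c * t ^+ 2 + c^-1 - t = c * (t - 2^-1 * c^-1) ^+ 2 + 3 / 4 * c^-1.
    by field; rewrite gt_eqF.
  by rewrite addr_ge0 // mulr_ge0 ?sqr_ge0 ?invr_ge0 ?(ltW c0).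
have mg k : measurable_fun setT (g k).
  apply: measurable_funD => //; apply: measurable_funM => //; apply: measurable_funX.
  exact: sqint_measurable.
have Ig k : (\int[mu]_p (g k p)%:E <= (2 * (2 ^+ k)^-1)%:E)%E.
  under eq_integral do rewrite /g EFinD.
  rewrite ge0_integralD //; last first.
  - by apply/measurable_EFinP; apply: measurable_funM => //; apply: measurable_funX; exact: sqint_measurable.
  - by move=> p _; rewrite lee_fin mulr_ge0 ?sqr_ge0 // ?(ltW (c_gt0 k)).
  have -> : (\int[mu]_p (2 ^+ k * D k p ^+ 2)%:E = (2 ^+ k * inn (D k) (D k))%:E)%E.
    rewrite EFinM -EFin_inn // -ge0_integralZl_EFin //.
      by move=> p _; rewrite lee_fin sqr_ge0.
    by apply/measurable_EFinP; apply: measurable_funX; exact: sqint_measurable.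
  rewrite (integral_cst mu measurableT) [X in (_ + _ * X)%E](probability_setT mu) mule1.
  rewrite -EFinD lee_fin mulr_natl mulr2n lerD2r.
  apply: le_trans (_ : 2 ^+ k * (2 ^+ k)^-1 ^+ 2 <= _); first by rewrite ler_pM2l.
  by rewrite expr2 mulVKf // gt_eqF.
have mgE k : measurable_fun setT (EFin \o g k) by apply/measurable_EFinP.
have g0E k p : setT p -> (0 <= (EFin \o g k) p)%E by rewrite lee_fin.
have Gfin : (\int[mu]_p (\sum_(k <oo) (g k p)%:E) < +oo)%E.
  rewrite (integral_nneseries mu measurableT mgE g0E).
  apply: (@le_lt_trans _ _ (\sum_(k <oo) (2 * (2 ^+ k)^-1)%:E)%E).
    apply: lee_nneseries => [k _ _|k _]; last exact: Ig.
    by apply: integral_ge0 => p _; exact: g0E.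
  have c := @cvg_geometric_eseries_half R 4 0.
  rewrite (@eq_eseriesr _ _ (fun k => (4 / (2 ^ (k + 1))%:R)%:E)) => [|k _].
    by rewrite (cvg_lim _ c) ?ltry.
  congr EFin; rewrite addn1 expnS natrM natrX.
  by field; rewrite gt_eqF.
have mG : measurable_fun setT (fun p => \sum_(k <oo) (g k p)%:E)%E.
  have h : measurable_fun setT (fun p => \sum_(i <oo | i \in predT) (g i p)%:E)%E.
    by apply: ge0_emeasurable_sum => [k p _ _|k _]; [exact: g0E|exact: mgE].
  exact: h.
have iG : mu.-integrable setT (fun p => \sum_(k <oo) (g k p)%:E)%E.
  apply/integrableP; split => //; rewrite (eq_integral (fun p => \sum_(k <oo) (g k p)%:E)%E) //.
  by move=> p _; rewrite gee0_abs // nneseries_ge0 // => k _ _; exact: g0E.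
(* The upper limit is measurable on the whole space and equals the limit wherever the subsequence
   converges. *)
pose z p := fine (limn_esup (fun k => (psum a 0 (N k) p)%:E)).
have zae : {ae mu, forall p, psum a 0 (N k) p @[k --> \oo] --> z p}.
  have := integrable_ae measurableT iG; apply: filterS => p /(_ I) fp.
  have cg : cvgn (series (g ^~ p)).
    apply: nondecreasing_is_cvgn.
      by apply/nondecreasing_seqP => n; rewrite /series /= big_nat_recr //= lerDl.
    exists (fine (\sum_(k <oo) (g k p)%:E)%E) => _ [n _ <-].
    rewrite -lee_fin fineK // /series /= -sumEFin.
    by apply: nneseries_lim_ge => *; rewrite lee_fin.
  have cD : cvgn (series (D ^~ p)).
    apply: normed_cvg; apply: (series_le_cvg _ _ _ cg) => k //=.
  have cS : cvgn (fun k => psum a 0 (N k) p).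
    rewrite (_ : (fun k => _) = fun k => psum a 0 (N 0%N) p + series (D ^~ p) k).
      have c1 : cvgn (fun _ : nat => psum a 0 (N 0%N) p) by exact: is_cvg_cst.
      exact: (is_cvgD c1 cD).
    by apply/funext => k; rewrite /series /= /D telescope_sumr // addrC subrK.
  have cE : (psum a 0 (N k) p)%:E @[k --> \oo] --> (limn (fun k => psum a 0 (N k) p))%:E.
    by apply: cvg_EFin => //; near=> n.
  by rewrite /z (cvg_limn_einf_sup cE).2.
have mz : measurable_fun setT z.
  apply: (measurableT_comp (fine_measurable measurableT)).
  by apply: measurable_fun_limn_esup => n; apply/measurable_EFinP.
(* Fatou along the subsequence: the squared distances to the n-th partial sum are |s (N k) - s n| by
   [psum_dist], and they tend to L - s n. *)
have zS n : (\int[mu]_p ((z p - psum a 0 n p) ^+ 2)%:E <= (L - s n)%:E)%E.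
  pose f k p := ((psum a 0 (N k) p - psum a 0 n p) ^+ 2)%:E.
  have mf k : measurable_fun setT (f k).
    by apply/measurable_EFinP; apply: measurable_funX; exact: measurable_funB.
  have f0 k p : setT p -> (0 <= f k p)%E by rewrite lee_fin sqr_ge0.
  have fl p : psum a 0 (N k) p @[k --> \oo] --> z p ->
     limn_einf (f ^~ p) = ((z p - psum a 0 n p) ^+ 2)%:E.
    move=> cz; suff /cvg_limn_einf_sup[] : f k p @[k --> \oo] --> ((z p - psum a 0 n p) ^+ 2)%:E by [].
    apply: cvg_EFin; first by near=> k.
    have c1 : psum a 0 (N k) p - psum a 0 n p @[k --> \oo] --> z p - psum a 0 n p.
      exact: cvgB cz (cvg_cst _).
    rewrite expr2 (_ : fine \o _ = fun k => (psum a 0 (N k) p - psum a 0 n p) * (psum a 0 (N k) p - psum a 0 n p)).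
      by have c2 := c1; exact: (cvgM c1 c2).
    by apply/funext => k; rewrite /= expr2.
  have F := fatou mu measurableT mf f0.
  have -> : (\int[mu]_p ((z p - psum a 0 n p) ^+ 2)%:E = \int[mu]_p limn_einf (f ^~ p))%E.
    apply: ge0_ae_eq_integral => //.
    - by apply/measurable_EFinP; apply: measurable_funX; exact: measurable_funB.
    - apply: (measurableT_comp (@oppe_measurable _ _)).
      by apply: measurable_fun_limn_esup => k; exact: (measurableT_comp (@oppe_measurable _ _)).
    - by move=> p _; rewrite lee_fin sqr_ge0.
    - move=> p _; rewrite limn_einf_lim; apply: lime_ge; first exact: is_cvg_einfs.
      by near=> k; apply: le_ereal_inf_tmp => _ [i _ <-]; exact: f0.
    - by apply: filterS zae => p /fl ->.
  apply: (le_trans F).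
  have cE : (fun k => \int[mu]_p f k p)%E @ \oo --> (L - s n)%:E.
    rewrite (_ : (fun k => _) = fun k => (`|s (N k) - s n|)%:E); last first.
      by apply/funext => k; rewrite -psum_dist -EFin_inn //; exact: sqintB.
    apply: cvg_EFin; first by near=> k.
    rewrite -[X in _ --> X](ger0_norm (_ : 0 <= L - s n)) ?subr_ge0 //.
    apply: cvg_norm; apply: cvgB (cvg_cst _) => //.
    apply/cvgrPdist_le => e e0.
    have := @cvg_geometric R 1 (2^-1) _; rewrite ger0_norm ?invr_ge0 // invf_lt1 ?ltr1n // => /(_ isT).
    move/cvgr0Pnorm_le => /(_ _ e0) [n0 _ Hn]; exists n0 => // k kn.
    rewrite /= ger0_norm ?subr_ge0 //; apply: le_trans (Hn k kn).
    rewrite /geometric /= mul1r exprVn ger0_norm ?invr_ge0 ?(ltW (c_gt0 _)) //.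
    apply: (le_trans (HN k)); rewrite expr2 ler_piMl ?invr_ge0 ?(ltW (c_gt0 _)) //.
    by rewrite invf_le1 // exprn_ege1 // ler1n.
  by rewrite (cvg_limn_einf_sup cE).1.
have hz0 n : sqint (fun p => z p - psum a 0 n p).
  by apply: sqintP; [exact: measurable_funB | exact: le_lt_trans (zS n) (ltry _)].
exists z; split.
  rewrite (_ : z = fun p => (z p - psum a 0 0 p) + psum a 0 0 p); first exact: sqintD.
  by apply/funext => p; rewrite subrK.
apply/cvgr0Pnorm_le => e e0.
have e2 : 0 < e ^+ 2 by rewrite exprn_gt0.
move/cvgrPdist_le : sc => /(_ _ e2) [n0 _ Hn]; exists n0 => // n nn.
rewrite /= (ger0_norm (nrm_ge0 _)) -(@ler_sqr R) ?nnegrE ?nrm_ge0 ?(ltW e0) // nrm_sqr.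
rewrite -lee_fin -EFin_inn //; apply: (le_trans (zS n)); rewrite lee_fin.
by apply: le_trans (Hn n nn); rewrite ler_norm.
Unshelve. all: by end_near. Qed.

End Orthonormal.
End SquareIntegrable.

(** * Convolution with zonal kernels under the invariant volume *)

Section Volume.
Context {R : realType} {M : cross}.
Variable vol : probability (borel_ambient R M) R.
Variable X : @cross_model R M.
Hypothesis hvol : is_invariant_volume vol.
Local Notation E := (ambient R M).
Local Notation B := (borel_ambient R M).
Local Notation S := (carrier R M).
Local Notation SB := (carrier R M : set B).
Local Notation base := (mbase X).
Local Notation sd := (msd X).
Local Notation rho := (mrho X).
Implicit Types (p q : E) (f : {poly R}) (w : E -> R).

Lemma carrier_measurable : measurable SB.
Proof.
rewrite -[SB]setCK; apply: measurableC; apply: sub_sigma_algebra.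
exact: closed_openC (mclosed X).
Qed.

Lemma continuous_measurable (w : E -> R) : continuous w ->
  measurable_fun setT (w : B -> R).
Proof.
move=> cw; apply: (measurability _ (measurable_realfun.RGenOInfty.measurableE R)).
move=> _ [_ [x ->] <-]; rewrite setTI; apply: sub_sigma_algebra => /=.
by apply: (iffLR (continuousP w)) => //; exact: rray_open.
Qed.

Definition bmeas (w : E -> R) : Prop :=
  measurable_fun SB (w : B -> R) /\ exists K, forall p, S p -> `|w p| <= K.

Lemma bmeas_continuous w : continuous w -> bmeas w.
Proof.
move=> cw; split.
  by apply: measurable_funTS; exact: continuous_measurable.
have cn : {within S, continuous (fun p => `|w p|)}.
  by apply: continuous_subspaceT => p; exact: cvg_norm (cw p).
have [c _ cmax] := compact_EVT_max (ex_intro _ base (mbaseS X)) (carrier_compact X) cn.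
by exists `|w c| => p Sp; apply: cmax; rewrite inE.
Qed.

Lemma bmeas_cst c : bmeas (fun=> c).
Proof. by apply: bmeas_continuous; exact: cst_continuous. Qed.

Lemma bmeasD w v : bmeas w -> bmeas v -> bmeas (fun p => w p + v p).
Proof.
move=> [mw [K bw]] [mv [L bv]]; split; first exact: measurable_funD.
by exists (K + L) => p Sp; rewrite (le_trans (ler_normD _ _)) // lerD ?bw ?bv.
Qed.

Lemma bmeasM w v : bmeas w -> bmeas v -> bmeas (fun p => w p * v p).
Proof.
move=> [mw [K bw]] [mv [L bv]]; split; first exact: measurable_funM.
by exists (K * L) => p Sp; rewrite normrM ler_pM ?bw ?bv.
Qed.

Lemma bmeas_sum (I : finType) (w : I -> E -> R) : (forall i, bmeas (w i)) ->
  bmeas (fun p => \sum_i w i p).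
Proof.
move=> bw; elim: (index_enum I) => [|i s IH].
  by rewrite (_ : (fun _ => _) = (fun=> 0)); [exact: bmeas_cst|apply/funext => p; rewrite big_nil].
rewrite (_ : (fun _ => _) = (fun p => w i p + \sum_(j <- s) w j p)); first exact: bmeasD.
by apply/funext => p; rewrite big_cons.
Qed.

Lemma bmeas_integrable w : bmeas w -> vol.-integrable SB (EFin \o w).
Proof.
move=> [mw [K bw]]; apply: measurable_bounded_integrable => //.
- exact: carrier_measurable.
- by rewrite (le_lt_trans (probability_le1 _ carrier_measurable)) // ltry.
- by exists K; split=> [|r Kr p Sp]; [rewrite num_real|exact: (le_trans (bw p Sp) (ltW Kr))].
Qed.

Definition intS (w : E -> R) : R := \int[vol]_(p in SB) w p.

Lemma eq_intS w v : (forall p, S p -> w p = v p) -> intS w = intS v.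
Proof. by move=> h; apply: eq_Rintegral => p; rewrite inE; exact: h. Qed.

Lemma intS_cst c : intS (fun=> c) = c.
Proof.
rewrite /intS Rintegral_cst; last exact: carrier_measurable.
rewrite (_ : fine _ = 1) ?mulr1 //.
by rewrite -[RHS]/(fine 1%E); congr fine; exact: hvol.1.
Qed.

Lemma intSD w v : bmeas w -> bmeas v ->
  intS (fun p => w p + v p) = intS w + intS v.
Proof.
move=> bw bv; apply: RintegralD; first exact: carrier_measurable.
all: exact: bmeas_integrable.
Qed.

Lemma intSZ a w : bmeas w -> intS (fun p => a * w p) = a * intS w.
Proof.
move=> bw; apply: RintegralZl; first exact: carrier_measurable.
exact: bmeas_integrable.
Qed.

Lemma intS_sum (I : finType) (w : I -> E -> R) : (forall i, bmeas (w i)) ->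
  intS (fun p => \sum_i w i p) = \sum_i intS (w i).
Proof.
move=> bw; have H : forall s : seq I, bmeas (fun p => \sum_(j <- s) w j p) /\
    intS (fun p => \sum_(j <- s) w j p) = \sum_(j <- s) intS (w j).
  elim=> [|i s [IH1 IH2]].
    rewrite (_ : (fun _ => _) = (fun=> 0)); last by apply/funext => p; rewrite big_nil.
    by rewrite intS_cst big_nil; split=> //; exact: bmeas_cst.
  rewrite (_ : (fun _ => _) = (fun p => w i p + \sum_(j <- s) w j p)); last first.
    by apply/funext => p; rewrite big_cons.
  by rewrite intSD // big_cons IH2; split=> //; exact: bmeasD.
exact: (H _).2.
Qed.

Lemma le_intS w v : bmeas w -> bmeas v -> (forall p, S p -> w p <= v p) ->
  intS w <= intS v.
Proof.
move=> bw bv h; apply: le_Rintegral => //; first exact: carrier_measurable.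
all: exact: bmeas_integrable.
Qed.

Lemma le_norm_intS w v : bmeas w -> bmeas v -> (forall p, S p -> `|w p| <= v p) ->
  `|intS w| <= intS v.
Proof.
move=> bw bv h; rewrite ler_norml; apply/andP; split; last first.
  by apply: le_intS => // p Sp; exact: le_trans (ler_norm _) (h p Sp).
rewrite lerNl -mulN1r -intSZ //; apply: le_intS => //.
  by apply: bmeasM => //; exact: bmeas_cst.
by move=> p Sp; rewrite mulN1r (le_trans _ (h p Sp)) // -normrN ler_norm.
Qed.

(** Invariance is given for sets; it says that [vol] and its pushforward by g agree on measurable
    subsets of the carrier, hence give the same integrals. *)
Lemma intS_symm g w : symm g -> continuous w -> intS (fun p => w (g p)) = intS w.
Proof.
move=> sg cw; rewrite /intS.
have cg : continuous g := lin_map_continuous (symm_lin sg).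
have mg : measurable_fun setT (g : B -> B).
  have GE : (measurable : set (set B)) = <<s (@open E : set (set B)) >> by [].
  apply: (measurability _ GE) => _ [A oA <-]; rewrite setTI.
  by apply: sub_sigma_algebra; exact: (iffLR (continuousP g)).
have [h [sh c1 c2]] := symm_inv sg.
have gA A : A `<=` SB -> SB `&` (g : B -> B) @^-1` A = (g : B -> B) @^-1` A.
  move=> AS; apply/seteqP; split=> p /=; first by case.
  move=> gp; split=> //.
  by rewrite -(c1 p); apply: (symmS sh); exact: AS.
have gS : (g : B -> B) @^-1` SB = SB.
  rewrite -gA //; apply/seteqP; split=> p /= => [[] //|Sp]; split=> //.
  exact: symmS sg Sp.
have bwg : bmeas (fun p => w (g p)).
  apply: bmeas_continuous => p; apply: continuous_comp; [exact: cg|exact: cw].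
congr fine.
have -> : (\int[vol]_(p in SB) (w p)%:E = \int[pushforward vol (g : B -> B)]_(p in SB) (w p)%:E)%E.
  apply: eq_measure_integral => A mA AS.
  have := hvol.2 g (symm_isometry sg) A mA; rewrite (gA A AS) setIidr //.
rewrite integral_pushforward ?gS //.
- by apply/measurable_EFinP; exact: continuous_measurable.
- exact: bmeas_integrable.
- exact: carrier_measurable.
Qed.

Local Notation alpha := (cross_alpha R M).
Local Notation beta := (cross_beta R M).
Local Notation Lop := (jacobi_op alpha beta).
Local Notation Jac := (jacobi alpha beta).
Local Notation eig := (jacobi_eig alpha beta).

Let a1 := cross_alpha_gt R M.
Let b1 := cross_beta_gt R M.
Let c0 := cross_ab_ge0 R M.

Lemma eig_ge0 j : 0 <= eig j.
Proof.
rewrite /jacobi_eig mulr_ge0 ?ler0n // -!addrA addr_ge0 ?ler0n //.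
by rewrite addrA; exact: c0.
Qed.

Lemma kernel_continuous f p : continuous (fun q => f.[sd p q]).
Proof.
move=> q; apply: (@continuous_comp _ _ _ (sd p) (horner f)).
  exact: sd_continuous.
exact: continuous_horner.
Qed.

Lemma kernel_bmeas f p : bmeas (fun q => f.[sd p q]).
Proof. by apply: bmeas_continuous; exact: kernel_continuous. Qed.

Lemma kernel_continuousl f p : continuous (fun q => f.[sd q p]).
Proof.
rewrite (_ : (fun q => _) = fun q => f.[sd p q]); first exact: kernel_continuous.
by apply/funext => q; rewrite sdC.
Qed.

(** Polynomials in the inner product split in this way; continuity of an integral in its parameter
    and the exchange of two integrals then reduce to linearity. *)
Definition finite_rank (k : E -> E -> R) : Prop :=
  exists (K : finType) (u v : K -> E -> R),
    [/\ forall i, continuous (u i), forall i, continuous (v i)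
      & forall p q, k p q = \sum_i u i p * v i q].

Lemma finite_rankD k l : finite_rank k -> finite_rank l ->
  finite_rank (fun p q => k p q + l p q).
Proof.
move=> [K [u [v [cu cv kE]]]] [L [u' [v' [cu' cv' lE]]]].
exists (K + L)%type, (fun s => match s with inl i => u i | inr j => u' j end),
  (fun s => match s with inl i => v i | inr j => v' j end).
split=> [[i|j]|[i|j]|p q] //.
by rewrite kE lE big_sumType.
Qed.

Lemma finite_rankM k l : finite_rank k -> finite_rank l ->
  finite_rank (fun p q => k p q * l p q).
Proof.
move=> [K [u [v [cu cv kE]]]] [L [u' [v' [cu' cv' lE]]]].
exists (K * L)%type, (fun s p => u s.1 p * u' s.2 p), (fun s p => v s.1 p * v' s.2 p).
split=> [[i j] p|[i j] p|p q].
- exact: cvgM (cu i p) (cu' j p).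
- exact: cvgM (cv i p) (cv' j p).
rewrite kE lE big_distrl /= (eq_bigr (fun k => \sum_l (u k p * u' l p) * (v k q * v' l q))).
  by rewrite (pair_bigA _ (fun k l => (u k p * u' l p) * (v k q * v' l q))).
by move=> i _; rewrite big_distrr; apply: eq_bigr => j _; rewrite /= mulrACA.
Qed.

Lemma finite_rank_cst c : finite_rank (fun _ _ => c).
Proof.
exists unit, (fun _ _ => c), (fun _ _ => 1); split=> [_ p|_ p|p q].
- exact: cst_continuous.
- exact: cst_continuous.
by rewrite (big_pred1 tt) ?mulr1 //; case.
Qed.

Lemma finite_rank_sd : finite_rank (fun p q => sd p q).
Proof.
have -> : (fun p q => sd p q) = (fun p q => (mkap X)^-1 +
    (- (mkap X)^-1) * \sum_(ij : 'I_(nrow M) * 'I_(ncol M)) p ij.1 ij.2 * q ij.1 ij.2).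
  apply/funext => p; apply/funext => q.
  rewrite /msd /dot (pair_bigA _ (fun i j => p i j * q i j)) /= mulrBl mul1r.
  by rewrite mulNr mulrC.
apply: finite_rankD; first exact: finite_rank_cst.
apply: finite_rankM; first exact: finite_rank_cst.
exists ('I_(nrow M) * 'I_(ncol M))%type, (fun ij p => p ij.1 ij.2), (fun ij q => q ij.1 ij.2).
by split=> // -[i j]; exact: coord_continuous.
Qed.

Lemma finite_rank_kernel f : finite_rank (fun p q => f.[sd p q]).
Proof.
elim/poly_ind: f => [|f c IH].
  rewrite (_ : (fun _ => _) = fun _ _ => 0); first exact: finite_rank_cst.
  by apply/funext => p; apply/funext => q; rewrite horner0.
rewrite (_ : (fun _ => _) = fun p q => f.[sd p q] * sd p q + c).
  apply: finite_rankD; last exact: finite_rank_cst.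
  by apply: finite_rankM => //; exact: finite_rank_sd.
by apply/funext => p; apply/funext => q; rewrite hornerD hornerMX hornerC.
Qed.

Definition zint f (phi : E -> R) p := intS (fun q => f.[sd p q] * phi q).

Lemma zint_lin phi k f g p : bmeas phi ->
  zint (k *: f + g) phi p = k * zint f phi p + zint g phi p.
Proof.
move=> bp; rewrite /zint -intSZ; last by apply: bmeasM => //; exact: kernel_bmeas.
rewrite -intSD.
- by apply: eq_intS => q _; rewrite hornerD hornerZ mulrDl mulrA.
- apply: bmeasM; [exact: bmeas_cst|apply: bmeasM => //; exact: kernel_bmeas].
- by apply: bmeasM => //; exact: kernel_bmeas.
Qed.

Lemma zint0 phi p : zint 0 phi p = 0.
Proof. by rewrite -[RHS]intS_cst; apply: eq_intS => q _; rewrite horner0 mul0r. Qed.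

Lemma zint_sum (I : finType) (c : I -> R) (F : I -> {poly R}) phi p : bmeas phi ->
  zint (\sum_i c i *: F i) phi p = \sum_i c i * zint (F i) phi p.
Proof.
move=> bp; elim: (index_enum I) => [|i s IH]; first by rewrite !big_nil zint0.
by rewrite !big_cons zint_lin // IH.
Qed.

Lemma zintZ k f phi p : bmeas phi -> zint (k *: f) phi p = k * zint f phi p.
Proof. by move=> bp; have := zint_lin k f 0 p bp; rewrite zint0 !addr0. Qed.

Lemma zint_continuous f phi : bmeas phi -> continuous (zint f phi).
Proof.
move=> bp; have [K [u [v [cu cv kE]]]] := finite_rank_kernel f.
rewrite (_ : zint f phi = fun p => \sum_i u i p * intS (fun q => v i q * phi q)).
  by apply: continuous_sumf => i p; exact: cvgMr_tmp (cu i p).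
apply/funext => p; rewrite /zint.
transitivity (intS (fun q => \sum_i u i p * (v i q * phi q))).
  by apply: eq_intS => q _; rewrite kE mulr_suml; apply: eq_bigr => i _; rewrite mulrA.
have bv i : bmeas (fun q => v i q * phi q).
  by apply: bmeasM => //; exact: bmeas_continuous.
rewrite intS_sum.
  by apply: eq_bigr => i _; rewrite intSZ.
by move=> i; apply: bmeasM => //; exact: bmeas_cst.
Qed.

Lemma zint_bmeas f phi : bmeas phi -> bmeas (zint f phi).
Proof. by move=> bp; apply: bmeas_continuous; exact: zint_continuous. Qed.

Lemma zint_zint f g phi p : bmeas phi -> zint f (zint g phi) p =
  intS (fun r => intS (fun q => f.[sd p q] * g.[sd q r]) * phi r).
Proof.
move=> bp; have [K [u [v [cu cv kE]]]] := finite_rank_kernel g.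
have bv i : bmeas (fun q => v i q * phi q).
  by apply: bmeasM => //; exact: bmeas_continuous.
have bu i : bmeas (fun q => f.[sd p q] * u i q).
  by apply: bmeasM; [exact: kernel_bmeas|exact: bmeas_continuous].
have bM (c : R) w : bmeas w -> bmeas (fun q => c * w q).
  by move=> bw; apply: bmeasM => //; exact: bmeas_cst.
transitivity (\sum_i intS (fun q => f.[sd p q] * u i q) * intS (fun r => v i r * phi r)).
  transitivity (intS (fun q => \sum_i intS (fun r => v i r * phi r) * (f.[sd p q] * u i q))).
    apply: eq_intS => q _; rewrite /zint.
    transitivity (f.[sd p q] * intS (fun r => \sum_i u i q * (v i r * phi r))).
      congr (_ * _); apply: eq_intS => r _.
      by rewrite kE mulr_suml; apply: eq_bigr => i _; rewrite mulrA.
    rewrite intS_sum; last by move=> i; exact: bM.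
    by rewrite mulr_sumr; apply: eq_bigr => i _; rewrite intSZ //; ring.
  rewrite intS_sum; last by move=> i; exact: bM.
  by apply: eq_bigr => i _; rewrite intSZ // mulrC.
transitivity (intS (fun r => \sum_i intS (fun q => f.[sd p q] * u i q) * (v i r * phi r))).
  rewrite intS_sum; last by move=> i; exact: bM.
  by apply: eq_bigr => i _; rewrite intSZ.
apply: eq_intS => r _.
transitivity (intS (fun q => \sum_i v i r * (f.[sd p q] * u i q)) * phi r).
  rewrite intS_sum; last by move=> i; exact: bM.
  by rewrite mulr_suml; apply: eq_bigr => i _; rewrite intSZ //; ring.
congr (_ * _); apply: eq_intS => q _; rewrite kE mulr_sumr.
by apply: eq_bigr => i _; ring.
Qed.

(** The separable form of the kernel makes the derivatives of the integral finite sums of integrals;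
    by uniqueness of derivatives their integrands are those found in [laplacian_on_zonal]. *)
Lemma laplacian_on_zint f phi : bmeas phi ->
  laplacian_on X (zint f phi) (fun p => - rho * zint (Lop f) phi p).
Proof.
move=> bp g sg.
have SE i : separable (fun t q => f.[sd (g (mflow X i t base)) q]).
  exact: (separable_horner f (zonal_separable X i sg)).
have : forall i, exists (h1 : R -> R) (s : R) (hq : E -> R -> R) (sq : E -> R),
  [/\ (forall t : R, is_derive t 1 (fun t => zint f phi (g (mflow X i t base))) (h1 t))
      /\ is_derive (0 : R) 1 h1 s,
      bmeas sq,
      forall q (t : R), is_derive t 1 (fun t => f.[sd (g (mflow X i t base)) q]) (hq q t),
      forall q, is_derive (0 : R) 1 (hq q) (sq q)
    & s = intS (fun q => sq q * phi q)].
  move=> i; have [K [u [e [e1 [e2 [cu de de1 hE]]]]]] := SE i.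
  have bu k : bmeas (fun q => u k q * phi q).
    by apply: bmeasM => //; exact: bmeas_continuous.
  pose I k := intS (fun q => u k q * phi q).
  exists (fun t => \sum_k I k * e1 k t), (\sum_k I k * e2 k),
    (fun q t => \sum_k u k q * e1 k t), (fun q => \sum_k u k q * e2 k); split.
  - split=> [t|].
      rewrite (_ : (fun t => _) = (fun t => \sum_k I k * e k t)).
        by apply: is_derive_sumf => k; apply: is_derive_scalef (de k t).
      apply/funext => s; rewrite /zint.
      transitivity (intS (fun q => \sum_k e k s * (u k q * phi q))).
        by apply: eq_intS => q _; rewrite hE mulr_suml; apply: eq_bigr => k _; ring.
      rewrite intS_sum; last by move=> k; apply: bmeasM => //; exact: bmeas_cst.
      by apply: eq_bigr => k _; rewrite intSZ // mulrC.
    by apply: is_derive_sumf => k; apply: is_derive_scalef (de1 k).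
  - apply: bmeas_sum => k; apply: bmeasM; last exact: bmeas_cst.
    exact: bmeas_continuous.
  - move=> q t; rewrite (_ : (fun t => _) = (fun t => \sum_k u k q * e k t)).
      by apply: is_derive_sumf => k; apply: is_derive_scalef (de k t).
    by apply/funext => s; rewrite hE.
  - by move=> q; apply: is_derive_sumf => k; apply: is_derive_scalef (de1 k).
  transitivity (intS (fun q => \sum_k e2 k * (u k q * phi q))).
    rewrite intS_sum; last by move=> k; apply: bmeasM => //; exact: bmeas_cst.
    by apply: eq_bigr => k _; rewrite intSZ // mulrC.
  by apply: eq_intS => q _; rewrite mulr_suml; apply: eq_bigr => k _; ring.
move=> /choice[h1 /choice[s /choice[hq /choice[sq H]]]].
exists h1, s; split.
- by move=> i t; have [[h _] _ _ _ _] := H i; exact: h.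
- by move=> i; have [[_ h] _ _ _ _] := H i.
have bsq i : bmeas (fun q => sq i q * phi q).
  by have [_ h _ _ _] := H i; exact: bmeasM.
rewrite (eq_bigr (fun i => intS (fun q => sq i q * phi q))); last first.
  by move=> i _; have [_ _ _ _ h] := H i.
rewrite -intS_sum // /zint -mulNr opprK -intSZ; last first.
  by apply: bmeasM => //; exact: kernel_bmeas.
apply: eq_intS => q Sq; rewrite -mulr_suml mulrA; congr (_ * _).
have [k1 [r [d1 d2 rE]]] := laplacian_on_zonal X f Sq sg.
transitivity (\sum_i r i); last by rewrite rE mulNr opprK.
apply: eq_bigr => i _.
have [_ _ h h' _] := H i.
rewrite -(is_derive_val (h' q)) -(is_derive_val (d2 i)).
congr (derive _ _ _); apply/funext => t.
by rewrite -(is_derive_val (h q t)) -(is_derive_val (d1 i t)).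
Qed.

Definition ell f : R := intS (fun q => f.[sd base q]).

Lemma intS_kernel f p : S p -> intS (fun q => f.[sd p q]) = ell f.
Proof.
move=> Sp; have [g sg gp] := symm_trans X Sp.
rewrite -(intS_symm sg (@kernel_continuous f p)).
by apply: eq_intS => q _; rewrite -gp sd_symm.
Qed.

(** By invariance the integral of f(s(p, .)) is the same for all p in the carrier, so its Laplacian
    is 0, while [laplacian_on_zint] evaluates it as -rho times the integral of the Jacobi operator
    applied to f. This identifies the law of s(p, .) through its action on polynomials. *)
Lemma ell_beta : beta_functional alpha beta ell.
Proof.
have zE f p : zint f (fun=> 1) p = intS (fun q => f.[sd p q]).
  by apply: eq_intS => q _; rewrite mulr1.
have bc := bmeas_cst 1.
split=> [k f g||f].
- by rewrite /ell -!zE zint_lin.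
- by rewrite /ell -[RHS]intS_cst; apply: eq_intS => q _; rewrite hornerC.
have L1 := laplacian_on_zint f bc.
have L2 := laplacian_on_ext (fun p Sp => etrans (zE f p) (intS_kernel f Sp)) (fun p _ => erefl) L1.
have := laplacian_on_uniq L2 (laplacian_on_cst X (ell f)) (mbaseS X).
move/eqP; rewrite mulf_eq0 oppr_eq0 (gt_eqF (mrho_gt0 X)) /= zE => /eqP <-.
by rewrite /ell.
Qed.

(** The swap of p and r shows that J_i and J_j may be convolved in either order. As a function of p
    the result has both rho eig i and rho eig j as eigenvalue, and these differ. *)
Lemma zint_cross i j p r : S p -> S r -> i != j ->
  intS (fun q => (Jac i).[sd p q] * (Jac j).[sd q r]) = 0.
Proof.
move=> Sp Sr ij.
have L k l : laplacian_on X (zint (Jac k) (fun q => (Jac l).[sd q r]))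
    (fun p => rho * eig k * zint (Jac k) (fun q => (Jac l).[sd q r]) p).
  have bl : bmeas (fun q => (Jac l).[sd q r]).
    by apply: bmeas_continuous; exact: kernel_continuousl.
  apply: laplacian_on_ext (laplacian_on_zint (Jac k) bl) => // u Su.
  by rewrite jacobi_eigen // zintZ //; ring.
have sw u : S u -> zint (Jac i) (fun q => (Jac j).[sd q r]) u =
    zint (Jac j) (fun q => (Jac i).[sd q r]) u.
  move=> Su; have [g [sg gu gr]] := mswap X Su Sr.
  have cc : continuous (fun q => (Jac i).[sd u q] * (Jac j).[sd q r]).
    by move=> q; exact: cvgM (@kernel_continuous _ _ q) (@kernel_continuousl _ _ q).
  rewrite /zint -(intS_symm sg cc); apply: eq_intS => q _.
  have e1 : sd u (g q) = sd q r by rewrite -gr sd_symm // sdC.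
  have e2 : sd (g q) r = sd u q by rewrite -gu sd_symm // sdC.
  by rewrite e1 e2 mulrC.
have L1 := L i j; have L2 := laplacian_on_ext (fun u Su => esym (sw u Su)) (fun _ _ => erefl) (L j i).
have := laplacian_on_uniq L1 L2 Sp; rewrite -(sw p Sp) => /eqP.
rewrite -subr_eq0 -mulrBl -mulrBr mulf_eq0 mulf_eq0 (gt_eqF (mrho_gt0 X)) /=.
case/orP => [|/eqP //]; rewrite subr_eq0 => /eqP /(jacobi_eig_inj c0) e.
by rewrite e eqxx in ij.
Qed.

Definition avg n phi p := zint ((1 - 'X) ^+ n) phi p / ell ((1 - 'X) ^+ n).

Lemma ell_pow_gt0 n : 0 < ell ((1 - 'X) ^+ n).
Proof. exact: bfun_pow_gt0 ell_beta n. Qed.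

(** Chebyshev's argument: |phi q - phi p| <= e + (2 K / dl) sd p q for near and far q alike, and
    [bfun_concentrate] gives the mean of sd p q under the weight (1 - s)^n. *)
Lemma avg_close n phi K dl e p : bmeas phi -> 0 < dl -> 0 <= e ->
  (forall q, S q -> `|phi q| <= K) -> S p ->
  (forall q, S q -> sd p q < dl -> `|phi q - phi p| <= e) ->
  `|avg n phi p - phi p| <= e + 2 * K / dl * ((alpha + 1) / (n%:R + alpha + beta + 2)).
Proof.
move=> bp dl0 e0 bK Sp near_p; have Z0 := ell_pow_gt0 n.
have n2 : 0 < n%:R + alpha + beta + 2.
  have := ler0n R n; move: (n%:R) c0 => x y z; lra.
have bk f := kernel_bmeas f p.
have bd : bmeas (fun q => phi q + - phi p) by apply: bmeasD => //; exact: bmeas_cst.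
have -> : avg n phi p - phi p =
    intS (fun q => ((1 - 'X) ^+ n).[sd p q] * (phi q + - phi p)) / ell ((1 - 'X) ^+ n).
  rewrite (_ : intS _ = zint ((1 - 'X) ^+ n) phi p + (- phi p) * ell ((1 - 'X) ^+ n)).
    by rewrite mulrDl mulfK ?gt_eqF.
  rewrite -(intS_kernel _ Sp) -intSZ // /zint -intSD.
  - by apply: eq_intS => q _; ring.
  - exact: bmeasM.
  - by apply: bmeasM => //; exact: bmeas_cst.
rewrite normrM normfV (gtr0_norm Z0) ler_pdivrMr //.
have conc := bfun_concentrate ell_beta n.
have KE : 0 <= 2 * K / dl.
  by rewrite divr_ge0 ?(ltW dl0) // mulr_ge0 // (le_trans _ (bK p Sp)).
have -> : (e + 2 * K / dl * ((alpha + 1) / (n%:R + alpha + beta + 2))) * ell ((1 - 'X) ^+ n)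
    = ell (e *: (1 - 'X) ^+ n + (2 * K / dl) *: ('X * (1 - 'X) ^+ n)).
  rewrite (bfunD ell_beta) !(bfunZ ell_beta).
  have -> : ell ('X * (1 - 'X) ^+ n) = (alpha + 1) * ell ((1 - 'X) ^+ n) / (n%:R + alpha + beta + 2).
    by apply: (canRL (mulfK (lt0r_neq0 n2))); rewrite mulrC conc.
  by ring.
rewrite -(intS_kernel _ Sp); apply: le_norm_intS => //; first exact: bmeasM.
move=> q Sq; have s0 := msd_ge0 X Sp Sq; have s1 := msd_le1 X Sp Sq.
have k0 : 0 <= (1 - sd p q) ^+ n by rewrite exprn_ge0 // subr_ge0.
have hE : ((1 - 'X) ^+ n).[sd p q] = (1 - sd p q) ^+ n.
  by rewrite horner_exp !hornerE.
rewrite hornerD !hornerZ hornerM hornerX !hE normrM (ger0_norm k0).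
rewrite [leRHS](_ : _ = (1 - sd p q) ^+ n * (e + 2 * K / dl * sd p q)); last by ring.
apply: ler_wpM2l => //; have [ls|ls] := ltP (sd p q) dl.
  by apply: le_trans (near_p q Sq ls) _; rewrite lerDl mulr_ge0.
apply: (@le_trans _ _ (2 * K)).
  by rewrite (le_trans (ler_normB _ _)) // mulr2n mulrDl !mul1r lerD ?bK.
rewrite -[X in X <= _]add0r lerD // -mulrA ler_peMr //.
  by rewrite mulr_ge0 // (le_trans _ (bK p Sp)).
by rewrite mulrC ler_pdivlMr // mul1r.
Qed.

Lemma continuous_addf (T : topologicalType) (f g : T -> R) :
  continuous f -> continuous g -> continuous (fun x => f x + g x).
Proof. by move=> cf cg x; exact: cvgD (cf x) (cg x). Qed.

Lemma continuous_mulf (T : topologicalType) (f g : T -> R) :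
  continuous f -> continuous g -> continuous (fun x => f x * g x).
Proof. by move=> cf cg x; exact: cvgM (cf x) (cg x). Qed.

Lemma continuous_scalef (T : topologicalType) (c : R) (f : T -> R) :
  continuous f -> continuous (fun x => c * f x).
Proof. by move=> cf; apply: continuous_mulf => // x; exact: cvg_cst. Qed.

Lemma harmonic_small (C e : R) : 0 <= C -> 0 < e -> exists N : nat, forall n, (N <= n)%N ->
  C * ((alpha + 1) / (n%:R + alpha + beta + 2)) <= e.
Proof.
move=> C0 e0; have a0 := a1; pose x := C * (alpha + 1) / e.
have x0 : 0 <= x by rewrite divr_ge0 ?mulr_ge0 // ltW.
exists (Num.bound x) => n Nn; have xn : x <= n%:R.
  by rewrite (le_trans (ltW (archi_boundP x0))) // ler_nat.
have n2 : n%:R < n%:R + alpha + beta + 2 by move: (n%:R) c0 => y; lra.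
have n0 : 0 < n%:R + alpha + beta + 2 by rewrite (le_lt_trans _ n2).
rewrite mulrA ler_pdivrMr // -ler_pdivrMl // mulrC.
exact: le_trans xn (ltW n2).
Qed.

Lemma avg_unif phi : continuous phi -> forall e, 0 < e ->
  exists N : nat, forall n, (N <= n)%N -> forall p, S p -> `|avg n phi p - phi p| <= e.
Proof.
move=> cp e e0; have e2 : 0 < e / 2 by rewrite divr_gt0.
have [dl dl0 H] := carrier_unif_continuous X cp e2.
have [_ [K bK]] := bmeas_continuous cp.
have K0 : 0 <= K by rewrite (le_trans _ (bK _ (mbaseS X))).
have [N HN] := harmonic_small (divr_ge0 (mulr_ge0 (ler0n R 2) K0) (ltW dl0)) e2.
exists N => n Nn p Sp; rewrite [leRHS](splitr e).
apply: le_trans (lerD (lexx _) (HN n Nn)).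
apply: avg_close => //; [exact: bmeas_continuous|exact: ltW|].
by move=> q Sq h; rewrite distrC ltW // H.
Qed.

Lemma intS_ae w v (Z : set B) : bmeas w -> bmeas v -> measurable Z -> vol Z = 0%E ->
  (forall q, S q -> ~ Z q -> w q = v q) -> intS w = intS v.
Proof.
move=> [mw _] [mv _] mZ Z0 H; congr fine; apply: ae_eq_integral.
- exact: carrier_measurable.
- exact/measurable_EFinP.
- exact/measurable_EFinP.
exists Z; split=> // q /= nq; apply: contrapT => nZ; apply: nq => Sq.
by rewrite H.
Qed.

(** The volume charges every neighbourhood: if Z contained all q of the carrier with sd p q < dl,
    the averages at p of the indicator of this neighbourhood would be 0, whereas [avg_close] puts
    one of them within 1/2 of 1. *)
Lemma ball_pos p dl (Z : set B) : S p -> 0 < dl -> measurable Z -> vol Z = 0%E ->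
  exists q, [/\ S q, sd p q < dl & ~ Z q].
Proof.
move=> Sp dl0 mZ Z0; apply: contrapT => nex.
have HZ q : S q -> sd p q < dl -> Z q.
  by move=> Sq h; apply: contrapT => nZ; apply: nex; exists q.
have mb : measurable ([set q | sd p q < dl] : set B).
  apply: sub_sigma_algebra; rewrite (_ : [set q | _] = sd p @^-1` [set x | x < dl]) //.
  by apply: (iffLR (continuousP (sd p))); [exact: sd_continuous|exact: open_lt].
pose phi q : R := \1_([set q | sd p q < dl] : set B) q.
have bphi : bmeas phi.
  split; first by apply: measurable_funTS; exact: measurable_indic.
  by exists 1 => q _; rewrite /phi indicE; case: (_ \in _); rewrite ?normr1 ?normr0.
have phi1 q : sd p q < dl -> phi q = 1 by move=> h; rewrite /phi indicE mem_set.
have h2 : 0 < 1 / 2 :> R by rewrite divr_gt0.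
have [N HN] := harmonic_small (divr_ge0 (mulr_ge0 (ler0n R 2) ler01) (ltW dl0)) h2.
have phip : phi p = 1 by rewrite phi1 // sdpp.
have b2 q : S q -> `|phi q| <= 1.
  by move=> _; rewrite /phi indicE; case: (_ \in _); rewrite ?normr1 ?normr0.
have := @avg_close N phi 1 dl 0 p bphi dl0 (lexx _) b2 Sp _.
have -> : avg N phi p = 0.
  rewrite /avg /zint (intS_ae (v := fun=> 0) (Z := Z)) ?intS_cst ?mul0r //.
  - by apply: bmeasM => //; exact: kernel_bmeas.
  - exact: bmeas_cst.
  move=> q Sq nZ; have : ~ sd p q < dl by move=> h; apply: nZ; exact: HZ.
  by move=> nd; rewrite /phi indicE memNset ?mulr0.
rewrite phip sub0r normrN normr1 add0r => H.
have : 1 <= 1 / 2 :> R.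
  apply: le_trans (HN N (leqnn N)); apply: H => q Sq h.
  by rewrite phi1 // subrr normr0.
by lra.
Qed.

Lemma avg_coefs : exists A : nat -> nat -> R, forall n phi p, bmeas phi ->
  avg n phi p = \sum_(j < n.+1) A n j * zint (Jac j) phi p.
Proof.
have H n : exists c : nat -> R, (1 - 'X : {poly R}) ^+ n = \sum_(j < n.+1) c j *: Jac j.
  apply: jacobi_basis => //; apply: leq_trans (size_poly_exp_leq _ _) _.
  rewrite (_ : 1 - 'X = - ('X - 1%:P)); last by rewrite opprB.
  by rewrite size_polyN size_XsubC mul1n.
have {H}[c H] := choice H.
exists (fun n j => c n j / ell ((1 - 'X) ^+ n)) => n phi p bp.
rewrite /avg {1}H zint_sum // mulr_suml; apply: eq_bigr => j _; ring.
Qed.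

Definition ell2 j := ell (Jac j ^+ 2).

Lemma zint_kernel i j p : S p ->
  zint (Jac i) (fun q => (Jac j).[sd p q]) p = if i == j then ell2 j else 0.
Proof.
move=> Sp; case: eqP => [->|/eqP ij].
  rewrite /ell2 -(intS_kernel _ Sp); apply: eq_intS => q _.
  by rewrite horner_exp expr2.
rewrite -(zint_cross Sp Sp ij); apply: eq_intS => q _; by rewrite (sdC X q).
Qed.

(** Averaging the kernel J_j(s(base, .)) and evaluating at base leaves the single term A n j ell2 j
    by orthogonality, while the averages tend to J_j(0) = 1. *)
Lemma avg_coef_cvg (A : nat -> nat -> R) : (forall n phi p, bmeas phi ->
    avg n phi p = \sum_(j < n.+1) A n j * zint (Jac j) phi p) ->
  forall j, A n j * ell2 j @[n --> \oo] --> (1 : R).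
Proof.
move=> HA j; apply/cvgrPdist_le => e e0.
have [N HN] := avg_unif (@kernel_continuous (Jac j) base) e0.
exists (maxn N j) => // n /=; rewrite geq_max => /andP[Nn jn].
have := HN n Nn base (mbaseS X).
rewrite HA; last exact: kernel_bmeas.
rewrite (bigD1 (Ordinal (jn : (j < n.+1)%N))) //= big1 => [|i ij].
  have /= -> := zint_kernel j j (mbaseS X).
  by rewrite eqxx addr0 (sdpp _ (mbaseS X)) jacobi_horner0 // distrC.
have -> := zint_kernel i j (mbaseS X); rewrite (_ : (i == j :> nat) = false) ?mulr0 //.
by apply: contraNF ij => /eqP e1; apply/eqP/val_inj.
Qed.

(** It is the integral of a square, and the value 0 would contradict the limit 1 in
    [avg_coef_cvg]. *)
Lemma ell2_gt0 j : 0 < ell2 j.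
Proof.
have [A HA] := avg_coefs.
rewrite lt_neqAle; apply/andP; split.
  apply/negP => /eqP h; have := avg_coef_cvg HA j.
  under eq_fun do rewrite -h mulr0.
  move=> c; have : limn (fun=> 0) = 1 :> R by exact: (cvg_lim (@Rhausdorff R) c).
  by rewrite lim_cst // => /eqP; rewrite eq_sym oner_eq0.
rewrite /ell2 /ell -(intS_cst 0); apply: le_intS; [exact: bmeas_cst|exact: kernel_bmeas|].
by move=> q _; rewrite horner_exp sqr_ge0.
Qed.

Lemma zint_bound f : exists K, 0 <= K /\ forall phi p e, bmeas phi -> S p ->
  (forall q, S q -> `|phi q| <= e) -> `|zint f phi p| <= K * e.
Proof.
have [_ [K0 bK0]] := kernel_bmeas f base.
pose h (x : R) := `|f.[x]|.
have ch : {within `[0, 1], continuous h}.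
  apply: continuous_subspaceT => x; apply: cvg_norm; exact: continuous_horner.
have [c _ cmax] := EVT_max ler01 ch.
exists (h c); split; first exact: normr_ge0.
move=> phi p e bp Sp be.
have -> : h c * e = intS (fun=> h c * e) by rewrite intS_cst.
apply: le_norm_intS; [by apply: bmeasM => //; exact: kernel_bmeas|exact: bmeas_cst|].
move=> q Sq; rewrite normrM ler_pM // ?be //; apply: cmax.
by rewrite in_itv /= msd_ge0 ?msd_le1.
Qed.

(** * Eigenfunctions and their zonal components *)

Section Eigenfunction.
Variables (phi : E -> R) (nu2 : R).
Hypotheses (cphi : continuous phi) (nu0 : 0 <= nu2).
Hypothesis Lphi : laplacian_on X phi (fun p => nu2 * phi p).

Let bphi : bmeas phi := bmeas_continuous cphi.

(** An average psi of phi is a combination of the convolutions zint J_j phi, which have the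
    eigenvalues rho eig j. Rescaling these by [ra j] gives w with (1 + Delta) w = (1 + nu2) psi, and
    the maximum principle applied to both signs of phi - w shows that w is close to phi. Convolution
    with J_i isolates one term and gives zint J_i phi = ra i zint J_i phi up to a small error; ra i
    is not 1. *)
Lemma zint_eigen_neq i p : S p -> nu2 != rho * eig i -> zint (Jac i) phi p = 0.
Proof.
move=> Sp ni; have [A HA] := avg_coefs.
pose ra j := (1 + nu2) / (1 + rho * eig j).
have rpos j : 0 < 1 + rho * eig j.
  by rewrite ltr_pwDl // mulr_ge0 ?eig_ge0 // ltW // mrho_gt0.
have [K [K0 bK]] := zint_bound (Jac i).
have ra0 : 0 <= ra i by apply: divr_ge0; [rewrite addr_ge0|exact: ltW].
suff H e : 0 < e -> `|zint (Jac i) phi p * (1 - ra i)| <= (K * (1 + nu2) + ra i * K) * e.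
  have z0 : zint (Jac i) phi p * (1 - ra i) = 0.
    apply/normr0_eq0/eqP; rewrite eq_le normr_ge0 andbT.
    have KK : 0 < K * (1 + nu2) + ra i * K + 1.
      by rewrite ltr_wpDl // addr_ge0 // mulr_ge0 // addr_ge0.
    apply/ler_addgt0Pr => e e0; rewrite add0r.
    apply: le_trans (H (e / (K * (1 + nu2) + ra i * K + 1)) (divr_gt0 e0 KK)) _.
    by rewrite mulrA ler_pdivrMr // mulrC ler_wpM2l ?(ltW e0) // lerDl.
  move/eqP: z0; rewrite mulf_eq0 => /orP[/eqP //|].
  rewrite subr_eq0 eq_sym /ra => /eqP h; move/negP: ni => []; apply/eqP.
  by have := canRL (divfK (lt0r_neq0 (rpos i))) h; rewrite mul1r => /addrI.
move=> e0; have [N HN] := avg_unif cphi e0.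
pose psi := avg N phi.
have psiE q : psi q = \sum_(j < N.+1) A N j * zint (Jac j) phi q by rewrite /psi HA.
pose w q := \sum_(j < N.+1) ra j * A N j * zint (Jac j) phi q.
have cz j : continuous (zint (Jac j) phi) by exact: zint_continuous.
have cw : continuous w by apply: continuous_sumf => j q; exact: cvgMl_tmp (cz j q).
have bw := bmeas_continuous cw.
have bz j : bmeas (zint (Jac j) phi) by exact: zint_bmeas.
have Lw : laplacian_on X w (fun q => (1 + nu2) * psi q - w q).
  have : laplacian_on X w (fun q => \sum_(j < N.+1) ra j * A N j * (- rho * zint (Lop (Jac j)) phi q)).
    by apply: laplacian_on_sum => j; apply: laplacian_onZ; exact: laplacian_on_zint.
  apply: laplacian_on_ext => // q _; rewrite psiE mulr_sumr -sumrB.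
  apply: eq_bigr => j _; rewrite jacobi_eigen // zintZ // /ra.
  by field; rewrite gt_eqF.
have close q : S q -> `|phi q - w q| <= (1 + nu2) * e.
  have n1 : 0 <= 1 + nu2 by rewrite addr_ge0.
  have cd : {within S, continuous (fun q => phi q + -1 * w q)}.
    by apply: continuous_subspaceT; apply: continuous_addf => //; exact: continuous_scalef.
  have cd' : {within S, continuous (fun q => -1 * phi q + w q)}.
    by apply: continuous_subspaceT; apply: continuous_addf => //; exact: continuous_scalef.
  have E1 u : S u -> phi u + -1 * w u + (nu2 * phi u + -1 * ((1 + nu2) * psi u - w u)) <= (1 + nu2) * e.
    move=> Su; have := HN N (leqnn N) u Su; rewrite distrC => /(le_trans (ler_norm _)) h.
    rewrite [leLHS](_ : _ = (1 + nu2) * (phi u - psi u)); last by ring.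
    by rewrite ler_wpM2l.
  have E2 u : S u -> -1 * phi u + w u + (-1 * (nu2 * phi u) + ((1 + nu2) * psi u - w u)) <= (1 + nu2) * e.
    move=> Su; have := HN N (leqnn N) u Su => /(le_trans (ler_norm _)) h.
    rewrite [leLHS](_ : _ = (1 + nu2) * (psi u - phi u)); last by ring.
    by rewrite ler_wpM2l.
  move=> Sq; rewrite ler_norml; apply/andP; split.
    have := maximum_principle (laplacian_onD (laplacian_onZ (-1) Lphi) Lw) cd' E2 Sq.
    by lra.
  have := maximum_principle (laplacian_onD Lphi (laplacian_onZ (-1) Lw)) cd E1 Sq.
  by lra.
have zz j : zint (Jac i) (zint (Jac j) phi) p = if (i == j :> nat) then zint (Jac i) (zint (Jac i) phi) p else 0.
  case: eqP => [-> //|/eqP ij]; rewrite zint_zint // -[RHS]intS_cst.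
  by apply: eq_intS => r Sr; rewrite zint_cross // mul0r.
have zsum (c : nat -> R) : zint (Jac i) (fun q => \sum_(j < N.+1) c j * zint (Jac j) phi q) p =
    \sum_(j < N.+1) c j * zint (Jac i) (zint (Jac j) phi) p.
  have bJ (j : nat) : bmeas (fun q => (Jac i).[sd p q] * zint (Jac j) phi q).
    by apply: bmeasM => //; exact: kernel_bmeas.
  transitivity (\sum_(j < N.+1) intS (fun q => c j * ((Jac i).[sd p q] * zint (Jac j) phi q))).
    rewrite -intS_sum; last by move=> j; apply: bmeasM => //; exact: bmeas_cst.
    by apply: eq_intS => q _; rewrite mulr_sumr; apply: eq_bigr => j _; rewrite mulrCA.
  by apply: eq_bigr => j _; rewrite intSZ.
have zw : zint (Jac i) w p = ra i * zint (Jac i) psi p.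
  rewrite /w (zsum (fun j => ra j * A N j)).
  rewrite (_ : psi = fun q => \sum_(j < N.+1) A N j * zint (Jac j) phi q); last exact/funext.
  rewrite zsum mulr_sumr; apply: eq_bigr => j _; rewrite zz mulrA.
  by case: eqP => [->|_]; rewrite ?mulr0.
have bpsi : bmeas psi.
  rewrite (_ : psi = fun q => \sum_(j < N.+1) A N j * zint (Jac j) phi q); last exact/funext.
  by apply: bmeas_sum => j; apply: bmeasM => //; exact: bmeas_cst.
have zB (f g : E -> R) : bmeas f -> bmeas g -> zint (Jac i) (fun q => f q - g q) p = zint (Jac i) f p - zint (Jac i) g p.
  move=> bf bg; have bk := kernel_bmeas (Jac i) p.
  rewrite -[X in _ + X]mulN1r /zint -intSZ; last exact: bmeasM.
  rewrite -intSD.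
  - by apply: eq_intS => q _; ring.
  - exact: bmeasM.
  - by apply: bmeasM; [exact: bmeas_cst|exact: bmeasM].
have bB (f g : E -> R) : bmeas f -> bmeas g -> bmeas (fun q => f q - g q).
  move=> bf bg; rewrite (_ : (fun q => _) = fun q => f q + -1 * g q).
    by apply: bmeasD => //; apply: bmeasM => //; exact: bmeas_cst.
  by apply/funext => q; rewrite mulN1r.
have -> : zint (Jac i) phi p * (1 - ra i) = zint (Jac i) (fun q => phi q - w q) p
    + ra i * zint (Jac i) (fun q => psi q - phi q) p.
  by rewrite !zB // zw; ring.
rewrite mulrDl (le_trans (ler_normD _ _)) // lerD //.
  by rewrite -mulrA; apply: bK => //; exact: bB.
rewrite normrM (ger0_norm ra0) -[leRHS]mulrA; apply: ler_wpM2l => //.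
apply: bK => //; first exact: bB.
by move=> q Sq; exact: HN.
Qed.

Lemma eigen_vanish : (forall i, nu2 != rho * eig i) -> forall p, S p -> phi p = 0.
Proof.
move=> H p Sp; have [A HA] := avg_coefs.
apply/normr0_eq0/eqP; rewrite eq_le normr_ge0 andbT; apply/ler_addgt0Pr => e e0.
have [N HN] := avg_unif cphi e0; rewrite add0r.
have := HN N (leqnn N) p Sp; rewrite HA // big1 ?sub0r ?normrN // => i _.
by rewrite zint_eigen_neq ?mulr0.
Qed.

(** Only the j-th term of [avg n phi] survives [zint_eigen_neq]; its coefficient tends to 1 / ell2
    j, while the averages tend to phi. *)
Lemma eigen_reproduce j p : S p -> nu2 = rho * eig j ->
  phi p = zint (Jac j) phi p / ell2 j.
Proof.
move=> Sp nj; have [A HA] := avg_coefs.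
apply: (canRL (mulfK (lt0r_neq0 (ell2_gt0 j)))).
have c1 : A n j * ell2 j * zint (Jac j) phi p @[n --> \oo] --> 1 * zint (Jac j) phi p.
  by exact: cvgMr_tmp (avg_coef_cvg HA j).
rewrite mul1r in c1.
have c2 : phi p * ell2 j @[n --> \oo] --> phi p * ell2 j by exact: cvg_cst.
have c3 : A n j * ell2 j * zint (Jac j) phi p @[n --> \oo] --> phi p * ell2 j.
  have c4 : avg n phi p @[n --> \oo] --> phi p.
    apply/cvgrPdist_le => e e0; have [N HN] := avg_unif cphi e0.
    by exists N => // n /= Nn; rewrite distrC; exact: HN.
  have c5 : avg n phi p * ell2 j @[n --> \oo] --> phi p * ell2 j by exact: cvgMr_tmp c4.
  apply: cvg_trans c5.
  apply: near_eq_cvg; exists j => // n /= jn.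
  rewrite HA // (bigD1 (Ordinal (jn : (j < n.+1)%N))) //= big1 => [|i ij].
    by rewrite addr0 mulrAC.
  rewrite zint_eigen_neq ?mulr0 // nj; apply: contraNneq ij => h.
  apply/eqP/val_inj; apply/esym/(jacobi_eig_inj c0).
  by apply: (mulfI (lt0r_neq0 (mrho_gt0 X))).
have e1 : limn (fun n => A n j * ell2 j * zint (Jac j) phi p) = zint (Jac j) phi p.
  by exact: (cvg_lim (@Rhausdorff R) c1).
by rewrite -e1; apply/esym; exact: (cvg_lim (@Rhausdorff R) c3).
Qed.

End Eigenfunction.

(** * The addition theorem for an eigenbasis *)

Section Basis.
Variables (nu : nat -> R) (phi : nat -> B -> R).
Hypothesis hphi : is_eigenbasis vol nu phi.

Let hsq j : sqint vol (phi j).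
Proof. by have [_ _ _ h _] := hphi; have [h1 _ _] := h j. Qed.

Let hortho i j : inn vol (phi i) (phi j) = (i == j)%:R.
Proof. by have [_ _ _ _ [h _]] := hphi; exact: h. Qed.

Lemma nu_gt0 i : (0 < i)%N -> 0 < nu i.
Proof. by have [_ h1 hm _ _] := hphi => i0; exact: lt_le_trans h1 (hm _ _ i0). Qed.

Lemma eigen_continuous j : exists F : E -> R, continuous F /\ forall p, S p -> phi j p = F p.
Proof.
have [_ _ _ h _] := hphi; have [_ [F [sF hF]] _] := h j.
by exists F; split => //; exact: (sF 0%N).1.
Qed.

Lemma eigen_laplacian j : laplacian_on X (phi j) (fun p => nu j ^+ 2 * phi j p).
Proof.
have [_ _ _ h _] := hphi; have [_ sF hF] := h j.
exact: laplacian_laplacian_on.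
Qed.

Lemma inn_intS (x y : B -> R) : sqint vol x -> sqint vol y ->
  inn vol x y = intS (fun p => x p * y p).
Proof.
move=> hx hy; have iS := inn_integrable hx hy; congr fine.
have mS := carrier_measurable; have mC := measurableC mS.
rewrite (negligible_integral mC measurableT iS).
  by rewrite setTD setCK.
apply: etrans (probability_setC vol mS) _.
have h : vol SB = 1%E by exact: hvol.1.
by rewrite h -EFinB subrr.
Qed.

(** A polynomial kernel is unbounded on the ambient space, whereas [sqint_bounded] asks for a global
    bound; extension by zero provides it. *)
Definition cut (w : E -> R) : B -> R := fun q => \1_SB q * w q.

Lemma cut_sqint w : continuous w -> sqint vol (cut w).
Proof.
move=> cw; have [_ [K bK]] := bmeas_continuous cw.
apply: (@sqint_bounded _ _ _ vol _ `|K|).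
  apply: measurable_funM; last exact: continuous_measurable.
  by apply: measurable_indic; exact: carrier_measurable.
move=> q; rewrite /cut indicE; have [/set_mem Sq|_] := boolP (q \in _).
  by rewrite mul1r (le_trans (bK q Sq)) // ler_norm.
by rewrite mul0r normr0.
Qed.

Lemma cutE w q : S q -> cut w q = w q.
Proof. by move=> Sq; rewrite /cut indicE mem_set // mul1r. Qed.

(** Otherwise all zonal components of phi i vanish, and [eigen_vanish] makes phi i zero on the
    carrier, against its norm 1. *)
Let nu_eig i : exists j, nu i ^+ 2 = rho * eig j.
Proof.
apply: contrapT => H; have [F [cF eF]] := eigen_continuous i.
have LF : laplacian_on X F (fun p => nu i ^+ 2 * F p).
  by apply: laplacian_on_ext (eigen_laplacian i) => p Sp; rewrite ?eF.
have F0 := eigen_vanish cF (sqr_ge0 _) LF.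
have := hortho i i; rewrite eqxx inn_intS // (@eq_intS _ (fun=> 0)) ?intS_cst.
  by move/eqP; rewrite eq_sym oner_eq0.
move=> p Sp; rewrite eF // F0 ?mul0r // => j; apply/negP => /eqP h.
by apply: H; exists j.
Qed.

Let kernel_coef i j p : S p -> inn vol (cut (fun q => (Jac j).[sd p q])) (phi i) =
  if nu i ^+ 2 == rho * eig j then phi i p * ell2 j else 0.
Proof.
move=> Sp; have [F [cF eF]] := eigen_continuous i.
have LF : laplacian_on X F (fun p => nu i ^+ 2 * F p).
  by apply: laplacian_on_ext (eigen_laplacian i) => q Sq; rewrite ?eF.
rewrite inn_intS //; last by apply: cut_sqint; exact: kernel_continuous.
rewrite (@eq_intS _ (fun q => (Jac j).[sd p q] * F q)); last first.
  by move=> q Sq; rewrite cutE // eF.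
rewrite -/(zint (Jac j) F p); case: eqP => [h|/eqP h].
  by rewrite eF // (eigen_reproduce cF (sqr_ge0 _) LF Sp h) divfK // gt_eqF // ell2_gt0.
exact: (zint_eigen_neq cF (sqr_ge0 _) LF Sp h).
Qed.

(** Parseval for the kernel J_j(s(p, .)): by [kernel_coef] its coefficients are phi i p ell2 j on
    the j-th eigenspace and 0 elsewhere, and its squared norm is ell2 j. A limit is taken because
    the eigenspace is not known to be finite dimensional. *)
Lemma eigen_addition p j : S p ->
  \sum_(0 <= i < n | nu i ^+ 2 == rho * eig j) phi i p ^+ 2 @[n --> \oo] --> (ell2 j)^-1.
Proof.
move=> Sp; set w := fun q => (Jac j).[sd p q].
have cw : continuous w by exact: kernel_continuous.
have hw := cut_sqint cw.
have hL : L2sum vol phi (fun i => inn vol (cut w) (phi i)) (cut w).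
  by have [_ _ _ _ [_ h]] := hphi; exact: (h (cut w) hw).
have := L2sum_parseval hsq hortho hL.
have -> : inn vol (cut w) (cut w) = ell2 j.
  rewrite inn_intS // /ell2 -(intS_kernel _ Sp); apply: eq_intS => q Sq.
  by rewrite cutE // /w horner_exp expr2.
have l0 := lt0r_neq0 (ell2_gt0 j).
move=> c; have c1 : (ell2 j)^-1 ^+ 2 @[n --> \oo] --> (ell2 j)^-1 ^+ 2 by exact: cvg_cst.
have c2 : (ell2 j)^-1 ^+ 2 * \sum_(0 <= i < n) inn vol (cut w) (phi i) ^+ 2 @[n --> \oo]
  --> (ell2 j)^-1 ^+ 2 * ell2 j by exact: (cvgM c1 c).
move: c2; rewrite {2}expr2 -mulrA mulVf // mulr1.
apply: cvg_trans; apply: near_eq_cvg; near=> n.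
rewrite /= [RHS]big_mkcond mulr_sumr; apply: eq_bigr => i _.
rewrite kernel_coef //; case: eqP => _; last by rewrite expr0n mulr0.
by rewrite mulrC exprVn exprMn mulfK // expf_neq0.
Unshelve. all: by end_near. Qed.

Lemma nneseries_single (u : nat -> \bar R) (m : nat) :
  (forall j, j != m -> u j = 0%E) -> (\sum_(j <oo) u j = u m)%E.
Proof.
move=> h; apply: lim_near_cst => //; exists m.+1 => // n /= mn.
rewrite (bigD1_seq m) ?mem_index_iota ?iota_uniq //= big1 ?adde0 // => j.
Qed.

Lemma nneseries_from1 (u : nat -> \bar R) :
  (\sum_(1 <= j <oo) u j = \sum_(j <oo) (if (0 < j)%N then u j else 0))%E.
Proof.
congr (limn _); apply/funext => -[|n]; first by rewrite !big_geq.
by rewrite [RHS]big_ltn //= add0e !big_add1.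
Qed.

(** The sum over i is regrouped by eigenvalue: it becomes a double series of nonnegative terms with
    one index j for each i > 0, and the order of summation is exchanged. *)
Lemma eigen_addition_series p (g : R -> R) : S p -> (forall x, 0 <= g x) ->
  (\sum_(1 <= i <oo) (phi i p ^+ 2 * g (nu i ^+ 2))%:E =
   \sum_(1 <= j <oo) ((ell2 j)^-1 * g (cross_gamma2 R M j))%:E)%E.
Proof.
move=> Sp g0; have rho0 := lt0r_neq0 (mrho_gt0 X).
have gE j : cross_gamma2 R M j = rho * eig j by exact: mgamma2.
have eig0 j : (0 < j)%N -> eig j != 0.
  move=> j0; apply/negP => /eqP h; suff e : j = 0%N by rewrite e in j0.
  by apply: (jacobi_eig_inj c0); rewrite h /jacobi_eig mul0r.
pose u i j := if (0 < i)%N && (nu i ^+ 2 == rho * eig j) then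
  (phi i p ^+ 2 * g (rho * eig j))%:E else 0%E.
have u0 i j : (0 <= u i j)%E.
  by rewrite /u; case: ifP => // _; rewrite lee_fin mulr_ge0 ?sqr_ge0.
rewrite !nneseries_from1.
transitivity (\sum_(i <oo) \sum_(j <oo) u i j)%E.
  apply: eq_eseriesr => i _; have [j hj] := nu_eig i.
  rewrite (@nneseries_single _ j) => [|k kj]; first by rewrite /u hj eqxx andbT.
  rewrite /u; case: andP => // -[_ /eqP]; rewrite hj => /(mulfI rho0) e.
  by rewrite (jacobi_eig_inj c0 e) eqxx in kj.
rewrite nneseries_interchange //; apply: eq_eseriesr => j _.
case: posnP => [->|j0].
  apply: eseries0 => i _ _; rewrite /u; case: andP => // -[i0 /eqP].
  rewrite /jacobi_eig mul0r mulr0 => /eqP; rewrite sqrf_eq0 => /eqP h.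
  by have := nu_gt0 i0; rewrite h ltxx.
have -> : (\sum_(i <oo) u i j = limn (fun n => ((\sum_(0 <= i < n | nu i ^+ 2 == rho * eig j)
   phi i p ^+ 2) * g (rho * eig j))%:E))%E.
  congr (limn _); apply/funext => n; rewrite mulr_suml -sumEFin [RHS]big_mkcond.
  apply: eq_bigr => i _; rewrite /u; case: posnP => //= ->.
  have [n00 _ _ _ _] := hphi; rewrite n00 expr0n /= eq_sym mulf_eq0.
  by rewrite (negbTE rho0) (negbTE (eig0 j j0)).
have cc : g (rho * eig j) @[n --> \oo] --> g (rho * eig j) by exact: cvg_cst.
have c2 : (\sum_(0 <= i < n | nu i ^+ 2 == rho * eig j) phi i p ^+ 2) * g (rho * eig j)
  @[n --> \oo] --> (ell2 j)^-1 * g (rho * eig j).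
  exact: (cvgM (@eigen_addition p j Sp) cc).
have c3 := cvg_EFin_seq c2.
by rewrite gE; exact: (cvg_lim _ c3).
Qed.

Local Notation N := (cross_mult (@Euler_Gamma R) alpha beta).
Local Notation gam := (cross_gamma R M).

Lemma ell2V j : (0 < j)%N -> (ell2 j)^-1 = N j.
Proof.
move=> j0; have h : ell2 j * N j = 1.
  apply: (bfun_jacobi_norm (@Euler_Gamma_like R) a1 b1 _ ell_beta).
  by rewrite ltr_wpDl // ltr0n.
by rewrite -[LHS]mulr1 -h mulKf // gt_eqF // ell2_gt0.
Qed.

Lemma nu_ge0 i : 0 <= nu i.
Proof.
have [n0 _ hmn _ _] := hphi; rewrite -n0; exact: hmn.
Qed.

Lemma cvg_le_bound (u : nat -> R) l b n0 : u n @[n --> \oo] --> l ->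
  (forall n, (n0 <= n)%N -> u n <= b) -> l <= b.
Proof.
move=> cu H; rewrite -(cvg_lim (@Rhausdorff R) cu).
by apply: limr_le; [apply/cvg_ex; exists l|exists n0].
Qed.

Lemma cauchy_schwarz_nat (u v : nat -> R) n1 n2 :
  (\sum_(n1 <= i < n2) u i * v i) ^+ 2 <=
  (\sum_(n1 <= i < n2) u i ^+ 2) * (\sum_(n1 <= i < n2) v i ^+ 2).
Proof.
have [n12|n21] := leqP n1 n2; last first.
  by rewrite !big_geq ?(ltnW n21) // expr0n /= mulr0.
elim: n2 n12 => [|n IH n12]; first by rewrite leqn0 => /eqP ->; rewrite !big_geq // expr0n /= mulr0.
have [->|n1n] := eqVneq n1 n.+1; first by rewrite !big_geq // expr0n /= mulr0.
have {n12 n1n} n12 : (n1 <= n)%N by rewrite -ltnS ltn_neqAle n1n.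
rewrite !big_nat_recr //=; move: (IH n12).
have A0 : 0 <= \sum_(n1 <= i < n) u i ^+ 2 by apply: sumr_ge0 => i _; exact: sqr_ge0.
have B0 : 0 <= \sum_(n1 <= i < n) v i ^+ 2 by apply: sumr_ge0 => i _; exact: sqr_ge0.
move: (\sum_(_ <= _ < _) _) A0 (\sum_(_ <= _ < _) _) B0 (\sum_(_ <= _ < _) _) (u n) (v n).
move=> A A0 B B0 C x y CAB.
have X0 : 0 <= A * y ^+ 2 + B * x ^+ 2 by rewrite addr_ge0 // mulr_ge0 ?sqr_ge0.
suff : 2 * C * x * y <= A * y ^+ 2 + B * x ^+ 2 by move: CAB; nra.
apply: (le_trans (ler_norm _)); rewrite -(@ler_sqr R) ?nnegrE //.
rewrite real_normK ?num_real //.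
have h1 : (2 * C * x * y) ^+ 2 <= 4 * (A * B) * (x * y) ^+ 2.
  have -> : (2 * C * x * y) ^+ 2 = 4 * C ^+ 2 * (x * y) ^+ 2 by ring.
  by rewrite ler_wpM2r ?sqr_ge0 // ler_wpM2l.
apply: (le_trans h1); rewrite -subr_ge0.
have -> : (A * y ^+ 2 + B * x ^+ 2) ^+ 2 - 4 * (A * B) * (x * y) ^+ 2 = (A * y ^+ 2 - B * x ^+ 2) ^+ 2 by ring.
exact: sqr_ge0.
Qed.

(** The mean A is divided out and ln x <= x - 1 is applied to each w l / A; the resulting exponents
    add up to 0. *)
Lemma weighted_amgm (I : finType) (lam w : I -> R) : (forall l, 0 < lam l) ->
  \sum_l lam l = 1 -> (forall l, 0 <= w l) -> 0 < \sum_l lam l * w l ->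
  \prod_l w l `^ lam l <= \sum_l lam l * w l.
Proof.
move=> l0 l1 w0; set A := \sum_l _ => A0.
have -> : \prod_l w l `^ lam l = A * \prod_l (w l / A) `^ lam l.
  rewrite [X in A * X](eq_bigr (fun l => w l `^ lam l * A `^ (- lam l))) => [|l _].
    by rewrite big_split /= prod_powR_sum // sumrN l1 powR_inv1 ?(ltW A0) // mulrCA divff ?mulr1 // gt_eqF.
  rewrite powRM ?invr_ge0 ?(ltW A0) //.
  by rewrite -powR_inv1 ?(ltW A0) // -powRrM mulN1r.
rewrite ler_piMr ?(ltW A0) //.
apply: (@le_trans _ _ (\prod_l expR (lam l * (w l / A - 1)))).
  apply: ler_prod => l _; rewrite powR_ge0 /=.
  have := w0 l; rewrite le_eqVlt => /orP[/eqP <-|wl].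
    by rewrite mul0r powR0 ?expR_ge0 // gt_eqF.
  rewrite /powR gt_eqF ?divr_gt0 // ler_expR ler_pM2l //.
  have h : ln (1 + (w l / A - 1)) <= w l / A - 1.
    by apply: le_ln1Dx; rewrite ltrBrDr addNr divr_gt0.
  by move: h; rewrite (_ : 1 + _ = w l / A) //; ring.
rewrite -expR_sum (_ : \sum_l _ = 0) ?expR0 //.
under eq_bigr do rewrite mulrBr mulr1 mulrA.
by rewrite sumrB -mulr_suml l1 divff ?subrr // gt_eqF.
Qed.

(** * The inequality with its constant *)

Section Weighted.
Variables (m : nat) (k : R) (r lam : 'I_m.+1 -> R).
Hypotheses (hm : (0 < m)%N) (hr : forall i j : 'I_m.+1, (i < j)%N -> r i < r j).
Hypotheses (hlam : forall j, 0 < lam j) (hsum : \sum_j lam j = 1).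
Hypothesis hk : k + (cross_dim M)%:R / 4 <= \sum_j lam j * r j.
Local Notation wden := (wden r).
Local Notation wgt := (wgt k r).
Local Notation cser := (fun h => fine (cross_series M k r h)).

(** By the addition theorem the left side does not depend on p: one series bounds the Cauchy-Schwarz
    factor at every point. *)
Lemma wgt_series h p : S p -> (forall l, 0 < h l) ->
  (\sum_(1 <= i <oo) (phi i p ^+ 2 * wgt h (nu i))%:E = cross_series M k r h)%E.
Proof.
move=> Sp h0; rewrite cross_seriesE.
(* [eigen_addition_series] takes functions of the eigenvalue nu^2, hence the square root, which on
   the other side turns gamma_j^2 into [cross_gamma]. *)
have e1 : (\sum_(1 <= i <oo) (phi i p ^+ 2 * wgt h (nu i))%:E =
    \sum_(1 <= i <oo) (phi i p ^+ 2 * wgt h (Num.sqrt (nu i ^+ 2)))%:E)%E.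
  congr (limn _); apply/funext => n; apply: eq_bigr => i _.
  by rewrite sqrtr_sqr ger0_norm // nu_ge0.
have g0 x : 0 <= wgt h (Num.sqrt x) by exact: wgt_ge0.
apply: (etrans e1); apply: (etrans (@eigen_addition_series p (fun x => wgt h (Num.sqrt x)) Sp g0)).
congr (limn _); apply/funext => n; apply: eq_big_nat => j /andP[j0 _].
by rewrite ell2V.
Qed.

Lemma wgt_partial h p n1 n2 : S p -> (forall l, 0 < h l) -> (0 < n1)%N ->
  \sum_(n1 <= i < n2) phi i p ^+ 2 * wgt h (nu i) <= cser h.
Proof.
move=> Sp h0 n10; have f0 i : 0 <= phi i p ^+ 2 * wgt h (nu i).
  by rewrite mulr_ge0 ?sqr_ge0 ?wgt_ge0.
have h1 : \sum_(1 <= i < n2) phi i p ^+ 2 * wgt h (nu i) <= cser h.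
  rewrite -lee_fin fineK; last exact: (cross_series_fin hm hr hlam hsum hk h0).
  rewrite -(wgt_series Sp h0) -sumEFin.
  by apply: nneseries_lim_ge => *; rewrite lee_fin.
have [n12|n21] := leqP n1 n2; last first.
  rewrite big_geq ?(ltnW n21) //; apply: le_trans h1.
  by apply: sumr_ge0 => i _; exact: f0.
apply: le_trans h1; rewrite (@big_cat_nat _ _ _ n1 1 n2) //= lerDr.
by apply: sumr_ge0 => i _; exact: f0.
Qed.

Lemma wgt_partial_cvg h p : S p -> (forall l, 0 < h l) ->
  \sum_(1 <= i < n) phi i p ^+ 2 * wgt h (nu i) @[n --> \oo] --> cser h.
Proof.
move=> Sp h0; set u := (fun n => _ : R).
have snd : nondecreasing_seq u.
  apply/nondecreasing_seqP => -[|n]; first by rewrite /u !big_geq.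
  by rewrite /u [leRHS]big_nat_recr //= lerDl mulr_ge0 ?sqr_ge0 ?wgt_ge0.
have cu : cvgn u.
  apply: nondecreasing_is_cvgn => //; exists (cser h) => _ [n _ <-]; exact: wgt_partial.
have := cvg_EFin_seq cu.
rewrite (_ : (fun n => (u n)%:E) = (fun n => \sum_(1 <= i < n) (phi i p ^+ 2 * wgt h (nu i))%:E)%E).
  move=> c; have := cvg_lim (@ereal_hausdorff R) c; rewrite (wgt_series Sp h0) => ->.
  exact: cu.
by apply/funext => n; rewrite sumEFin.
Qed.

Lemma cser_gt0 h : (forall l, 0 < h l) -> 0 < cser h.
Proof.
move=> h0; have h1 : 0 < N 1 * wgt h (gam 1).
  rewrite mulr_gt0 ?cross_mult_gt0 // divr_gt0 ?powR_gt0 ?wden_gt0 //; exact: gam_gt0.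
apply: lt_le_trans h1 _; rewrite -lee_fin fineK; last exact: (cross_series_fin hm hr hlam hsum hk h0).
have e : (N 1 * wgt h (gam 1))%:E = (\sum_(1 <= j < 2) (N j * wgt h (gam j))%:E)%E by rewrite big_nat1.
rewrite cross_seriesE e.
apply: nneseries_lim_ge => j j0 _; rewrite lee_fin mulr_ge0 ?wgt_ge0 //.
by rewrite ltW // cross_mult_gt0.
Qed.

Section Function.
Variable x : B -> R.
Local Notation a := (fun i => inn vol x (phi i)).

Definition lcoef s (i : nat) : R := if i is 0 then 0 else a i * nu i `^ (2 * s).

Lemma lcoef_sqr s i : (0 < i)%N -> lcoef s i ^+ 2 = a i ^+ 2 * nu i `^ (4 * s).
Proof.
case: i => [//|i] i0; rewrite /lcoef exprMn; congr (_ * _).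
by rewrite -powR_mulrn ?powR_ge0 // -powRrM; congr (_ `^ _); ring.
Qed.

(** [riesz_fischer] shows that an L_2 sum exists, so that [xget] returns one and not its default
    value. *)
Lemma laplace_powerP s K : (forall n, \sum_(1 <= i < n) a i ^+ 2 * nu i `^ (4 * s) <= K) ->
  L2sum vol phi (lcoef s) (laplace_power vol nu phi s x).
Proof.
move=> HK; pose P z := is_L2_sum vol (fun j p => if j is 0%N then 0
   else L2_inner vol x (phi j) * nu j `^ (2 * s) * phi j p) z.
have PE z : P z <-> L2sum vol phi (lcoef s) z.
  rewrite /P (_ : (fun j p => _) = fun j p => lcoef s j * phi j p) //.
  by apply/funext => -[|j]; apply/funext => p; rewrite ?mul0r.
apply/PE; have [|z /PE Pz] := riesz_fischer hsq hortho (a := lcoef s) (K := K).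
  move=> n; apply: le_trans (HK n); case: n => [|n]; first by rewrite !big_geq.
  rewrite big_ltn // expr0n add0r le_eqVlt; apply/orP; left; apply/eqP.
  by apply: eq_big_nat => i /andP[i0 _]; rewrite lcoef_sqr.
exact: (@xgetPex _ (fun=> 0) P (ex_intro _ z Pz)).
Qed.

(** As nu i >= nu 1 > 0, lowering the exponent from r_m to s costs only the constant nu_1^(4 s - 4
    r_m). The index 2 r_m of [H0] stands for the exponent 4 r_m of nu. *)
Lemma lap_partial s : H0 vol nu phi (2 * r ord_max) x -> s <= r ord_max ->
  exists K, forall n, \sum_(1 <= i < n) a i ^+ 2 * nu i `^ (4 * s) <= K.
Proof.
move=> [_ _ hfin] sr; pose K0 := fine (\sum_(1 <= j <oo)
  (`|L2_inner vol x (phi j)| ^+ 2 * nu j `^ (2 * (2 * r ord_max)))%:E)%E.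
have f0 j : 0 <= `|L2_inner vol x (phi j)| ^+ 2 * nu j `^ (2 * (2 * r ord_max)).
  by rewrite mulr_ge0 ?powR_ge0 ?exprn_ge0.
have nu1 : 0 < nu 1%N by exact: nu_gt0.
have HK n : \sum_(1 <= j < n) `|L2_inner vol x (phi j)| ^+ 2 * nu j `^ (2 * (2 * r ord_max)) <= K0.
  rewrite -lee_fin fineK.
    by rewrite -sumEFin; apply: nneseries_lim_ge => *; rewrite lee_fin.
  by rewrite ge0_fin_numE //; apply: nneseries_ge0 => *; rewrite lee_fin.
exists (K0 * nu 1%N `^ (4 * s - 4 * r ord_max)) => n.
apply: le_trans (ler_wpM2r (powR_ge0 _ _) (HK n)); rewrite mulr_suml.
rewrite [leLHS]big_nat_cond [leRHS]big_nat_cond; apply: ler_sum => i /andP[/andP[i0 _] _].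
have n0 := nu_gt0 i0; rewrite real_normK ?num_real // -[leRHS]mulrA ler_wpM2l ?sqr_ge0 //.
have -> : 4 * s = 2 * (2 * r ord_max) + (4 * s - 4 * r ord_max) by ring.
rewrite powRD_gt0 // ler_wpM2l ?powR_ge0 //.
have -> : 2 * (2 * r ord_max) + (4 * s - 4 * r ord_max) - 4 * r ord_max = - (4 * (r ord_max - s)) by ring.
have -> : 4 * s - 4 * r ord_max = - (4 * (r ord_max - s)) by ring.
rewrite !powRN lef_pV2 ?posrE ?powR_gt0 //.
apply: ge0_ler_powR; rewrite ?nnegrE ?nu_ge0 //; first by rewrite mulr_ge0 // subr_ge0.
by have [_ _ hmn _ _] := hphi; exact: hmn.
Qed.

Lemma r_le l : r l <= r ord_max.
Proof.
have := leq_ord l; rewrite leq_eqVlt => /orP[/eqP e|lm]; last by rewrite ltW // hr.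
by rewrite (_ : l = ord_max) //; exact: val_inj.
Qed.

Lemma k_le : k <= r ord_max.
Proof.
have : \sum_j lam j * r j <= r ord_max.
  rewrite -[leRHS]mul1r -hsum mulr_suml; apply: ler_sum => l _.
  by rewrite ler_wpM2l ?r_le // ltW.
have : 0 <= (cross_dim M)%:R :> R by [].
by move: hk; move: ((cross_dim M)%:R) => y; lra.
Qed.

Lemma ae_combine (P Q P' : B -> Prop) : (forall p, P p -> Q p -> P' p) ->
  {ae vol, forall p, P p} -> {ae vol, forall p, Q p} -> {ae vol, forall p, P' p}.
Proof.
move=> h [Z [mZ Z0 HZ]] [Y [mY Y0 HY]]; exists (Z `|` Y); split.
- exact: measurableU.
- have h1 : (vol (Z `|` Y) <= vol Z + vol Y)%E by exact: measureU2.
  apply/eqP; rewrite eq_le measure_ge0 andbT; apply: (le_trans h1).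
  by rewrite Z0 Y0 adde0.
- move=> p /= nT; apply: contrapT => /not_orP[nZ nY]; apply: nT; apply: h.
    by apply: contrapT => nP; apply: nZ; exact: HZ.
  by apply: contrapT => nP; apply: nY; exact: HY.
Qed.

Lemma ae_eq_limit c z (y : B -> R) : L2sum vol phi c z ->
  (forall p, S p -> psum phi c 0 n p @[n --> \oo] --> y p) ->
  {ae vol, forall p, y p = z p}.
Proof.
move=> hL hy; have aeS : {ae vol, forall p, SB p}.
  exists (~` SB); split => //; first exact: measurableC carrier_measurable.
  apply: etrans (probability_setC vol carrier_measurable) _.
  have h : vol SB = 1%E by exact: hvol.1.
  by rewrite h -EFinB subrr.
have h := @L2_lim_ae _ _ _ vol (psum phi c 0) z y (psum_sqint hsq c 0) hL.1 (L2sum_inn0 hL).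
by apply: ae_combine aeS h => p Sp; apply; exact: hy.
Qed.

Lemma C_norm_le (y : B -> R) b : (forall p, S p -> `|y p| <= b) -> C_norm y <= b.
Proof.
move=> H; apply: ge_sup; first by exists `|y base|, base => //; exact: mbaseS.
by move=> _ [p Sp <-]; exact: H.
Qed.

Section Bound.
Hypothesis H0x : H0 vol nu phi (2 * r ord_max) x.
Local Notation D := (fun l => L2_norm vol (laplace_power vol nu phi (r l) x)).
Hypothesis D0 : forall l, 0 < D l.

Let h l := lam l / D l ^+ 2.
Let h0 l : 0 < h l. Proof. by rewrite divr_gt0 // exprn_gt0. Qed.
Let c := lcoef k.
(** Partial sums of the weighted energy sum_l h_l D_l^2, which equals 1 for this h; the remainder 1
    - en n controls the tails uniformly in p. *)
Let en n := \sum_(0 <= i < n) \sum_l h l * lcoef (r l) i ^+ 2.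

Let lapL l : L2sum vol phi (lcoef (r l)) (laplace_power vol nu phi (r l) x).
Proof. by have [K HK] := lap_partial H0x (r_le l); exact: laplace_powerP HK. Qed.

Let en_cvg : en n @[n --> \oo] --> (1 : R).
Proof.
have -> : (1 : R) = \sum_l h l * D l ^+ 2.
  by rewrite -hsum; apply: eq_bigr => l _; rewrite divfK // expf_neq0 // gt_eqF.
rewrite (_ : en = fun n => \sum_l h l * \sum_(0 <= i < n) lcoef (r l) i ^+ 2).
  apply: cvg_sumf => l; apply: cvgMl_tmp.
  rewrite [X in _ --> X](nrm_sqr vol (laplace_power vol nu phi (r l) x)).
  exact: (L2sum_parseval hsq hortho (lapL l)).
apply/funext => n; rewrite /en exchange_big; apply: eq_bigr => l _.
by rewrite mulr_sumr.
Qed.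

Let en_term i : 0 <= \sum_l h l * lcoef (r l) i ^+ 2.
Proof. by apply: sumr_ge0 => l _; rewrite mulr_ge0 ?sqr_ge0 // (ltW (h0 l)). Qed.

Let en_nd : nondecreasing_seq en.
Proof. by apply/nondecreasing_seqP => n; rewrite /en [leRHS]big_nat_recr //= lerDl; exact: en_term. Qed.

Let en_le1 n : en n <= 1.
Proof.
rewrite -(cvg_lim (@Rhausdorff R) en_cvg); apply: nondecreasing_cvgn_le; first exact: en_nd.
by apply/cvg_ex; exists (1 : R); exact: en_cvg.
Qed.

Let en_ge0 n : 0 <= en n.
Proof. by apply: sumr_ge0 => i _; exact: en_term. Qed.

(** Cauchy-Schwarz on a block of indices: the case n1 = 1 bounds the sum, and the tails give
    absolute and uniform convergence, hence a continuous representative. *)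
Let cs_bound p n1 n2 : S p -> (0 < n1 <= n2)%N ->
  (\sum_(n1 <= i < n2) `|c i * phi i p|) ^+ 2 <= (en n2 - en n1) * cser h.
Proof.
move=> Sp /andP[n10 n12].
pose u i := `|a i| * Num.sqrt (wden h (nu i)).
pose v i := `|phi i p| * (nu i `^ (2 * k) / Num.sqrt (wden h (nu i))).
have e1 : \sum_(n1 <= i < n2) `|c i * phi i p| = \sum_(n1 <= i < n2) u i * v i.
  apply: eq_big_nat => -[|i] /andP[i1 _]; first by move: i1; rewrite leqNgt n10.
  have w0 := wden_gt0 r h0 (nu_gt0 (ltn0Sn i)).
  rewrite /c /lcoef /u /v !normrM (ger0_norm (powR_ge0 _ _)).
  have q0 : Num.sqrt (wden h (nu i.+1)) != 0 by rewrite gt_eqF // sqrtr_gt0.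
  by move: (Num.sqrt _) q0 => q q0; field.
rewrite e1; apply: (le_trans (cauchy_schwarz_nat _ _ _ _)); apply: ler_pM.
- by apply: sumr_ge0 => i _; exact: sqr_ge0.
- by apply: sumr_ge0 => i _; exact: sqr_ge0.
- rewrite /en (@big_cat_nat _ _ _ n1 0 n2) //= (addrC (\sum_(0 <= i < n1) _)) addrK.
  rewrite le_eqVlt; apply/orP; left; apply/eqP; apply: eq_big_nat => i /andP[i1 _].
  have i0 : (0 < i)%N by exact: leq_trans n10 i1.
  rewrite /u exprMn real_normK ?num_real // sqr_sqrtr ?(wden_ge0 _ _ h0) //.
  rewrite -[wden h (nu i)]/(\sum_l h l * nu i `^ (4 * r l)) mulr_sumr.
  by apply: eq_bigr => l _; rewrite lcoef_sqr // mulrCA.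
- apply: le_trans (wgt_partial n2 Sp h0 n10); rewrite le_eqVlt; apply/orP; left; apply/eqP.
  apply: eq_big_nat => i /andP[i1 _].
  rewrite /v !exprMn real_normK ?num_real // exprVn sqr_sqrtr ?(wden_ge0 _ _ h0) //.
  rewrite -[wgt h (nu i)]/(nu i `^ (4 * k) / wden h (nu i)).
  congr (_ * (_ / _)); rewrite -powR_mulrn ?powR_ge0 // -powRrM; congr (_ `^ _); ring.
Qed.

Let s0 : 0 <= cser h. Proof. exact: ltW (cser_gt0 h0). Qed.

Let ps_cvg p : S p -> cvgn (fun n => psum phi c 0 n p).
Proof.
move=> Sp; apply: (@normed_cvg R R^o (fun i => c i * phi i p)).
apply: nondecreasing_is_cvgn.
  by apply/nondecreasing_seqP => n; rewrite /series /= [leRHS]big_nat_recr //= lerDl.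
exists (Num.sqrt (cser h)) => _ [n _ <-] /=; rewrite /series /=.
case: n => [|n]; first by rewrite big_geq // sqrtr_ge0.
rewrite big_ltn // {1}/c /lcoef mul0r normr0 add0r.
rewrite -(@ger0_norm _ (\sum_(_ <= _ < _) _)) ?sumr_ge0 // -sqrtr_sqr ler_wsqrtr //.
apply: (le_trans (cs_bound Sp (_ : (0 < 1 <= n.+1)%N))) => //.
apply: ler_piMl; first exact: s0.
by rewrite lerBlDr (le_trans (en_le1 _)) // lerDl; exact: en_ge0.
Qed.

Let y p := limn (fun n => psum phi c 0 n p).

Let y_close p n : S p -> (0 < n)%N ->
  `|y p - psum phi c 0 n p| <= Num.sqrt ((1 - en n) * cser h).
Proof.
move=> Sp n0.
have c1 : `|psum phi c 0 m0 p - psum phi c 0 n p| @[m0 --> \oo] --> `|y p - psum phi c 0 n p|.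
  have c2 : psum phi c 0 m0 p @[m0 --> \oo] --> y p := ps_cvg Sp.
  have c3 : psum phi c 0 n p @[m0 --> \oo] --> psum phi c 0 n p by exact: cvg_cst.
  exact: cvg_norm (cvgB c2 c3).
apply: (cvg_le_bound c1 (n0 := n)) => q nq; rewrite psumB //.
rewrite -(@ger0_norm _ `|_|) // -sqrtr_sqr ler_wsqrtr //.
apply: (@le_trans _ _ ((\sum_(n <= i < q) `|c i * phi i p|) ^+ 2)).
  by rewrite lerXn2r ?nnegrE ?sumr_ge0 // ler_norm_sum.
apply: (le_trans (cs_bound Sp _)); first by rewrite n0.
by apply: ler_wpM2r; [exact: s0|rewrite lerD2r; exact: en_le1].
Qed.

Let y_cont : {within S, continuous (y : E -> R)}.
Proof.
apply/subspace_continuousP => p Sp; apply/cvgrPdist_le => e e0.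
have e3 : 0 < e / 3 by rewrite divr_gt0.
have cl : (1 - en n) * cser h @[n --> \oo] --> (1 - 1) * cser h.
  have c1 : (1 : R) @[n --> \oo] --> (1 : R) by exact: cvg_cst.
  by apply: cvgMr_tmp; exact: cvgB c1 en_cvg.
rewrite subrr mul0r in cl.
have [n0 _ Hn] := (cvgr0Pnorm_le _).1 cl _ (exprn_gt0 2 e3).
pose n := n0.+1; have small : Num.sqrt ((1 - en n) * cser h) <= e / 3.
  rewrite (_ : e / 3 = Num.sqrt ((e / 3) ^+ 2)); last by rewrite sqrtr_sqr ger0_norm // ltW.
  by apply: ler_wsqrtr; exact: le_trans (ler_norm _) (Hn n (leqnSn _)).
(* Off the carrier phi i is arbitrary, so continuity of the partial sums is read on extensions. *)
pose F i := projT1 (cid (eigen_continuous i)).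
have cF i : continuous (F i) := (projT2 (cid (eigen_continuous i))).1.
have eF i q : S q -> phi i q = F i q := (projT2 (cid (eigen_continuous i))).2 q.
pose G q := \sum_(i < n) c i * F i q.
have cG : continuous G by apply: continuous_sumf => i; exact: continuous_scalef.
have GE q : S q -> psum phi c 0 n q = G q.
  by move=> Sq; rewrite /psum big_mkord; apply: eq_bigr => i _; rewrite eF.
have HG : nbhs (p : E) (fun q => `|G p - G q| <= e / 3) by exact: (cvgrPdist_le _ _).1 (cG p) _ e3.
change (nbhs (p : E) (fun q : E => S q -> `|y p - y q| <= e)).
apply: (filterS _ HG) => q Hq Sq.
have h1 := y_close Sp (ltn0Sn n0); have h2 := y_close Sq (ltn0Sn n0).
rewrite -/n !GE // in h1 h2.
have -> : y p - y q = (y p - G p) + (G p - G q) - (y q - G q) by ring.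
apply: (le_trans (ler_normB _ _)); apply: (le_trans (lerD (ler_normD _ _) (lexx _))).
have := le_trans h1 small; have := le_trans h2 small; lra.
Qed.

Lemma bound_exists : exists y : B -> R,
  [/\ {within S, continuous (y : E -> R)},
      {ae vol, forall p, y p = laplace_power vol nu phi k x p}
    & C_norm y <= Num.sqrt (fine (cross_constant M k r lam) * \prod_j lam j `^ (- lam j)) *
        \prod_j D j `^ lam j].
Proof.
exists y; split; first exact: y_cont.
  have [K HK] := lap_partial H0x k_le.
  by apply: ae_eq_limit (laplace_powerP HK) _ => p Sp; exact: ps_cvg.
apply: (@le_trans _ _ (Num.sqrt (cser h))).
  (* The coefficient of index 0 is zero, so the partial sum up to 1 vanishes and the case n = 1 of
     [y_close] bounds |y p| itself. *)
  apply: C_norm_le => p Sp; have := y_close Sp (ltn0Sn 0).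
  rewrite /psum big_nat1 {1}/c /lcoef mul0r subr0 => /le_trans; apply.
  apply: ler_wsqrtr; apply: ler_piMl; first exact: s0.
  by rewrite lerBlDr lerDl; exact: en_ge0.
have PD0 : 0 <= \prod_j D j `^ lam j by apply: prodr_ge0 => j _; exact: powR_ge0.
rewrite -[X in _ <= _ * X](ger0_norm PD0) -sqrtr_sqr -sqrtrM; last first.
  rewrite mulr_ge0 //; last by apply: prodr_ge0 => j _; exact: powR_ge0.
  apply: fine_ge0; apply: le_trans (cross_constant_ge M k r lam h0).
  apply: mule_ge0; last exact: (cross_series_ge0 M k r h0).
  by rewrite lee_fin; apply: prodr_ge0 => j _; exact: powR_ge0.
apply: ler_wsqrtr.
have HC : (\prod_l h l `^ lam l) * cser h <= fine (cross_constant M k r lam).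
  rewrite -lee_fin EFinM (fineK (cross_series_fin hm hr hlam hsum hk h0)).
  rewrite (fineK (cross_constant_fin hm hr hlam hsum hk)).
  exact: (cross_constant_ge M k r lam h0).
(* With h_l = lambda_l / D_l^2 the three products cancel, so cser h takes the form of the right-hand
   side with the value at h in place of the supremum. *)
have HE : (\prod_l h l `^ lam l) * (\prod_j lam j `^ (- lam j)) * (\prod_j D j `^ lam j) ^+ 2 = 1.
  rewrite -prodrXl -!big_split /= big1 // => l _.
  rewrite /h powRM ?invr_ge0 ?sqr_ge0 ?(ltW (hlam _)) // -powR_inv1 ?sqr_ge0 // -powRrM mulN1r.
  rewrite !powRN -(powR_mulrn 2 (ltW (D0 l))) -powRrM -(powR_mulrn 2 (powR_ge0 _ _)) -powRrM.
  rewrite (mulrC _ (lam l)).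
  have d0 : D l `^ (lam l * 2) != 0 by rewrite gt_eqF // powR_gt0.
  have l0 : lam l `^ lam l != 0 by rewrite gt_eqF // powR_gt0.
  by move: (D l `^ _) d0 (lam l `^ _) l0 => u u0 v v0; field; rewrite u0 v0.
have PL0 : 0 <= \prod_j lam j `^ (- lam j) by apply: prodr_ge0 => j _; exact: powR_ge0.
move: HC HE PL0; set Ph := \prod_l h l `^ _; set PL := \prod_j lam j `^ _.
set PD := \prod_j D j `^ _ => HC HE PL0.
have e1 : (Ph * cser h) * (PL * PD ^+ 2) = cser h.
  transitivity (cser h * (Ph * PL * PD ^+ 2)); first by ring.
  by rewrite HE mulr1.
rewrite -[leLHS]e1 -[leRHS]mulrA; apply: ler_wpM2r HC.
by rewrite mulr_ge0 ?sqr_ge0.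
Qed.

End Bound.

(** The weights lambda_l / D_l^2 require all norms to be positive. If one of them is 0, then all
    coefficients of positive index vanish because nu i > 0, and y = 0 serves. *)
Lemma zero_case l : H0 vol nu phi (2 * r ord_max) x ->
  L2_norm vol (laplace_power vol nu phi (r l) x) = 0 -> forall s i, lcoef s i = 0.
Proof.
move=> H0x D0; have [K HK] := lap_partial H0x (r_le l).
have := L2sum_parseval hsq hortho (laplace_powerP HK); rewrite -nrm_sqr.
rewrite -[nrm vol _]/(L2_norm vol (laplace_power vol nu phi (r l) x)) D0 expr0n /= => c0'.
have z i : lcoef (r l) i = 0.
  apply/eqP; rewrite -sqrf_eq0 eq_le sqr_ge0 andbT.
  have nd : nondecreasing_seq (fun n => \sum_(0 <= j < n) lcoef (r l) j ^+ 2).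
    by apply/nondecreasing_seqP => n; rewrite [leRHS]big_nat_recr //= lerDl sqr_ge0.
  have cv : cvgn (fun n => \sum_(0 <= j < n) lcoef (r l) j ^+ 2) by apply/cvg_ex; exists (0 : R).
  have := nondecreasing_cvgn_le nd cv i.+1; rewrite (cvg_lim (@Rhausdorff R) c0').
  apply: le_trans; rewrite big_nat_recr //= lerDr.
  by apply: sumr_ge0 => j _; exact: sqr_ge0.
move=> s [//|i]; have /eqP := z i.+1; rewrite /lcoef mulf_eq0 powR_eq0.
by rewrite (gt_eqF (nu_gt0 (ltn0Sn i))) /= orbF => /eqP ->; rewrite mul0r.
Qed.

End Function.

Lemma upper_bound : kolmogorov_inequality vol nu phi k r lam
  (Num.sqrt (fine (cross_constant M k r lam) * \prod_j lam j `^ (- lam j))).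
Proof.
move=> x H0x.
case: (pselect (forall l, 0 < L2_norm vol (laplace_power vol nu phi (r l) x))) => [D0|].
  exact: bound_exists.
move=> /existsNP[l /negP]; rewrite -leNgt => Dl.
have {}Dl : L2_norm vol (laplace_power vol nu phi (r l) x) = 0.
  by apply/eqP; rewrite eq_le Dl /=; exact: (nrm_ge0 vol).
have z := zero_case H0x Dl.
exists (fun=> 0); split; first by apply: continuous_subspaceT; exact: cst_continuous.
  have [K HK] := lap_partial H0x k_le.
  have := @ae_eq_limit (lcoef x k) _ (fun=> 0) (laplace_powerP HK); apply => p Sp.
  rewrite (_ : (fun n => _) = fun=> 0); first exact: cvg_cst.
  by apply/funext => n; rewrite /psum big1 // => i _; rewrite z mul0r.
apply: C_norm_le => p _; rewrite normr0 mulr_ge0 ?sqrtr_ge0 //.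
by apply: prodr_ge0 => j _; exact: powR_ge0.
Qed.

Lemma psum_trunc c n n1 p : (forall i, (n <= i)%N -> c i = 0) -> (n <= n1)%N ->
  psum phi c 0 n1 p = psum phi c 0 n p.
Proof.
move=> hc nn; rewrite /psum (@big_cat_nat _ _ _ n 0 n1) //= [X in _ + X]big_nat_cond [X in _ + X]big1 ?addr0 //.
by move=> i /andP[/andP[ni _] _]; rewrite hc // mul0r.
Qed.

Lemma L2sum_finite c n : (forall i, (n <= i)%N -> c i = 0) ->
  L2sum vol phi c (psum phi c 0 n).
Proof.
move=> hc; split; first exact: psum_sqint.
apply/cvgr0Pnorm_le => e e0; exists n => // n1 nn /=.
have -> : nrm vol (fun p => psum phi c 0 n p - psum phi c 0 n1 p) = 0.
  apply/eqP; rewrite -sqrf_eq0 nrm_sqr psum_dist //.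
  rewrite distrC (@big_cat_nat _ _ _ n 0 n1) //= (addrC (\sum_(0 <= i < n) _)) addrK.
  rewrite big_nat_cond big1 ?normr0 // => i /andP[/andP[ni _] _].
  by rewrite hc // expr0n.
by rewrite normr0 ltW.
Qed.

Lemma sum_tail_le (u : nat -> R) n n1 : (forall i, (n <= i)%N -> u i = 0) ->
  (forall i, 0 <= u i) -> \sum_(1 <= i < n1) u i <= \sum_(1 <= i < n) u i.
Proof.
move=> hu u0; elim: n1 => [|n1 IH]; first by rewrite big_geq // sumr_ge0.
case: n1 IH => [|n1] IH; first by rewrite big_geq // sumr_ge0.
rewrite big_nat_recr //=; have [nn|nn] := leqP n n1.+1; first by rewrite hu // addr0.
rewrite -big_nat_recr //= (@big_cat_nat _ _ _ n1.+2 1 n) //= lerDl.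
by apply: sumr_ge0 => i _; exact: u0.
Qed.

Lemma continuous_sd_close (w : E -> R) p e : {within S, continuous w} -> S p -> 0 < e ->
  exists2 dl, 0 < dl & forall q, S q -> sd p q < dl -> `|w p - w q| <= e.
Proof.
move=> cw Sp e0.
have HG : nbhs (p : E) (fun q : E => S q -> `|w p - w q| <= e).
  exact: (cvgrPdist_le _ _).1 ((subspace_continuousP _ _).1 cw p Sp) _ e0.
have [del /= del0 H] := (nbhs_ballP _ _).1 HG.
have cn : continuous (fun q : E => `|q - p|).
  move=> q; have c1 : (q' @[q' --> q] --> q) by exact: cvg_id.
  have c2 : {for q, continuous (fun _ : E => p)} by exact: cst_continuous.
  exact: cvg_norm (cvgB c1 c2).
have [dl dl0 Hd] := carrier_unif_continuous X cn del0.
exists dl => // q Sq h; apply: (H q _ Sq); rewrite -ball_normE /= distrC.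
by have := Hd p q Sp Sq h; rewrite subrr normr0 sub0r normrN normr_id.
Qed.

(** The inequality ties its function y to Delta^k x only almost everywhere. Since neighbourhoods
    have positive volume by [ball_pos], continuity determines y at every point, in particular at the
    base. *)
Lemma ae_eq_on_carrier (y F : E -> R) (z : B -> R) : {within S, continuous y} ->
  continuous F -> {ae vol, forall p : B, y p = z p} -> {ae vol, forall p : B, S p -> F p = z p} ->
  forall p, S p -> y p = F p.
Proof.
move=> cy cF ae1 ae2 p Sp; have [Z [mZ Z0 HZ]] := ae_combine (fun p h1 h2 => conj h1 h2) ae1 ae2.
apply/eqP; rewrite -subr_eq0 -normr_eq0 eq_le normr_ge0 andbT.
apply/ler_addgt0Pr => e e0; rewrite add0r; have e2 : 0 < e / 2 by rewrite divr_gt0.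
have [d1 d10 H1] := continuous_sd_close cy Sp e2.
have [d2 d20 H2] := continuous_sd_close (continuous_subspaceT cF) Sp e2.
have d0 : 0 < Num.min d1 d2 by rewrite lt_min d10.
have [q [Sq]] := ball_pos Sp d0 mZ Z0; rewrite lt_min => /andP[q1 q2] nZ.
have [h1 h2] : (y q = z q) /\ (S q -> F q = z q).
  by apply: contrapT => h; apply: nZ; apply: HZ.
have -> : y p - F p = (y p - y q) - (F p - F q) by rewrite h1 h2 //; ring.
have := H1 q Sq q1; have := H2 q Sq q2 => a2 a3.
by apply: (le_trans (ler_normB _ _)); rewrite [e](splitr e) lerD.
Qed.

(** * Sharpness of the constant *)

Section Sharp.
Variable K' : R.
Hypothesis HK' : kolmogorov_inequality vol nu phi k r lam K'.

Section Extremal.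
Variables (h : 'I_m.+1 -> R) (n : nat).
Hypothesis h0 : forall l, 0 < h l.
Local Notation p0 := base.
(** The equality case of Cauchy-Schwarz at p0, cut off at n so that x is a finite sum and all powers
    of the Laplacian act on it. *)
Let bb i : R := if (0 < i < n)%N then phi i p0 * nu i `^ (2 * k) / wden h (nu i) else 0.
Let x := psum phi bb 0 n.
Let Sn := \sum_(1 <= i < n) phi i p0 ^+ 2 * wgt h (nu i).
Hypothesis Sn0 : 0 < Sn.

Let n_gt0 : (0 < n)%N.
Proof. by rewrite lt0n; apply/eqP => e; move: Sn0; rewrite /Sn big_geq ?ltxx // e. Qed.

Let bb0 i : (n <= i)%N -> bb i = 0.
Proof. by rewrite /bb leqNgt => /negbTE ->; rewrite andbF. Qed.

Let hx : sqint vol x. Proof. exact: psum_sqint. Qed.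

Let xcoef i : inn vol x (phi i) = bb i.
Proof. exact: (L2sum_coef hsq hortho _ (L2sum_finite bb0)). Qed.

Let lcoef0 s i : (n <= i)%N -> lcoef x s i = 0.
Proof. by case: i => [//|i] ni; rewrite /lcoef xcoef bb0 // mul0r. Qed.

Let part s n1 : \sum_(1 <= i < n1) inn vol x (phi i) ^+ 2 * nu i `^ (4 * s) <=
  \sum_(1 <= i < n) inn vol x (phi i) ^+ 2 * nu i `^ (4 * s).
Proof.
apply: sum_tail_le => i; last by rewrite mulr_ge0 ?sqr_ge0 ?powR_ge0.
by move=> ni; rewrite xcoef bb0 // expr0n mul0r.
Qed.

Let lapL s := laplace_powerP (part s).

Let xH0 : H0 vol nu phi (2 * r ord_max) x.
Proof.
split; first exact: hx.
  by rewrite -[LHS]/(inn vol x (phi 0%N)) xcoef /bb.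
apply: (@le_lt_trans _ _ (\sum_(1 <= i < n) inn vol x (phi i) ^+ 2 * nu i `^ (4 * r ord_max))%:E); last exact: ltry.
apply: lime_le.
  by apply: is_cvg_nneseries => *; rewrite lee_fin mulr_ge0 ?powR_ge0 ?exprn_ge0.
apply: nearW => n1; rewrite sumEFin lee_fin; apply: le_trans (part (r ord_max) n1).
rewrite le_eqVlt; apply/orP; left; apply/eqP; apply: eq_bigr => i _.
by rewrite real_normK ?num_real //; congr (_ * _ `^ _); ring.
Qed.

Let D l := L2_norm vol (laplace_power vol nu phi (r l) x).

Let DE l : D l ^+ 2 = \sum_(0 <= i < n) lcoef x (r l) i ^+ 2.
Proof.
rewrite /D -[LHS]/(nrm vol _ ^+ 2) nrm_sqr.
have c1 := L2sum_parseval hsq hortho (lapL (r l)).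
have c2 := L2sum_parseval hsq hortho (L2sum_finite (fun i => @lcoef0 (r l) i)).
rewrite -(cvg_lim (@Rhausdorff R) c1) (cvg_lim (@Rhausdorff R) c2).
by rewrite inn_psum_sqr.
Qed.

(** For the coefficients bb both sides have the terms phi_i(p0)^2 nu_i^(4 k) / wden; the same number
    Sn reappears as the value of Delta^k x at p0. *)
Let hD : \sum_l h l * D l ^+ 2 = Sn.
Proof.
under eq_bigr do rewrite DE mulr_sumr.
rewrite exchange_big /= /Sn big_ltn ?n_gt0 // [X in X + _]big1 ?add0r => [|l _]; last by rewrite expr0n mulr0.
apply: eq_big_nat => i /andP[i0 ilt].
rewrite (eq_bigr (fun l => bb i ^+ 2 * (h l * nu i `^ (4 * r l)))) => [|l _]; last first.
  by rewrite lcoef_sqr // xcoef mulrCA.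
rewrite -mulr_sumr -[X in _ * X]/(wden h (nu i)) /bb i0 ilt /=.
rewrite -[wgt h (nu i)]/(nu i `^ (4 * k) / wden h (nu i)).
have -> : 4 * k = 2 * k + 2 * k by ring.
have w0 := lt0r_neq0 (wden_gt0 r h0 (nu_gt0 i0)).
rewrite powRD_gt0 ?nu_gt0 //; move: (wden h (nu i)) w0 => w w0.
by move: (nu i `^ _) => z; field.
Qed.

(** Let P be the product of the D_l^lambda_l and H that of the (h_l / lambda_l)^lambda_l. The
    inequality at p0 gives Sn <= K' P, and the weighted mean inequality applied to [hD] gives H P^2
    <= Sn; eliminating P leaves Sn H <= K'^2. *)
Lemma extremal_bound :
  0 <= K' /\ Sn * ((\prod_l h l `^ lam l) * \prod_l lam l `^ (- lam l)) <= K' ^+ 2.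
Proof.
have [y [cy aey Cy]] := HK' xH0.
pose F i := projT1 (cid (eigen_continuous i)).
have cF i : continuous (F i) := (projT2 (cid (eigen_continuous i))).1.
have eF i q : S q -> phi i q = F i q := (projT2 (cid (eigen_continuous i))).2 q.
pose G q := \sum_(i < n) lcoef x k i * F i q.
have cG : continuous G by apply: continuous_sumf => i; exact: continuous_scalef.
have GE q : S q -> psum phi (lcoef x k) 0 n q = G q.
  by move=> Sq; rewrite /psum big_mkord; apply: eq_bigr => i _; rewrite eF.
have ae2 : {ae vol, forall p : B, S p -> G p = laplace_power vol nu phi k x p}.
  have : {ae vol, forall p, psum phi (lcoef x k) 0 n p = laplace_power vol nu phi k x p}.
    apply: ae_eq_limit (lapL k) _ => p Sp; apply/cvgrPdist_le => e e0; exists n => // n1 nn /=.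
    by rewrite (psum_trunc _ (fun i => @lcoef0 k i) nn) subrr normr0 ltW.
  by move=> hh; apply: (ae_combine _ hh hh) => p hp _ Sp; rewrite -GE.
have yG := ae_eq_on_carrier cy cG aey ae2.
have Sb := mbaseS X.
have y0 : y p0 = Sn.
  rewrite yG // -GE // /psum /Sn big_ltn ?n_gt0 // mul0r add0r; apply: eq_big_nat => -[//|i] /andP[i0 ilt].
  rewrite /lcoef xcoef /bb i0 ilt /= -[wgt h (nu i.+1)]/(nu i.+1 `^ (4 * k) / wden h (nu i.+1)).
  have -> : 4 * k = 2 * k + 2 * k by ring.
  by rewrite powRD_gt0 ?nu_gt0 //; ring.
have SnC : Sn <= C_norm y.
  rewrite -y0; apply: (le_trans (ler_norm _)); apply: ub_le_sup; last by exists p0.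
  have [_ [b Hb]] := bmeas_continuous cG.
  by exists b => _ [p Sp <-]; rewrite yG //; exact: Hb.
pose P := \prod_l D l `^ lam l.
have P0 : 0 <= P by apply: prodr_ge0 => l _; exact: powR_ge0.
have SP : Sn <= K' * P := le_trans SnC Cy.
have K0 : 0 <= K'.
  rewrite leNgt; apply/negP => Kn; have : K' * P <= 0 by rewrite nmulr_rle0.
  by move=> h1; have := le_lt_trans (le_trans SP h1) Sn0; rewrite ltxx.
split=> //; set H := (X in Sn * X).
have H0' : 0 < H by rewrite mulr_gt0 // prodr_gt0 // => l _; rewrite powR_gt0.
have amgm : H * P ^+ 2 <= Sn.
  have D0 l : 0 <= D l := nrm_ge0 vol _.
  pose w l := h l * D l ^+ 2 / lam l.
  have w0 l : 0 <= w l by rewrite /w !mulr_ge0 ?invr_ge0 ?sqr_ge0 ?(ltW (h0 l)) ?(ltW (hlam l)).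
  have wE : \sum_l lam l * w l = Sn.
    by rewrite -hD; apply: eq_bigr => l _; rewrite mulrCA divff ?mulr1 // gt_eqF.
  have := weighted_amgm hlam hsum w0; rewrite wE => /(_ Sn0); apply: le_trans.
  rewrite le_eqVlt; apply/orP; left; apply/eqP.
  rewrite /H /P -prodrXl -!big_split /=; apply: eq_bigr => l _.
  rewrite /w powRM ?mulr_ge0 ?invr_ge0 ?sqr_ge0 ?(ltW (h0 _)) ?(ltW (hlam _)) //.
  rewrite powRM ?sqr_ge0 ?(ltW (h0 _)) // -powR_inv1 ?(ltW (hlam _)) // -powRrM mulN1r.
  rewrite -(powR_mulrn 2 (powR_ge0 _ _)) -powRrM -(powR_mulrn 2 (D0 l)) -powRrM.
  by rewrite (mulrC 2%:R) mulrAC.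
have S2 : Sn ^+ 2 <= K' ^+ 2 * P ^+ 2.
  by rewrite -exprMn lerXn2r ?nnegrE ?mulr_ge0 // ltW.
rewrite -(ler_pM2l Sn0) mulrA -expr2.
apply: (le_trans (ler_wpM2r (ltW H0') S2)); rewrite -mulrA mulrC ler_wpM2r ?sqr_ge0 //.
by rewrite mulrC.
Qed.

End Extremal.

(** For each h the truncation is removed by letting n grow; the supremum over h is taken last, so
    that it need not be attained. *)
Lemma lower_bound : Num.sqrt (fine (cross_constant M k r lam) * \prod_j lam j `^ (- lam j)) <= K'.
Proof.
pose L := \prod_j lam j `^ (- lam j).
have L0 : 0 < L by apply: prodr_gt0 => l _; rewrite powR_gt0.
have key h : (forall l, 0 < h l) ->
    0 <= K' /\ cser h * ((\prod_l h l `^ lam l) * L) <= K' ^+ 2.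
  move=> h0; have c1 := wgt_partial_cvg (mbaseS X) h0.
  have [n0 _ Hn] : \forall n \near \oo, 0 < \sum_(1 <= i < n) phi i base ^+ 2 * wgt h (nu i).
    exact: cvgr_gt c1 _ (cser_gt0 h0).
  split; first by have [] := extremal_bound h0 (Hn n0 (leqnn _)).
  have c2 : (\sum_(1 <= i < n) phi i base ^+ 2 * wgt h (nu i)) * ((\prod_l h l `^ lam l) * L) @[n --> \oo]
     --> cser h * ((\prod_l h l `^ lam l) * L) by exact: cvgMr_tmp c1.
  apply: (cvg_le_bound c2 (n0 := n0)) => n nn.
  by have [] := extremal_bound h0 (Hn n nn).
have K0 : 0 <= K' by have [] := key (fun=> 1) (fun=> ltr01).
rewrite -(ger0_norm K0) -sqrtr_sqr ler_wsqrtr // -/L -ler_pdivlMr //.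
rewrite -lee_fin fineK; last exact: (cross_constant_fin hm hr hlam hsum hk).
apply: ge_ereal_sup => _ [h /= h0 <-].
have [_ H] := key h h0.
rewrite -(fineK (cross_series_fin hm hr hlam hsum hk h0)) -EFinM lee_fin ler_pdivlMr //.
by apply: le_trans H; rewrite mulrA [X in X * L]mulrC -mulrA mulrA mulrAC.
Qed.

End Sharp.
End Weighted.
End Basis.
End Volume.

(** * The model of the sphere *)

Section Sphere.
Variables (R : realType) (b : nat) (hb : (0 < b)%N).
Local Notation M := (Sphere hb).
Local Notation E := 'M[R]_(1, b.+1).
Implicit Types (p q u v x y : E).

Let ee (j : 'I_b.+1) : E := delta_mx ord0 j.
Let e0 : E := ee ord0.
Let el (i : 'I_b) : E := ee (lift ord0 i).

Definition hreflect (k : R) u x : E := x + k *: (dot x u *: u).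

Let sphereP p : carrier R M p <-> dot p p = 1.
Proof.
rewrite /carrier /unit_sphere /= (_ : \sum_(i < b.+1) p ord0 i ^+ 2 = dot p p) //.
by rewrite /dot big_ord1; apply: eq_bigr => i _; rewrite expr2.
Qed.

(** The condition on k covers the Householder reflection k = -2 / |u|^2 and the identity k = 0; the
    latter arises, through the convention 1/0 = 0, when the two points to be swapped coincide. *)
Let hreflect_dot k u x y : k * (2 + k * dot u u) = 0 ->
  dot (hreflect k u x) (hreflect k u y) = dot x y.
Proof.
move=> hk; rewrite /hreflect !dotDl !dotDr !dotZl !dotZr (dotC u y).
transitivity (dot x y + dot x u * dot y u * (k * (2 + k * dot u u))); first by ring.
by rewrite hk mulr0 addr0.
Qed.

Let hreflectK k u : k * (2 + k * dot u u) = 0 -> involutive (hreflect k u).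
Proof.
move=> hk x; rewrite /hreflect !dotDl !dotZl.
transitivity (x + (dot x u * (k * (2 + k * dot u u))) *: u); last by rewrite hk mulr0 scale0r addr0.
rewrite -addrA; congr (x + _); rewrite !scalerA -scalerDl; congr (_ *: _); ring.
Qed.

Let hreflect_symm k u : k * (2 + k * dot u u) = 0 -> @symm R M (hreflect k u).
Proof.
move=> hk; have H : @ortho_map R M (hreflect k u).
  split=> [a x y|x y|x]; last 2 first.
  - exact: hreflect_dot.
  - by rewrite !sphereP hreflect_dot.
  rewrite /hreflect dotDl dotZl scalerDl !scalerDr !scalerA !addrA; congr (_ + _).
  by rewrite addrAC; congr (_ + _ + _); congr (_ *: _); ring.
by exists (hreflect k u); split => //; exact: hreflectK.
Qed.

Let sphere_swap p q : carrier R M p -> carrier R M q ->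
  exists g, [/\ @symm R M g, g p = q & g q = p].
Proof.
rewrite !sphereP => Sp Sq; pose u := p - q; pose k := - 2 / dot u u.
have hk : k * (2 + k * dot u u) = 0.
  rewrite /k; have [->|n0] := eqVneq (dot u u) 0; first by rewrite invr0 !mulr0 !mul0r.
  by field.
have sg := hreflect_symm hk; have gp : hreflect k u p = q.
  have [u0|n0] := eqVneq (dot u u) 0.
    have /eqP := dot_eq0 u0; rewrite /u subr_eq0 => /eqP e.
    by rewrite /hreflect /k u0 invr0 mulr0 scale0r addr0.
  have uu : dot u u = 2 * dot p u.
    by rewrite /u !dotDl !dotDr !dotNl !dotNr (dotC q p) Sp Sq; ring.
  have pu0 : dot p u != 0 by apply: contra_neq n0 => h; rewrite uu h mulr0.
  rewrite /hreflect scalerA (_ : k * dot p u = -1); last by rewrite /k uu; field.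
  by rewrite scaleN1r /u opprB addrC subrK.
exists (hreflect k u); split => //; by rewrite -gp hreflectK.
Qed.

(** The half angle makes the reflection along this vector send e0 to cos t e0 + sin t e_i. At t = 0
    it is not the identity, but it fixes e0. *)
Let uvec (i : 'I_b) (t : R) : E := trig_curve (1 / 2) 0 (- el i) e0 t.
Let flow i t := hreflect (- 2) (uvec i t).

Let dot_ee i j : dot (ee i) (ee j) = (i == j)%:R.
Proof. by rewrite dot_delta mxE eqxx eq_sym. Qed.

Let d00 : dot e0 e0 = 1. Proof. by rewrite dot_ee eqxx. Qed.
Let dll i : dot (el i) (el i) = 1. Proof. by rewrite dot_ee eqxx. Qed.
Let d0l i : dot e0 (el i) = 0. Proof. by rewrite dot_ee. Qed.
Let dl0 i : dot (el i) e0 = 0. Proof. by rewrite dotC d0l. Qed.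

Let uvec_dot i t : dot (uvec i t) (uvec i t) = 1.
Proof.
rewrite /uvec /trig_curve add0r !dotDl !dotDr !dotZl !dotZr !dotNl !dotNr d00 dll d0l dl0.
by rewrite -[RHS](cos2Dsin2 (1 / 2 * t)); ring.
Qed.

Let flow_symm i t : @symm R M (flow i t).
Proof. by apply: hreflect_symm; rewrite uvec_dot; ring. Qed.

Let flow_base i t : flow i t e0 = trig_curve 1 0 e0 (el i) t.
Proof.
rewrite /flow /hreflect /uvec /trig_curve !add0r (mul1r t).
rewrite dotDr !dotZr dotNr d00 d0l oppr0 mulr0 add0r mulr1.
have tE : t = 1 / 2 * t + 1 / 2 * t by field.
rewrite [in RHS]tE cosD sinD; set c := cos _; set s := sin _.
have cs : c ^+ 2 + s ^+ 2 = 1 by exact: cos2Dsin2.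
rewrite !scalerDr !scalerN !scalerA addrA addrAC -{1}[e0]scale1r -scalerDl -scaleNr.
by move: c s cs => c s cs; congr (_ *: _ + _ *: _); [lra|ring].
Qed.

Let flow_derivable i x : derivable (fun t => flow i t x) (0 : R) 1.
Proof.
have du := is_derive_trig_curve (1 / 2) (0 : E) (- el i) e0 0.
set du' := trig_curve _ _ _ _ _ in du.
have dx : is_derive (0 : R) 1 (fun _ : R => x) (0 : E) by exact: is_derive_cst.
have dd := is_derive_dot dx du.
set d1 := (X in is_derive _ _ _ X) in dd.
have dm : is_derive (0 : R) 1 (fun t : R => dot x (uvec i t) *: uvec i t)
    (\matrix_(a, j) (d1 * uvec i 0 a j + dot x (uvec i 0) * du' a j)).
  apply: is_derive_mx => a j.
  rewrite (_ : (fun t => _) = fun t => dot x (uvec i t) * uvec i t a j); last first.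
    by apply/funext => t; rewrite mxE.
  by rewrite mxE; exact: is_derive_mulf dd (is_derive_coord a j du).
exact: is_derive_derivable (is_derive_addf dx (is_derive_scalef (- 2) dm)).
Qed.

Let sphere_tangent (c : R -> E) : @smooth_curve R M c -> c 0 = e0 ->
  dot (derive1 c 0) e0 = 0.
Proof.
move=> [sc cS] c0; have dc := smooth_derive1 0 sc.
have d1 := is_derive_dot dc dc; rewrite c0 (dotC e0) in d1.
have d2 : is_derive (0 : R) 1 (fun t => dot (c t) (c t)) (0 : R).
  rewrite (_ : (fun t => _) = fun=> 1); first exact: is_derive_cst.
  by apply/funext => t; exact: (sphereP _).1 (cS t).
have := is_derive_val d1; rewrite (is_derive_val d2) => /esym.
by rewrite derive1E => h; move: (dot _ _) h => z; lra.
Qed.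

Let sphere_expand v : v = dot v e0 *: e0 + \sum_i dot v (el i) *: el i.
Proof.
rewrite {1}[v]matrix_sum_delta big_ord1 big_ord_recl; congr (_ *: _ + _); rewrite ?dot_delta //.
by apply: eq_bigr => i _; rewrite dot_delta.
Qed.

Let metricE u v : @metric R M u v = dot u v.
Proof. by rewrite /metric /= mul1r. Qed.

Let sphere_dot_bound p q : carrier R M p -> carrier R M q -> -1 <= dot p q <= 1.
Proof.
rewrite !sphereP => Sp Sq; have h1 := dot_ge0 (p + q); have h2 := dot_ge0 (p - q).
move: h1 h2; rewrite !dotDl !dotDr !dotNl !dotNr (dotC q p) Sp Sq => h1 h2.
by move: (dot p q) h1 h2 => z h1 h2; apply/andP; split; lra.
Qed.

Let coord_sum q : carrier R M q -> \sum_i dot (el i) q ^+ 2 = 1 - dot e0 q ^+ 2.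
Proof.
move=> Sq; have h : dot q q = 1 by exact: (sphereP q).1 Sq.
rewrite /dot big_ord1 big_ord_recl in h.
rewrite (eq_bigr (fun i => q ord0 (lift ord0 i) * q ord0 (lift ord0 i))).
  by rewrite (dotC e0) dot_delta -h expr2 addrAC subrr add0r.
by move=> i _; rewrite dotC dot_delta expr2.
Qed.

Lemma sphere_model : @cross_model R M.
Proof.
have b0 : cross_dim M = b by [].
(* The inner product runs over [-1, 1], hence kappa = 2; the eigenvalues j (j + b - 1) give rho = 1,
   and the unit speed geodesics have frequency 1. *)
apply: (@CrossModel R M e0 2 1 1 (fun=> 0) (fun=> e0) el flow).
- by apply/sphereP; rewrite dot_ee eqxx.
- have c1 : closed ([set 1] : set R) by exact: closed_eq.
  have cd : continuous (fun p : E => dot p p).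
    apply: continuous_sumf => i; apply: continuous_sumf => j p.
    have c2 : (x i j : R) @[x --> p] --> (p i j : R) by exact: coord_continuous.
    by have c3 := c2; exact: (cvgM c2 c3).
  rewrite (_ : carrier R M = (fun p : E => dot p p) @^-1` [set 1]).
    by apply: closed_comp => // p _; exact: cd.
  by apply/seteqP; split=> p /sphereP.
- by move=> p /sphereP.
- by [].
- by [].
- by move=> p q Sp Sq; have /andP[h1 h2] := sphere_dot_bound Sp Sq; rewrite divr_ge0 // subr_ge0.
- move=> p q Sp Sq; have /andP[h1 h2] := sphere_dot_bound Sp Sq.
  by rewrite ler_pdivrMr // mul1r; move: (dot p q) h1 => z; lra.
- exact: sphere_swap.
- exact: flow_symm.
- exact: flow_base.
- exact: flow_derivable.
- by move=> i; rewrite add0r.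
- by move=> i j; rewrite metricE !scale1r dot_ee.
- move=> c sc c0; rewrite [LHS]sphere_expand (sphere_tangent sc c0) scale0r add0r.
  by apply: eq_bigr => i _; rewrite metricE !scale1r.
- by move=> c sc c0 i; rewrite !dotZr (sphere_tangent sc c0) !mulr0.
- move=> q Sq; rewrite (eq_bigr (fun i => dot (el i) q ^+ 2)) => [|i _]; last by rewrite scale1r.
  by rewrite coord_sum //; move: (dot e0 q) => z; field.
- move=> q Sq; rewrite (eq_bigr (fun=> - dot e0 q)) => [|i _]; last first.
    by rewrite !dotZl; ring.
  rewrite sumr_const card_ord -[LHS]mulr_natr /cross_alpha /cross_beta /=.
  by move: (dot e0 q) (b%:R) => z y; field.
- by move=> j; rewrite /cross_alpha /cross_beta /=; move: (j%:R) (b%:R) => x y; field.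
Qed.

End Sphere.

(** * Projective spaces as Hermitian projections over a composition algebra *)

Section HermitianProjections.
Variables (R : realType) (D nn : nat).
Local Notation n := nn.+2.
Local Notation V := 'rV[R]_D.
Variables (mul : V -> V -> V) (conj : V -> V) (one : V).
Implicit Types (x y z u : V).
Local Notation "x ** y" := (mul x y) (at level 40, left associativity).
Local Notation re x := (dot x one).
(** A composition algebra with unit. [adjl] and [mulVl] stand in for associativity, which fails for
    the octonions: multiplicativity of the norm and the flexible and Moufang laws follow from
    them. *)
Hypotheses (mulDl : forall (a : R) x y z, (a *: x + y) ** z = a *: (x ** z) + y ** z)
  (mulDr : forall (a : R) x y z, z ** (a *: x + y) = a *: (z ** x) + z ** y)
  (conjE : forall x, conj x = (2 * re x) *: one - x)
  (conjM : forall x y, conj (x ** y) = conj y ** conj x)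
  (one_dot : dot one one = 1)
  (mul1 : forall x, one ** x = x) (mulx1 : forall x, x ** one = x)
  (adjl : forall u x y, dot (u ** x) y = dot x (conj u ** y))
  (mulVl : forall u x, conj u ** (u ** x) = dot u u *: x).

Lemma conj_lin (a : R) x y : conj (a *: x + y) = a *: conj x + conj y.
Proof.
rewrite !conjE dotDl dotZl scalerBr scalerA mulrDr scalerDl !opprD !addrA.
by rewrite -!addrA; congr (_ *: _ + _); [ring|rewrite addrCA].
Qed.

Lemma conjD x y : conj (x + y) = conj x + conj y.
Proof. by have := conj_lin 1 x y; rewrite !scale1r. Qed.

Lemma re_conj x : re (conj x) = re x.
Proof. by rewrite conjE dotDl dotZl dotNl one_dot; ring. Qed.

Lemma conjK x : conj (conj x) = x.
Proof. by rewrite [LHS]conjE re_conj conjE opprB addrC subrK. Qed.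

Lemma conj1 : conj one = one.
Proof. by rewrite conjE one_dot mulr1 -{2}[one]scale1r -scalerBl (_ : 2 - 1 = 1) ?scale1r //; ring. Qed.

Lemma dot_conj x y : dot (conj x) (conj y) = dot x y.
Proof. by rewrite !conjE !dotDl !dotDr !dotZl !dotZr !dotNl !dotNr one_dot (dotC one y); ring. Qed.

Lemma conj0 : conj 0 = 0.
Proof. by rewrite conjE dot0l mulr0 scale0r subr0. Qed.

Lemma conjZ (a : R) x : conj (a *: x) = a *: conj x.
Proof. by have := conj_lin a x 0; rewrite !addr0 conj0 addr0. Qed.

Lemma mul0v x : 0 ** x = 0.
Proof. by have := mulDl (-1) 0 0 x; rewrite scaler0 addr0 scaleN1r addNr. Qed.
Lemma mulv0 x : x ** 0 = 0.
Proof. by have := mulDr (-1) 0 0 x; rewrite scaler0 addr0 scaleN1r addNr. Qed.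
Lemma mulAl x y z : (x + y) ** z = x ** z + y ** z.
Proof. by have := mulDl 1 x y z; rewrite !scale1r. Qed.
Lemma mulAr x y z : z ** (x + y) = z ** x + z ** y.
Proof. by have := mulDr 1 x y z; rewrite !scale1r. Qed.
Lemma mulZl (a : R) x z : (a *: x) ** z = a *: (x ** z).
Proof. by have := mulDl a x 0 z; rewrite !addr0 mul0v addr0. Qed.
Lemma mulZr (a : R) x z : z ** (a *: x) = a *: (z ** x).
Proof. by have := mulDr a x 0 z; rewrite !addr0 mulv0 addr0. Qed.

Lemma mulVr u x : u ** (conj u ** x) = dot u u *: x.
Proof. by have := mulVl (conj u) x; rewrite conjK dot_conj. Qed.

Lemma adjr u x y : dot (x ** u) y = dot x (y ** conj u).
Proof. by rewrite -dot_conj conjM adjl -[RHS]dot_conj conjM. Qed.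

Lemma mulrVr u x : (x ** conj u) ** u = dot u u *: x.
Proof. by apply: (can_inj conjK); rewrite !conjM conjK conjZ mulVl. Qed.

Lemma mulrVl u x : (x ** u) ** conj u = dot u u *: x.
Proof. by have := mulrVr (conj u) x; rewrite conjK dot_conj. Qed.

Lemma norm_mul x y : dot (x ** y) (x ** y) = dot x x * dot y y.
Proof. by rewrite adjl mulVl dotZr. Qed.

Lemma mul_conj x : x ** conj x = dot x x *: one.
Proof. by have := mulVr x one; rewrite mulx1. Qed.

Lemma conj_mul x : conj x ** x = dot x x *: one.
Proof. by have := mulVl x one; rewrite mulx1. Qed.

Lemma re_mul x y : re (x ** y) = dot x (conj y).
Proof. by rewrite adjr mul1. Qed.

Lemma mulNr x z : z ** (- x) = - (z ** x).
Proof. by rewrite -scaleN1r mulZr scaleN1r. Qed.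
Lemma mulNl x z : (- x) ** z = - (x ** z).
Proof. by rewrite -scaleN1r mulZl scaleN1r. Qed.

(** Polarization of <x b, x e> = |x|^2 <b, e> at x = a + c. *)
Lemma exchange a b c e :
  dot (a ** b) (c ** e) + dot (a ** e) (c ** b) = 2 * dot a c * dot b e.
Proof.
have h x : dot (x ** b) (x ** e) = dot x x * dot b e by rewrite adjl mulVl dotZr.
have := h (a + c); rewrite !mulAl !dotDl !dotDr !h (dotC c a) (dotC (a ** e)).
by move: (dot _ _) (dot (a ** b) _) (dot (c ** b) _) (dot a a) (dot c c) (dot a c) => *; nra.
Qed.

Lemma bimul_dot u x y z : dot ((u ** x) ** (y ** u)) z =
  2 * dot (u ** x) (conj y) * dot u z - dot u u * dot (conj (x ** y)) z.
Proof.
have := exchange y u (conj (u ** x)) z.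
rewrite -adjl conjM mulrVr dotZr -conjM -(dot_conj y) conjK (dotC (conj y)).
rewrite (adjl y) (dotC z) -conjM (dotC _ z) => /(canRL (addrK _)) -> //.
Qed.

(** By [bimul_dot], the left side tested against any z depends on x and y only through x y, because
    <u x, conj y> = <u, conj (x y)>; so the pair (x, y) may be replaced by (x y, 1). *)
Lemma moufang u x y : (u ** x) ** (y ** u) = (u ** (x ** y)) ** u.
Proof.
have e z : dot ((u ** x) ** (y ** u) - (u ** (x ** y)) ** u) z = 0.
  have -> : (u ** (x ** y)) ** u = (u ** (x ** y)) ** (one ** u) by rewrite mul1.
  rewrite dotDl dotNl !bimul_dot mulx1 conj1 re_mul.
  by rewrite (_ : dot (u ** x) (conj y) = dot u (conj (x ** y))) ?subrr // adjr -conjM.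
by apply/eqP; rewrite -subr_eq0; apply/eqP/dot_eq0/e.
Qed.

Lemma flexible u x : (u ** x) ** u = u ** (x ** u).
Proof. by have := moufang u one x; rewrite mul1 mulx1. Qed.

Lemma flexible_conj u x : (u ** x) ** conj u = u ** (x ** conj u).
Proof. by rewrite conjE !(mulAr, mulNr, mulZr) !mulx1 flexible. Qed.

Lemma mul_suml (I : finType) (F : I -> V) z : (\sum_l F l) ** z = \sum_l F l ** z.
Proof. by elim/big_rec2: _ => [|l x y _ <-]; rewrite ?mul0v // mulAl. Qed.
Lemma mul_sumr (I : finType) (F : I -> V) z : z ** (\sum_l F l) = \sum_l z ** F l.
Proof. by elim/big_rec2: _ => [|l x y _ <-]; rewrite ?mulv0 // mulAr. Qed.
Lemma conj_sum (I : finType) (F : I -> V) : conj (\sum_l F l) = \sum_l conj (F l).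
Proof. by elim/big_rec2: _ => [|l x y _ <-]; rewrite ?conj0 // conjD. Qed.

Local Notation F := ('I_n -> 'I_n -> V).
Implicit Types f g : F.

Definition star f : F := fun a b => conj (f b a).
Definition mm f g : F := fun a b => \sum_l f a l ** g l b.

Lemma starK f : star (star f) = f.
Proof. by apply/funext => a; apply/funext => b; rewrite /star conjK. Qed.

Definition projf f : Prop := [/\ star f = f, mm f f = f & \sum_a f a a = one].

Lemma herm_diag f a : star f = f -> f a a = re (f a a) *: one.
Proof.
move=> sf; have h : conj (f a a) = f a a by rewrite -[RHS](congr1 (fun k => k a a) sf).
rewrite conjE in h; have h2 : (2 * re (f a a)) *: one = 2 *: f a a.
  by rewrite -[LHS](subrK (f a a)) h -mulr2n scaler_nat.
by apply: (@scalerI _ _ (2 : R)); rewrite ?pnatr_eq0 // -h2 scalerA.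
Qed.

Lemma herm_conj f a b : star f = f -> conj (f a b) = f b a.
Proof. by move=> sf; rewrite -[RHS](congr1 (fun k => k b a) sf). Qed.

(* Cauchy-Schwarz gives |f_ab|^2 <= f_aa f_bb, with equality because the traces
   of f and of its square are 1; then the terms of the sum f_ab = sum_l f_al f_lb
   have norms adding up to |f_ab|, and so are aligned. *)
Lemma proj_rank1 f : projf f -> [/\ \sum_a re (f a a) = 1,
  forall a, 0 <= re (f a a),
  forall a b, dot (f a b) (f a b) = re (f a a) * re (f b b)
  & forall a l b, f a l ** f l b = re (f l l) *: f a b].
Proof.
move=> [sf ff tr]; pose r a := re (f a a); pose N a b := dot (f a b) (f a b).
have N0 a b : 0 <= N a b by exact: dot_ge0.
have NC a b : N a b = N b a by rewrite /N -(herm_conj b a sf) dot_conj.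
have S1 : \sum_a r a = 1 by rewrite /r -dot_suml tr.
have S2 a : \sum_b N a b = r a.
  rewrite /r -[in RHS](congr1 (fun k => k a a) ff) /mm dot_suml; apply: eq_bigr => b _.
  by rewrite re_mul herm_conj.
have r0 a : 0 <= r a by rewrite -S2; exact: sumr_ge0.
have Nle a b : N a b <= r b.
  by rewrite NC -S2 (bigD1 a) //= lerDl; exact: sumr_ge0.
have S3 a b : N a b <= r a * r b.
  pose A l := conj (f a l) ** f a b.
  have AB : \sum_l dot (A l) (f l b) = N a b.
    rewrite [RHS]/N -[X in _ = dot _ X](congr1 (fun k => k a b) ff) /mm dotC dot_suml; apply: eq_bigr => l _.
    by rewrite /A adjl conjK dotC.
  have AA : \sum_l dot (A l) (A l) = r a * N a b.
    by rewrite -S2 mulr_suml; apply: eq_bigr => l _; rewrite /A norm_mul dot_conj.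
  have BB : \sum_l dot (f l b) (f l b) = r b.
    by rewrite -S2; apply: eq_bigr => l _; rewrite -/(N l b) NC.
  have : 0 <= \sum_l dot (r b *: A l - N a b *: f l b) (r b *: A l - N a b *: f l b).
    by apply: sumr_ge0 => l _; exact: dot_ge0.
  rewrite (_ : \sum_l _ = r b * N a b * (r a * r b - N a b)); last first.
    transitivity (\sum_l (r b ^+ 2 * dot (A l) (A l) - 2 * r b * N a b * dot (A l) (f l b)
        + N a b ^+ 2 * dot (f l b) (f l b))); last first.
      by rewrite big_split sumrB /= -!mulr_sumr AA AB BB; ring.
    apply: eq_bigr => l _.
    by rewrite !dotDl !dotDr !dotNl !dotNr !dotZl !dotZr (dotC (f l b) (A l)); ring.
  have := N0 a b; rewrite le_eqVlt => /orP[/eqP <- _|Np]; first by rewrite mulr_ge0.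
  have rp : 0 < r b by exact: lt_le_trans Np (Nle a b).
  by rewrite pmulr_rge0 ?mulr_gt0 // subr_ge0.
have S4 a b : N a b = r a * r b.
  have e : \sum_a \sum_b (r a * r b - N a b) = 0.
    transitivity (\sum_a (r a * 1 - r a)); last by rewrite big1 // => l _; rewrite mulr1 subrr.
    by apply: eq_bigr => l _; rewrite sumrB S2 -mulr_sumr S1.
  have e1 := psumr_eq0P (fun a _ => sumr_ge0 (P := xpredT) _ (fun b _ => _)) e.
  have e2 : \sum_b (r a * r b - N a b) = 0.
    by apply: e1 => // x y; rewrite subr_ge0.
  have := psumr_eq0P (P := xpredT) (F := fun b => r a * r b - N a b) _ e2.
  move=> /(_ (fun b _ => _)) h; apply/esym/eqP; rewrite -subr_eq0; apply/eqP/h => //.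
  by move=> x; rewrite subr_ge0.
split=> // a l b; pose w m := f a m ** f m b.
have ww m : dot (w m) (w m) = r m ^+ 2 * N a b by rewrite norm_mul -!/(N _ _) !S4; ring.
have dif m : dot (w m - r m *: f a b) (w m - r m *: f a b) = 2 * r m * (r m * N a b - dot (w m) (f a b)).
  by rewrite !dotDl !dotDr !dotNl !dotNr !dotZl !dotZr (dotC (f a b) (w m)) ww -/(N a b); ring.
have t0 m : 0 <= r m * N a b - dot (w m) (f a b).
  have := dot_ge0 (w m - r m *: f a b); rewrite dif.
  have := r0 m; rewrite le_eqVlt => /orP[/eqP rm|rm]; last by rewrite pmulr_rge0 // mulr_gt0.
  have : dot (w m) (w m) = 0 by rewrite ww -rm expr0n mul0r.
  by move=> /dot_eq0 ->; rewrite dot0l -rm mul0r subrr.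
have ts : \sum_m (r m * N a b - dot (w m) (f a b)) = 0.
  rewrite sumrB -mulr_suml S1 mul1r -dot_suml -[\sum_m w m]/(mm f f a b) ff.
  by rewrite subrr.
have tl : r l * N a b - dot (w l) (f a b) = 0.
  by apply: (psumr_eq0P (P := xpredT) (F := fun m => r m * N a b - dot (w m) (f a b)) _ ts) => // m _.
apply/eqP; rewrite -subr_eq0; apply/eqP/dot_eq0; rewrite -/(r l) -/(w l) dif tl mulr0 //.
Qed.

(** For three indices, idempotency reduces to norm identities and one product identity: cancelling a
    factor in f_il f_lj = r_l f_ij, or in its conjugate, yields the other products. In this form it
    can be verified over the octonions. *)
Lemma three_idem f i j l : i != j -> l != i -> l != j ->
  (forall a, [|| a == i, a == j | a == l]) -> star f = f -> \sum_a re (f a a) = 1 ->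
  dot (f i j) (f i j) = re (f i i) * re (f j j) ->
  dot (f i l) (f i l) = re (f i i) * re (f l l) ->
  dot (f j l) (f j l) = re (f j j) * re (f l l) ->
  f i l ** f l j = re (f l l) *: f i j -> mm f f = f.
Proof.
move=> ij li lj all3 sf S1 Nij Nil Njl Bij.
have sum3 (W : nmodType) (G : 'I_n -> W) : \sum_a G a = G i + G j + G l.
  rewrite (bigD1 i) //= (bigD1 j) 1?eq_sym //= (bigD1 l) //= ?li ?lj // big_pred0 ?addr0 ?addrA // => a.
  by have := all3 a; case: (a == i); case: (a == j); case: (a == l).
have hd a := herm_diag a sf; have hc a b := herm_conj a b sf.
rewrite sum3 in S1; set ri := re (f i i) in S1 Nij Nil *; set rj := re (f j j) in S1 Nij Njl *.
set t := re (f l l) in S1 Nil Njl Bij *.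
have K1 : f i j ** f j l = rj *: f i l.
  (* The cancellation divides by t; for t = 0 the norm identities make f i l and f j l vanish. *)
  have [t0|t0] := eqVneq t 0.
    have -> : f i l = 0 by apply: dot_eq0; rewrite Nil t0 mulr0.
    have -> : f j l = 0 by apply: dot_eq0; rewrite Njl t0 mulr0.
    by rewrite mulv0 scaler0.
  apply: (scalerI t0); rewrite -mulZl -Bij -(hc l j) mulrVl -(hc j l) dot_conj Njl scalerA.
  by rewrite mulrC.
have K2 : f j i ** f i l = ri *: f j l.
  have [t0|t0] := eqVneq t 0.
    have -> : f i l = 0 by apply: dot_eq0; rewrite Nil t0 mulr0.
    have -> : f j l = 0 by apply: dot_eq0; rewrite Njl t0 mulr0.
    by rewrite mulv0 scaler0.
  have Bji : f j l ** f l i = t *: f j i.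
    by rewrite -(hc i j) -conjZ -Bij conjM !hc.
  apply: (scalerI t0); rewrite -mulZl -Bji -(hc l i) mulrVl -(hc i l) dot_conj Nil scalerA.
  by rewrite mulrC.
have Sx : ri + rj + t = 1 by exact: S1.
have P a b : f a b ** f b a = dot (f a b) (f a b) *: one by rewrite -(hc a b) mul_conj.
have Nc a b : dot (f b a) (f b a) = dot (f a b) (f a b) by rewrite -(hc a b) dot_conj.
have dz (p : R) : dot (p *: one) (p *: one) = p * p by rewrite dotZl dotZr one_dot mulr1.
have E (a b : 'I_n) : mm f f a b = f a b -> mm f f b a = f b a.
  move=> h; rewrite -[RHS](hc a b) -h /mm conj_sum; apply: eq_bigr => m _.
  by rewrite conjM !hc.
have Eii : mm f f i i = f i i.
  rewrite /mm sum3 !P Nij Nil (hd i) dz -/ri -!(scalerDl one); congr (_ *: _).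
  by transitivity (ri * (ri + rj + t)); [ring | rewrite Sx mulr1].
have Ejj : mm f f j j = f j j.
  rewrite /mm sum3 !P (Nc i j) Nij Njl (hd j) dz -/rj -!(scalerDl one); congr (_ *: _).
  by transitivity (rj * (ri + rj + t)); [ring | rewrite Sx mulr1].
have Ell : mm f f l l = f l l.
  rewrite /mm sum3 !P (Nc i l) Nil (Nc j l) Njl (hd l) dz -/t -!(scalerDl one); congr (_ *: _).
  by transitivity (t * (ri + rj + t)); [ring | rewrite Sx mulr1].
have Eij : mm f f i j = f i j.
  rewrite /mm sum3 (hd i) (hd j) Bij mulZl mul1 mulZr mulx1 -/ri -/rj -!scalerDl.
  by rewrite Sx scale1r.
have Eil : mm f f i l = f i l.
  rewrite /mm sum3 (hd i) (hd l) K1 mulZl mul1 mulZr mulx1 -/ri -/t -!scalerDl.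
  by rewrite Sx scale1r.
have Ejl : mm f f j l = f j l.
  rewrite /mm sum3 (hd j) (hd l) K2 mulZl mul1 mulZr mulx1 -/rj -/t -!scalerDl.
  by rewrite Sx scale1r.
apply/funext => a; apply/funext => b.
have := all3 a; have := all3 b; do 2! case/or3P=> /eqP ->; by [|exact: E].
Qed.

Section Block.
Variables (i j : 'I_n) (c s : R) (u : V).
Hypotheses (ij : i != j) (cs : c ^+ 2 + s ^+ 2 = 1) (u1 : dot u u = 1).

(* Multiplication on the left by the symmetry ((c, s u), (s u^* , - c)) of the
   coordinates i and j. *)
Definition lrow f : F := fun a b =>
  if a == i then c *: f i b + s *: (u ** f j b)
  else if a == j then s *: (conj u ** f i b) - c *: f j b else f a b.
Definition rcol f : F := star (lrow (star f)).
Definition block f : F := rcol (lrow f).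

Let ji : (j == i) = false. Proof. by rewrite eq_sym (negbTE ij). Qed.
Lemma rcolE f a b : rcol f a b =
  if b == i then c *: f a i + s *: (f a j ** conj u)
  else if b == j then s *: (f a i ** u) - c *: f a j else f a b.
Proof.
rewrite /rcol /star /lrow; case: eqP => _; first by rewrite conjD !conjZ conjM !conjK.
case: eqP => _; last by rewrite conjK.
by rewrite conjD !conjZ -scaleNr conjZ scaleNr conjM !conjK.
Qed.

Let sq0 (x y : V) : c *: (c *: x + s *: y) + s *: (s *: x - c *: y) = x.
Proof.
apply/rowP => t; rewrite !mxE; transitivity ((c ^+ 2 + s ^+ 2) * x ord0 t); first by ring.
by rewrite cs mul1r.
Qed.

Let sq1 (x y : V) : s *: (c *: y + s *: x) - c *: (s *: y - c *: x) = x.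
Proof.
apply/rowP => t; rewrite !mxE; transitivity ((c ^+ 2 + s ^+ 2) * x ord0 t); first by ring.
by rewrite cs mul1r.
Qed.

Lemma lrowK f : lrow (lrow f) = f.
Proof.
apply/funext => a; apply/funext => b; rewrite /lrow eqxx ji eqxx.
case: eqP => [->|_]; first by rewrite mulAr mulNr !mulZr mulVr u1 scale1r sq0.
case: eqP => [->|//]; by rewrite mulAr !mulZr mulVl u1 scale1r sq1.
Qed.

Lemma rcolK f : rcol (rcol f) = f.
Proof. by rewrite /rcol starK lrowK starK. Qed.

(** Rows and columns are multiplied by the same u and its conjugate, so the two orders differ only
    by reassociations covered by the flexible laws. *)
Lemma lrow_rcol f : lrow (rcol f) = rcol (lrow f).
Proof.
have fc x : (conj u ** x) ** u = conj u ** (x ** u) by have := flexible_conj (conj u) x; rewrite conjK.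
apply/funext => a; apply/funext => b; rewrite rcolE /lrow !rcolE.
by case: (a == i); case: (a == j); case: (b == i); case: (b == j);
  rewrite ?mulAr ?mulAl ?mulNr ?mulNl ?mulZr ?mulZl ?flexible ?flexible_conj ?fc;
  apply/rowP => t; rewrite ?mxE; ring.
Qed.

Lemma blockK f : block (block f) = f.
Proof. by rewrite /block (lrow_rcol (lrow f)) lrowK rcolK. Qed.

Lemma block_star f : star f = f -> star (block f) = block f.
Proof.
move=> sf; rewrite /block {1}/rcol starK -lrow_rcol; congr (lrow _).
by rewrite /rcol sf.
Qed.

Definition fdot f g : R := \sum_a \sum_b dot (f a b) (g a b).

Lemma fdot_star f g : fdot (star f) (star g) = fdot f g.
Proof.
rewrite /fdot exchange_big; apply: eq_bigr => a _; apply: eq_bigr => b _.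
exact: dot_conj.
Qed.

Lemma lrow_dot f g : fdot (lrow f) (lrow g) = fdot f g.
Proof.
rewrite /fdot exchange_big [RHS]exchange_big; apply: eq_bigr => b _.
rewrite (bigD1 i) //= (bigD1 j) //= 1?eq_sym // [RHS](bigD1 i) //= [in RHS](bigD1 j) //= 1?eq_sym //.
rewrite !addrA; congr (_ + _); last first.
  by apply: eq_bigr => a /andP[ai aj]; rewrite /lrow (negbTE ai) (negbTE aj).
rewrite /lrow !eqxx ji; set p := f i b; set q := f j b; set p' := g i b; set q' := g j b.
rewrite !dotDl !dotDr !dotNl !dotNr !dotZl !dotZr.
have e1 : dot (u ** q) (u ** q') = dot q q' by rewrite adjl mulVl u1 scale1r.
have e2 : dot (conj u ** p) (conj u ** p') = dot p p' by rewrite adjl conjK mulVr u1 scale1r.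
have e3 : dot (conj u ** p) q' = dot p (u ** q') by rewrite adjl conjK.
have e4 : dot q (conj u ** p') = dot (u ** q) p' by rewrite adjl.
rewrite e1 e2 e3 e4; transitivity ((c ^+ 2 + s ^+ 2) * (dot p p' + dot q q')); first by ring.
by rewrite cs mul1r.
Qed.

Lemma block_dot f g : fdot (block f) (block g) = fdot f g.
Proof. by rewrite /block /rcol fdot_star lrow_dot fdot_star lrow_dot. Qed.

Lemma block_lin (k : R) f g : block (fun p q => k *: f p q + g p q) =
  (fun p q => k *: block f p q + block g p q).
Proof.
have L f1 g1 : lrow (fun p q => k *: f1 p q + g1 p q) = (fun p q => k *: lrow f1 p q + lrow g1 p q).
  apply/funext => p; apply/funext => q; rewrite /lrow; case: eqP => _.
    by rewrite mulDr; apply/rowP => t; rewrite !mxE; ring.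
  case: eqP => _ //; by rewrite mulDr; apply/rowP => t; rewrite !mxE; ring.
have St f1 g1 : star (fun p q => k *: f1 p q + g1 p q) = (fun p q => k *: star f1 p q + star g1 p q).
  by apply/funext => p; apply/funext => q; rewrite /star conj_lin.
by rewrite /block /rcol L St L St.
Qed.

Let upair x y : x ** conj y + y ** conj x = (2 * dot x y) *: one.
Proof.
have := mul_conj (x + y); rewrite conjD mulAl !mulAr !mul_conj dotDl !dotDr (dotC y x) => h.
by apply/rowP => t; move: (congr1 (fun v : V => v ord0 t) h); rewrite !mxE; lra.
Qed.

Lemma block_diag f : star f = f ->
  [/\ block f i i = (c ^+ 2 * re (f i i) + 2 * c * s * dot u (f i j) + s ^+ 2 * re (f j j)) *: one,
      block f j j = (s ^+ 2 * re (f i i) - 2 * c * s * dot u (f i j) + c ^+ 2 * re (f j j)) *: one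
    & block f i j = (c * s * (re (f i i) - re (f j j)) + 2 * s ^+ 2 * dot u (f i j)) *: u - f i j].
Proof.
move=> sf; have fji : f j i = conj (f i j) by rewrite -[LHS](congr1 (fun k => k j i) sf).
have P1 := upair u (f i j); rewrite -fji in P1.
have P2 : conj u ** f i j + f j i ** u = (2 * dot u (f i j)) *: one.
  by have := upair (conj u) (f j i); rewrite fji !conjK dot_conj.
have P3 : (u ** f j i) ** u = (2 * dot u (f i j)) *: u - f i j.
  have e : u ** f j i = (2 * dot u (f i j)) *: one - f i j ** conj u by rewrite -P1 addrK.
  by rewrite e mulAl mulNl mulZl mul1 mulrVr u1 scale1r.
rewrite /block !rcolE /lrow !eqxx ji (herm_diag i sf) (herm_diag j sf).
have re1 (a : R) : re (a *: one) = a by rewrite dotZl one_dot mulr1.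
rewrite !re1; move: (re (f i i)) (re (f j j)) => r1 r2.
split.
- rewrite !(mulAl, mulZl, mulZr, mulx1) mul_conj u1 scale1r; apply/rowP => t.
  move: (congr1 (fun v : V => v ord0 t) P1); rewrite !mxE => /(canRL (addrK _)) ->; ring.
- rewrite !(mulAl, mulNl, mulZl, mulZr, mulx1) conj_mul u1 scale1r; apply/rowP => t.
  move: (congr1 (fun v : V => v ord0 t) P2); rewrite !mxE => /(canRL (addrK _)) ->; ring.
- rewrite !(mulAl, mulZl, mulZr, mulx1, mul1) P3; apply/rowP => t.
  rewrite !mxE; transitivity ((c * s * (r1 - r2) + 2 * s ^+ 2 * dot u (f i j)) * u ord0 t
    - (c ^+ 2 + s ^+ 2) * f i j ord0 t); [by ring|by rewrite cs mul1r].
Qed.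

Lemma block_trace f : star f = f -> \sum_a block f a a = \sum_a f a a.
Proof.
move=> sf; rewrite (bigD1 i) //= (bigD1 j) //= 1?eq_sym // [RHS](bigD1 i) //= [in RHS](bigD1 j) //= 1?eq_sym //.
rewrite !addrA; congr (_ + _); last first.
  apply: eq_bigr => a /andP[ai aj].
  by rewrite /block rcolE (negbTE ai) (negbTE aj) /lrow (negbTE ai) (negbTE aj).
have [-> -> _] := block_diag sf; rewrite -scalerDl [in RHS](herm_diag i sf) [in RHS](herm_diag j sf).
rewrite -scalerDl; congr (_ *: _).
transitivity ((c ^+ 2 + s ^+ 2) * (re (f i i) + re (f j j))); first by ring.
by rewrite cs mul1r.
Qed.

(** If T is the symmetry, block f = T f T; with the left factor read as (T f) T and the right one as
    T (f T), the inner T T is the identity. *)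
Lemma block_idem_assoc f : (forall x y z, (x ** y) ** z = x ** (y ** z)) ->
  mm f f = f -> mm (block f) (block f) = block f.
Proof.
move=> A ff.
have H1 g h : mm (rcol g) (lrow h) = mm g h.
  apply/funext => a; apply/funext => b; rewrite /mm.
  rewrite (bigD1 i) //= (bigD1 j) //= 1?eq_sym // [RHS](bigD1 i) //= [in RHS](bigD1 j) //= 1?eq_sym //.
  rewrite !addrA; congr (_ + _); last first.
    by apply: eq_bigr => l /andP[li lj]; rewrite rcolE /lrow (negbTE li) (negbTE lj).
  rewrite !rcolE /lrow !eqxx ji.
  rewrite !(mulAl, mulAr, mulNl, mulNr, mulZl, mulZr) !A mulVr mulVl u1 !scale1r.
  apply/rowP => t; rewrite !mxE.
  transitivity ((c ^+ 2 + s ^+ 2) * ((g a i ** h i b) ord0 t + (g a j ** h j b) ord0 t)); first by ring.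
  by rewrite cs mul1r.
have H2 g h : mm (lrow g) h = lrow (mm g h).
  apply/funext => a; apply/funext => b; rewrite /mm /lrow; case: eqP => _.
    rewrite mul_sumr !scaler_sumr -big_split; apply: eq_bigr => l _ /=.
    by rewrite mulAl !mulZl A.
  case: eqP => _ //; rewrite mul_sumr !scaler_sumr -sumrB; apply: eq_bigr => l _ /=.
  by rewrite mulAl mulNl !mulZl A.
have H3 g h : mm g (rcol h) = rcol (mm g h).
  apply/funext => a; apply/funext => b; rewrite rcolE /mm.
  transitivity (\sum_l g a l ** (if b == i then c *: h l i + s *: (h l j ** conj u)
     else if b == j then s *: (h l i ** u) - c *: h l j else h l b)).
    by apply: eq_bigr => l _; rewrite rcolE.
  case: eqP => _.
    rewrite mul_suml !scaler_sumr -big_split; apply: eq_bigr => l _ /=.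
    by rewrite mulAr !mulZr A.
  case: eqP => _ //; rewrite mul_suml !scaler_sumr -sumrB; apply: eq_bigr => l _ /=.
  by rewrite mulAr mulNr !mulZr A.
rewrite {2}/block -lrow_rcol {1}/block H1 H2 H3 ff lrow_rcol //.
Qed.

(** Without associativity, conjugation by T is not evidently multiplicative, so the criterion
    [three_idem] is checked entry by entry. The product (u f_jl) (f_li u), with u on both ends, is
    resolved by [moufang]. *)
Lemma block_idem_three f l : l != i -> l != j ->
  (forall a, [|| a == i, a == j | a == l]) ->
  projf f -> mm (block f) (block f) = block f.
Proof.
move=> li lj all3 pf; have [sf ff tr] := pf; have [S1 r0 NE RE] := proj_rank1 pf.
have [Bii Bjj Bij] := block_diag sf; have sB := block_star sf.
set ri := re (f i i) in Bii Bjj Bij; set rj := re (f j j) in Bii Bjj Bij.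
set k := dot u (f i j) in Bii Bjj Bij; pose t := re (f l l).
have re1 (a : R) : re (a *: one) = a by rewrite dotZl one_dot mulr1.
have Bll : block f l l = f l l.
  by rewrite /block rcolE (negbTE li) (negbTE lj) /lrow (negbTE li) (negbTE lj).
have Bil : block f i l = c *: f i l + s *: (u ** f j l).
  by rewrite /block rcolE (negbTE li) (negbTE lj) /lrow eqxx.
have Bjl : block f j l = s *: (conj u ** f i l) - c *: f j l.
  by rewrite /block rcolE (negbTE li) (negbTE lj) /lrow ji eqxx.
have Blj : block f l j = s *: (f l i ** u) - c *: f l j.
  by rewrite /block rcolE ji eqxx /lrow (negbTE li) (negbTE lj).
have kt : dot (f i l) (u ** f j l) = t * k.
  by rewrite -(herm_conj l j sf) -adjr RE dotZl (dotC (f i j)).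
have kt2 : dot (conj u ** f i l) (f j l) = t * k by rewrite adjl conjK kt.
apply: (three_idem (i := i) (j := j) (l := l)) => //.
- by rewrite -dot_suml block_trace // tr.
- rewrite Bii Bjj Bij !re1 !dotDl !dotDr !dotNl !dotNr !dotZl !dotZr u1 (dotC (f i j) u) -/k NE -/ri -/rj.
  apply/eqP; rewrite -subr_eq0; apply/eqP.
  transitivity ((c ^+ 2 + s ^+ 2 - 1) * (2 * c * s * k * (ri - rj) + 4 * s ^+ 2 * k ^+ 2
    - ri * rj * (c ^+ 2 + s ^+ 2 + 1))); [by ring|by rewrite cs subrr mul0r].
- rewrite Bil Bii Bll !re1 !dotDl !dotDr !dotZl !dotZr (dotC (u ** _)) kt norm_mul u1 !NE -/ri -/rj -/t; ring.
- rewrite Bjl Bjj Bll !re1 !dotDl !dotDr !dotNl !dotNr !dotZl !dotZr (dotC (f j l)) kt2 norm_mul dot_conj u1 !NE -/ri -/rj -/t; ring.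
- rewrite Bil Blj Bll -/t Bij.
  have m1 : f i l ** (f l i ** u) = (ri * t) *: u by rewrite -(herm_conj i l sf) mulVr NE.
  have m2 : (u ** f j l) ** f l j = (rj * t) *: u by rewrite -(herm_conj j l sf) mulrVl NE.
  have m3 : (u ** f j l) ** (f l i ** u) = (t * (2 * k)) *: u - t *: f i j.
    rewrite moufang RE -/t mulZr mulZl; have fji := herm_conj i j sf.
    have P1 := upair u (f i j); rewrite fji in P1.
    have -> : u ** f j i = (2 * k) *: one - f i j ** conj u by rewrite -P1 addrK.
    by rewrite mulAl mulNl mulZl mul1 mulrVr u1 scale1r scalerBr scalerA.
  rewrite !(mulAl, mulAr, mulNr, mulZl, mulZr) m1 m2 m3 RE -/t; apply/rowP => q.
  rewrite !mxE; transitivity ((c * s * (ri - rj) + 2 * s ^+ 2 * k) * t * u ord0 q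
    - (c ^+ 2 + s ^+ 2) * t * f i j ord0 q); [by ring|by rewrite cs; ring].
Qed.

End Block.

Local Notation E := 'M[R]_(n * n, D).
Implicit Types X Y : E.

Definition ent X : F := fun a b => row (mxvec_index a b) X.
Definition mk f : E := \matrix_(i, t) mxvec (\matrix_(a, b) f a b ord0 t) ord0 i.

Lemma mkK f : ent (mk f) = f.
Proof.
apply/funext => a; apply/funext => b; apply/rowP => t.
by rewrite /ent /mk !mxE mxvecE mxE.
Qed.

Lemma entK X : mk (ent X) = X.
Proof.
apply/matrixP => i t; case/mxvec_indexP: i => a b.
by rewrite /ent /mk !mxE mxvecE !mxE.
Qed.

Lemma entP X Y : (forall a b, ent X a b = ent Y a b) -> X = Y.
Proof.
move=> h; rewrite -[X]entK -[Y]entK; congr mk.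
by apply/funext => a; apply/funext => b.
Qed.

Lemma entL (k : R) X Y a b : ent (k *: X + Y) a b = k *: ent X a b + ent Y a b.
Proof. by apply/rowP => t; rewrite /ent !mxE. Qed.
Lemma entD X Y a b : ent (X + Y) a b = ent X a b + ent Y a b.
Proof. by apply/rowP => t; rewrite /ent !mxE. Qed.
Lemma entZ (k : R) X a b : ent (k *: X) a b = k *: ent X a b.
Proof. by apply/rowP => t; rewrite /ent !mxE. Qed.
Lemma entN X a b : ent (- X) a b = - ent X a b.
Proof. by apply/rowP => t; rewrite /ent !mxE. Qed.

Lemma mk_lin (k : R) f g : mk (fun p q => k *: f p q + g p q) = k *: mk f + mk g.
Proof. by apply: entP => a b; rewrite entL !mkK. Qed.

Lemma ent_dot X Y : dot X Y = fdot (ent X) (ent Y).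
Proof.
rewrite /dot (reindex _ (curry_mxvec_bij _ _)) /= /fdot.
rewrite (pair_bigA _ (fun a b => dot (ent X a b) (ent Y a b))) /=.
apply: eq_bigr => -[a b] _ /=; rewrite /dot big_ord1.
by apply: eq_bigr => t _; rewrite /ent !mxE.
Qed.

Definition single a b x : E := mk (fun p q => if (p == a) && (q == b) then x else 0).

Lemma singleE a b x p q : ent (single a b x) p q = if (p == a) && (q == b) then x else 0.
Proof. by rewrite /single mkK. Qed.

Lemma single_dot a b x Y : dot (single a b x) Y = dot x (ent Y a b).
Proof.
rewrite ent_dot /fdot (bigD1 a) //= (bigD1 b) //= singleE !eqxx /= !big1 ?addr0 //.
  move=> p pa; rewrite big1 // => q _; by rewrite singleE (negbTE pa) dot0l.
by move=> q qb; rewrite singleE (negbTE qb) andbF dot0l.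
Qed.

Definition base : E := single ord0 ord0 one.

Section Space.
Variable S : set E.
Hypothesis SE : forall X, S X <-> projf (ent X).
Hypothesis block_idem : forall i j c s u f, i != j -> c ^+ 2 + s ^+ 2 = 1 ->
  dot u u = 1 -> projf f -> mm (block i j c s u f) (block i j c s u f) = block i j c s u f.

(** With [gsymm], the counterparts of [ortho_map] and [symm] for an arbitrary set S of matrices;
    they unfold to these when S is the carrier. *)
Definition gortho (g : E -> E) : Prop :=
  [/\ lin_map g, forall X Y, dot (g X) (g Y) = dot X Y
    & forall p, S p -> S (g p)].

Definition gsymm (g : E -> E) : Prop :=
  exists h, [/\ gortho g, gortho h, cancel g h & cancel h g].

Definition bmap i j c s u X : E := mk (block i j c s u (ent X)).

Section Bmap.
Variables (i j : 'I_n) (c s : R) (u : V).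
Hypotheses (ij : i != j) (cs : c ^+ 2 + s ^+ 2 = 1) (u1 : dot u u = 1).

Lemma bmapK : involutive (bmap i j c s u).
Proof. by move=> X; rewrite /bmap mkK blockK // entK. Qed.

Lemma bmap_symm : gsymm (bmap i j c s u).
Proof.
have H : gortho (bmap i j c s u).
  split=> [k X Y|X Y|X].
  - rewrite /bmap -mk_lin; congr mk; rewrite -block_lin; congr block.
    by apply/funext => a; apply/funext => b; rewrite entL.
  - by rewrite !ent_dot /bmap !mkK block_dot.
  - rewrite !SE /bmap mkK => pf; have [sf ff tr] := pf; split.
    + exact: block_star.
    + exact: block_idem.
    + by rewrite block_trace.
by exists (bmap i j c s u); split => //; exact: bmapK.
Qed.

Lemma bmap_fix X : (forall b, ent X i b = 0) -> (forall b, ent X j b = 0) ->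
  (forall b, ent X b i = 0) -> (forall b, ent X b j = 0) -> bmap i j c s u X = X.
Proof.
move=> h1 h2 h3 h4; have lf : lrow i j c s u (ent X) = ent X.
  apply/funext => a; apply/funext => b; rewrite /lrow.
  have [->|_] := eqVneq a i; first by rewrite !h1 h2 mulv0 !scaler0 addr0.
  by have [->|//] := eqVneq a j; rewrite h1 !h2 mulv0 !scaler0 subr0.
apply: entP => a b; rewrite /bmap mkK /block lf rcolE //.
have [->|_] := eqVneq b i; first by rewrite !h3 h4 mul0v !scaler0 addr0.
by have [->|//] := eqVneq b j; rewrite h3 !h4 mul0v !scaler0 subr0.
Qed.

Lemma bmap_out X a : a != i -> a != j -> ent (bmap i j c s u X) a a = ent X a a.
Proof. by move=> ai aj; rewrite /bmap mkK /block rcolE // (negbTE ai) (negbTE aj) /lrow (negbTE ai) (negbTE aj). Qed.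

End Bmap.

Lemma gsymmS (g : E -> E) p : gsymm g -> S p -> S (g p).
Proof. by move=> [h [[_ _ H] _ _ _]]; exact: H. Qed.

Lemma gsymm_comp (g h : E -> E) : gsymm g -> gsymm h -> gsymm (g \o h).
Proof.
move=> [g' [[lg dg Sg] [lg' dg' Sg'] c1 c2]] [h' [[lh dh Sh] [lh' dh' Sh'] c3 c4]].
exists (h' \o g'); split.
- split=> [a v w /=|v w /=|p /Sh /Sg //]; first by rewrite lh lg.
  by rewrite dg dh.
- split=> [a v w /=|v w /=|p /Sg' /Sh' //]; first by rewrite lg' lh'.
  by rewrite dh' dg'.
- exact: (can_comp c1 c3).
- exact: (can_comp c4 c2).
Qed.

Lemma gsymm_id : gsymm id.
Proof. by exists id; split. Qed.

Lemma gsymm_inv (g : E -> E) : gsymm g -> exists h, [/\ gsymm h, cancel g h & cancel h g].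
Proof. by move=> [h [a b c e]]; exists h; split=> //; exists g; split. Qed.

Local Notation rd X a := (re (ent X a a)).

(* The symmetry whose unit vector (c, s u^* ) is the line of the 2 x 2 block. *)
Lemma rotate_block X i j : S X -> i != j -> 0 < rd X i + rd X j ->
  exists c s u, [/\ c ^+ 2 + s ^+ 2 = 1, dot u u = 1,
    rd (bmap i j c s u X) i = rd X i + rd X j & rd (bmap i j c s u X) j = 0].
Proof.
move=> /SE pf ij; have [sf _ _] := pf; have [_ r0 NE _] := proj_rank1 pf.
set f := ent X in pf sf r0 NE *; have := r0 j; have := r0 i.
move: (NE i j); set ri := re (f i i); set rj := re (f j j) => Nij ri0 rj0 S0.
(* u is the direction of f i j, whose norm is sqrt (r_i r_j) by [proj_rank1]; if f i j = 0, any unit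
   vector serves. *)
have [u [u1 uk]] : exists u, dot u u = 1 /\ dot u (f i j) = Num.sqrt ri * Num.sqrt rj.
  rewrite -sqrtrM // -Nij; have [f0|f0] := eqVneq (dot (f i j) (f i j)) 0.
    by exists one; rewrite f0 sqrtr0 (dot_eq0 f0) dot0r.
  have fp : 0 < dot (f i j) (f i j) by rewrite lt_neqAle eq_sym f0 dot_ge0.
  have sp : Num.sqrt (dot (f i j) (f i j)) != 0 by rewrite gt_eqF // sqrtr_gt0.
  have sq := sqr_sqrtr (ltW fp).
  exists ((Num.sqrt (dot (f i j) (f i j)))^-1 *: f i j).
  rewrite !dotZl dotZr; move: (Num.sqrt _) sp sq => z sp <-; split; by field.
have [w [w0 w2]] : exists w, w != 0 /\ w ^+ 2 = ri + rj.
  by exists (Num.sqrt (ri + rj)); rewrite gt_eqF ?sqrtr_gt0 // sqr_sqrtr // ltW.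
have e1 := sqr_sqrtr ri0; have e2 := sqr_sqrtr rj0.
have re1 (a : R) : re (a *: one) = a by rewrite dotZl one_dot mulr1.
exists (Num.sqrt ri / w), (Num.sqrt rj / w), u; rewrite /bmap mkK.
have cs : (Num.sqrt ri / w) ^+ 2 + (Num.sqrt rj / w) ^+ 2 = 1.
  by rewrite !exprMn e1 e2 -mulrDl -w2 exprVn divff // expf_neq0.
have [-> -> _] := block_diag ij cs u1 sf; rewrite !re1 uk -/ri -/rj; split => //.
- move: e1 e2 w2; move: (Num.sqrt ri) (Num.sqrt rj) => x y <- <- w2.
  transitivity ((x ^+ 2 + y ^+ 2) ^+ 2 / w ^+ 2); first by field.
  by rewrite -w2; field.
- by move: e1 e2; move: (Num.sqrt ri) (Num.sqrt rj) => x y <- <-; field.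
Qed.

Lemma base_eq X : S X -> (forall a, a != ord0 -> rd X a = 0) -> X = base.
Proof.
move=> /SE pf h; have [sf _ tr] := pf; have [S1 _ NE _] := proj_rank1 pf.
have r1 : rd X ord0 = 1.
  by rewrite -S1 (bigD1 ord0) //= big1 ?addr0 // => a a0; exact: h.
apply: entP => a b; rewrite singleE.
have z : (a != ord0) || (b != ord0) -> ent X a b = 0.
  by move=> /orP[a0|b0]; apply: dot_eq0; rewrite NE; [rewrite h // mul0r|rewrite (h b b0) mulr0].
have [a0|a0] := eqVneq a ord0; last by rewrite z // a0.
have [b0|b0] := eqVneq b ord0; last by rewrite z // b0 orbT.
by rewrite a0 b0 (herm_diag ord0 sf) r1 scale1r.
Qed.

Let e1 : 'I_n := lift ord0 ord0.

(** Each block in the coordinates 1 and j moves the diagonal mass at j to 1. Index 0 is never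
    touched, so that base stays fixed, which [space_swap] relies on. *)
Lemma eliminate X (k : nat) : S X ->
  exists g : E -> E, [/\ gsymm g, g base = base
  & forall a : 'I_n, (1 < a < k)%N -> rd (g X) a = 0].
Proof.
move=> SX; elim: k => [|k [g [sg gb gk]]].
  by exists id; split=> // [|a]; [exact: gsymm_id|rewrite ltn0 andbF].
have [k1|k1] := leqP k 1.
  exists g; split=> // a /andP[a1]; rewrite ltnS => ak; exfalso.
  by have := leq_trans a1 (leq_trans ak k1); rewrite ltnn.
have [kn|kn] := leqP n k.
  exists g; split=> // a /andP[a1 ak]; apply: gk; rewrite a1 /=.
  exact: leq_trans (ltn_ord a) kn.
pose j : 'I_n := Ordinal kn; have ej : e1 != j by rewrite -val_eqE /= neq_ltn k1.
have SgX := gsymmS sg SX; have pf := (SE _).1 SgX; have [_ r0 _ _] := proj_rank1 pf.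
(* Diagonal entries are nonnegative, so if the sum is not positive, both already vanish. *)
have [p|p] := ltP 0 (rd (g X) e1 + rd (g X) j); last first.
  exists g; split=> // a /andP[a1]; rewrite ltnS leq_eqVlt => /orP[/eqP ak|ak]; last by apply: gk; rewrite a1.
  have -> : a = j by exact: val_inj.
  have := r0 e1; have := r0 j; move: p; move: (re _) (re _) => x y h1 h2 h3; lra.
have [c [s [u [cs u1 _ hj]]]] := rotate_block SgX ej p.
exists (bmap e1 j c s u \o g); split.
- by apply: gsymm_comp sg; exact: bmap_symm.
- rewrite /= gb; apply: bmap_fix => // b; rewrite singleE //; first by rewrite -val_eqE /= gtn_eqF // ltnW.
  by rewrite andbF.
  by rewrite -[j == _]val_eqE /= gtn_eqF ?andbF // ltnW.
- move=> a /andP[a1]; rewrite ltnS leq_eqVlt => /orP[/eqP ak|ak] /=.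
    by have -> : a = j by exact: val_inj.
  rewrite bmap_out ?gk ?a1 // -val_eqE /=; first by rewrite gtn_eqF.
  by rewrite ltn_eqF.
Qed.

(** After [eliminate] only the indices 0 and 1 carry mass, and one block moves it to 0. This block
    map is an involution, hence exchanges the two points. *)
Lemma move_to_base X : S X -> exists h B : E -> E, [/\ gsymm h, gsymm B, h base = base,
  B base = h X & B (h X) = base].
Proof.
move=> SX; have [h [sh hb hk]] := eliminate n SX; have ShX := gsymmS sh SX.
have pf := (SE _).1 ShX; have [S1 r0 _ _] := proj_rank1 pf.
have e0 : ord0 != e1 by [].
have other a : a != ord0 -> a != e1 -> rd (h X) a = 0.
  move=> a0 a1; apply: hk; rewrite ltn_ord andbT.
  by case: a a0 a1 => -[|[|a]] ha.
have r01 : rd (h X) ord0 + rd (h X) e1 = 1.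
  rewrite -S1 (bigD1 ord0) //= (bigD1 e1) //= big1 ?addr0 //.
  by move=> a /andP[a0 a1]; exact: other.
have p01 : 0 < rd (h X) ord0 + rd (h X) e1 by rewrite r01.
have [c [s [u [cs u1 h0 hj]]]] := rotate_block ShX e0 p01.
have bS : S (bmap ord0 e1 c s u (h X)) by apply: gsymmS => //; exact: bmap_symm.
have hB : bmap ord0 e1 c s u (h X) = base.
  apply: base_eq => // a a0; have [->|a1] := eqVneq a e1; first exact: hj.
  by rewrite bmap_out // other.
exists h, (bmap ord0 e1 c s u); split => //; first exact: bmap_symm.
by rewrite -hB bmapK.
Qed.

Lemma baseS : S base.
Proof.
rewrite SE; split.
- apply/funext => a; apply/funext => b; rewrite /star !singleE andbC.
  by case: ifP => _; rewrite ?conj1 ?conj0.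
- apply/funext => a; apply/funext => b; rewrite /mm (bigD1 ord0) //= !singleE eqxx andbT /=.
  rewrite big1 ?addr0; last by move=> l l0; rewrite singleE (negbTE l0) andbF mul0v.
  by case: (a == ord0); case: (b == ord0); rewrite ?mul0v ?mulv0 ?mul1.
- rewrite (bigD1 ord0) //= singleE eqxx big1 ?addr0 // => a a0.
  by rewrite singleE (negbTE a0).
Qed.

(** A symmetry k sends p to base, and an involution B2 exchanges base and k q; conjugating B2 by k
    gives the swap. *)
Lemma space_swap p q : S p -> S q -> exists g : E -> E, [/\ gsymm g, g p = q & g q = p].
Proof.
move=> Sp Sq; have [h1 [B1 [sh1 sB1 _ _ hB1]]] := move_to_base Sp.
pose g1 := B1 \o h1; have sg1 : gsymm g1 by exact: gsymm_comp.
have [h2 [B2 [sh2 sB2 hb b1 b2]]] := move_to_base (gsymmS sg1 Sq).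
pose k := h2 \o g1; have sk : gsymm k by exact: gsymm_comp.
have kp : k p = base by rewrite /k /g1 /= hB1 hb.
have [k' [sk' c1 c2]] := gsymm_inv sk.
exists (k' \o B2 \o k); split; first by do 2! apply: gsymm_comp => //.
- by rewrite /= -/(k p) kp b1 -[h2 _]/(k q) c1.
- change (k' (B2 (k q)) = p); rewrite (_ : B2 (k q) = base); first by rewrite -kp c1.
  exact: b2.
Qed.

Lemma space_dot1 p : S p -> dot p p = 1.
Proof.
move=> /SE pf; have [S1 _ NE _] := proj_rank1 pf; rewrite ent_dot /fdot.
transitivity (\sum_a rd p a * \sum_b rd p b); last by rewrite S1 -mulr_suml S1 mul1r.
by apply: eq_bigr => a _; rewrite mulr_sumr; apply: eq_bigr => b _; rewrite NE.
Qed.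

Lemma space_dot_le1 p q : S p -> S q -> dot p q <= 1.
Proof.
move=> Sp Sq; have := dot_ge0 (p - q).
rewrite !dotDl !dotDr !dotNl !dotNr (dotC q p) !space_dot1 //.
by move: (dot p q) => z; lra.
Qed.

Lemma base_dot q : dot base q = rd q ord0.
Proof. by rewrite single_dot dotC. Qed.

Lemma space_dot_ge0 p q : S p -> S q -> 0 <= dot p q.
Proof.
move=> Sp Sq; have [g [sg gp _]] := space_swap Sp baseS.
have <- : dot (g p) (g q) = dot p q by case: sg => h [[_ H _] _ _ _].
rewrite gp base_dot; have [_ r0 _ _] := proj_rank1 ((SE _).1 (gsymmS sg Sq)).
exact: r0.
Qed.

Local Notation ev t := (delta_mx ord0 t : V).

Lemma mul_coord x y t : (x ** y) ord0 t =
  \sum_p \sum_q x ord0 p * y ord0 q * (ev p ** ev q) ord0 t.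
Proof.
have ex z : z = \sum_p z ord0 p *: ev p by rewrite {1}[z]matrix_sum_delta big_ord1.
rewrite {1}[x]ex mul_suml summxE; apply: eq_bigr => p _.
rewrite {1}[y]ex mul_sumr summxE; apply: eq_bigr => q _.
by rewrite mulZl mulZr !mxE mulrA.
Qed.

Lemma is_derive_mul (G H : R -> V) (t : R) (dG dH : V) :
  is_derive t 1 G dG -> is_derive t 1 H dH ->
  is_derive t 1 (fun w => G w ** H w) (dG ** H t + G t ** dH).
Proof.
move=> hG hH; apply: is_derive_mx => i q; rewrite (ord1 i).
rewrite (_ : (fun w => _) = fun w => \sum_p \sum_r G w ord0 p * H w ord0 r * (ev p ** ev r) ord0 q);
  last by apply/funext => w; rewrite mul_coord.
rewrite mxE !mul_coord -big_split; apply: is_derive_sumf => p /=.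
rewrite -big_split; apply: is_derive_sumf => r /=; rewrite -mulrDl.
have h1 := is_derive_mulf (is_derive_coord ord0 p hG) (is_derive_coord ord0 r hH).
have h2 : is_derive t 1 (fun=> (ev p ** ev r) ord0 q) (0 : R) by exact: is_derive_cst.
by have := is_derive_mulf h1 h2; rewrite mulr0 addr0.
Qed.

Lemma is_derive_ent (c : R -> E) (t : R) dc a b : is_derive t 1 c dc ->
  is_derive t 1 (fun w => ent (c w) a b) (ent dc a b).
Proof.
move=> h; apply: is_derive_mx => i q; rewrite /ent !mxE.
rewrite (_ : (fun w => _) = fun w => c w (mxvec_index a b) q); last by apply/funext => w; rewrite mxE.
exact: is_derive_coord.
Qed.

Lemma space_closed : closed S.
Proof.
pose cn (G : E -> R) := continuous G.
have ce a b q : cn (fun X => ent X a b ord0 q).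
  rewrite (_ : (fun X => _) = fun X : E => X (mxvec_index a b) q); last by apply/funext => X; rewrite mxE.
  exact: coord_continuous.
have ck (k : R) : cn (fun=> k) by exact: cst_continuous.
have cs (I : finType) (G : I -> E -> R) : (forall l, cn (G l)) -> cn (fun X => \sum_l G l X).
  by move=> h; exact: continuous_sumf.
have cM (G H : E -> R) : cn G -> cn H -> cn (fun X => G X * H X).
  move=> cG cH X; have h1 : G Y @[Y --> X] --> G X by exact: cG.
  have h2 : H Y @[Y --> X] --> H X by exact: cH.
  exact: (cvgM h1 h2).
have cN (G H : E -> R) : cn G -> cn H -> cn (fun X => G X - H X).
  move=> cG cH X; have h1 : G Y @[Y --> X] --> G X by exact: cG.
  have h2 : H Y @[Y --> X] --> H X by exact: cH.
  exact: (cvgB h1 h2).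
have cm a l b q : cn (fun X => (ent X a l ** ent X l b) ord0 q).
  rewrite (_ : (fun X => _) = fun X => \sum_p \sum_r ent X a l ord0 p * ent X l b ord0 r * (ev p ** ev r) ord0 q);
    last by apply/funext => X; rewrite mul_coord.
  by apply: (cs _ _ _) => p; apply: (cs _ _ _) => r; apply: (cM _ _); [apply: (cM _ _); exact: ce|exact: ck].
have cj a b q : cn (fun X => conj (ent X a b) ord0 q).
  rewrite (_ : (fun X => _) = fun X => (2 * one ord0 q) * (\sum_p ent X a b ord0 p * one ord0 p) - ent X a b ord0 q); last first.
    by apply/funext => X; rewrite conjE !mxE /dot big_ord1 mulrAC.
  apply: (cN _ _); [apply: (cM _ _); [exact: ck|apply: (cs _ _ _) => p; apply: (cM _ _); [exact: ce|exact: ck]]|exact: ce].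
have cl (G : E -> R) (w : R) : cn G -> closed [set X | G X = w].
  move=> cG; rewrite (_ : [set X | G X = w] = G @^-1` [set w]) //.
  by apply: closed_comp => [X _|]; [exact: cG|exact: closed_eq].
have -> : S = (\bigcap_(abq in [set: 'I_n * 'I_n * 'I_D])
     ([set X | conj (ent X abq.1.2 abq.1.1) ord0 abq.2 - ent X abq.1.1 abq.1.2 ord0 abq.2 = 0] `&`
      [set X | \sum_l (ent X abq.1.1 l ** ent X l abq.1.2) ord0 abq.2 - ent X abq.1.1 abq.1.2 ord0 abq.2 = 0] `&`
      [set X | \sum_l ent X l l ord0 abq.2 = one ord0 abq.2])).
  apply/seteqP; split => [X /SE [sf ff tr] [[a b] q] _ /=|X h].
    split; last by rewrite -tr summxE.
    split; apply/eqP; rewrite subr_eq0; apply/eqP.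
      by rewrite -[in RHS](congr1 (fun k => k a b) sf).
    by rewrite -[in RHS](congr1 (fun k => k a b) ff) /mm summxE.
  apply/SE; split.
  - apply/funext => a; apply/funext => b; apply/rowP => q.
    by have [[/= /eqP]] := h (a, b, q) Logic.I; rewrite subr_eq0 => /eqP.
  - apply/funext => a; apply/funext => b; apply/rowP => q.
    by have [[/= _ /eqP]] := h (a, b, q) Logic.I; rewrite subr_eq0 /mm summxE => /eqP.
  - by apply/rowP => q; have [_ /=] := h (ord0, ord0, q) Logic.I; rewrite summxE.
apply: closed_bigI => -[[a b] q] _ /=; apply: closedI; first apply: closedI; apply: cl => //.
- by apply: cN.
- apply: cN => //; apply: cs => l; exact: cm.
- by apply: cs => l; exact: ce.
Qed.

Variables (d : nat) (idx : 'I_d -> 'I_nn.+1 * 'I_D).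
Hypothesis idx_bij : bijective idx.

(** A tangent vector at base is given by its first row off the corner; [idx] enumerates its real
    coordinates as a column j > 0 and a coordinate of the algebra. *)
Definition cj (i : 'I_d) : 'I_n := lift ord0 (idx i).1.
Definition cu (i : 'I_d) : V := ev (idx i).2.
Definition pflow i (t : R) : E -> E := bmap ord0 (cj i) (cos t) (sin t) (cu i).
(** The halves come from cos^2 t = (1 + cos 2t) / 2 and sin t cos t = (sin 2t) / 2, which give the
    geodesic the form of a [trig_curve] of frequency 2. *)
Definition pA i : E := (1 / 2 : R) *: (base + single (cj i) (cj i) one).
Definition pB i : E := (1 / 2 : R) *: (base - single (cj i) (cj i) one).
Definition pC i : E := (1 / 2 : R) *: (single ord0 (cj i) (cu i) + single (cj i) ord0 (conj (cu i))).

Let j0 i : ord0 != cj i. Proof. by []. Qed.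
Let cu1 i : dot (cu i) (cu i) = 1. Proof. by rewrite dot_delta mxE !eqxx. Qed.

Lemma pflow_symm i t : gsymm (pflow i t).
Proof. by apply: bmap_symm; [exact: j0|exact: cos2Dsin2|exact: cu1]. Qed.

(** The coefficients do not depend on c and s, so the flow is differentiable in t at every matrix,
    as [mflow_derivable] asks. *)
Lemma block_poly i j u f a b : i != j -> exists v1 v2 v3 v4 v5 v6 : V, forall c s,
  block i j c s u f a b = v1 + c *: v2 + s *: v3 + c ^+ 2 *: v4 + (c * s) *: v5 + s ^+ 2 *: v6.
Proof.
move=> ij; have ji : (j == i) = false by rewrite eq_sym (negbTE ij).
have L k : exists v1 v2 v3 : V, forall c s, lrow i j c s u f a k = v1 + c *: v2 + s *: v3.
  rewrite /lrow; case: (a == i); first by exists 0, (f i k), (u ** f j k) => c s; rewrite add0r.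
  case: (a == j); last by exists (f a k), 0, 0 => c s; rewrite !scaler0 !addr0.
  by exists 0, (- f j k), (conj u ** f i k) => c s; rewrite add0r scalerN addrC.
have [[x1 [x2 [x3 hi]]] [y1 [y2 [y3 hj]]]] := (L i, L j).
case bi : (b == i).
  exists 0, x1, (y1 ** conj u), x2, (x3 + y2 ** conj u), (y3 ** conj u) => c s.
  rewrite /block rcolE // bi hi hj !mulAl !mulZl; apply/rowP => t; rewrite !mxE; ring.
case bj : (b == j).
  exists 0, (- y1), (x1 ** u), (- y2), (x2 ** u - y3), (x3 ** u) => c s.
  rewrite /block rcolE // bi bj hi hj !mulAl !mulZl; apply/rowP => t; rewrite !mxE; ring.
have [z1 [z2 [z3 hb]]] := L b.
by exists z1, z2, z3, 0, 0, 0 => c s; rewrite /block rcolE // bi bj hb !scaler0 !addr0.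
Qed.

Lemma pflow_derivable i X : derivable (fun t => pflow i t X) (0 : R) 1.
Proof.
apply/derivable_mxP => p q; case/mxvec_indexP: p => a b.
rewrite (_ : (fun t => _) = fun t => block ord0 (cj i) (cos t) (sin t) (cu i) (ent X) a b ord0 q); last first.
  by apply/funext => t; rewrite /pflow /bmap /mk mxE mxvecE mxE.
have [v1 [v2 [v3 [v4 [v5 [v6 h]]]]]] := block_poly (cu i) (ent X) a b (j0 i).
rewrite (_ : (fun t => _) = fun t => v1 ord0 q + cos t * v2 ord0 q + sin t * v3 ord0 q
    + cos t * cos t * v4 ord0 q + cos t * sin t * v5 ord0 q + sin t * sin t * v6 ord0 q); last first.
  by apply/funext => t; rewrite h !mxE !expr2.
have dk (k : R) : derivable (fun _ : R => k) (0 : R) 1 by exact: derivable_cst.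
have dc : derivable (fun t : R => cos t) (0 : R) 1 by exact: derivable_cos.
have ds : derivable (fun t : R => sin t) (0 : R) 1 by exact: derivable_sin.
have dM (g k : R -> R) : derivable g (0 : R) 1 -> derivable k (0 : R) 1 -> derivable (fun t => g t * k t) (0 : R) 1 by exact: derivable_mulf.
have dA (g k : R -> R) : derivable g (0 : R) 1 -> derivable k (0 : R) 1 -> derivable (fun t => g t + k t) (0 : R) 1 by exact: derivableD.
exact: (dA _ _ (dA _ _ (dA _ _ (dA _ _ (dA _ _ (dk _) (dM _ _ dc (dk _))) (dM _ _ ds (dk _)))
  (dM _ _ (dM _ _ dc dc) (dk _))) (dM _ _ (dM _ _ dc ds) (dk _))) (dM _ _ (dM _ _ ds ds) (dk _))).
Qed.

Lemma pflow_base i t : pflow i t base = trig_curve 2 (pA i) (pB i) (pC i) t.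
Proof.
apply: entP => a b; rewrite /pflow /bmap mkK /block rcolE // /lrow /trig_curve /pA /pB /pC.
rewrite !(entD, entZ, entN) !singleE (mulr_natl t 2) mulr2n cosD sinD.
have : cos t ^+ 2 + sin t ^+ 2 = 1 by exact: cos2Dsin2.
rewrite !eqxx (eq_sym (cj i) ord0) (negbTE (j0 i)) /=; move: (cos t) (sin t) => c s cs.
have ss : s * s = 1 - c * c by rewrite -cs !expr2 addrAC subrr add0r.
have hfE : 1 / 2 + 1 / 2 = 1 :> R by field.
move: (1 / 2 : R) hfE => hf hfE.
have [ea|a0] := eqVneq a ord0; [subst a|have [ea|aj] := eqVneq a (cj i); [subst a|]];
  (have [eb|b0] := eqVneq b ord0; [subst b|have [eb|bj] := eqVneq b (cj i); [subst b|]]);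
  rewrite ?(eq_sym (cj i) ord0) ?eqxx ?(negbTE (j0 i)) /= ?(mulv0, mul0v, scaler0, addr0, add0r, subr0, mulZl, mul1, mulx1, sub0r) //.
all: rewrite ?conj_mul ?(cu1 i) ?scale1r.
all: by apply/rowP => q; rewrite !mxE -[LHS]mul1r -[X in X * _]hfE ?[s * (s * _)]mulrA ?ss; ring.
Qed.

Lemma pcurve0 i : pA i + pB i = base.
Proof.
rewrite /pA /pB -scalerDr addrACA subrr addr0; by apply/matrixP => p q; rewrite !mxE; field.
Qed.

Let vel i : E := (2 : R) *: pC i.
Let acc i : E := (2 : R) *: (- (2 : R) *: pB i).

Lemma pvel_dot i Y : (forall a b, ent Y b a = conj (ent Y a b)) ->
  dot (vel i) Y = 2 * dot (cu i) (ent Y ord0 (cj i)).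
Proof.
move=> h; rewrite /vel /pC !dotZl dotDl !single_dot (h ord0) dot_conj.
by move: (dot _ _) => z; field.
Qed.

Lemma pacc_dot i Y : dot (acc i) Y = - 2 * (rd Y ord0 - rd Y (cj i)).
Proof.
rewrite /acc /pB !dotZl dotDl dotNl !single_dot !(dotC one).
by move: (re _) (re _) => z w; field.
Qed.

Let pC_herm i a b : ent (vel i) b a = conj (ent (vel i) a b).
Proof.
rewrite /vel /pC !(entZ, entD) !conjZ conjD !singleE; congr (_ *: (_ *: _)).
rewrite [X in _ = X + _](_ : _ = if (b == cj i) && (a == ord0) then conj (cu i) else 0); last first.
  by rewrite andbC; case: ifP; rewrite ?conj0.
rewrite [X in _ = _ + X](_ : _ = if (b == ord0) && (a == cj i) then cu i else 0); last first.
  by rewrite andbC; case: ifP; rewrite ?conj0 ?conjK.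
exact: addrC.
Qed.

Lemma pvel_ortho i j : 1 / 2 * dot (vel i) (vel j) = (i == j)%:R.
Proof.
rewrite pvel_dot => [|a b]; last exact: pC_herm.
rewrite /vel /pC !(entZ, entD) !singleE eqxx (negbTE (j0 j)) /= addr0.
have -> : (i == j) = (cj i == cj j) && ((idx i).2 == (idx j).2).
  by rewrite -(inj_eq (bij_inj idx_bij)) /cj (inj_eq (@lift_inj _ ord0)); case: (idx i); case: (idx j).
case: (cj i == cj j); last by rewrite !scaler0 dot0r !mulr0.
rewrite !dotZr dot_delta mxE eqxx /= eq_sym.
by move: (_ == _) => z; case: z; field.
Qed.

Lemma sum_idx (W : nmodType) (G : 'I_n -> 'I_D -> W) :
  \sum_i G (cj i) (idx i).2 = \sum_(j < nn.+1) \sum_s G (lift ord0 j) s.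
Proof.
rewrite pair_bigA (reindex _ (onW_bij _ idx_bij)) /=; exact: eq_bigr.
Qed.

(** Differentiating star X = X and X X = X at base gives v = v base + base v for a Hermitian v. This
    kills all entries outside the first row and column, and the corner, which equals its double. *)
Lemma ptangent_ent (c : R -> E) : smooth (c : R^o -> E) -> (forall t, S (c t)) ->
  c 0 = base -> [/\ forall a b, ent (derive1 c 0) b a = conj (ent (derive1 c 0) a b),
    ent (derive1 c 0) ord0 ord0 = 0
  & forall a b, a != ord0 -> b != ord0 -> ent (derive1 c 0) a b = 0].
Proof.
move=> sc cS c0; have dc := smooth_derive1 0 sc; set v := derive1 c 0 in dc *.
have de a b := is_derive_ent a b dc.
have H a b : ent v b a = conj (ent v a b).
  have h1 := de b a; have h2 := is_derive_addf (is_deriveZl one (is_derive_scalef 2 (is_derive_dot (de a b) (is_derive_cst one _ _))))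
     (is_derive_scalef (-1) (de a b)).
  have e : (fun w => ent (c w) b a) = (fun w => (2 *: re (ent (c w) a b)) *: one + -1 *: ent (c w) a b).
    apply/funext => w; have [sf _ _] := (SE _).1 (cS w).
    by rewrite -(herm_conj a b sf) conjE scaleN1r.
  rewrite e in h1; have := is_derive_val h1; rewrite (is_derive_val h2) => <-.
  by rewrite dot0r addr0 scaleN1r conjE.
have I a b : ent v a b = \sum_l (ent v a l ** ent base l b + ent base a l ** ent v l b).
  have h1 := de a b; have h2 : is_derive (0 : R) 1 (fun w => \sum_l ent (c w) a l ** ent (c w) l b)
      (\sum_l (ent v a l ** ent (c 0) l b + ent (c 0) a l ** ent v l b)).
    by apply: is_derive_sumf => l; exact: is_derive_mul.
  have e : (fun w => ent (c w) a b) = (fun w => \sum_l ent (c w) a l ** ent (c w) l b).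
    apply/funext => w; have [_ ff _] := (SE _).1 (cS w).
    by rewrite -[LHS](congr1 (fun k => k a b) ff).
  by rewrite e in h1; rewrite -(is_derive_val h1) (is_derive_val h2) c0.
have z a b : \sum_l (ent v a l ** ent base l b + ent base a l ** ent v l b) =
    (if b == ord0 then ent v a ord0 else 0) + (if a == ord0 then ent v ord0 b else 0).
  rewrite (bigD1 ord0) //= !singleE eqxx /= andbT big1 ?addr0.
    by case: (a == ord0); case: (b == ord0); rewrite ?mulv0 ?mul0v ?mulx1 ?mul1.
  by move=> l l0; rewrite !singleE (negbTE l0) andbF mulv0 mul0v addr0.
split=> //.
  by have := I ord0 ord0; rewrite z eqxx => /esym/eqP; rewrite -subr_eq0 addrK => /eqP.
by move=> a b a0 b0; rewrite I z (negbTE a0) (negbTE b0) addr0.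
Qed.

Lemma ptangent (c : R -> E) : smooth (c : R^o -> E) -> (forall t, S (c t)) ->
  c 0 = base -> derive1 c 0 = \sum_i (1 / 2 * dot (derive1 c 0) (vel i)) *: vel i.
Proof.
move=> sc cS c0; have [h v0 vv] := ptangent_ent sc cS c0; move: (derive1 c 0) h v0 vv => v h v0 vv.
have e i : (1 / 2 * dot v (vel i)) *: vel i =
   ent v ord0 (cj i) ord0 (idx i).2 *: (single ord0 (cj i) (cu i) + single (cj i) ord0 (conj (cu i))).
  rewrite dotC pvel_dot // (dotC (cu i)) dot_delta /vel /pC !scalerA; congr (_ *: _).
  by move: (ent _ _ _ _ _) => z; field.
rewrite (eq_bigr _ (fun i _ => e i)).
rewrite (sum_idx (fun j s => ent v ord0 j ord0 s *: (single ord0 j (ev s) + single j ord0 (conj (ev s))))).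
have ents (I : finType) (G : I -> E) a b : ent (\sum_l G l) a b = \sum_l ent (G l) a b.
  by elim/big_rec2: _ => [|l x y _ <-]; rewrite ?entD //; apply/rowP => t; rewrite /ent !mxE.
have ex y : y = \sum_s y ord0 s *: ev s by rewrite {1}[y]matrix_sum_delta big_ord1.
apply: entP => a b; rewrite ents.
transitivity (\sum_(j < nn.+1) ((if (a == ord0) && (b == lift ord0 j) then ent v ord0 b else 0) +
   (if (a == lift ord0 j) && (b == ord0) then conj (ent v ord0 a) else 0))); last first.
  apply: eq_bigr => j _; rewrite ents.
  rewrite (eq_bigr (fun s => ent v ord0 (lift ord0 j) ord0 s *: (if (a == ord0) && (b == lift ord0 j) then ev s else 0)
     + ent v ord0 (lift ord0 j) ord0 s *: (if (a == lift ord0 j) && (b == ord0) then conj (ev s) else 0))); last first.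
    by move=> s _; rewrite entZ entD !singleE scalerDr.
  rewrite big_split /=; congr (_ + _).
    case: ifP => [/andP[_ /eqP ->]|_]; first exact: ex.
    by rewrite big1 // => s _; rewrite scaler0.
  case: ifP => [/andP[/eqP -> _]|_]; last by rewrite big1 // => s _; rewrite scaler0.
  by rewrite {1}[ent v _ _]ex conj_sum; apply: eq_bigr => s _; rewrite conjZ.
have [a0|a0] := eqVneq a ord0.
  rewrite a0; have [->|b0] := eqVneq b ord0.
    by rewrite v0 big1 // => j _; rewrite ?andbF /= ?addr0 //; case: ifP.
  have [k bk] : exists k, b = lift ord0 k by case: (unliftP ord0 b) b0 => [k -> _|-> /eqP //]; exists k.
  rewrite (bigD1 k) //= bk eqxx ?andbF /= addr0 big1 ?addr0 // => j jk.
  by rewrite (inj_eq (@lift_inj _ ord0)) eq_sym (negbTE jk) ?andbF addr0.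
have [k ak] : exists k, a = lift ord0 k by case: (unliftP ord0 a) a0 => [k -> _|-> /eqP //]; exists k.
have [b0|b0] := eqVneq b ord0; last by rewrite vv // big1 // => j _; rewrite /= andbF addr0.
rewrite (bigD1 k) //= ak eqxx b0 /= add0r -h big1 ?addr0 // => j jk.
by rewrite (inj_eq (@lift_inj _ ord0)) eq_sym (negbTE jk) addr0.
Qed.

Lemma ptangent_acc (c : R -> E) : smooth (c : R^o -> E) -> (forall t, S (c t)) ->
  c 0 = base -> forall i, dot (derive1 c 0) (acc i) = 0.
Proof.
move=> sc cS c0 i; have [h v0 vv] := ptangent_ent sc cS c0.
by rewrite dotC pacc_dot v0 vv ?dot0l ?subrr ?mulr0 // eq_sym.
Qed.

Lemma psum_rd q : S q -> \sum_(j < nn.+1) rd q (lift ord0 j) = 1 - rd q ord0.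
Proof.
move=> /SE pf; have [S1 _ _ _] := proj_rank1 pf.
by move: S1; rewrite big_ord_recl => <-; rewrite addrAC subrr add0r.
Qed.

(** The squares add up to 4 |q_0j|^2 in each column j, that is 4 r_0 r_j by [proj_rank1]; the sum
    over j is 4 r_0 (1 - r_0), and r_0 = <base, q> is 1 - s. *)
Lemma psum_vel q : S q -> \sum_i dot (vel i) q ^+ 2 =
  4 * 1 ^+ 2 * ((1 - dot base q) / 1 * (1 - (1 - dot base q) / 1)).
Proof.
move=> Sq; have pf := (SE _).1 Sq; have [sf _ _] := pf; have [_ _ NE _] := proj_rank1 pf.
rewrite (eq_bigr (fun i => 4 * ent q ord0 (cj i) ord0 (idx i).2 ^+ 2)); last first.
  move=> i _; rewrite pvel_dot => [|a b]; last by rewrite (herm_conj a b sf).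
  by rewrite dotC dot_delta; ring.
rewrite (sum_idx (fun j s => 4 * ent q ord0 j ord0 s ^+ 2)).
transitivity (\sum_(j < nn.+1) 4 * rd q ord0 * rd q (lift ord0 j)).
  apply: eq_bigr => j _; rewrite -mulr_sumr -mulrA -NE; congr (_ * _).
  by rewrite /dot big_ord1; apply: eq_bigr => s _; rewrite expr2.
by rewrite -mulr_sumr psum_rd // base_dot; move: (re _) => z; field.
Qed.

(** The origin of beta = D / 2 - 1: the term r_0 - r_j is repeated once for each of the D
    coordinates of the algebra, and the r_j with j > 0 add up to 1 - r_0. *)
Lemma psum_acc q (al be : R) : S q -> al + 1 = (D * nn.+1)%:R / 2 -> be + 1 = D%:R / 2 ->
  \sum_i dot (acc i) q = - (4 * 1 * ((al + 1) - (al + be + 2) * ((1 - dot base q) / 1))).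
Proof.
move=> Sq ha hb; rewrite (eq_bigr _ (fun i _ => pacc_dot i q)).
rewrite (sum_idx (fun j _ => - 2 * (rd q ord0 - rd q j))).
transitivity (- 2 * D%:R * (nn.+1%:R * rd q ord0 - \sum_(j < nn.+1) rd q (lift ord0 j))).
  transitivity (\sum_(j < nn.+1) (- 2 * D%:R * rd q ord0 - 2 * - D%:R * rd q (lift ord0 j))).
    by apply: eq_bigr => j _; rewrite sumr_const card_ord -[LHS]mulr_natr; ring.
  by rewrite sumrB sumr_const card_ord -mulr_sumr -[X in X - _]mulr_natr; ring.
rewrite psum_rd // base_dot (_ : al + be + 2 = (al + 1) + (be + 1)); last by ring.
by rewrite ha hb natrM; move: (re _) (D%:R) (nn.+1%:R) => z y x; field.
Qed.

End Space.
End HermitianProjections.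

(** * Cayley-Dickson algebras up to the octonions *)

Section CayleyDicksonAlgebra.
Variable R : realType.
Local Notation T k := 'rV[R]_(cdim k).
Local Notation cm := cdmul.
Local Notation cc := cdconj.
Local Notation oo k := (cdone R k).

Record cd_algebra (k : nat) : Prop := CdAlgebra {
  cd_mulDl : forall (a : R) (x y z : T k), cm (a *: x + y) z = a *: cm x z + cm y z;
  cd_mulDr : forall (a : R) (x y z : T k), cm z (a *: x + y) = a *: cm z x + cm z y;
  cd_conjE : forall x : T k, cc x = (2 * dot x (oo k)) *: oo k - x;
  cd_conjM : forall x y : T k, cc (cm x y) = cm (cc y) (cc x);
  cd_one_dot : dot (oo k) (oo k) = 1;
  cd_mul1 : forall x : T k, cm (oo k) x = x;
  cd_mulx1 : forall x : T k, cm x (oo k) = x;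
  cd_adjl : forall u x y : T k, dot (cm u x) y = dot x (cm (cc u) y);
  cd_mulVl : forall u x : T k, cm (cc u) (cm u x) = dot u u *: x
}.

Definition cd_assoc (k : nat) : Prop :=
  forall x y z : T k, cm (cm x y) z = cm x (cm y z).

Lemma dot_row (m n : nat) (x y : 'rV[R]_(m + n)) :
  dot x y = dot (lsubmx x) (lsubmx y) + dot (rsubmx x) (rsubmx y).
Proof.
rewrite /dot !big_ord1 big_split_ord /=; congr (_ + _).
  by apply: eq_bigr => i _; rewrite !mxE.
by apply: eq_bigr => i _; rewrite !mxE.
Qed.

Lemma cd_algebra0 : cd_algebra 0.
Proof.
by split; intros; rewrite ?/dot ?big_ord1; try (apply/rowP => i; rewrite ?(ord1 i)); rewrite ?mxE /=; ring.
Qed.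

(** Associativity of the level below lets the mixed terms of the doubled product cancel; the doubled
    algebra itself may fail to be associative. *)
Lemma cd_algebraS k : cd_algebra k -> cd_assoc k -> cd_algebra k.+1.
Proof.
move=> C A; have [mDl mDr cE cM o1 m1 mx1 aj mV] := C.
have cL := conj_lin cE; have cD := conjD cE; have cZ := conjZ cE; have c0 := conj0 cE; have cK := conjK cE o1.
have c1 := conj1 cE o1; have m0 := mul0v mDl; have m0r := mulv0 mDr; have mA := mulAl mDl; have mAr := mulAr mDr.
have mN := mulNl mDl; have mNr := mulNr mDr.
have ajr := adjr cE cM o1 aj; have rV := mulrVl cE cM o1 mV; have Vr := mulVr cE o1 mV; have rVr := mulrVr cE cM o1 mV.
have cN (x : T k) : cc (- x) = - cc x by rewrite -scaleN1r cZ scaleN1r.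
have dc := dot_conj cE o1.
split=> /=.
- move=> a x y z; rewrite !linearP /= scale_row_mx add_row_mx !(mDl, mDr); congr row_mx.
    by apply/rowP => i; rewrite !mxE; ring.
  by apply/rowP => i; rewrite !mxE; ring.
- move=> a x y z; rewrite !linearP /= scale_row_mx add_row_mx !(cL, mDl, mDr); congr row_mx.
    by apply/rowP => i; rewrite !mxE; ring.
  by apply/rowP => i; rewrite !mxE; ring.
- move=> x; rewrite dot_row row_mxKl row_mxKr dot0r addr0 scale_row_mx scaler0 -[X in _ = _ - X]hsubmxK.
  by rewrite opp_row_mx add_row_mx add0r cE.
- move=> x y; rewrite !row_mxKl !row_mxKr !(cD, cN, cM, cK, mN, mNr) opprK; congr row_mx.
  by rewrite opprD addrC.
- by rewrite dot_row row_mxKl row_mxKr dot0l addr0.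
- by move=> x; rewrite row_mxKl row_mxKr m0r m0 subr0 addr0 m1 mx1 hsubmxK.
- by move=> x; rewrite row_mxKl row_mxKr c0 c1 !m0 subr0 add0r !mx1 hsubmxK.
- move=> u x y; rewrite !dot_row !row_mxKl !row_mxKr !dotDl !dotDr !dotNl mN mNr !dotNr opprK.
  set a := lsubmx u; set b := rsubmx u; set c := lsubmx x; set d := rsubmx x.
  set e := lsubmx y; set f := rsubmx y.
  have -> : dot (cm a c) e = dot c (cm (cc a) e) by rewrite aj.
  have -> : dot (cm (cc d) b) e = dot d (cm b (cc e)) by rewrite ajr -dc cM !cK.
  have -> : dot (cm d a) f = dot d (cm f (cc a)) by rewrite ajr.
  have -> : dot (cm b (cc c)) f = dot c (cm (cc f) b) by rewrite aj -dc cM !cK.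
  by move: (dot _ _) (dot _ _) (dot _ _) (dot _ _) => *; ring.
- move=> u x; rewrite !row_mxKl !row_mxKr dot_row -[X in _ = _ *: X]hsubmxK scale_row_mx.
  set a := lsubmx u; set b := rsubmx u; set c := lsubmx x; set d := rsubmx x.
  rewrite !(cD, cN, cM, cK, mA, mAr, mN, mNr) !A mV; congr row_mx.
    have -> : cm c (cm (cc b) b) = dot b b *: c by rewrite -A rVr.
    by apply/rowP => i; rewrite !mxE; ring.
  have -> : cm d (cm a (cc a)) = dot a a *: d by rewrite -A rV.
  by rewrite Vr; apply/rowP => i; rewrite !mxE; ring.
Qed.

Definition cd_comm (k : nat) : Prop := forall x y : T k, cm x y = cm y x.

Lemma cd_commS k : cd_comm k -> (forall x : T k, cc x = x) -> cd_comm k.+1.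
Proof.
move=> Cm ci x y; rewrite /= !ci; congr row_mx; last exact: addrC.
by rewrite Cm (Cm (rsubmx y)).
Qed.

Lemma cd_assocS k : cd_algebra k -> cd_assoc k -> cd_comm k -> cd_assoc k.+1.
Proof.
move=> C A Cm x y z; have [mDl mDr cE cM o1 m1 mx1 aj mV] := C.
have cD := conjD cE; have cZ := conjZ cE; have cK := conjK cE o1.
have mA := mulAl mDl; have mAr := mulAr mDr; have mN := mulNl mDl; have mNr := mulNr mDr.
have cN (w : T k) : cc (- w) = - cc w by rewrite -scaleN1r cZ scaleN1r.
have rot (p q r : T k) : cm p (cm q r) = cm r (cm p q) by rewrite [RHS]Cm A.
rewrite /= !row_mxKl !row_mxKr.
set a := lsubmx x; set b := rsubmx x; set c := lsubmx y; set d := rsubmx y.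
set e := lsubmx z; set f := rsubmx z.
rewrite !(cD, cN, cM, cK, mA, mAr, mN, mNr) !A; congr row_mx.
  rewrite (rot (cc d) b e) (rot (cc f) d a) (rot (cc f) b (cc c)).
  by apply/rowP => i; rewrite !mxE; ring.
rewrite (rot f (cc d) b) (Cm f (cc d)) (Cm a c) (Cm a (cc e)) (Cm (cc c) (cc e)).
by apply/rowP => i; rewrite !mxE; ring.
Qed.

(** Each doubling consumes one property: trivial conjugation on the reals makes the complexes
    commutative, and commutativity there makes the quaternions associative. *)
Lemma cd_assoc_le2 k : (k <= 2)%N -> cd_assoc k.
Proof.
have A0 : cd_assoc 0 by move=> x y z; apply/rowP => i; rewrite !mxE mulrA.
have C0 : cd_comm 0 by move=> x y; apply/rowP => i; rewrite !mxE mulrC.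
have A1 : cd_assoc 1 := cd_assocS cd_algebra0 A0 C0.
have C1 : cd_comm 1 by exact: cd_commS.
by case: k => [|[|[|//]]] // _; exact: cd_assocS (cd_algebraS cd_algebra0 A0) A1 C1.
Qed.

Lemma cd_algebra_le3 k : (k <= 3)%N -> cd_algebra k.
Proof.
elim: k => [_|k IH k3]; first exact: cd_algebra0.
by apply: cd_algebraS; [exact: IH (ltnW k3)|exact: cd_assoc_le2].
Qed.

End CayleyDicksonAlgebra.

(** * The models of the projective spaces *)

Section ProjectiveModels.
Variable R : realType.

Lemma proj_spaceE (nn k : nat) (X : 'M[R]_(nn.+2 * nn.+2, cdim k)) :
  @proj_space R nn.+2 k X <-> projf (@cdmul R k) (@cdconj R k) (cdone R k) (ent X).
Proof.
split=> [[h1 h2 h3]|[h1 h2 h3]].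
  split=> //; apply/funext => a; apply/funext => b; last exact: h2.
  by rewrite /star -[LHS]h1.
split=> // a b; first by rewrite -[LHS](congr1 (fun f => f b a) h1).
by rewrite -[RHS](congr1 (fun f => f a b) h2).
Qed.

Lemma index_bij (d m D : nat) : d = (m * D)%N ->
  exists idx : 'I_d -> 'I_m * 'I_D, bijective idx.
Proof.
move=> dE; have e : d = #|{: 'I_m * 'I_D}| by rewrite card_prod !card_ord.
exists (fun i => enum_val (cast_ord e i)).
exists (fun p => cast_ord (esym e) (enum_rank p)) => [i|p].
  by rewrite enum_valK cast_ordK.
by rewrite cast_ordKV enum_rankK.
Qed.

Lemma third_index (i j : 'I_3) : i != j ->
  exists l, [/\ l != i, l != j & forall a, [|| a == i, a == j | a == l]].
Proof.
(* The three indices add up to 3. *)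
move=> ij; exists (inord (3 - i - j)).
by case: i ij => -[|[|[|//]]] hi; case: j => -[|[|[|//]]] hj //= _; split;
  rewrite -?val_eqE /= ?inordK //; case=> -[|[|[|//]]] ha; rewrite -!val_eqE /= ?inordK.
Qed.

Section Facts.
Variables (nn k : nat).
Local Notation S := (@proj_space R nn.+2 k).
Local Notation cm := (@cdmul R k).
Local Notation cc := (@cdconj R k).
Local Notation oo := (cdone R k).
Local Notation E := 'M[R]_(nn.+2 * nn.+2, cdim k).

(** The one input with two proofs: associativity up to the quaternions in any size, the Moufang
    argument for 3 x 3 octonionic matrices. *)
Definition block_stable : Prop := forall (i j : 'I_nn.+2) c s u f,
  i != j -> c ^+ 2 + s ^+ 2 = 1 -> dot u u = 1 -> projf cm cc oo f ->
  mm cm (block cm cc i j c s u f) (block cm cc i j c s u f) = block cm cc i j c s u f.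

Hypothesis C : cd_algebra R k.

Lemma block_stable_assoc : cd_assoc R k -> block_stable.
Proof.
move=> A i j c s u f ij cs u1 [_ ff _].
have [mDl mDr cE cM o1 m1 mx1 aj mV] := C.
by eapply block_idem_assoc; eassumption.
Qed.

Lemma block_stable_three : (forall i j : 'I_nn.+2, i != j ->
    exists l, [/\ l != i, l != j & forall a, [|| a == i, a == j | a == l]]) -> block_stable.
Proof.
move=> third i j c s u f ij cs u1 pf; have [l [li lj all3]] := third i j ij.
have [mDl mDr cE cM o1 m1 mx1 aj mV] := C.
by eapply block_idem_three; eassumption.
Qed.

Variables (d : nat) (idx : 'I_d -> 'I_nn.+1 * 'I_(cdim k)).
Let b0 : E := base nn oo.
Let vel i : E := (2 : R) *: pC cc idx i.
Let acc i : E := (2 : R) *: (- (2 : R) *: pB oo idx i).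
Let sd (p q : E) : R := (1 - dot p q) / 1.

Record projective_facts : Prop := ProjectiveFacts {
  pf_base : S b0;
  pf_closed : closed S;
  pf_dot1 : forall p, S p -> dot p p = 1;
  pf_sd_ge0 : forall p q, S p -> S q -> 0 <= sd p q;
  pf_sd_le1 : forall p q, S p -> S q -> sd p q <= 1;
  pf_swap : forall p q, S p -> S q -> exists g, [/\ gsymm S g, g p = q & g q = p];
  pf_symm : forall i t, gsymm S (pflow cm cc idx i t);
  pf_flow_base : forall i t, pflow cm cc idx i t b0 =
    trig_curve 2 (pA oo idx i) (pB oo idx i) (pC cc idx i) t;
  pf_derivable : forall i x, derivable (fun t => pflow cm cc idx i t x) (0 : R) 1;
  pf_curve0 : forall i, pA oo idx i + pB oo idx i = b0;
  pf_ortho : forall i j, 1 / 2 * dot (vel i) (vel j) = (i == j)%:R;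
  pf_tangent : forall c : R -> E, smooth (c : R^o -> E) /\ (forall t, S (c t)) -> c 0 = b0 ->
    derive1 c 0 = \sum_i (1 / 2 * dot (derive1 c 0) (vel i)) *: vel i;
  pf_tangent_acc : forall c : R -> E, smooth (c : R^o -> E) /\ (forall t, S (c t)) -> c 0 = b0 ->
    forall i, dot (derive1 c 0) (acc i) = 0;
  pf_sum_vel : forall q, S q -> \sum_i dot (vel i) q ^+ 2 = 4 * 1 ^+ 2 * (sd b0 q * (1 - sd b0 q));
  pf_sum_acc : forall al be : R, al + 1 = (cdim k * nn.+1)%:R / 2 ->
    be + 1 = (cdim k)%:R / 2 -> forall q, S q ->
    \sum_i dot (acc i) q = - (4 * 1 * ((al + 1) - (al + be + 2) * sd b0 q))
}.

Lemma projective_factsP : block_stable -> bijective idx -> projective_facts.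
Proof.
rewrite /block_stable => bi ib; have SE := @proj_spaceE nn k.
have [mDl mDr cE cM o1 m1 mx1 aj mV] := C.
split.
- by eapply baseS; eassumption.
- by eapply space_closed; eassumption.
- by move=> p; eapply space_dot1; eassumption.
- by move=> p q Sp Sq; rewrite /sd divr1 subr_ge0; eapply space_dot_le1; eassumption.
- by move=> p q Sp Sq; rewrite /sd divr1 gerBl; eapply space_dot_ge0; eassumption.
- by move=> p q Sp Sq; eapply space_swap; eassumption.
- by move=> i t; eapply pflow_symm; eassumption.
- by move=> i t; eapply pflow_base; eassumption.
- by move=> i x; eapply pflow_derivable; eassumption.
- by move=> i; apply: pcurve0.
- by move=> i j; eapply pvel_ortho; eassumption.
- by move=> c [sc cS] c0; eapply ptangent; eassumption.
- by move=> c [sc cS] c0 i; eapply ptangent_acc; eassumption.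
- by move=> q Sq; eapply psum_vel; eassumption.
- by move=> al be ha hb q Sq; eapply psum_acc; eassumption.
Qed.

End Facts.

(** kappa = 1 because the inner product of two projections runs over [0, 1]; the frequency is 2, and
    rho = 4 matches gamma_j^2 = 4 j (j + alpha + beta + 1). *)
Ltac projective_model M F nn k idx :=
  apply: (@CrossModel R M (base nn (cdone R k)) 1 4 2 (pA (cdone R k) idx) (pB (cdone R k) idx)
    (pC (@cdconj R k) idx) (pflow (@cdmul R k) (@cdconj R k) idx));
  [ exact: (pf_base F) | exact: (pf_closed F) | exact: (pf_dot1 F) | exact: ltr01 | exact: ltr0n
  | exact: (pf_sd_ge0 F) | exact: (pf_sd_le1 F) | exact: (pf_swap F) | exact: (pf_symm F)
  | exact: (pf_flow_base F) | exact: (pf_derivable F) | exact: (pf_curve0 F) | exact: (pf_ortho F)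
  | exact: (pf_tangent F) | exact: (pf_tangent_acc F)
  | exact: (pf_sum_vel F)
  | apply: (pf_sum_acc F); rewrite /cross_alpha /cross_beta /cross_dim
  | move=> j; rewrite /cross_alpha /cross_beta /cross_gamma2 /cross_dim ].

Lemma real_model b (hb : (0 < b)%N) : @cross_model R (RealProj hb).
Proof.
case: b hb => [//|b] hb.
have [idx ib] := cid (@index_bij b.+1 b.+1 (cdim 0) (esym (muln1 _))).
have C : cd_algebra R 0 by exact: cd_algebra_le3.
have F := projective_factsP C (block_stable_assoc C (@cd_assoc_le2 R 0 isT)) ib.
projective_model (RealProj hb) F b 0%N idx.
- by rewrite mul1n; field.
- by rewrite (_ : cdim 0 = 1%N) //; field.
- by move: (j%:R) (b.+1%:R) => x y; field.
Qed.

Lemma complex_model b (hb : (0 < b)%N) : @cross_model R (ComplexProj hb).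
Proof.
case: b hb => [//|b] hb.
have [idx ib] := cid (@index_bij (2 * b.+1) b.+1 (cdim 1) (mulnC _ _)).
have C : cd_algebra R 1 by exact: cd_algebra_le3.
have F := projective_factsP C (block_stable_assoc C (@cd_assoc_le2 R 1 isT)) ib.
projective_model (ComplexProj hb) F b 1%N idx.
- by move: ((2 * b.+1)%:R) => x; field.
- by rewrite (_ : cdim 1 = 2%N) //; field.
- by rewrite natrM; move: (j%:R) (b.+1%:R) => x y; field.
Qed.

Lemma quat_model b (hb : (0 < b)%N) : @cross_model R (QuatProj hb).
Proof.
case: b hb => [//|b] hb.
have [idx ib] := cid (@index_bij (4 * b.+1) b.+1 (cdim 2) (mulnC _ _)).
have C : cd_algebra R 2 by exact: cd_algebra_le3.
have F := projective_factsP C (block_stable_assoc C (@cd_assoc_le2 R 2 isT)) ib.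
projective_model (QuatProj hb) F b 2%N idx.
- by move: ((4 * b.+1)%:R) => x; field.
- by rewrite (_ : cdim 2 = 4%N) //; field.
- by rewrite natrM; move: (j%:R) (b.+1%:R) => x y; field.
Qed.

Lemma cayley_model : @cross_model R CayleyPlane.
Proof.
have [idx ib] := cid (@index_bij 16 2 (cdim 3) erefl).
have C : cd_algebra R 3 by exact: cd_algebra_le3.
have F := projective_factsP C (block_stable_three C third_index) ib.
projective_model CayleyPlane F 1%N 3%N idx.
- by rewrite (_ : (cdim 3 * 2)%N = 16%N) //; field.
- by rewrite (_ : cdim 3 = 8%N) //; field.
- by move: (j%:R) => x; field.
Qed.

End ProjectiveModels.

Lemma cross_model_of (R : realType) (M : cross) : @cross_model R M.
Proof.
case: M => [b hb|b hb|b hb|b hb|].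
- exact: sphere_model.
- exact: real_model.
- exact: complex_model.
- exact: quat_model.
- exact: cayley_model.
Qed.

Theorem theorem13 (R : realType) (M : cross)
    (vol : probability (borel_ambient R M) R)
    (hvol : is_invariant_volume vol)
    (nu : nat -> R) (phi : nat -> borel_ambient R M -> R)
    (hphi : is_eigenbasis vol nu phi)
    (m : nat) (hm : (0 < m)%N)
    (r : 'I_m.+1 -> R) (k : R) (lambda : 'I_m.+1 -> R)
    (hr : forall i j : 'I_m.+1, (i < j)%N -> r i < r j)
    (hlambda : forall j, 0 < lambda j)
    (hsum : \sum_(j < m.+1) lambda j = 1)
    (hk : k + (cross_dim M)%:R / 4 <= \sum_(j < m.+1) lambda j * r j) :
  let C := cross_constant M k r lambda in
  let K := Num.sqrt (fine C * \prod_(j < m.+1) lambda j `^ (- lambda j)) in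
  [/\ C \is a fin_num,
      kolmogorov_inequality vol nu phi k r lambda K
    & forall K' : R,
        kolmogorov_inequality vol nu phi k r lambda K' -> K <= K'].
Proof.
move=> C K; have X := cross_model_of R M.
split; first exact: (cross_constant_fin hm hr hlambda hsum hk).
- exact: (upper_bound X hvol hphi hm hr hlambda hsum hk).
- by move=> K' HK'; exact: (lower_bound X hvol hphi hm hr hlambda hsum hk HK').
Qed.
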